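(* Suppose that the Moments, Smoothness and non-degeneracy, Stability and Identifiability conditions listed in the context hold, that the prior density $\pi_1$ on $\Theta_\gamma$ is continuous and bounded in $\overline\Theta_\gamma$ with $\pi_1(\gamma_0)>0$, and that there is a constant $c_1\in(0,1)$ with $T_n\gtrsim n^{c_1}$. For $\mathfrak b>0$ let $$\mathfrak F_{1,n}(\mathfrak b):=-\frac1{n\mathfrak b}\log\left(\int_{\Theta_\gamma}\exp\{\mathfrak b\,\mathbb H_{1,n}(\gamma)\}\pi_1(\gamma)d\gamma\right).$$ Then the following stochastic expansions hold as $n\to\infty$: $$\mathfrak F_{1,n}(1)=-\frac1n\mathbb H_{1,n}(\hat\gamma_n)+\frac{p_\gamma}{2n}\log n+O_p\left(\frac1n\right),$$ $$\mathfrak F_{1,n}(h)=-\frac1n\mathbb H_{1,n}(\hat\gamma_n)+\frac{p_\gamma}{2T_n}\log T_n+O_p\left(\frac1{T_n}\right).$$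
   Context: Model. $(\Omega,\mathcal F,P)$ is a probability space with expectation $E$ and a filtration $(\mathcal F_t)_{t\ge0}$ to which all processes are adapted. $Z$ is an $r$-dimensional L\'evy process, independent of $X_0$. The $d$-dimensional process $X$ solves $dX_t=a(X_t,\alpha_0)dt+c(X_{t-},\gamma_0)dZ_t$, where $a:\mathbb R^d\times\overline{\Theta}_\alpha\to\mathbb R^d$ and $c:\mathbb R^d\times\overline{\Theta}_\gamma\to\mathbb R^d\otimes\mathbb R^r$ are given functions, $\Theta_\alpha\subset\mathbb R^{p_\alpha}$ and $\Theta_\gamma\subset\mathbb R^{p_\gamma}$ are bounded convex domains, $\Theta=\Theta_\alpha\times\Theta_\gamma$, $\theta=(\alpha,\gamma)$, and $\theta_0=(\alpha_0,\gamma_0)\in\Theta$ is the true value. We observe $\mathbf X_n=(X_{t_j})_{j=0}^n$, $t_j=jh$, with $h=h_n>0$, $T_n:=nh\to\infty$ and $nh^2\to0$ as $n\to\infty$. Notation. $S(x,\gamma)=c(x,\gamma)c(x,\gamma)^\top$; $\Delta_jX=X_{t_j}-X_{t_{j-1}}$; $f_{j-1}(\theta)=f(X_{t_{j-1}},\theta)$; $|A|$ is the determinant of a square matrix $A$; $A^{\otimes2}=AA^\top$; $M[B]=\mathrm{trace}(MB^\top)$ for matrices of the same size; $\lesssim$ and $\gtrsim$ mean inequality (for all large $n$, for sequences) up to a universal positive constant; $\lambda_{\min}$ is the minimum eigenvalue. First-stage Gaussian quasi-likelihood. $$\mathbb H_{1,n}(\gamma)=-\frac12\sum_{j=1}^n\left(\log|2\pi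 hS_{j-1}(\gamma)|+\frac1hS_{j-1}^{-1}(\gamma)[(\Delta_jX)^{\otimes2}]\right),\qquad\hat\gamma_n\in\mathrm{argmax}_\gamma\mathbb H_{1,n}(\gamma).$$ Conditions. (Moments) $E[Z_1]=0$, $E[Z_1^{\otimes2}]=I_r$, $E[|Z_1|^q]<\infty$ for all $q>0$. (Smoothness and non-degeneracy) The components $f$ of $a$ and $c$ belong to $\mathcal C^{2,4}_\sharp$: $f(\cdot,\theta)$ is globally Lipschitz uniformly in $\theta\in\overline\Theta$; $f$ is 2 times continuously differentiable in $x$ and 4 times in $\theta$, all partial derivatives are continuous over $\overline\Theta$ for each $x$, and $\max_{i\le2}\max_{j\le4}\sup_{\theta\in\overline\Theta}|\partial_\theta^j\partial_x^if(x,\theta)|\lesssim1+|x|^{C}$ for some $C\ge0$. Also $\sup_{\gamma\in\overline\Theta_\gamma}\lambda_{\min}\{S(x,\gamma)\}^{-1}\lesssim1+|x|^{C_0}$ for some $C_0\ge0$. (Stability) There is a probability measure $\pi$ such that for every $q>0$ there is $\mathsf a>0$ with $\sup_{t\ge0}e^{\mathsf at}\sup_{f:|f|\le g}|\int f(y)P_t(x,dy)-\int f(y)\pi(dy)|\lesssim g(x)$ for $x\in\mathbb R^d$, where $g(x)=1+|x|^q$ and $P_t(x,dy)=P(X_t\in dy|X_0=x)$; and $\sup_{t\ge0}E[|X_t|^q]<\infty$ for every $q>0$. (Identifiability) There are $\chi_\gamma,\chi_\alpha>0$ such that for every $\gamma$ and $\alpha$, $-\frac12\int\{\mathrm{trace}(S(x,\gamma)^{-1}S(x,\gamma_0)-I_d)+\log\frac{|S(x,\gamma)|}{|S(x,\gamma_0)|}\}\pi(dx)\le-\chi_\gamma|\gamma-\gamma_0|^2$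 and $-\frac12\int S^{-1}(x,\gamma_0)[(a(x,\alpha)-a(x,\alpha_0))^{\otimes2}]\pi(dx)\le-\chi_\alpha|\alpha-\alpha_0|^2$, where $S^{-1}[v^{\otimes2}]=v^\top S^{-1}v$. *)

(* Defs.v *)
From HB Require Import structures.
From mathcomp Require Import all_boot all_order all_algebra.
From mathcomp Require Import all_classical all_reals all_analysis.

Set Implicit Arguments.
Unset Strict Implicit.
Unset Printing Implicit Defensive.
Import Order.TTheory GRing.Theory Num.Theory.
Import numFieldNormedType.Exports.

Local Open Scope classical_set_scope.
Local Open Scope ring_scope.

(** * Vectors and matrices *)

(* Vectors of R^d are columns; the library's norm on matrices is the sup norm,
   so the Euclidean (Frobenius) one is spelled out. *)
Definition enorm (R : realType) (m n : nat) (A : 'M[R]_(m, n)) : R :=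
  Num.sqrt (\sum_i \sum_j A i j ^+ 2).

(* A^{(x)2} and M[B] *)
Definition mxsq (R : realType) (m n : nat) (A : 'M[R]_(m, n)) : 'M[R]_m :=
  A *m A^T.

Definition mxdot (R : realType) (m n : nat) (M B : 'M[R]_(m, n)) : R :=
  \tr (M *m B^T).

Definition lambda_min (R : realType) (n : nat) (A : 'M[R]_n) : R :=
  inf [set l | eigenvalue A l].

Definition borel_vec (R : realType) (d : nat) :=
  g_sigma_algebraType (@open 'cV[R]_d).

(* Lebesgue measure on R^p as an iterated product, by integrating over the
   first coordinate the measure of the sections. *)
Fixpoint lebesgue_vec (R : realType) (p : nat) : set 'cV[R]_p -> \bar R :=
  match p with
  | 0 => fun A => (\1_A (0 : 'cV[R]_0))%:E
  | q.+1 => fun A =>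
      (\int[@lebesgue_measure R]_x
         lebesgue_vec [set v : 'cV[R]_q | A (col_mx (x%:M : 'M[R]_1) v)])%E
  end.

(** * Processes on a filtered probability space *)

(* Processes are functions of a real time of which only the values at
   nonnegative times are used. *)

Section Processes.
Context (R : realType) (dO : measure_display) (Om : measurableType dO).
Context (P : probability Om R).
Implicit Types (F : R -> set (set Om)) (G : set (set Om)).

Definition filtration F : Prop :=
  (forall t, 0 <= t -> sigma_algebra setT (F t) /\ F t `<=` measurable) /\
  (forall s t, 0 <= s -> s <= t -> F s `<=` F t).

Definition measurable_wrt G (m n : nat) (Y : Om -> 'M[R]_(m, n)) : Prop :=
  forall B, <<s @open 'M[R]_(m, n) >> B -> G (Y @^-1` B).

Definition adapted F (m n : nat) (Y : R -> Om -> 'M[R]_(m, n)) : Prop :=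
  forall t, 0 <= t -> measurable_wrt (F t) (Y t).

Definition cadlag (m n : nat) (y : R -> 'M[R]_(m, n)) : Prop :=
  (forall t, 0 <= t -> y s @[s --> t^'+] --> y t) /\
  (forall t, 0 < t -> cvg (y s @[s --> t^'-])).

Definition left_limit (m n : nat) (y : R -> 'M[R]_(m, n)) (t : R) :
    'M[R]_(m, n) :=
  lim (y s @[s --> t^'-]).

(* [mu_ext P] is the outer probability; it spares measurability side
   conditions on suprema over uncountable sets of times. *)
Definition bigOp (Y : nat -> Om -> R) (u : nat -> R) : Prop :=
  forall e : R, 0 < e -> exists M : R,
    \forall n \near \oo, (mu_ext P [set w | M * u n < `|Y n w|]%R <= e%:E)%E.

(* Uniform convergence on compacts in probability.  Time 0 is left out: a
   stochastic integral over ]0, t] ignores the value of the integrand at 0. *)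
Definition cvg_ucp (m n : nat) (Y : nat -> R -> Om -> 'M[R]_(m, n))
    (Y0 : R -> Om -> 'M[R]_(m, n)) : Prop :=
  forall T e : R, 0 < T -> 0 < e ->
    mu_ext P [set w | exists2 t, 0 < t <= T & e < enorm (Y k t w - Y0 t w)]
      @[k --> \oo] --> 0%E.

Definition stopping_time F (tau : Om -> R) : Prop :=
  (forall w, 0 <= tau w) /\ forall t, 0 <= t -> F t [set w | tau w <= t].

(* The sigma-algebra of the events prior to tau *)
Definition stopped F (tau : Om -> R) : set (set Om) :=
  [set A | measurable A /\
           forall t, 0 <= t -> F t (A `&` [set w | tau w <= t])].

(* H_t = \sum_(i < N) H_i 1_{]T_i, T_(i+1)]}(t) *)
Record simple_process (m n : nat) := SimpleProcess {
  sp_size : nat ;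
  sp_time : nat -> Om -> R ;
  sp_val : nat -> Om -> 'M[R]_(m, n) }.

Definition simple_predictable F (m n : nat) (H : simple_process m n) : Prop :=
  [/\ forall i, (i <= sp_size H)%N -> stopping_time F (sp_time H i),
      forall i w, (i < sp_size H)%N -> sp_time H i w <= sp_time H i.+1 w &
      forall i, (i < sp_size H)%N ->
        measurable_wrt (stopped F (sp_time H i)) (sp_val H i)].

Definition sp_eval (m n : nat) (H : simple_process m n) (t : R) (w : Om) :
    'M[R]_(m, n) :=
  \sum_(i < sp_size H)
     if sp_time H i w < t <= sp_time H i.+1 w then sp_val H i w else 0.

Definition sp_integral (m n : nat) (H : simple_process m n)
    (Z : R -> Om -> 'cV[R]_n) (t : R) (w : Om) : 'cV[R]_m :=
  \sum_(i < sp_size H)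
     sp_val H i w *m (Z (Num.min t (sp_time H i.+1 w)) w
                      - Z (Num.min t (sp_time H i w)) w).

(* I_t = \int_{]0, t]} H_s dZ_s for a left-continuous integrand H: the
   extension, continuous for the ucp topology, of the elementary integral of
   simple predictable processes. *)
Definition stochastic_integral F (m n : nat) (Z : R -> Om -> 'cV[R]_n)
    (H : R -> Om -> 'M[R]_(m, n)) (I : R -> Om -> 'cV[R]_m) : Prop :=
  (exists Hk : nat -> simple_process m n,
     (forall k, simple_predictable F (Hk k)) /\
     cvg_ucp (fun k => sp_eval (Hk k)) H) /\
  (forall Hk : nat -> simple_process m n,
     (forall k, simple_predictable F (Hk k)) ->
     cvg_ucp (fun k => sp_eval (Hk k)) H ->
     cvg_ucp (fun k => sp_integral (Hk k) Z) I).

(* Levy process with respect to the filtration F *)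
Definition levy_process F (r : nat) (Z : R -> Om -> 'cV[R]_r) : Prop :=
  [/\ adapted F Z,
      {ae P, forall w, Z 0 w = 0 /\ cadlag (Z ^~ w)},
      forall (s t : R) A B, 0 <= s -> s <= t -> F s A ->
        <<s @open 'cV[R]_r >> B ->
        P (A `&` [set w | B (Z t w - Z s w)]) =
        (P A * P [set w | B (Z t w - Z s w)%R])%E,
      forall (s t : R) B, 0 <= s -> s <= t -> <<s @open 'cV[R]_r >> B ->
        P [set w | B (Z t w - Z s w)] = P [set w | B (Z (t - s) w)] &
      forall s e : R, 0 <= s -> 0 < e ->
        P [set w | e < enorm (Z t w - Z s w)]
          @[t --> within [set t | 0 <= t] (nbhs s)] --> 0%E].

Definition independent_of_process (m r : nat) (V : Om -> 'cV[R]_m)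
    (Z : R -> Om -> 'cV[R]_r) : Prop :=
  forall A D,
    <<s @open 'cV[R]_m >> A ->
    <<s [set D | exists t B, [/\ 0 <= t, <<s @open 'cV[R]_r >> B &
                                 D = Z t @^-1` B]] >> D ->
    P (V @^-1` A `&` D) = (P (V @^-1` A) * P D)%E.

(* dY_t = a(Y_t) dt + c(Y_{t-}) dZ_t *)
Definition sde_solution F (d r : nat) (a : 'cV[R]_d -> 'cV[R]_d)
    (c : 'cV[R]_d -> 'M[R]_(d, r)) (Z : R -> Om -> 'cV[R]_r)
    (Y : R -> Om -> 'cV[R]_d) : Prop :=
  [/\ adapted F Y,
      {ae P, forall w, cadlag (Y ^~ w)} &
      exists2 I : R -> Om -> 'cV[R]_d,
        stochastic_integral F Z (fun t w => c (left_limit (Y ^~ w) t)) I &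
        {ae P, forall w, forall t, 0 <= t ->
           Y t w = Y 0 w
             + \col_i (\int[@lebesgue_measure R]_(s in `[0, t]) (a (Y s w) i 0))
             + I t w}].

(* P_t(x, dy) = P(Y_t \in dy | Y_0 = x): the transition function of the
   time-homogeneous Markov processes solving the equation.  Ranging over all
   solutions includes those started at a deterministic x, which pins down
   P_t(x, .) (take s = 0) at every such x and not only almost everywhere for
   the law of one given initial value. *)
Definition transition_function F (d r : nat) (a : 'cV[R]_d -> 'cV[R]_d)
    (c : 'cV[R]_d -> 'M[R]_(d, r)) (Z : R -> Om -> 'cV[R]_r)
    (Pt : R -> R.-pker borel_vec R d ~> borel_vec R d) : Prop :=
  forall Y : R -> Om -> 'cV[R]_d, sde_solution F a c Z Y ->
  forall (s t : R) A B, 0 <= s -> 0 <= t -> F s A -> <<s @open 'cV[R]_d >> B ->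
    P (A `&` (Y (s + t) @^-1` B)) = (\int[P]_(w in A) Pt t (Y s w) B)%E.

End Processes.

(** * Conditions of the model *)

Definition bounded_convex_domain (R : realType) (p : nat) (U : set 'cV[R]_p) :
    Prop :=
  [/\ open U, U !=set0, bounded_set U & convex_set U].

Definition moment_condition (R : realType) (dO : measure_display)
    (Om : measurableType dO) (P : probability Om R) (r : nat)
    (V : Om -> 'cV[R]_r) : Prop :=
  [/\ forall i, ('E_P[(fun w => V w i 0)%R] = 0)%E,
      forall i j, ('E_P[(fun w => mxsq (V w) i j)%R] =
                    ((1%:M : 'M[R]_r) i j)%:E)%E &
      forall q : R, 0 < q -> ('E_P[(fun w => enorm (V w) `^ q)%R] < +oo)%E].

(* [D u v] is the partial derivative of f along the list of indices u in x and
   then along v in theta.  The theta-derivatives live on the open set Th and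
   extend continuously to its closure. *)
Definition C24sharp (R : realType) (d p : nat) (Th : set 'cV[R]_p)
    (f : 'cV[R]_d -> 'cV[R]_p -> R) : Prop :=
  (exists L : R, forall th, closure Th th -> forall x y,
     `|f x th - f y th| <= L * enorm (x - y)) /\
  exists D : seq 'I_d -> seq 'I_p -> 'cV[R]_d -> 'cV[R]_p -> R,
  [/\ forall x th, closure Th th -> D [::] [::] x th = f x th,
      forall u i x th, (size u < 2)%N -> closure Th th ->
        is_derive x (delta_mx i 0 : 'cV[R]_d)
          (fun y => D u [::] y th : R^o) (D (i :: u) [::] x th),
      forall u v k x th, (size u <= 2)%N -> (size v < 4)%N -> Th th ->
        is_derive th (delta_mx k 0 : 'cV[R]_p)
          (fun eta => D u v x eta : R^o) (D u (k :: v) x th),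
      (forall u th, (size u <= 2)%N -> closure Th th ->
         continuous (fun y => D u [::] y th)) /\
      (forall u v x, (size u <= 2)%N -> (size v <= 4)%N ->
         {within closure Th, continuous (D u v x)}) &
      exists C K : R, 0 <= C /\
        forall u v x th, (size u <= 2)%N -> (size v <= 4)%N ->
          closure Th th -> `|D u v x th| <= K * (1 + enorm x `^ C)].

Definition diffusion_sq (R : realType) (d r p : nat)
    (c : 'cV[R]_d -> 'cV[R]_p -> 'M[R]_(d, r)) (x : 'cV[R]_d) (g : 'cV[R]_p) :
    'M[R]_d :=
  c x g *m (c x g)^T.

Definition smoothness (R : realType) (d r pa pg : nat)
    (Tha : set 'cV[R]_pa) (Thg : set 'cV[R]_pg)
    (a : 'cV[R]_d -> 'cV[R]_pa -> 'cV[R]_d)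
    (c : 'cV[R]_d -> 'cV[R]_pg -> 'M[R]_(d, r)) : Prop :=
  (forall i, C24sharp Tha (fun x al => a x al i 0)) /\
  (forall i j, C24sharp Thg (fun x g => c x g i j)).

(* Positivity is stated since 0^-1 = 0 in the library. *)
Definition nondegeneracy (R : realType) (d r pg : nat) (Thg : set 'cV[R]_pg)
    (c : 'cV[R]_d -> 'cV[R]_pg -> 'M[R]_(d, r)) : Prop :=
  exists C0 K : R, 0 <= C0 /\
    forall x g, closure Thg g ->
      0 < lambda_min (diffusion_sq c x g) /\
      (lambda_min (diffusion_sq c x g))^-1 <= K * (1 + enorm x `^ C0).

Definition stability (R : realType) (dO : measure_display)
    (Om : measurableType dO) (P : probability Om R) (d : nat)
    (X : R -> Om -> 'cV[R]_d)
    (Pt : R -> R.-pker borel_vec R d ~> borel_vec R d)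
    (pi0 : probability (borel_vec R d) R) : Prop :=
  (forall q : R, 0 < q -> exists2 a : R, 0 < a & exists K : R,
     forall (x : 'cV[R]_d) (t : R) (f : borel_vec R d -> R), 0 <= t ->
       measurable_fun setT f -> (forall y, `|f y| <= 1 + enorm y `^ q) ->
       ((expR (a * t))%:E *
          `|\int[Pt t x]_y (f y)%:E - \int[pi0]_y (f y)%:E|
        <= (K * (1 + enorm x `^ q))%:E)%E) /\
  (forall q : R, 0 < q -> exists M : R, forall t, 0 <= t ->
     ('E_P[(fun w => enorm (X t w) `^ q)%R] <= M%:E)%E).

Definition identifiability (R : realType) (d r pa pg : nat)
    (Tha : set 'cV[R]_pa) (Thg : set 'cV[R]_pg)
    (a : 'cV[R]_d -> 'cV[R]_pa -> 'cV[R]_d)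
    (c : 'cV[R]_d -> 'cV[R]_pg -> 'M[R]_(d, r))
    (pi0 : probability (borel_vec R d) R) (al0 : 'cV[R]_pa) (g0 : 'cV[R]_pg) :
    Prop :=
  let S := diffusion_sq c in
  exists chig chia : R, [/\ 0 < chig, 0 < chia,
    forall g, Thg g ->
      - 2^-1 * (\int[pi0]_x (\tr (invmx (S x g) *m S x g0 - 1%:M)
                             + ln (\det (S x g) / \det (S x g0))))
      <= - chig * enorm (g - g0) ^+ 2 &
    forall al, Tha al ->
      - 2^-1 * (\int[pi0]_x mxdot (invmx (S x g0)) (mxsq (a x al - a x al0)))
      <= - chia * enorm (al - al0) ^+ 2].

Definition prior_density (R : realType) (p : nat) (U : set 'cV[R]_p)
    (pr : 'cV[R]_p -> R) : Prop :=
  (forall g, U g -> 0 <= pr g) /\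
  (\int[@lebesgue_vec R p : set (borel_vec R p) -> \bar R]_(g in U)
     (pr g)%:E = 1)%E.

(** * Gaussian quasi-likelihood and quasi-free energy *)

(* [x : R -> 'cV_d] is a path, observed at the times j h for j <= n. *)
Definition quasi_loglik (R : realType) (d r p : nat)
    (c : 'cV[R]_d -> 'cV[R]_p -> 'M[R]_(d, r)) (x : R -> 'cV[R]_d)
    (n : nat) (h : R) (g : 'cV[R]_p) : R :=
  let S := diffusion_sq c in
  - 2^-1 * \sum_(1 <= j < n.+1)
    (ln (\det ((2 * pi * h) *: S (x (j.-1%:R * h)) g))
     + h^-1 * mxdot (invmx (S (x (j.-1%:R * h)) g))
                    (mxsq (x (j%:R * h) - x (j.-1%:R * h)))).

Definition free_energy (R : realType) (p : nat) (U : set 'cV[R]_p)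
    (pr : 'cV[R]_p -> R) (H : 'cV[R]_p -> R) (n : nat) (b : R) : R :=
  - (n%:R * b)^-1 *
    ln (fine (\int[@lebesgue_vec R p : set (borel_vec R p) -> \bar R]_(g in U)
                (expR (b * H g) * pr g)%:E)%E).

(* Main.v *)
Require Import Defs.
From HB Require Import structures.
From mathcomp Require Import all_boot all_order all_algebra.
From mathcomp Require Import all_classical all_reals all_analysis.
From mathcomp Require Import measurable_realfun.
From mathcomp Require Import ring lra.
From mathcomp Require Import complex.

(** The free energy is minus the logarithm of an integral of e^(N G), divided by
    N, where G = H_(1,n)/n is the normalized quasi-likelihood and N is n for the
    first expansion and T_n = n h for the second. Laplace's method ([laplace])
    gives log of the integral = N G(maximizer) - (p/2) log N + O(1), as soon as G
    minus its maximum is squeezed between two negative quadratic functions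
    centred at the maximizer; its constants depend on these quadratics and on the prior only.
    Everything therefore reduces to producing, for every e > 0, an event of
    probability at least 1 - e on which such a squeeze holds with constants that
    do not depend on n ([good_event]). A law of large numbers for the contrast
    provides it.

    The squeeze comes from three facts. For each parameter g, the difference
    G(g) - G(g0) converges in probability to the integral that the
    identifiability condition bounds by -chi |g - g0|^2 ([contrast_cvg]). The
    first three derivatives of G along segments are bounded by an average Psi_n
    of functions of the data which does not involve the parameter and is bounded
    in mean ([quasi_loglik_C3], [square_average_bound]); hence on a good event
    the convergence at finitely many points of a net extends to the whole
    parameter set. Finally, a function with bounded third derivatives that is
    below -chi |g - g0|^2 up to a small constant, relative to its value at g0,
    has its maximizer near g0 and satisfies quadratic bounds around it
    ([maximizer]): a definite decrease over a fixed distance forces the second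
    derivative along the segment to be negative somewhere, hence everywhere on
    it.

    The convergence of the contrast rests on two laws of large numbers. Averages
    of functions of the observations converge by exponential ergodicity: the
    Markov property and the decay of [transition_decay] bound the covariances
    geometrically, so the variance is of order 1/n + 1/T_n
    ([ergodic_average]). Averages of squared increments divided by h are
    compared with the diffusion matrix ([quadratic_average]): over a step the
    solution moves like the Levy process with frozen coefficients, up to a
    remainder that is of order h in L^2 ([remainder_moment]), and the
    compensated squares of the increments of the Levy process are martingale
    differences ([orthogonal_sum]) with second moments controlled by the fourth
    moments of the process ([levy_incr_moments]).

    The moments of the increments of the solution come straight from the definition
    of the stochastic integral. The increments are limits in
    probability of Riemann sums ([sde_riemann]); for these sums second moments
    are computed by orthogonality ([levy_sum_Ltwo]), and bounds on second
    moments survive the limit ([pcvg_Ltwo]). Likewise conditional expectations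
    appear only through equalities of integrals over the events of a
    sub-sigma-algebra ([sub_integral_eq]). *)

Set Implicit Arguments.
Unset Strict Implicit.
Unset Printing Implicit Defensive.
Import Order.TTheory GRing.Theory Num.Theory.
Import numFieldNormedType.Exports.
Local Open Scope classical_set_scope.
Local Open Scope ring_scope.

(** * Smallest eigenvalue and determinant *)

(** The eigenvalues of a symmetric matrix are real, since v S v^* is its own
    conjugate when S is real symmetric, so a factorization over the complex
    numbers descends. *)
Lemma charpoly_factor (R : rcfType) (d : nat) (S : 'M[R]_d) : S^T = S ->
  exists rs : seq R, char_poly S = \prod_(x <- rs) ('X - x%:P).
Proof.
move=> Ssym.
pose iota : {rmorphism R -> complex R} := real_complex R.
have [r] := closed_field_poly_normal (char_poly (map_mx iota S)).
rewrite (monicP (char_poly_monic _)) scale1r => pE.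
have rootr z : z \in r -> z \is Num.real.
  move=> zr; have : root (char_poly (map_mx iota S)) z by rewrite pE root_prod_XsubC.
  rewrite -eigenvalue_root_char => /eigenvalueP[v vS v0].
  have hv : v *m map_mx iota S *m (map_mx Num.conj v)^T = z *: (v *m (map_mx Num.conj v)^T).
    by rewrite vS scalemxAl.
  pose q := (v *m (map_mx Num.conj v)^T) 0 0.
  have q0 : 0 < q.
    rewrite /q mxE; have [j vj] : exists j, v 0 j != 0.
      apply/existsP; apply: contraR v0; rewrite negb_exists => /forallP v0.
      apply/eqP/rowP => j; rewrite mxE; apply/eqP; by have := v0 j; rewrite negbK.
    rewrite (bigD1 j)//= ltr_pwDl//; last first.
      by apply: sumr_ge0 => k _; rewrite !mxE mul_conjC_ge0.
    by rewrite !mxE mul_conjC_gt0.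
  pose w := (v *m map_mx iota S *m (map_mx Num.conj v)^T) 0 0.
  have wE : w = z * q by rewrite /w hv mxE.
  have wr : Num.conj w = w.
    rewrite /w !mxE rmorph_sum/=.
    under eq_bigr do rewrite !mxE rmorphM/= rmorph_sum/= mulr_suml.
    under [RHS]eq_bigr do rewrite !mxE mulr_suml.
    rewrite exchange_big/=; apply: eq_bigr => i _; apply: eq_bigr => j _.
    rewrite !mxE !rmorphM/= conjCK.
    have -> : Num.conj (iota (S i j)) = iota (S i j).
      by apply/CrealP; apply/complex_realP; exists (S i j).
    have <- : S i j = S j i by rewrite -{1}Ssym mxE.
    have swap (A B C : complex R) : A * B * C = C * B * A by rewrite mulrC mulrA mulrAC.
    exact: swap.
  have qr : q \is Num.real by apply: gtr0_real.
  have -> : z = w / q by rewrite wE mulfK// gt_eqF.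
  by rewrite rpredM ?rpredV//; apply/CrealP.
exists (map (@complex.Re R) r).
apply: (map_poly_inj iota); rewrite map_char_poly pE rmorph_prod/= big_map.
rewrite big_seq [RHS]big_seq; apply: eq_bigr => z zr.
by rewrite rmorphB/= map_polyX map_polyC/= (RRe_real (rootr _ zr)).
Qed.

(** [inf] takes the value 0 on sets that are not bounded below, so positivity
    of [lambda_min S] already contains the existence of a lower bound. *)
Lemma lambda_min_le (R : realType) (d : nat) (S : 'M[R]_d) x :
  0 < lambda_min S -> eigenvalue S x -> lambda_min S <= x.
Proof.
move=> l0 ex; apply: ge_inf => //.
have hi : has_inf [set l | eigenvalue S l].
  apply: contrapT => ninf; move: l0; rewrite /lambda_min.
  have ns : ~ has_sup (-%R @` [set l | eigenvalue S l]) by move=> /has_inf_supN.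
  by rewrite /inf (sup_out ns) oppr0 ltxx.
by case: hi.
Qed.

(** The determinant is the product of the d eigenvalues. This turns the bound
    on the smallest eigenvalue of S into one on 1/|S|, hence on the entries of
    S^-1, which are rational functions with denominator |S|. *)
Lemma lambda_min_det (R : realType) (d : nat) (S : 'M[R]_d) :
  S^T = S -> 0 < lambda_min S -> lambda_min S ^+ d <= \det S.
Proof.
move=> Ssym l0; have [rs rsE] := charpoly_factor Ssym.
have srs : size rs = d.
  have := size_char_poly S; rewrite rsE size_prod_XsubC => -[]; exact.
have -> : \det S = \prod_(x <- rs) x.
  have /(congr1 (fun y => (-1) ^+ d * y)) := char_poly_det S.
  rewrite mulrA -exprD addnn -mul2n exprM sqrrN expr1n expr1n mul1r => <-.
  rewrite -horner_coef0 rsE horner_prod -srs.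
  rewrite (eq_bigr (fun x => -1 * x)); last first.
    by move=> x _; rewrite !hornerE mulN1r.
  by rewrite big_split/= big_const_seq count_predT iter_mulr_1 mulrA -exprD addnn -mul2n exprM sqrrN !expr1n mul1r.
have : forall x, x \in rs -> lambda_min S <= x.
  move=> x xrs; apply: lambda_min_le => //.
  by rewrite eigenvalue_root_char rsE root_prod_XsubC.
move: (lambda_min S) l0 => l l0; rewrite -srs; elim: rs {rsE srs} => [|x s IH] H.
  by rewrite big_nil expr0.
rewrite big_cons /= exprS ler_pM//.
- exact: ltW.
- exact/exprn_ge0/ltW.
- by apply: H; rewrite inE eqxx.
- by apply: IH => y ys; apply: H; rewrite inE ys orbT.
Qed.

(** * Measurability of vector-valued maps *)

Lemma open_cont_meas (R : realType) (d : nat) (U : set 'cV[R]_d) (f : 'cV[R]_d -> R) :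
  open U -> (forall x, U x -> {for x, continuous f}) ->
  measurable_fun (U : set (borel_vec R d)) (f : borel_vec R d -> R).
Proof.
move=> oU cf.
apply: (measurability _ (RGenOpens.measurableE R)) => _ [_ [a [b ->]] <-].
apply: sub_sigma_algebra.
rewrite openE => x [Ux]; rewrite /= in_itv/= => /andP[ax xb].
rewrite /interior; apply: filterI; first exact: open_nbhs_nbhs.
have : nbhs (f x) `]a, b[%classic.
  by apply: open_nbhs_nbhs; split; [exact: interval_open|rewrite /= in_itv/= ax xb].
by move=> /(cf _ Ux).
Qed.

Lemma cont_meas (R : realType) (d : nat) (f : 'cV[R]_d -> R) :
  continuous f -> measurable_fun setT (f : borel_vec R d -> R).
Proof. by move=> cf; apply: open_cont_meas => [|x _]; [exact: openT|exact: cf]. Qed.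

Lemma coord_meas (R : realType) (d : nat) (i : 'I_d) :
  measurable_fun setT ((fun x : 'cV[R]_d => x i 0) : borel_vec R d -> R).
Proof. by apply: cont_meas; exact: coord_continuous. Qed.

(** R^d has a countable base: balls with rational centres and radii. The ball of
    radius 0 is empty, which serves as default value for the indices to be
    skipped. *)
Lemma open_vecE (R : realType) (d : nat) (U : set 'cV[R]_d) : open U ->
  exists (c : nat -> 'cV[R]_d) (r : nat -> R), U = \bigcup_k ball (c k) (r k).
Proof.
move=> oU.
pose cr (k : nat) : 'cV[rat]_d * rat := odflt (0, 0) (unpickle k).
pose c k : 'cV[R]_d := map_mx ratr (cr k).1.
pose r k : R := ratr (cr k).2.
exists c; exists (fun k => if `[< ball (c k) (r k) `<=` U >] then r k else 0).
apply/seteqP; split; last first.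
  move=> x [k _]; case: asboolP => [+|_]; first exact.
  by move=> [+ _]; rewrite ltxx.
move=> x Ux; move: oU; rewrite openE => /(_ _ Ux); rewrite /interior -nbhs_ballE => -[e e0 xe].
have [q] := rat_in_itvoo (divr_gt0 e0 (ltr0n _ 2)).
rewrite in_itv/= => /andP[q0 qe].
have H (i : 'I_d) : exists z : rat, `|x i 0 - ratr z| < ratr q.
  have : x i 0 - ratr q < x i 0 + ratr q by rewrite ltrBlDr -addrA ltrDl addr_gt0.
  move=> /rat_in_itvoo[z]; rewrite in_itv/= => /andP[h1 h2]; exists z.
  by rewrite ltr_norml; apply/andP; split; lra.
have [z hz] := choice H.
exists (pickle ((\col_i z i, q) : 'cV[rat]_d * rat)) => //.
have cE : c (pickle ((\col_i z i, q) : 'cV[rat]_d * rat)) = \col_i ratr (z i).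
  by rewrite /c /cr pickleK/=; apply/colP => i; rewrite !mxE.
have rE : r (pickle ((\col_i z i, q) : 'cV[rat]_d * rat)) = ratr q.
  by rewrite /r /cr pickleK.
rewrite cE rE; case: asboolP => [_|[]].
  split=> // i j; rewrite ord1 !mxE /ball/= distrC; exact: hz.
move=> y [_ hy]; apply: xe; split=> // i j; rewrite (ord1 j).
have := hy i 0; rewrite mxE /ball/= => h.
rewrite /ball/=; have := hz i => h'.
have -> : x i 0 - y i 0 = (x i 0 - ratr (z i)) + (ratr (z i) - y i 0) by ring.
apply: (le_lt_trans (ler_normD _ _)); lra.
Qed.

(** An open set is a countable union of balls of the sup norm, and such a ball is
    a finite intersection of conditions on single coordinates. *)
Lemma vec_meas (R : realType) (d : nat) (dT : measure_display) (T : measurableType dT)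
    (D : set T) (f : T -> 'cV[R]_d) : measurable D ->
  (forall i, measurable_fun D (fun w => f w i 0)) ->
  measurable_fun D (f : T -> borel_vec R d).
Proof.
move=> mD mf.
apply: (@measurability _ _ _ (borel_vec R d) D f (@open 'cV[R]_d)) => // _ [U oU <-].
have [c [r ->]] := open_vecE oU.
rewrite preimage_bigcup setI_bigcupr; apply: bigcupT_measurable => k.
have [r0|r0] := ltP 0 (r k); last first.
  rewrite (_ : D `&` _ = set0)//; apply/seteqP; split=> // x [_ [+ _]].
  by rewrite ltNge r0.
rewrite (_ : D `&` _ = D `&` \bigcap_(i in [set: 'I_d]) (D `&` (fun w => f w i 0) @^-1` `](c k i 0 - r k), (c k i 0 + r k)[ )).
  apply: measurableI => //; apply: fin_bigcap_measurable; first exact: finite_finset.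
  by move=> i _; apply: mf => //; exact: measurable_itv.
have E (y : 'cV[R]_d) i : (y i 0 \in `](c k i 0 - r k), (c k i 0 + r k)[) = (`|c k i 0 - y i 0| < r k).
  by rewrite in_itv/= -ltr_distl distrC.
apply/seteqP; split=> x.
  by move=> [Dx [_ xb]]; split=> // i _; split => //=; rewrite E; exact: (xb i 0).
move=> [Dx xb]; split=> //; split=> // i j; rewrite (ord1 j).
by have [_ ] := xb i I; rewrite /= E.
Qed.

Lemma measurable_wrt_fun (R : realType) (dO : measure_display) (Om : measurableType dO) (G : set (set Om)) (m : nat)
    (Y : Om -> 'cV[R]_m) : sigma_algebra setT G -> measurable_wrt G Y ->
  measurable_fun setT (Y : g_sigma_algebraType G -> borel_vec R m).
Proof.
move=> sG mY _ B mB; rewrite setTI; apply: sub_sigma_algebra; exact: mY.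
Qed.

(** * Integration against the iterated Lebesgue measure *)

Lemma col_mx_meas (R : realType) (q : nat) :
  measurable_fun setT ((fun z => col_mx (z.1%:M : 'M[R]_1) z.2) : (measurableTypeR R * borel_vec R q)%type -> borel_vec R q.+1).
Proof.
apply: vec_meas => // i.
case: (split_ordP (i : 'I_(1 + q))) => j ->.
  rewrite (_ : (fun _ => _) = fst); last by apply/funext => -[w v] /=; rewrite (@col_mxEu _ 1 q) mxE (ord1 j) eqxx mulr1n.
  exact: measurable_fst.
rewrite (_ : (fun _ => _) = (fun x : 'cV[R]_q => x j 0) \o snd); last by apply/funext => -[w v] /=; rewrite (@col_mxEd _ 1 q).
exact: (measurableT_comp (coord_meas j)) measurable_snd.
Qed.

Lemma lebesgue_vecS (R : realType) (q : nat) (A : set 'cV[R]_q.+1) :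
  lebesgue_vec A = product_measure1 (@lebesgue_measure R) (@lebesgue_vec R q : set (borel_vec R q) -> \bar R)
     ((fun z : R * 'cV[R]_q => col_mx (z.1%:M : 'M[R]_1) z.2) @^-1` A).
Proof.
rewrite /= /product_measure1; apply: eq_integral => x _ /=; congr lebesgue_vec.
by rewrite xsectionE.
Qed.
Lemma product_sigma_finite (R : realType) d1 d2 (T1 : measurableType d1) (T2 : measurableType d2)
  (m1 : {sigma_finite_measure set T1 -> \bar R}) (m2 : {sigma_finite_measure set T2 -> \bar R}) :
  sigma_finite setT (m1 \x m2)%E.
Proof.
have /sigma_finiteP[F [TF ndF Foo]] := sigma_finiteT m1.
have /sigma_finiteP[G [TG ndG Goo]] := sigma_finiteT m2.
exists (fun n => F n `*` G n).
  apply/seteqP; split=> [[x y] _|//].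
  have [n _ Fnx] : (\bigcup_n F n) x by rewrite -TF.
  have [k _ Gky] : (\bigcup_n G n) y by rewrite -TG.
  exists (maxn n k) => //; split => /=.
    by have /subsetPset := ndF _ _ (leq_maxl n k); exact.
  by have /subsetPset := ndG _ _ (leq_maxr n k); exact.
move=> k; have [mF Fk] := Foo k; have [mG Gk] := Goo k.
split; first exact: measurableX.
by rewrite product_measure1E// lte_mul_pinfty// ge0_fin_numE.
Qed.

(** By induction on the dimension, [lebesgue_vec] is the push-forward of a
    product measure under (x, v) |-> col_mx x v, so it is a measure and the
    integration theory applies to it. *)
Lemma lebesgue_vec_measure (R : realType) (p : nat) :
  exists m : {sigma_finite_measure set (borel_vec R p) -> \bar R},
    (m : set 'cV[R]_p -> \bar R) = @lebesgue_vec R p.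
Proof.
elim: p => [|q [m mE]].
  exists (@dirac _ (borel_vec R 0) (0 : 'cV[R]_0) R).
  apply/funext => A; rewrite /dirac/= ; reflexivity.
pose phi : (measurableTypeR R * borel_vec R q)%type -> borel_vec R q.+1 := fun z => col_mx (z.1%:M : 'M[R]_1) z.2.
have mphi : measurable_fun setT phi by exact: col_mx_meas.
pose M : {measure set (borel_vec R q.+1) -> \bar R} := measure_function_pushforward__canonical__measure_function_Measure (@lebesgue_measure R \x m)%E mphi.
have ME : (M : set _ -> \bar R) = @lebesgue_vec R q.+1.
  by apply/funext => A; rewrite lebesgue_vecS -mE.
have sf : sigma_finite setT M.
  have [F [FU mF]] := product_sigma_finite (@lebesgue_measure R) m.
  pose psi : borel_vec R q.+1 -> (measurableTypeR R * borel_vec R q)%type := fun y => (usubmx (y : 'cV_(1 + q)) 0 0, dsubmx (y : 'cV_(1 + q))).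
  have mpsi : measurable_fun setT psi.
    apply/measurable_fun_pairP; split => /=.
      rewrite (_ : _ \o _ = (fun x : 'cV_(q.+1) => x 0 0)); first exact: coord_meas.
      apply/funext => y /=; rewrite mxE; congr (y _ _); exact/val_inj.
    apply: vec_meas => // i; rewrite (_ : (fun _ => _) = (fun x : 'cV_(q.+1) => x (rshift 1 i) 0)); first exact: coord_meas.
    by apply/funext => y /=; rewrite mxE.
  have phiK z : psi (phi z) = z.
    by rewrite /psi /phi col_mxKu col_mxKd mxE eqxx mulr1n; case: z.
  exists (fun n => psi @^-1` F n); first by rewrite -preimage_bigcup -FU.
  move=> n; split; first by rewrite -[X in measurable X]setTI; apply: mpsi => //; case: (mF n).
  rewrite /M /= /pushforward -comp_preimage.
  rewrite (_ : psi \o phi = id); last by apply/funext => z /=; rewrite phiK.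
  by case: (mF n).
pose M' : {sigma_finite_measure set (borel_vec R q.+1) -> \bar R} :=
  HB.pack (M : set _ -> \bar R) (Measure.class M) (@Measure_isSigmaFinite.Build _ _ _ M sf).
by exists M'.
Qed.

Lemma lebesgue_vec_tonelli (R : realType) (q : nat) (f : 'cV[R]_q.+1 -> \bar R) :
  measurable_fun setT (f : borel_vec R q.+1 -> \bar R) -> (forall x, 0 <= f x)%E ->
  (\int[@lebesgue_vec R q.+1 : set (borel_vec R q.+1) -> \bar R]_g f g =
   \int[@lebesgue_measure R]_x
     \int[@lebesgue_vec R q : set (borel_vec R q) -> \bar R]_v f (col_mx (x%:M : 'M[R]_1) v))%E.
Proof.
move=> mf f0; have [m mE] := lebesgue_vec_measure R q.
pose phi : (measurableTypeR R * borel_vec R q)%type -> borel_vec R q.+1 := fun z => col_mx (z.1%:M : 'M[R]_1) z.2.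
have E : @lebesgue_vec R q.+1 = pushforward (@lebesgue_measure R \x m)%E phi.
  by apply/funext => A; rewrite lebesgue_vecS -mE.
rewrite E ge0_integral_pushforward//; last exact: col_mx_meas.
rewrite preimage_setT fubini_tonelli1//.
- by rewrite /fubini_F -mE.
- exact: (measurableT_comp mf (@col_mx_meas R q)).
- by move=> x; exact: f0.
Qed.

Lemma integral_gauss1 (R : realType) (l m : R) : 0 < l ->
  (\int[@lebesgue_measure R]_x (expR (- (l * (x - m) ^+ 2)))%:E = (Num.sqrt (pi / l))%:E)%E.
Proof.
move=> l0; pose s := Num.sqrt ((2 * l)^-1).
have s2 : s ^+ 2 = (2 * l)^-1 by rewrite sqr_sqrtr// invr_ge0 mulr_ge0// ltW.
have s0 : s != 0 by rewrite sqrtr_eq0 -ltNge invr_gt0 mulr_gt0.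
have pk : Num.sqrt (s ^+ 2 * pi *+ 2) = Num.sqrt (pi / l).
  by rewrite s2; congr Num.sqrt; rewrite -mulr_natr; field; lra.
have pk0 : 0 < Num.sqrt (pi / l) by rewrite sqrtr_gt0 divr_gt0// pi_gt0.
have E x : (expR (- (l * (x - m) ^+ 2)))%:E = ((Num.sqrt (pi / l))%:E * (normal_pdf m s x)%:E)%E.
  have -> : normal_pdf m s x = (Num.sqrt (pi / l))^-1 * expR (- (l * (x - m) ^+ 2)).
    rewrite /normal_pdf (negbTE s0) /normal_peak pk; congr (_ * _).
    by rewrite /normal_fun; congr expR; rewrite s2 -mulr_natr; field; lra.
  have : Num.sqrt (pi / l) != 0 by rewrite gt_eqF.
  move: (Num.sqrt _) => y y0; by rewrite -EFinM [X in _ = X%:E]mulrA mulfV// mul1r.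
under eq_integral do rewrite E.
rewrite ge0_integralZl//.
- by rewrite integral_normal_pdf mule1.
- by apply/measurable_EFinP; exact: measurable_normal_pdf.
- by move=> x _; rewrite lee_fin normal_pdf_ge0.
Qed.

Lemma coordD_meas (R : realType) (d : nat) (i : 'I_d) (m : R) :
  measurable_fun setT ((fun x : 'cV[R]_d => x i 0 - m) : borel_vec R d -> R).
Proof. by apply: measurable_funB => //; exact: coord_meas. Qed.

Lemma gauss_vec_meas (R : realType) (p : nat) (l : R) (m : 'cV[R]_p) :
  measurable_fun setT ((fun g : 'cV[R]_p => expR (- (l * \sum_i (g i 0 - m i 0) ^+ 2))) : borel_vec R p -> R).
Proof.
apply: measurableT_comp; first exact: measurable_expR.
apply: measurableT_comp; first exact: oppr_measurable.
apply: measurable_funM => //; apply: measurable_sum => i.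
by apply: measurable_funX; exact: coordD_meas.
Qed.

(** Tonelli's theorem reduces the integral to the normal density on the line. *)
Lemma integral_gauss_vec (R : realType) (p : nat) (l : R) (m : 'cV[R]_p) : 0 < l ->
  (\int[@lebesgue_vec R p : set (borel_vec R p) -> \bar R]_g
    (expR (- (l * \sum_i (g i 0 - m i 0) ^+ 2)))%:E = (Num.sqrt (pi / l) ^+ p)%:E)%E.
Proof.
move=> l0; elim: p m => [|q IH] m.
  have -> : @lebesgue_vec R 0 = @dirac _ (borel_vec R 0) (0 : 'cV[R]_0) R by [].
  rewrite integral_dirac//; last first.
    apply/measurable_EFinP; exact: gauss_vec_meas.
  by rewrite diracT mul1e big_ord0 mulr0 oppr0 expR0 expr0.
rewrite lebesgue_vec_tonelli; [|by apply/measurable_EFinP; exact: gauss_vec_meas|by move=> x; rewrite lee_fin expR_ge0].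
pose m' : 'cV[R]_q := dsubmx (m : 'cV_(1 + q)).
have E x (v : 'cV[R]_q) : (expR (- (l * \sum_(i < q.+1) ((col_mx (x%:M : 'M[R]_1) v : 'cV_(q.+1)) i 0 - m i 0) ^+ 2)))%:E
   = ((expR (- (l * (x - m 0 0) ^+ 2)))%:E * (expR (- (l * \sum_i (v i 0 - m' i 0) ^+ 2)))%:E)%E.
  have -> : \sum_(i < q.+1) ((col_mx (x%:M : 'M[R]_1) v : 'cV_(q.+1)) i 0 - m i 0) ^+ 2 =
     (x - m 0 0) ^+ 2 + \sum_i (v i 0 - m' i 0) ^+ 2.
    rewrite big_ord_recl; apply: f_equal2.
      have -> : (ord0 : 'I_q.+1) = lshift q (0 : 'I_1) by apply/val_inj.
      rewrite (@col_mxEu _ 1 q) mxE eqxx mulr1n.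
      by have <- : (0 : 'I_q.+1) = lshift q (0 : 'I_1) by apply/val_inj.
    apply: eq_bigr => i _; have -> : lift ord0 i = rshift 1 i by apply/val_inj.
    by rewrite (@col_mxEd _ 1 q) mxE.
  by rewrite mulrDr opprD expRD EFinM.
have [mm mmE] := lebesgue_vec_measure R q.
transitivity (\int[@lebesgue_measure R]_x
    ((expR (- (l * (x - m 0 0) ^+ 2)))%:E * (Num.sqrt (pi / l) ^+ q)%:E))%E.
  apply: eq_integral => x _; rewrite -(IH m') -mmE.
  under eq_integral do rewrite E.
  rewrite ge0_integralZl//.
  - by apply/measurable_EFinP; exact: gauss_vec_meas.
rewrite ge0_integralZr//.
- by rewrite integral_gauss1// -EFinM exprS.
- apply/measurable_EFinP; apply: measurableT_comp; first exact: measurable_expR.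
  apply: measurableT_comp; first exact: oppr_measurable.
  by apply: measurable_funM => //; apply: measurable_funX; exact: measurable_funB.
Qed.

Lemma lebesgue_vec_cube (R : realType) (p : nat) (r : R) (m : 'cV[R]_p) : 0 < r ->
  lebesgue_vec [set g : 'cV[R]_p | forall i, `|g i 0 - m i 0| < r] = ((2 * r) ^+ p)%:E.
Proof.
move=> r0; elim: p m => [|q IH] m.
  rewrite /= expr0 indicE mem_set//=; by case.
rewrite /=.
pose m' : 'cV[R]_q := dsubmx (m : 'cV_(1 + q)).
pose I := `](m 0 0 - r), (m 0 0 + r)[%classic : set R.
transitivity (\int[@lebesgue_measure R]_x (((2 * r) ^+ q)%:E * (\1_I x)%:E))%E.
  apply: eq_integral.
  move=> x _; rewrite indicE.
  have IE : (x \in I) = (`|x - m 0 0| < r).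
    by rewrite /I mem_setE in_itv/= -ltr_distl.
  have H (v : 'cV[R]_q) : (forall i : 'I_q.+1, `|(col_mx (x%:M : 'M[R]_1) v : 'cV_(q.+1)) i 0 - m i 0| < r) <->
     (`|x - m 0 0| < r /\ forall i, `|v i 0 - m' i 0| < r).
    split=> [H|[H1 H2] i].
      split; last by move=> i; have := H (rshift 1 i); rewrite (@col_mxEd _ 1 q) mxE.
      have := H (lshift q (0 : 'I_1)); rewrite (@col_mxEu _ 1 q) mxE eqxx mulr1n.
      by have -> : lshift q (0 : 'I_1) = 0 :> 'I_q.+1 by apply/val_inj.
    case: (split_ordP (i : 'I_(1 + q))) => j ->.
      rewrite (@col_mxEu _ 1 q) mxE (ord1 j) eqxx mulr1n.
      by have -> : lshift q (0 : 'I_1) = 0 :> 'I_q.+1 by apply/val_inj.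
    by rewrite (@col_mxEd _ 1 q); have := H2 j; rewrite mxE.
  rewrite IE; case: ltP => h.
    rewrite mule1 -(IH m'); congr lebesgue_vec; apply/seteqP; split=> v /=.
      by move/H => [].
    by move=> h2; apply/H.
  rewrite mule0 (_ : [set _ | _] = set0).
    by have [mm mmE] := lebesgue_vec_measure R q; rewrite -mmE measure0.
  apply/seteqP; split=> v //= /H[+ _]; by rewrite ltNge h.
rewrite ge0_integralZl//.
- have -> : (\int[@lebesgue_measure R]_x (\1_I x)%:E = (2 * r)%:E)%E.
    rewrite integral_indic//; last exact: measurable_itv.
    have -> : I `&` setT = I by exact: setIT.
    have := @lebesgue_measure_itv R `](m 0 0 - r), (m 0 0 + r)[; rewrite /= lte_fin ifT; last lra.
    by move=> ->; rewrite -EFinD; congr EFin; lra.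
  by rewrite -EFinM exprSr.
- by apply/measurable_EFinP; apply: measurable_indic; exact: measurable_itv.
- by rewrite lee_fin exprn_ge0// mulr_ge0// ltW.
Qed.

(** * The Laplace approximation *)

Lemma norm_coord (R : realType) (m n : nat) (A : 'M[R]_(m, n)) i j : `|A i j| <= `|A|.
Proof.
rewrite [leRHS]/Num.norm /= mx_normrE.
exact: (@le_bigmax _ _ _ _ (fun ij : 'I_m * 'I_n => `|A ij.1 ij.2|) (i, j)).
Qed.

Lemma norm_le_coord (R : realType) (m n : nat) (A : 'M[R]_(m, n)) r :
  0 <= r -> (forall i j, `|A i j| <= r) -> `|A| <= r.
Proof.
move=> r0 H; rewrite [leLHS]/Num.norm /= mx_normrE.
by apply: bigmax_le => // -[i j] _; exact: H.
Qed.

(** Laplace's method, with constants that do not depend on the function G but only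
    on its quadratic bounds around the maximizer. Above, the integrand is at most
    e^(N G(gh)) times a Gaussian of variance of order 1/N; below, it is at
    least a constant multiple of e^(N G(gh)) on the cube of radius N^(-1/2)
    around gh. Both have integral of order N^(-p/2), whence the term
    (p/2) log N. *)
Lemma laplace (R : realType) (p : nat) (Th : set 'cV[R]_p) (pr : 'cV[R]_p -> R)
    (g0 : 'cV[R]_p) (M m0 s0 lam Lam s : R) :
  open Th -> {within closure Th, continuous pr} ->
  (forall g, Th g -> 0 <= pr g <= M) ->
  (forall g, `|g - g0| < s0 -> Th g /\ m0 <= pr g) -> 0 < m0 -> 0 < s0 -> 0 < lam -> 0 < Lam -> 0 < s ->
  exists C N0 : R, 0 < N0 /\ forall (G : 'cV[R]_p -> R) (gh : 'cV[R]_p) (N : R), N0 <= N ->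
    (forall g, Th g -> {for g, continuous G}) ->
    `|gh - g0| <= s0 / 2 ->
    (forall g, Th g -> G g - G gh <= - lam * `|g - gh| ^+ 2) ->
    (forall g, `|g - gh| <= s -> - Lam * `|g - gh| ^+ 2 <= G g - G gh) ->
    `| ln (fine (\int[@lebesgue_vec R p : set (borel_vec R p) -> \bar R]_(g in Th) (expR (N * G g) * pr g)%:E)%E)
       - N * G gh + p%:R / 2 * ln N| <= C.
Proof.
move=> oTh cpr prM prm m00 s00 lam0 Lam0 sp0.
have [mu muE] := lebesgue_vec_measure R p.
have prc g : Th g -> {for g, continuous pr}.
  move=> Thg; have := continuous_subspaceW (@subset_closure _ Th) cpr.
  rewrite continuous_open_subspace// => /(_ g); apply; exact: mem_set.
pose A := expR (- Lam) * m0 * 2 ^+ p.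
pose B := (M + 1) * Num.sqrt (pi * (p%:R + 1) / lam) ^+ p.
have A0 : 0 < A by rewrite /A !mulr_gt0 ?expR_gt0 ?exprn_gt0.
have M0 : 0 <= M.
  have [] := prm g0; first by rewrite subrr normr0.
  by move=> /prM/andP[h1 h2] _; apply: le_trans h2.
have B0 : 0 < B.
  rewrite /B mulr_gt0 ?ltr_wpDl// exprn_gt0// sqrtr_gt0 divr_gt0// mulr_gt0 ?pi_gt0//.
(* The threshold on N makes the cube of radius N^(-1/2) fit into both
   neighbourhoods where the lower bounds are available. *)
exists (`|ln A| + `|ln B|); exists (Num.max (s ^- 2) ((s0 / 2) ^- 2)).
split; first by rewrite lt_max invr_gt0 exprn_gt0.
move=> G gh N; rewrite ge_max => /andP[Ns Ns0] cG gh0 up lo.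
have N0 : 0 < N by apply: lt_le_trans Ns; rewrite invr_gt0 exprn_gt0.
pose r := (Num.sqrt N)^-1.
have r0 : 0 < r by rewrite invr_gt0 sqrtr_gt0.
have r2 : r ^+ 2 = N^-1 by rewrite /r exprVn sqr_sqrtr// ltW.
have rle x : 0 < x -> x ^- 2 <= N -> r <= x.
  move=> x0 xN; rewrite -(@ler_pXn2r _ 2)// ?nnegrE ?(ltW x0) ?(ltW r0)//.
  by rewrite r2 invf_ple ?posrE ?exprn_gt0.
have rs : r <= s by exact: rle.
have rs0 : r <= s0 / 2 by apply: rle => //; rewrite divr_gt0.
set c := expR (N * G gh).
have c0 : 0 < c by exact: expR_gt0.
set f := fun g => expR (N * G g) * pr g.
have mTh : measurable (Th : set (borel_vec R p)) by apply: sub_sigma_algebra.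
have mf : measurable_fun (Th : set (borel_vec R p)) (f : borel_vec R p -> R).
  apply: open_cont_meas => // g Thg.
  apply: continuousM; last exact: prc.
  apply: continuous_comp; last exact: continuous_expR.
  by apply: continuousM; [exact: cst_continuous|exact: cG].
have f0 g : Th g -> 0 <= f g by move=> /prM/andP[h _]; rewrite mulr_ge0// expR_ge0.
pose Cb := [set g : 'cV[R]_p | forall i, `|g i 0 - gh i 0| < r].
have CbN g : Cb g -> `|g - gh| <= r.
  by move=> Cg; apply: norm_le_coord => [|i j]; rewrite ?ltW// !mxE (ord1 j).
have CbTh g : Cb g -> Th g /\ m0 <= pr g.
  move=> Cg; apply: prm.
  rewrite -(subrK gh g) -addrA; apply: (@le_lt_trans _ _ (`|g - gh| + `|gh - g0|)); first exact: ler_normD.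
  (* In dimension 0 the strict bound on the coordinates says nothing about the
     norm, which is 0. *)
  have [p0|p0] := posnP p.
    have z (x : 'cV[R]_p) : `|x| = 0.
      have -> : x = 0 by apply/colP => i; have := ltn_ord i; rewrite [X in (_ < X)%N]p0.
      by rewrite normr0.
    by rewrite !z addr0.
  have : `|g - gh| < r; last lra.
  rewrite [ltLHS]/Num.norm /= mx_normrE; apply: bigmax_lt => // -[i j] _ /=.
  by have := Cg i; rewrite !mxE (ord1 j).
have mCb : measurable (Cb : set (borel_vec R p)).
  rewrite (_ : Cb = \bigcap_(i in [set: 'I_p]) ((fun g : borel_vec R p => g i 0) @^-1` `](gh i 0 - r), (gh i 0 + r)[)).
    apply: fin_bigcap_measurable; first exact: finite_finset.
    by move=> i _; rewrite -[X in measurable X]setTI; apply: coord_meas => //; exact: measurable_itv.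
  by apply/seteqP; split=> g /= H i; have := H i; rewrite /= in_itv/= -ltr_distl//; exact.
set I := integral _ _ _.
have fE g : f g = c * (expR (N * (G g - G gh)) * pr g).
  by rewrite /f /c mulrA -expRD -mulrDr addrCA subrr addr0.
have IL : ((c * A * r ^+ p)%:E <= I)%E.
  have -> : ((c * A * r ^+ p)%:E = \int[mu]_(g in Cb) (c * (expR (- Lam) * m0))%:E)%E.
    rewrite integral_cst// [X in (_ * X)%E](_ : _ = ((2 * r) ^+ p)%:E).
      by rewrite -EFinM /A exprMn; congr EFin; ring.
    by rewrite -(lebesgue_vec_cube gh r0) -muE.
  rewrite /I -muE; apply: (@le_trans _ _ (\int[mu]_(g in Cb) (f g)%:E)%E).
    apply: ge0_le_integral => //.
    - by move=> g _; rewrite lee_fin !mulr_ge0 ?expR_ge0// ltW.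
    - by apply/measurable_EFinP; apply: measurable_funS mf => // g /CbTh[].
    - move=> g Cg; have [Tg mg] := CbTh _ Cg; rewrite lee_fin fE ler_pM2l//.
      rewrite ler_pM ?expR_ge0// ?(ltW m00)// ler_expR.
      have h1 : `|g - gh| <= s by apply: le_trans (CbN _ Cg) rs.
      apply: (@le_trans _ _ (N * (- Lam * `|g - gh| ^+ 2))); last by rewrite ler_pM2l// lo.
      have h2 : `|g - gh| ^+ 2 <= r ^+ 2 by rewrite lerXn2r ?nnegrE ?CbN// ltW.
      rewrite mulrCA mulNr lerN2 ler_piMr ?(ltW Lam0)//.
      by apply: le_trans (ler_wpM2l (ltW N0) h2) _; rewrite r2 mulfV// gt_eqF.
  apply: ge0_subset_integral => //.
  - exact/measurable_EFinP.
  - by move=> g /CbTh[].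
have IU : (I <= (c * B * r ^+ p)%:E)%E.
  (* The squared Euclidean norm is at most p times the squared sup norm; adding 1 to p
     avoids a division by 0. *)
  pose l := N * (lam / (p%:R + 1)).
  have p10 : 0 < p%:R + 1 :> R by rewrite ltr_wpDl.
  have l0 : 0 < l by rewrite mulr_gt0// divr_gt0.
  pose e (g : 'cV[R]_p) := expR (- (l * \sum_i (g i 0 - gh i 0) ^+ 2)).
  have -> : ((c * B * r ^+ p)%:E = \int[mu]_g ((c * (M + 1))%:E * (e g)%:E))%E.
    rewrite ge0_integralZl//; last 3 first.
      by apply/measurable_EFinP; exact: gauss_vec_meas.
      by move=> g _; rewrite lee_fin expR_ge0.
      by rewrite lee_fin mulr_ge0 ?addr_ge0// ltW.
    rewrite [X in (_ * X)%E](_ : _ = (Num.sqrt (pi / l) ^+ p)%:E); last first.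
      by rewrite -(integral_gauss_vec gh l0) -muE.
    rewrite -EFinM; congr EFin.
    have -> : Num.sqrt (pi / l) = Num.sqrt (pi * (p%:R + 1) / lam) * r.
      have -> : r = Num.sqrt N^-1 by rewrite sqrtrV// ltW.
      rewrite -sqrtrM; last by rewrite !mulr_ge0 ?pi_ge0 ?invr_ge0// ltW.
      by congr Num.sqrt; rewrite /l; field; rewrite !gt_eqF//.
    by rewrite exprMn /B; ring.
  rewrite /I -muE; apply: (@le_trans _ _ (\int[mu]_(g in Th) ((c * (M + 1))%:E * (e g)%:E))%E).
    apply: ge0_le_integral => //.
    - exact/measurable_EFinP.
    - apply/measurable_EFinP; apply: measurable_funM => //; apply: measurable_funTS; exact: gauss_vec_meas.
    - move=> g Tg; rewrite -EFinM lee_fin -/(f g) fE -[leRHS]mulrA ler_pM2l// [leRHS]mulrC.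
      have /andP[q1 q2] := prM _ Tg.
      apply: ler_pM; rewrite ?expR_ge0//; last by apply: (le_trans q2); rewrite ler_wpDr.
      rewrite ler_expR /l -mulrA -mulrN ler_pM2l//; apply: (le_trans (up _ Tg)).
      rewrite mulNr lerN2 -mulrA ler_pM2l// ler_pdivrMl//.
      apply: (@le_trans _ _ (\sum_(i < p) `|g - gh| ^+ 2)).
        apply: ler_sum => i _; rewrite -[leLHS]real_normK ?num_real// lerXn2r ?nnegrE//.
        by have := norm_coord (g - gh) i 0; rewrite !mxE.
      by rewrite sumr_const card_ord -[leLHS]mulr_natl ler_wpM2r ?sqr_ge0// lerDl ler01.
  apply: ge0_subset_integral => //.
  - by apply/measurable_EFinP; apply: measurable_funM => //; exact: gauss_vec_meas.
  - by move=> g _; rewrite -EFinM lee_fin !mulr_ge0 ?expR_ge0 ?addr_ge0// ltW.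
have [Ir IrE] : exists Ir, I = Ir%:E.
  exists (fine I); rewrite fineK// ge0_fin_numE; last first.
    by apply: le_trans IL; rewrite lee_fin !mulr_ge0 ?exprn_ge0// ltW.
  by apply: le_lt_trans IU _; rewrite ltry.
rewrite IrE /=; move: IL IU; rewrite IrE !lee_fin => IL IU.
have rp0 : 0 < r ^+ p by rewrite exprn_gt0.
have pos x : 0 < x -> 0 < c * x * r ^+ p by move=> x0; apply: mulr_gt0 => //; exact: mulr_gt0.
have Ir0 : 0 < Ir by apply: lt_le_trans IL; exact: pos.
have lr : ln (r ^+ p) = - (p%:R / 2 * ln N).
  rewrite lnXn// /r lnV ?posrE ?sqrtr_gt0//.
  have -> : ln N = ln (Num.sqrt N) *+ 2 by rewrite -lnXn ?sqrtr_gt0// sqr_sqrtr// ltW.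
  by rewrite -mulr_natl -[in RHS]mulr_natl; field.
have lnE x : 0 < x -> ln (c * x * r ^+ p) = N * G gh + ln x - p%:R / 2 * ln N.
  move=> x0; rewrite lnM ?posrE//; last exact: mulr_gt0.
  by rewrite lnM ?posrE// lr /c expRK.
have h1 : N * G gh + ln A - p%:R / 2 * ln N <= ln Ir.
  by rewrite -lnE// ler_ln// posrE; exact: pos.
have h2 : ln Ir <= N * G gh + ln B - p%:R / 2 * ln N.
  by rewrite -lnE// ler_ln// posrE; exact: pos.
rewrite ler_norml; apply/andP; split.
  have := ler_norm (- ln A); rewrite normrN; have := normr_ge0 (ln B); move: h1; clear; lra.
have := ler_norm (ln B); have := normr_ge0 (ln A); move: h2; clear; lra.
Qed.

(** * From a near-maximum to quadratic bounds *)

Lemma is_derive_shift (R : realType) (f : R -> R) (t d : R) :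
  is_derive (0 : R) 1 (fun e => f (t + e)) d -> is_derive t 1 f d.
Proof.
move=> H.
have E : f = (fun e => f (t + e)) \o (fun x => x - t).
  by apply/funext => x /=; rewrite addrC subrK.
rewrite E -[d]mulr1; apply: is_derive1_comp.
  by rewrite /= subrr.
rewrite -[X in is_derive _ _ _ X]subr0; apply: is_deriveB.
Qed.

Lemma is_derive_line (R : realType) (p : nat) (h : 'cV[R]_p -> R) (g v : 'cV[R]_p) (t d : R) :
  is_derive (0 : R) 1 (fun e : R => h (g + t *: v + e *: v)) d ->
  is_derive (t : R) 1 (fun e : R => h (g + e *: v)) d.
Proof.
move=> H; apply: is_derive_shift.
have -> // : (fun e : R => h (g + (t + e) *: v)) = (fun e : R => h (g + t *: v + e *: v)).
by apply/funext => e; rewrite scalerDl addrA.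
Qed.

(* Universally quantified hypotheses only slow linear arithmetic down. *)
Ltac lralean := repeat match goal with H : forall _, _ |- _ => clear H end; lra.

(** A one-dimensional argument that replaces the nondegeneracy of the second
    derivative at the maximum. The decrease over [0, s] forces f'' <= -k
    somewhere in between, the bound on f''' then forces f'' <= -k/2 on the
    whole interval, and integrating twice from the critical point 0 gives the
    quadratic upper bound. *)
Lemma taylor_strict (R : realType) (f f1 f2 f3 : R -> R) (s k C : R) :
  0 < s -> 0 < k -> C * s <= k / 2 ->
  (forall t, `|t| < 2 * s -> is_derive (t : R) 1 f (f1 t)) ->
  (forall t, `|t| < 2 * s -> is_derive (t : R) 1 f1 (f2 t)) ->
  (forall t, `|t| < 2 * s -> is_derive (t : R) 1 f2 (f3 t)) ->
  (forall t, `|t| < 2 * s -> `|f2 t| <= C) ->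
  (forall t, `|t| < 2 * s -> `|f3 t| <= C) ->
  f1 0 = 0 -> f s - f 0 <= - k * s ^+ 2 ->
  forall t, 0 <= t <= s -> f t - f 0 <= - (k / 4) * t ^+ 2 /\ - C * t ^+ 2 <= f t - f 0.
Proof.
move=> s0 k0 Cs d1 d2 d3 b2 b3 f10 fs.
have mvt (g g' : R -> R) : (forall t, `|t| < 2 * s -> is_derive (t : R) 1 g (g' t)) ->
    forall a b, 0 <= a -> a < b -> b <= s -> exists2 c, a < c < b & g b - g a = g' c * (b - a).
  move=> dg a b a0 ab bs.
  have [||c + E] := @MVT R g g' a b ab.
  - move=> x; rewrite in_itv/= => /andP[x1 x2]; apply: dg; rewrite ger0_norm; lralean.
  - apply: derivable_within_continuous => x; rewrite in_itv/= => /andP[x1 x2].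
    have H : is_derive x 1 g (g' x) by apply: dg; rewrite ger0_norm; lralean.
    exact: ex_derive.
  - by rewrite in_itv/=; exists c.
have C0 : 0 <= C by apply: le_trans (b2 0 _); rewrite ?normr0 ?mulr_gt0.
have E1 t : 0 < t <= s -> exists2 c, 0 < c < t & f1 t = f2 c * t.
  move=> /andP[t0 ts]; have [c ct E] := mvt _ _ d2 0 t (lexx 0) t0 ts.
  by exists c => //; move: E; rewrite f10 !subr0.
have [eta /andP[e1 e2]] := mvt _ _ d1 0 s (lexx 0) s0 (lexx s); rewrite subr0 => Eeta.
have [xi /andP[x1 x2] Exi] : exists2 c, 0 < c < eta & f1 eta = f2 c * eta by apply: E1; lralean.
have f2xi : f2 xi <= - k.
  rewrite leNgt; apply/negP => h.
  move: fs; rewrite Eeta Exi; apply/negP; rewrite -ltNge.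
  have : - k * (eta * s) < f2 xi * (eta * s) by rewrite ltr_pM2r// mulr_gt0.
  have : k * (eta * s) <= k * s ^+ 2 by rewrite ler_pM2l// expr2 ler_wpM2r// ltW.
  lralean.
have f2u u : 0 <= u <= s -> f2 u <= - (k / 2).
  move=> /andP[u0 us].
  have : f2 u - f2 xi <= C * s.
    have [->|uxi] := eqVneq u xi; first by rewrite subrr mulr_ge0// ltW.
    have B c : 0 < c < s -> `|f3 c| <= C by move=> /andP[c0 cs]; apply: b3; rewrite ger0_norm; lralean.
    have [ux|xu|ux] := ltgtP u xi; last by rewrite ux eqxx in uxi.
      have [c /andP[c1 c2] E] := mvt _ _ d3 u xi u0 ux ltac:(lralean).
      have : `|f2 xi - f2 u| <= C * s.
        rewrite E normrM ler_pM//; first by apply: B; lralean.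
        by rewrite ger0_norm; lralean.
      by rewrite distrC; apply: le_trans; exact: ler_norm.
    have [c /andP[c1 c2] E] := mvt _ _ d3 xi u (ltW x1) xu us.
    have : `|f2 u - f2 xi| <= C * s.
      rewrite E normrM ler_pM//; first by apply: B; lralean.
      by rewrite ger0_norm; lralean.
    by apply: le_trans; exact: ler_norm.
  lralean.
move=> t /andP[t0 ts].
have [t0'|] := ltP 0 t; last first.
  move=> t1; have -> : t = 0 by lralean.
  by rewrite subrr expr0n /= !mulr0.
split.
  have dg (u : R) : `|u| < 2 * s -> is_derive (u : R) 1 (fun t => f t + (k / 4) * t ^+ 2) (f1 u + (k / 2) * u).
    move=> us; have H := d1 _ us; apply: is_derive_eq; by rewrite /GRing.scale/=; field.
  have [c /andP[c1 c2]] := mvt _ _ dg 0 t (lexx 0) t0' ts.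
  have [xc /andP[xc1 xc2] ->] : exists2 x, 0 < x < c & f1 c = f2 x * c by apply: E1; lralean.
  rewrite expr0n /= mulr0 addr0 subr0 => E.
  have : f2 xc <= - (k / 2) by apply: f2u; lralean.
  move=> h; have : (f2 xc + k / 2) * (c * t) <= 0 by rewrite mulr_le0_ge0 ?mulr_ge0//; lralean.
  have -> : (f2 xc + k / 2) * (c * t) = (f2 xc * c + k / 2 * c) * t by ring.
  rewrite -E; lralean.
have [c /andP[c1 c2]] := mvt _ _ d1 0 t (lexx 0) t0' ts.
have [xc /andP[xc1 xc2] ->] : exists2 x, 0 < x < c & f1 c = f2 x * c by apply: E1; lralean.
rewrite subr0 => ->.
have : `|f2 xc| <= C by apply: b2; rewrite ger0_norm; lralean.
rewrite ler_norml => /andP[h _].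
rewrite expr2 mulrA ler_pM2r//.
have : - C * c <= f2 xc * c by rewrite ler_pM2r.
have : C * c <= C * t by rewrite ler_wpM2l// ltW.
lralean.
Qed.

(** The hypothesis on G is a quadratic decrease away from g0 up to an error dl that
    is small but fixed. It localizes the maximizer within distance s/2 of g0.
    Along the segment from gh to any point at distance s from it the function
    decreases by a fixed amount, because that point is at distance s/2 from g0
    at least; [taylor_strict] converts this into quadratic bounds at gh. Far
    from gh the decrease by a fixed amount is quadratic too, the domain being
    bounded. *)
Lemma maximizer (R : realType) (p : nat) (Th : set 'cV[R]_p) (g0 : 'cV[R]_p) (chi C Dm s0 : R) :
  open Th -> 0 < chi -> 0 <= C -> 0 < s0 ->
  (forall g, `|g - g0| < s0 -> Th g) ->
  (forall g g', closure Th g -> closure Th g' -> `|g - g'| <= Dm) ->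
  exists dl lam Lam s : R, [/\ 0 < dl, 0 < lam, 0 < Lam, 0 < s &
  forall (G : 'cV[R]_p -> R) (G1 G2 G3 : 'cV[R]_p -> 'cV[R]_p -> R) (gh : 'cV[R]_p),
    closure Th gh -> (forall g, closure Th g -> G g <= G gh) ->
    {within closure Th, continuous G} ->
    (forall g, Th g -> G g - G g0 <= - chi * `|g - g0| ^+ 2 + dl) ->
    (forall v g, `|v| <= 1 -> Th g -> [/\
       is_derive (0 : R) 1 (fun t => G (g + t *: v)) (G1 v g),
       is_derive (0 : R) 1 (fun t => G1 v (g + t *: v)) (G2 v g),
       is_derive (0 : R) 1 (fun t => G2 v (g + t *: v)) (G3 v g),
       `|G2 v g| <= C & `|G3 v g| <= C]) ->
    [/\ `|gh - g0| <= s0 / 2,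
      (forall g, Th g -> G g - G gh <= - lam * `|g - gh| ^+ 2) &
      (forall g, `|g - gh| <= s -> - Lam * `|g - gh| ^+ 2 <= G g - G gh)]].
Proof.
move=> oTh chi0 C0 s00 s0Th Dmb.
(* The first bound keeps the segments of length 2s from gh inside the ball where
   Th is known; the second makes the variation of the second derivative along
   them small compared with chi. *)
pose s := Num.min (s0 / 4) (chi / (16 * (C + 1))).
have C1 : 0 < C + 1 by lra.
have s_gt0 : 0 < s by rewrite lt_min !divr_gt0 ?mulr_gt0.
have ss0 : s <= s0 / 4 by rewrite ge_min lexx.
have sC : (C + 1) * s <= chi / 16.
  have : s <= chi / (16 * (C + 1)) by rewrite ge_min lexx orbT.
  move=> h; apply: le_trans (ler_wpM2l (ltW C1) h) _.
  by rewrite le_eqVlt; apply/orP; left; apply/eqP; field; lra.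
have Thg0 : Th g0 by apply: s0Th; rewrite subrr normr0.
have Dm0 : 0 <= Dm by apply: le_trans (Dmb g0 g0 _ _); rewrite ?subrr ?normr0//; exact: subset_closure.
pose dl := chi * s ^+ 2 / 32.
have s2 : 0 < chi * s ^+ 2 by rewrite mulr_gt0// exprn_gt0.
pose lam := Num.min (chi / 32) (chi * s ^+ 2 / (8 * (Dm + 1) ^+ 2)).
have D1 : 0 < (Dm + 1) ^+ 2 by rewrite exprn_gt0//; lra.
have lam0 : 0 < lam by rewrite lt_min; apply/andP; split; apply: divr_gt0 => //; rewrite mulr_gt0.
exists dl, lam, (C + 1), s; split=> //.
  by rewrite /dl; lra.
move=> G G1 G2 G3 gh clgh mxg cG up der.
have Gg0 : G g0 <= G gh by apply: mxg; exact: subset_closure.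
have ghs : `|gh - g0| <= s / 2.
  rewrite leNgt; apply/negP => far.
  (* The maximizer may lie on the boundary, whereas the bounds hold inside. *)
  have [g [Tg ggh Ggg]] : exists g, [/\ Th g, `|gh - g| < s / 4 & G gh - chi * s ^+ 2 / 64 < G g].
    have e0 : 0 < chi * s ^+ 2 / 64 by lra.
    have /subspace_continuousP/(_ _ clgh) cGh := cG.
    have : nbhs (G gh) [set y | G gh - chi * s ^+ 2 / 64 < y].
      apply/nbhs_ballP; exists (chi * s ^+ 2 / 64) => //= y; rewrite /ball/= => h.
      by have := ler_norm (G gh - y); move: h; clear; lra.
    move=> h; have {h}H : nbhs gh [set g | closure Th g -> G gh - chi * s ^+ 2 / 64 < G g] := cGh _ h.
    have s40 : 0 < s / 4 by rewrite divr_gt0.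
    have [g [Tg [g1 g2]]] := clgh _ (filterI H (nbhsx_ballx gh (s / 4) s40)).
    exists g; split=> //; first by rewrite mx_norm_ball in g2.
    by apply: g1; exact: subset_closure.
  have far' : s / 4 < `|g - g0|.
    have : `|gh - g0| <= `|gh - g| + `|g - g0| by apply: ler_distD.
    by move: far ggh; clear; lra.
  have := up _ Tg.
  have : chi * (s / 4) ^+ 2 <= chi * `|g - g0| ^+ 2.
    by rewrite ler_pM2l// lerXn2r ?nnegrE// ltW//; lra.
  have -> : chi * (s / 4) ^+ 2 = chi * s ^+ 2 / 16 by field.
  rewrite /dl; lra.
have farb g : Th g -> s / 2 <= `|g - g0| -> G g - G gh <= - (chi / 8) * s ^+ 2.
  move=> Tg far; have := up _ Tg.
  have : chi * (s / 2) ^+ 2 <= chi * `|g - g0| ^+ 2.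
    by rewrite ler_pM2l// lerXn2r ?nnegrE//; lra.
  have -> : chi * (s / 2) ^+ 2 = chi * s ^+ 2 / 4 by field.
  rewrite /dl; lra.
have near g : `|g - gh| <= s ->
    G g - G gh <= - (chi / 32) * `|g - gh| ^+ 2 /\ - C * `|g - gh| ^+ 2 <= G g - G gh.
  move=> gs; have [->|gne] := eqVneq g gh.
    by rewrite !subrr normr0 expr0n /= !mulr0.
  have t0 : 0 < `|g - gh| by rewrite normr_gt0 subr_eq0.
  pose v := `|g - gh|^-1 *: (g - gh).
  have v1 : `|v| = 1 by rewrite normrZ ger0_norm ?invr_ge0// mulVf// gt_eqF.
  have inTh t : `|t| < 2 * s -> Th (gh + t *: v).
    move=> ts; apply: s0Th; rewrite addrAC.
    apply: le_lt_trans (ler_normD _ _) _; rewrite normrZ v1 mulr1; move: ts ghs ss0 s00; clear; lra.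
  have in2s t : - s < t -> t < s -> `|t| < 2 * s.
    by rewrite ltr_norml; move: s_gt0; clear => ? ? ?; apply/andP; split; lra.
  have s2s : `|s| < 2 * s by rewrite ger0_norm ?(ltW s_gt0)// ltr_pMl// ltr1n.
  have := @taylor_strict R (fun t => G (gh + t *: v)) (fun t => G1 v (gh + t *: v))
    (fun t => G2 v (gh + t *: v)) (fun t => G3 v (gh + t *: v)) s (chi / 8) C s_gt0.
  have gE : gh + `|g - gh| *: v = g.
    by rewrite /v scalerA mulfV ?gt_eqF// scale1r addrC subrK.
  have v1' : `|v| <= 1 by rewrite v1.
  have H t (ts : `|t| < 2 * s) := der v _ v1' (inTh t ts).
  have d1 t : `|t| < 2 * s -> is_derive (t : R) 1 (fun t => G (gh + t *: v)) (G1 v (gh + t *: v)).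
    by move=> /H[h _ _ _ _]; exact: is_derive_line.
  move=> T.
  have [|||||||||] := T _ _ d1 _ _ _ _ _ _ `|g - gh| _.
  - by rewrite divr_gt0.
  - by move: sC s_gt0; clear; rewrite mulrDl mul1r => ? ?; lra.
  - by move=> t /H[_ h _ _ _]; exact: (@is_derive_line _ _ (G1 v)).
  - by move=> t /H[_ _ h _ _]; exact: (@is_derive_line _ _ (G2 v)).
  - by move=> t /H[].
  - by move=> t /H[].
  - have z0 : `|0 : R| < 2 * s by rewrite normr0 mulr_gt0.
    have h1 := d1 0 z0.
    have h2 : is_derive (0 : R) 1 (fun t => G (gh + t *: v)) 0.
      apply: (@derive1_at_max _ _ (- s) s); first by rewrite ge0_cp ?ltW.
      + move=> t; rewrite in_itv/= => /andP[ta tb].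
        have h : is_derive (t : R) 1 (fun t => G (gh + t *: v)) (G1 v (gh + t *: v)).
          by apply: d1; exact: in2s.
        exact: ex_derive.
      + by rewrite in_itv/= oppr_lt0 s_gt0.
      + move=> t; rewrite in_itv/= => /andP[ta tb]; rewrite scale0r addr0; apply: mxg.
        by apply: subset_closure; apply: inTh; exact: in2s.
    by rewrite -(@derive_val _ _ _ _ _ _ _ h1) (@derive_val _ _ _ _ _ _ _ h2).
  - rewrite scale0r addr0; apply: farb; first exact: inTh.
    have : `|s *: v| <= `|gh + s *: v - g0| + `|gh - g0|.
      have {1}-> : s *: v = (gh + s *: v - g0) - (gh - g0).
        by rewrite opprB addrA subrK addrC addKr.
      exact: ler_normB.
    rewrite normrZ v1 mulr1 ger0_norm ?(ltW s_gt0)//; move: ghs; clear => ? ?; lra.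
  - by rewrite normr_ge0 gs.
  - rewrite scale0r addr0 gE => h1 h2; split=> //; apply: le_trans h1 _.
    have -> : chi / 32 = chi / 8 / 4 by clear; field.
    by rewrite !mulNr lerN2 ler_wpM2r ?sqr_ge0.
split.
- by apply: le_trans ghs _; move: ss0 s00; clear => ? ?; lra.
- move=> g Tg; have [/near[h _]|far] := leP `|g - gh| s.
    apply: le_trans h _; rewrite !mulNr lerN2 ler_wpM2r ?sqr_ge0//.
    by rewrite ge_min lexx.
  apply: (@le_trans _ _ (- (chi / 8) * s ^+ 2)).
    apply: farb => //.
    have : `|g - gh| <= `|g - g0| + `|gh - g0| by rewrite [`|gh - _|]distrC; apply: ler_distD.
    by move: far ghs; clear => ? ? ?; lra.
  rewrite !mulNr lerN2; apply: (@le_trans _ _ (lam * (Dm + 1) ^+ 2)).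
    have cg := @subset_closure _ _ _ Tg.
    rewrite ler_wpM2l ?(ltW lam0)//.
    have := Dmb _ _ cg clgh; have h1 : 0 <= Dm + 1 by rewrite addr_ge0.
    by move=> h2; rewrite lerXn2r ?nnegrE// (le_trans h2)// lerDl.
  apply: (@le_trans _ _ (chi * s ^+ 2 / (8 * (Dm + 1) ^+ 2) * (Dm + 1) ^+ 2)).
    by rewrite ler_wpM2r// ?sqr_ge0// ge_min lexx orbT.
  by rewrite le_eqVlt; apply/orP; left; apply/eqP; field; rewrite lt0r_neq0// ltr_wpDl.
- by move=> g /near[_]; apply: le_trans; rewrite !mulNr lerN2 ler_wpM2r ?sqr_ge0// lerDl ler01.
Qed.

(** * Functions of polynomial growth with their directional derivatives *)

(** The weight against which growth in x is measured: it is at least 1, so its powers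
    are ordered by their exponents and bounds can be added and multiplied. *)
Definition wt (R : realType) (d : nat) (x : 'cV[R]_d) : R := 1 + enorm x.

Section smooth_class.
Context (R : realType) (d p : nat) (Th : set 'cV[R]_p).
Implicit Types (f g : 'cV[R]_p -> 'cV[R]_d -> 'cV[R]_p -> R).

Lemma wt_ge1 (x : 'cV[R]_d) : 1 <= wt x.
Proof. by rewrite /wt lerDl sqrtr_ge0. Qed.

Lemma wt_mono (x : 'cV[R]_d) m n : (m <= n)%N -> wt x ^+ m <= wt x ^+ n.
Proof. by move=> mn; rewrite ler_weXn2l// wt_ge1. Qed.

Definition pgrowth f : Prop := exists K m, 0 <= K /\
  forall v x (y : 'cV[R]_p), `|v| <= 1 -> Th y -> `|f v x y| <= K * wt x ^+ m.

(** Differentiability in the parameter y, k times along one direction v, with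
    polynomial growth in x. The direction is an argument of the functions, so
    that the derivatives, which depend on it, belong to the same class; only
    directional derivatives at parameters of the open set Th occur, and all
    later Taylor expansions are along segments. *)
Fixpoint smooth_pg (k : nat) f : Prop := pgrowth f /\
  match k with
  | 0 => True
  | k'.+1 => exists2 f', smooth_pg k' f' &
      forall v x (y : 'cV[R]_p), `|v| <= 1 -> Th y ->
        is_derive (0 : R) 1 (fun t : R => f v x (y + t *: v)) (f' v x y)
  end.

Lemma smooth_pg_growth k f : smooth_pg k f -> pgrowth f.
Proof. by case: k => [|k] []. Qed.

Lemma smooth_pgW k f : smooth_pg k.+1 f -> smooth_pg k f.
Proof.
elim: k f => [|k IH] f [gf [f' sf' df]]; first by split.
by split=> //; exists f' => //; exact: IH.
Qed.

Lemma pgrowth_cst (c : R) : pgrowth (fun _ _ _ => c).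
Proof. by exists `|c|, 0%N; split=> // v x g _ _; rewrite expr0 mulr1. Qed.

Lemma pgrowthD f g : pgrowth f -> pgrowth g -> pgrowth (fun v x y => f v x y + g v x y).
Proof.
move=> [K [m [K0 H]]] [K' [m' [K'0 H']]].
exists (K + K'), (maxn m m'); split; first by rewrite addr_ge0.
move=> v x y v1 Ty; apply: (le_trans (ler_normD _ _)); rewrite mulrDl lerD//.
  by apply: (le_trans (H _ _ _ v1 Ty)); rewrite ler_wpM2l// wt_mono// leq_maxl.
by apply: (le_trans (H' _ _ _ v1 Ty)); rewrite ler_wpM2l// wt_mono// leq_maxr.
Qed.

Lemma pgrowthM f g : pgrowth f -> pgrowth g -> pgrowth (fun v x y => f v x y * g v x y).
Proof.
move=> [K [m [K0 H]]] [K' [m' [K'0 H']]].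
exists (K * K'), (m + m')%N; split; first by rewrite mulr_ge0.
move=> v x y v1 Ty; rewrite normrM exprD mulrACA ler_pM//; [exact: H|exact: H'].
Qed.

Lemma smooth_pg_cst k (c : R) : smooth_pg k (fun _ _ _ => c).
Proof.
elim: k c => [|k IH] c; first by split=> //; exact: pgrowth_cst.
split; first exact: pgrowth_cst.
by exists (fun _ _ _ => 0) => // v x g _ _; exact: is_derive_cst.
Qed.

Lemma smooth_pg_eq k f g : (forall v x y, Th y -> f v x y = g v x y) -> open Th ->
  smooth_pg k f -> smooth_pg k g.
Proof.
move=> E oTh; case: k => [|k] [gf H]; split=> //.
- by case: gf => K [m [K0 B]]; exists K, m; split=> // v x y v1 Ty; rewrite -E//; exact: B.
- by case: gf => K [m [K0 B]]; exists K, m; split=> // v x y v1 Ty; rewrite -E//; exact: B.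
case: H => f' sf' df; exists f' => // v x y v1 Ty.
have := df v x y v1 Ty; apply: near_eq_is_derive => //; rewrite ?oner_neq0//.
have : nbhs y Th by exact: open_nbhs_nbhs.
have cv : (fun t : R => y + t *: v) t @[t --> (0 : R)] --> y + 0 *: v.
  by apply: cvgD; [exact: cvg_cst|apply: cvgZr_tmp; exact: cvg_id].
rewrite scale0r addr0 in cv.
move=> /cv; rewrite /fmap /= => h; near=> t; apply: E; near: t; exact: h.
Unshelve. all: by end_near. Qed.

Lemma smooth_pgD k f g : smooth_pg k f -> smooth_pg k g -> smooth_pg k (fun v x y => f v x y + g v x y).
Proof.
elim: k f g => [|k IH] f g [gf H] [gg H']; first by split=> //; exact: pgrowthD.
split; first exact: pgrowthD.
case: H => f' sf' df; case: H' => g' sg' dg.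
exists (fun v x y => f' v x y + g' v x y); first exact: IH.
by move=> v x y v1 Ty; apply: is_deriveD; [exact: df|exact: dg].
Qed.

Lemma smooth_pgM k f g : smooth_pg k f -> smooth_pg k g -> smooth_pg k (fun v x y => f v x y * g v x y).
Proof.
elim: k f g => [|k IH] f g sf sg.
  by split=> //; apply: pgrowthM; apply: (@smooth_pg_growth 0).
have sf0 := smooth_pgW sf; have sg0 := smooth_pgW sg.
case: sf => gf [f' sf' df]; case: sg => gg [g' sg' dg].
split; first exact: pgrowthM.
exists (fun v x y => f v x y * g' v x y + g v x y * f' v x y).
  by apply: smooth_pgD; exact: IH.
move=> v x y v1 Ty; have h1 := df v x y v1 Ty; have h2 := dg v x y v1 Ty.
have := is_deriveM h1 h2; rewrite scale0r addr0; exact.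
Qed.

Lemma smooth_pgZ k (c : R) f : smooth_pg k f -> smooth_pg k (fun v x y => c * f v x y).
Proof. by move=> sf; apply: smooth_pgM => //; exact: smooth_pg_cst. Qed.

Lemma smooth_pg_sum k (I : Type) (s : seq I) (P : pred I) (F : I -> _) :
  (forall i, smooth_pg k (F i)) -> smooth_pg k (fun v x y => \sum_(i <- s | P i) F i v x y).
Proof.
move=> H; elim: s => [|i s IH].
  have -> : (fun v x y => \sum_(i <- [::] | P i) F i v x y) = (fun _ _ _ => 0 : R).
    by apply/funext => v; apply/funext => x; apply/funext => y; rewrite big_nil.
  exact: smooth_pg_cst.
have -> : (fun v x y => \sum_(i <- i :: s | P i) F i v x y) =
   (fun v x y => (if P i then F i v x y else 0) + \sum_(i <- s | P i) F i v x y).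
  by apply/funext => v; apply/funext => x; apply/funext => y; rewrite big_cons; case: (P i); rewrite ?add0r.
apply: smooth_pgD => //; case: (P i); [exact: H|exact: smooth_pg_cst].
Qed.

(** The derivative of 1/f is -(1/f)(1/f) f', so by induction the class is stable by
    inversion as soon as 1/f itself has polynomial growth. *)
Lemma smooth_pgV k f : (forall v x y, Th y -> 0 < f v x y) ->
  smooth_pg k f -> pgrowth (fun v x y => (f v x y)^-1) -> smooth_pg k (fun v x y => (f v x y)^-1).
Proof.
move=> f0; elim: k => [|k IH] sf gV; first by split.
have sV := IH (smooth_pgW sf) gV.
split=> //; case: sf => gf [f' sf' df].
exists (fun v x y => - 1 * ((f v x y)^-1 * ((f v x y)^-1 * f' v x y))).
  by apply: smooth_pgZ; do 2 apply: smooth_pgM => //.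
move=> v x y v1 Ty; have h := df v x y v1 Ty.
have nz : f v x (y + 0 *: v) != 0 by rewrite scale0r addr0 lt0r_neq0// f0.
have := @is_deriveV R (fun t : R => f v x (y + t *: v)) 0 _ _ nz h; rewrite scale0r addr0.
have -> : - f v x y ^- 2 *: f' v x y = - 1 * ((f v x y)^-1 * ((f v x y)^-1 * f' v x y)).
  by rewrite /GRing.scale/= expr2 invfM mulN1r mulNr mulrA.
exact.
Qed.

Lemma smooth_pg_ln k f : (forall v x y, Th y -> 0 < f v x y) ->
  smooth_pg k f -> pgrowth (fun v x y => (f v x y)^-1) -> smooth_pg k (fun v x y => ln (f v x y)).
Proof.
move=> f0 sf gV.
have gln : pgrowth (fun v x y => ln (f v x y)).
  have [K [m [K0 H]]] := pgrowthD (smooth_pg_growth sf) gV; exists K, m; split=> //.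
  move=> v x y v1 Ty; apply: le_trans (H v x y v1 Ty).
  have fp := f0 v x y Ty; have fV : 0 < (f v x y)^-1 by rewrite invr_gt0.
  rewrite [leRHS]ger0_norm; last by rewrite addr_ge0// ltW.
  rewrite ler_norml; apply/andP; split.
    rewrite lerNl -lnV ?posrE//; apply: le_trans (ltW (ln_sublinear fV)) _; lra.
  apply: le_trans (ltW (ln_sublinear fp)) _; lra.
case: k sf => [|k] sf; first by split.
split=> //; have sV := smooth_pgV f0 (smooth_pgW sf) gV.
case: sf => gf [f' sf' df].
exists (fun v x y => (f v x y)^-1 * f' v x y); first exact: smooth_pgM.
move=> v x y v1 Ty; have h := df v x y v1 Ty.
apply: is_derive1_comp => //=; rewrite scale0r addr0; apply: is_derive1_ln; exact: f0.
Qed.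

End smooth_class.

Lemma powR_wt (R : realType) (d : nat) (C : R) : 0 <= C ->
  exists m, forall x : 'cV[R]_d, 1 + enorm x `^ C <= 2 * wt x ^+ m.
Proof.
move=> C0; exists (Num.bound C) => x.
have x0 : 0 <= enorm x by exact: sqrtr_ge0.
have w1 := wt_ge1 x.
have : enorm x `^ C <= wt x ^+ Num.bound C.
  rewrite -powR_mulrn; last by apply: le_trans w1.
  apply: (@le_trans _ _ (wt x `^ C)).
    apply: ge0_ler_powR => //; rewrite ?nnegrE//; first by apply: le_trans w1.
    by rewrite /wt lerDr.
  by apply: ler_powR => //; apply/ltW/archi_boundP.
have : 1 <= wt x ^+ Num.bound C by apply: exprn_ege1.
lra.
Qed.

Lemma is_derive_dir (R : realType) (p : nat) (f : 'cV[R]_p -> R) (z e : 'cV[R]_p) (l : R) :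
  is_derive z e (f : 'cV[R]_p -> R^o) l -> is_derive (0 : R) 1 (fun t : R => f (z + t *: e)) l.
Proof.
move=> [df <-].
have E : (fun h : R => h^-1 *: (((fun t : R => f (z + t *: e)) \o shift (0 : R)) (h *: (1 : R)) - f (z + 0 *: e))) =
   (fun h : R => h^-1 *: ((f \o shift z) (h *: e) - f z)).
  apply/funext => h /=; rewrite addr0 scale0r addr0 [z + _]addrC.
  by congr (_ *: (f (_ *: _ + _) - _)); rewrite /GRing.scale/= mulr1.
split; first by rewrite /derivable E.
by rewrite /derive E.
Qed.

Lemma mvt0 (R : realType) (f df : R -> R) (b : R) :
  (forall s, `|s| <= `|b| -> is_derive (s : R) 1 f (df s)) ->
  exists2 c, `|c| <= `|b| & f b - f 0 = df c * b.
Proof.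
move=> H.
have cont (i : interval R) : (forall x, x \in i -> `|x| <= `|b|) -> {within [set` i], continuous f}.
  move=> ib; apply: derivable_within_continuous => x /ib/H h; exact: ex_derive.
have [b0|b0|->] := ltgtP b 0.
- have nb : `|b| = - b by rewrite ltr0_norm.
  have ib x : b <= x -> x <= 0 -> `|x| <= `|b| by move=> h1 h2; rewrite nb ler0_norm//; lra.
  have [||c] := @MVT R f df b 0 b0.
  + by move=> x; rewrite in_itv/= => /andP[h1 h2]; apply/H/ib; exact: ltW.
  + by apply: cont => x; rewrite in_itv/= => /andP[h1 h2]; exact: ib.
  rewrite in_itv/= => /andP[h1 h2] E; exists c; first by apply: ib; exact: ltW.
  by rewrite -opprB E; ring.
- have nb : `|b| = b by rewrite gtr0_norm.
  have ib x : 0 <= x -> x <= b -> `|x| <= `|b| by move=> h1 h2; rewrite nb ger0_norm//; lra.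
  have [||c] := @MVT R f df 0 b b0.
  + by move=> x; rewrite in_itv/= => /andP[h1 h2]; apply/H/ib; exact: ltW.
  + by apply: cont => x; rewrite in_itv/= => /andP[h1 h2]; exact: ib.
  rewrite in_itv/= => /andP[h1 h2] E; exists c; first by apply: ib; exact: ltW.
  by rewrite E subr0.
- by exists 0; rewrite ?normr0// subrr mulr0.
Qed.

(** The mean value theorem in the direction e, at the moving base point y + t w:
    continuity of the partial derivative at y absorbs the displacement t w. *)
Lemma is_derive_step (R : realType) (p : nat) (Th : set 'cV[R]_p) (f df : 'cV[R]_p -> R)
   (e : 'cV[R]_p) (y w : 'cV[R]_p) (a : R) :
  open Th -> Th y ->
  (forall z, Th z -> is_derive z e (f : 'cV[R]_p -> R^o) (df z)) ->
  {for y, continuous df} ->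
  is_derive (0 : R) 1 (fun t : R => f (y + t *: w + (t * a) *: e) - f (y + t *: w)) (a * df y).
Proof.
move=> oTh Ty dfe cdf.
set g := fun t : R => _.
have g0 : g 0 = 0 by rewrite /g mul0r scale0r !addr0 scale0r addr0 subrr.
suff H : (fun h : R => h^-1 *: ((g \o shift (0 : R)) (h *: (1 : R)) - g 0)) h @[h --> (0 : R)^'] --> a * df y.
  by split; [apply/cvg_ex; exists (a * df y)|exact: cvg_lim H].
apply/cvgrPdist_le => eps eps0.
pose e' := eps / (`|a| + 1).
have e'0 : 0 < e' by rewrite divr_gt0// ltr_wpDl.
have : \forall z \near y, Th z /\ `|df y - df z| <= e'.
  near=> z; split; near: z; first exact: open_nbhs_nbhs.
  move/cvgrPdist_le : cdf; exact.
move=> /nbhs_normP[dl /= dl0 Hdl].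
pose M := `|w| + `|a| * `|e| + 1.
have M0 : 0 < M by rewrite ltr_wpDl// addr_ge0// mulr_ge0.
near=> h.
have h0 : h != 0 by near: h; exact: nbhs_dnbhs_neq.
have hM : `|h| * M < dl.
  rewrite -ltr_pdivlMr//; near: h.
  apply: dnbhs0_lt; exact: divr_gt0.
have key s : `|s| <= `|h * a| -> Th (y + h *: w + s *: e) /\ `|df y - df (y + h *: w + s *: e)| <= e'.
  move=> sh; apply: Hdl => /=; rewrite -addrA opprD addrA subrr add0r normrN.
  apply: le_lt_trans (ler_normD _ _) _; rewrite !normrZ.
  apply: le_lt_trans hM; rewrite /M !mulrDr mulr1 -addrA lerD//.
  by rewrite ler_wpDr// mulrA -normrM ler_wpM2r.
have [|c ch E] := @mvt0 R (fun s : R => f (y + h *: w + s *: e)) (fun s => df (y + h *: w + s *: e)) (h * a).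
  move=> s sh; apply: is_derive_line; apply: is_derive_dir; apply: dfe.
  by have [] := key s sh.
rewrite /= g0 subr0 addr0 /GRing.scale/= mulr1.
rewrite scale0r addr0 in E; rewrite /g E.
have -> : a * df y - h^-1 * (df (y + h *: w + c *: e) * (h * a)) = a * (df y - df (y + h *: w + c *: e)).
  by field.
have [_ hc] := key c ch.
rewrite normrM; apply: le_trans (ler_wpM2l (normr_ge0 a) hc) _.
rewrite /e' mulrCA ler_piMr ?(ltW eps0)// ler_pdivrMr ?mul1r ?lerDl// ltr_wpDl//.
Unshelve. all: by end_near. Qed.

(** Continuous partial derivatives give the derivative in every direction, by
    moving one coordinate at a time. *)
Lemma is_derive_total (R : realType) (p : nat) (Th : set 'cV[R]_p) (f : 'cV[R]_p -> R)
   (df : 'I_p -> 'cV[R]_p -> R) (y v : 'cV[R]_p) :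
  open Th -> Th y ->
  (forall k z, Th z -> is_derive z (delta_mx k 0 : 'cV[R]_p) (f : 'cV[R]_p -> R^o) (df k z)) ->
  (forall k, {for y, continuous (df k)}) ->
  is_derive (0 : R) 1 (fun t : R => f (y + t *: v)) (\sum_k v k 0 * df k y).
Proof.
move=> oTh Ty dfe cdf.
pose w m : 'cV[R]_p := \sum_(k < p | (k < m)%N) v k 0 *: delta_mx k 0.
suff H m : (m <= p)%N -> is_derive (0 : R) 1 (fun t : R => f (y + t *: w m)) (\sum_(k < p | (k < m)%N) v k 0 * df k y).
  have := H p (leqnn p).
  have -> : w p = v.
    rewrite [RHS](matrix_sum_delta v) /w.
    by apply: eq_big => k; [rewrite ltn_ord|move=> _; rewrite big_ord1].
  by under eq_bigl do rewrite ltn_ord.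
elim: m => [|m IH] mp.
  rewrite big_pred0//.
  have -> : (fun t : R => f (y + t *: w 0%N)) = (fun _ : R => f y).
    by apply/funext => t; rewrite /w big_pred0// scaler0 addr0.
  exact: is_derive_cst.
pose k := Ordinal mp.
have spl (V : nmodType) (F : 'I_p -> V) : \sum_(i < p | (i < m.+1)%N) F i = \sum_(i < p | (i < m)%N) F i + F k.
  rewrite (bigD1 k)//= addrC; congr (_ + _); apply: eq_bigl => i.
  by rewrite -val_eqE/= ltnS; case: ltngtP.
rewrite spl.
have -> : (fun t : R => f (y + t *: w m.+1)) = (fun t : R => f (y + t *: w m) +
     (f (y + t *: w m + (t * v k 0) *: delta_mx k 0) - f (y + t *: w m))).
  apply/funext => t; rewrite [RHS]addrC subrK; congr f.
  by rewrite /w spl scalerDr scalerA addrA.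
apply: is_deriveD; first by apply: IH; exact: ltnW.
by apply: (is_derive_step _ _ oTh Ty (dfe k)); exact: cdf.
Qed.

Lemma smooth_pg_dir (R : realType) (d p : nat) (Th : set 'cV[R]_p) n (k : 'I_p) :
  smooth_pg Th n (fun v (_ : 'cV[R]_d) _ => v k 0).
Proof.
have g : pgrowth Th (fun v (_ : 'cV[R]_d) _ => v k 0).
  exists 1, 0%N; split=> // v x y v1 _; rewrite expr0 mulr1; apply: le_trans v1; exact: norm_coord.
case: n => [|n]; first by split.
split=> //; exists (fun _ _ _ => 0); first exact: smooth_pg_cst.
by move=> v x y _ _; exact: is_derive_cst.
Qed.

(** Differentiating in the direction v turns a partial derivative D_w f into the
    combination sum_k v_k D_(k :: w) f, of the same kind; three steps stay within
    the four derivatives that are controlled. *)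
Lemma C24sharp_smooth (R : realType) (d p : nat) (Th : set 'cV[R]_p)
    (f : 'cV[R]_d -> 'cV[R]_p -> R) : open Th -> C24sharp Th f ->
  smooth_pg Th 3 (fun _ x y => f x y).
Proof.
move=> oTh [_ [D [Df _ dD [_ cD] [C [K [C0 bD]]]]]].
have [m wm] := powR_wt d C0.
suff H n w : (size w + n <= 3)%N -> smooth_pg Th n (fun _ x y => D [::] w x y).
  apply: (smooth_pg_eq _ oTh (H 3%N [::] isT)) => v x y Ty.
  by apply: Df; exact: subset_closure.
elim: n w => [|n IH] w sw.
  split=> //; exists (2 * `|K|), m; split; first by rewrite mulr_ge0.
  move=> v x y _ Ty; have := bD [::] w x y isT.
  rewrite addn0 in sw; move=> /(_ (leq_trans sw _) (subset_closure Ty)) h.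
  apply: le_trans (h _) _ => //; apply: (@le_trans _ _ (`|K| * (1 + enorm x `^ C))).
    by rewrite ler_wpM2r ?ler_norm// addr_ge0// powR_ge0.
  by rewrite [2 * _]mulrC -mulrA ler_wpM2l.
have sw3 : (size w < 4)%N by rewrite ltnS; apply: leq_trans sw; rewrite leq_addr.
split.
  exists (2 * `|K|), m; split; first by rewrite mulr_ge0.
  move=> v x y _ Ty; apply: le_trans (bD [::] w x y isT (ltnW sw3) (subset_closure Ty)) _.
  apply: (@le_trans _ _ (`|K| * (1 + enorm x `^ C))).
    by rewrite ler_wpM2r ?ler_norm// addr_ge0// powR_ge0.
  by rewrite [2 * _]mulrC -mulrA ler_wpM2l.
exists (fun v x y => \sum_k v k 0 * D [::] (k :: w) x y).
  apply: smooth_pg_sum => k; apply: smooth_pgM; first exact: smooth_pg_dir.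
  by apply: IH; rewrite /= addSnnS.
move=> v x y v1 Ty; apply: (@is_derive_total R p Th (D [::] w x) (fun k => D [::] (k :: w) x) y v oTh Ty) => [k z Tz|k].
  exact: dD.
have := continuous_subspaceW (@subset_closure _ Th) (cD [::] (k :: w) x isT sw3).
by rewrite continuous_open_subspace// => /(_ y); apply; exact: mem_set.
Qed.

(** * Smoothness of the quasi-likelihood *)

(** Determinants are polynomials in the entries, so every property of functions that
    is stable by the ring operations passes to them. It is used for
    smoothness, for continuity and for measurability. *)
Lemma det_closed (R : comNzRingType) (T : Type) (P : (T -> R) -> Prop) :
  (forall c, P (fun _ => c)) -> (forall f g, P f -> P g -> P (fun t => f t + g t)) ->
  (forall f g, P f -> P g -> P (fun t => f t * g t)) ->
  forall n (A : T -> 'M[R]_n), (forall i j, P (fun t => A t i j)) -> P (fun t => \det (A t)).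
Proof.
move=> Pc PD PM n A PA.
have sumP (I : Type) (s : seq I) (F : I -> T -> R) : (forall i, P (F i)) -> P (fun t => \sum_(i <- s) F i t).
  move=> H; elim: s => [|i s IH].
    by rewrite (_ : (fun _ => _) = fun _ => 0)//; apply/funext => t; rewrite big_nil.
  rewrite (_ : (fun _ => _) = fun t => F i t + \sum_(j <- s) F j t); first exact: PD.
  by apply/funext => t; rewrite big_cons.
have prodP (I : Type) (s : seq I) (F : I -> T -> R) : (forall i, P (F i)) -> P (fun t => \prod_(i <- s) F i t).
  move=> H; elim: s => [|i s IH].
    by rewrite (_ : (fun _ => _) = fun _ => 1)//; apply/funext => t; rewrite big_nil.
  rewrite (_ : (fun _ => _) = fun t => F i t * \prod_(j <- s) F j t); first exact: PM.
  by apply/funext => t; rewrite big_cons.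
by apply: sumP => s; apply: PM => //; exact: prodP.
Qed.

Lemma adj_closed (R : comNzRingType) (T : Type) (P : (T -> R) -> Prop) :
  (forall c, P (fun _ => c)) -> (forall f g, P f -> P g -> P (fun t => f t + g t)) ->
  (forall f g, P f -> P g -> P (fun t => f t * g t)) ->
  forall n (A : T -> 'M[R]_n), (forall i j, P (fun t => A t i j)) ->
  forall i j, P (fun t => (\adj (A t)) i j).
Proof.
move=> Pc PD PM n A PA i j.
rewrite (_ : (fun _ => _) = fun t => (-1) ^+ (j + i) * \det (row' j (col' i (A t)))).
  apply: (PM) => //; apply: (det_closed Pc PD PM) => a b.
  by rewrite (_ : (fun _ => _) = fun t => A t (lift j a) (lift i b))//; apply/funext => t; rewrite !mxE.
by apply/funext => t; rewrite mxE.
Qed.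

Lemma sqmx_closed (R : comNzRingType) (T : Type) (P : (T -> R) -> Prop) :
  (forall c, P (fun _ => c)) -> (forall f g, P f -> P g -> P (fun t => f t + g t)) ->
  (forall f g, P f -> P g -> P (fun t => f t * g t)) ->
  forall d r (A : T -> 'M[R]_(d, r)), (forall i j, P (fun t => A t i j)) ->
  forall i j, P (fun t => (A t *m (A t)^T) i j).
Proof.
move=> Pc PD PM d r A PA i j.
rewrite (_ : (fun _ => _) = fun t => \sum_k A t i k * A t j k); last first.
  by apply/funext => t; rewrite mxE; apply: eq_bigr => k _; rewrite mxE.
elim: (index_enum _) => [|k s IH].
  by rewrite (_ : (fun _ => _) = fun _ => 0)//; apply/funext => t; rewrite big_nil.
rewrite (_ : (fun _ => _) = fun t => A t i k * A t j k + \sum_(l <- s) A t i l * A t j l).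
  by apply: PD => //; exact: PM.
by apply/funext => t; rewrite big_cons.
Qed.

Lemma enorm_le_norm (R : realType) (m n : nat) (A : 'M[R]_(m, n)) :
  enorm A <= Num.sqrt ((m * n)%:R) * `|A|.
Proof.
have h : \sum_i \sum_j A i j ^+ 2 <= (m * n)%:R * `|A| ^+ 2.
  apply: (@le_trans _ _ (\sum_(i < m) \sum_(j < n) `|A| ^+ 2)).
    apply: ler_sum => i _; apply: ler_sum => j _.
    by rewrite -[leLHS]real_normK ?num_real// lerXn2r ?nnegrE// norm_coord.
  by rewrite !(sumr_const, card_ord) -mulrnA mulnC -[leLHS]mulr_natl.
rewrite /enorm; apply: (le_trans (ler_wsqrtr h)).
by rewrite sqrtrM// sqrtr_sqr normr_id.
Qed.

Lemma coord_le_enorm (R : realType) (m n : nat) (A : 'M[R]_(m, n)) i j : `|A i j| <= enorm A.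
Proof.
rewrite -sqrtr_sqr /enorm ler_wsqrtr// (bigD1 i)//= (bigD1 j)//= -addrA lerDl.
apply: addr_ge0; last by do 2 (apply: sumr_ge0 => ? _); exact: sqr_ge0.
by apply: sumr_ge0 => k _; exact: sqr_ge0.
Qed.

Lemma norm_le_enorm (R : realType) (m n : nat) (A : 'M[R]_(m, n)) : `|A| <= enorm A.
Proof. by apply: norm_le_coord => [|i j]; [exact: sqrtr_ge0|exact: coord_le_enorm]. Qed.

Lemma lipschitz_continuous (R : realType) (d : nat) (f : 'cV[R]_d -> R) (L : R) :
  (forall x y, `|f x - f y| <= L * enorm (x - y)) -> continuous f.
Proof.
move=> H x; apply/(@cvgrPdist_le _ _ _ (nbhs x) (nbhs_filter x)) => e e0.
pose K := `|L| * Num.sqrt ((d * 1)%:R) + 1.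
have K0 : 0 < K by rewrite ltr_wpDl// mulr_ge0// sqrtr_ge0.
near=> y; apply: le_trans (H x y) _.
apply: (@le_trans _ _ (K * `|x - y|)).
  apply: (@le_trans _ _ (`|L| * enorm (x - y))).
    by rewrite ler_wpM2r ?sqrtr_ge0// ler_norm.
  apply: (@le_trans _ _ (`|L| * Num.sqrt ((d * 1)%:R) * `|x - y|)).
    by rewrite -mulrA ler_wpM2l// enorm_le_norm.
  by rewrite ler_wpM2r// /K lerDl.
rewrite -ler_pdivlMl//; near: y; apply: cvgr_dist_le; last by rewrite mulr_gt0// invr_gt0.
exact: cvg_id.
Unshelve. all: by end_near. Qed.

Lemma sum_option (V : nmodType) (T : finType) (F : option T -> V) :
  \sum_o F o = F None + \sum_t F (Some t).
Proof.
rewrite (bigD1 None)//=; congr (_ + _).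
by rewrite (reindex_omap Some id)//=; [apply: eq_bigl => t; rewrite eqxx|case].
Qed.

Lemma smooth_pg3_derivs (R : realType) (d p : nat) (Th : set 'cV[R]_p) f :
  smooth_pg Th 3 f -> exists f1 f2 f3 : 'cV[R]_p -> 'cV[R]_d -> 'cV[R]_p -> R, exists K m, 0 <= K /\
   forall v x y, `|v| <= 1 -> Th y ->
   [/\ is_derive (0 : R) 1 (fun t : R => f v x (y + t *: v)) (f1 v x y),
     is_derive (0 : R) 1 (fun t : R => f1 v x (y + t *: v)) (f2 v x y) &
     is_derive (0 : R) 1 (fun t : R => f2 v x (y + t *: v)) (f3 v x y)] /\
   [/\ `|f1 v x y| <= K * wt x ^+ m, `|f2 v x y| <= K * wt x ^+ m & `|f3 v x y| <= K * wt x ^+ m].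
Proof.
move=> [_ [f1 [[K1 [m1 [K10 b1]]] [f2 [[K2 [m2 [K20 b2]]] [f3 [[K3 [m3 [K30 b3]]] _] d3]] d2]] d1]].
exists f1, f2, f3, (K1 + K2 + K3), (m1 + m2 + m3)%N; split; first by rewrite !addr_ge0.
move=> v x y v1 Ty; split; first by split; [exact: d1|exact: d2|exact: d3].
have le K m : 0 <= K -> K <= K1 + K2 + K3 -> (m <= m1 + m2 + m3)%N ->
    K * wt x ^+ m <= (K1 + K2 + K3) * wt x ^+ (m1 + m2 + m3).
  move=> K0 KK mm; apply: ler_pM => //; last exact: wt_mono.
  by rewrite exprn_ge0// (le_trans ler01)// wt_ge1.
split.
- by apply: (le_trans (b1 _ _ _ v1 Ty)); apply: le => //; [lra|rewrite -addnA leq_addr].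
- by apply: (le_trans (b2 _ _ _ v1 Ty)); apply: le => //; [lra|rewrite addnAC leq_addl].
- by apply: (le_trans (b3 _ _ _ v1 Ty)); apply: le => //; [lra|rewrite leq_addl].
Qed.

Lemma smooth_pg3_family (R : realType) (d p : nat) (Th : set 'cV[R]_p) (I : finType)
   (F : I -> 'cV[R]_d -> 'cV[R]_p -> R) :
  (forall i, smooth_pg Th 3 (fun _ x y => F i x y)) ->
  exists F1 F2 F3 : I -> 'cV[R]_p -> 'cV[R]_d -> 'cV[R]_p -> R, exists K m, 0 <= K /\
   forall i v x y, `|v| <= 1 -> Th y ->
   [/\ is_derive (0 : R) 1 (fun t : R => F i x (y + t *: v)) (F1 i v x y),
     is_derive (0 : R) 1 (fun t : R => F1 i v x (y + t *: v)) (F2 i v x y) &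
     is_derive (0 : R) 1 (fun t : R => F2 i v x (y + t *: v)) (F3 i v x y)] /\
   [/\ `|F1 i v x y| <= K * wt x ^+ m, `|F2 i v x y| <= K * wt x ^+ m & `|F3 i v x y| <= K * wt x ^+ m].
Proof.
move=> sF.
have [F1 H1] := choice (fun i => smooth_pg3_derivs (sF i)).
have [F2 H2] := choice H1; have [F3 H3] := choice H2; have [Ki H4] := choice H3.
have [mi H5] := choice H4.
exists F1, F2, F3, (\sum_i Ki i), (\sum_i mi i)%N.
split; first by apply: sumr_ge0 => i _; have [] := H5 i.
move=> i v x y v1 Ty; have [K0 /(_ v x y v1 Ty)[dF bF]] := H5 i; split=> //.
have le : Ki i * wt x ^+ mi i <= (\sum_i Ki i) * wt x ^+ (\sum_i mi i).
  apply: ler_pM => //.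
  - by rewrite exprn_ge0// (le_trans ler01)// wt_ge1.
  - by rewrite (bigD1 i)//= lerDl; apply: sumr_ge0 => j _; have [] := H5 j.
  - by apply: wt_mono; rewrite (bigD1 i)//= leq_addr.
by case: bF => b1 b2 b3; split; [apply: le_trans b1 le|apply: le_trans b2 le|apply: le_trans b3 le].
Qed.

Lemma is_derive_wsum (R : realType) (n : nat) (I : finType) (b : 'I_n -> I -> R)
   (f : 'I_n -> I -> R -> R) (df : 'I_n -> I -> R) (k0 : R) :
  (forall j i, is_derive (0 : R) 1 (f j i) (df j i)) ->
  is_derive (0 : R) 1 (fun t : R => k0 + \sum_(j < n) \sum_i b j i * f j i t) (\sum_(j < n) \sum_i b j i * df j i).
Proof.
move=> H.
have seqD (J : Type) (s : seq J) (g : J -> R -> R) (dg : J -> R) :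
    (forall j, is_derive (0 : R) 1 (g j) (dg j)) ->
    is_derive (0 : R) 1 (fun t => \sum_(j <- s) g j t) (\sum_(j <- s) dg j).
  move=> Hg; elim: s => [|j s IH].
    rewrite big_nil (_ : (fun _ => _) = fun _ => 0); first exact: is_derive_cst.
    by apply/funext => t; rewrite big_nil.
  rewrite big_cons (_ : (fun _ => _) = fun t => g j t + \sum_(i <- s) g i t).
    exact: is_deriveD.
  by apply/funext => t; rewrite big_cons.
have inner j : is_derive (0 : R) 1 (fun t => \sum_i b j i * f j i t) (\sum_i b j i * df j i).
  exact: (seqD _ _ (fun i t => b j i * f j i t)).
have outer := seqD _ (index_enum 'I_n) (fun j t => \sum_i b j i * f j i t) _ inner.
have := is_deriveD (is_derive_cst k0 (0 : R) (1 : R)) outer; rewrite add0r; exact.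
Qed.

Section likelihood_coefficients.
Context (R : realType) (d r p : nat) (Th : set 'cV[R]_p)
  (c : 'cV[R]_d -> 'cV[R]_p -> 'M[R]_(d, r)).
Hypothesis oTh : open Th.
Hypothesis sc : forall i j, C24sharp Th (fun x g => c x g i j).
Hypothesis nd : nondegeneracy Th c.
Let S := diffusion_sq c.

Lemma diffusion_sq_sym x y : (S x y)^T = S x y.
Proof. by rewrite /S /diffusion_sq trmx_mul trmxK. Qed.

Lemma det_diffusion_gt0 x y : closure Th y -> 0 < \det (S x y).
Proof.
move=> cy; have [C0 [K [_ H]]] := nd; have [l0 _] := H x y cy.
apply: lt_le_trans (lambda_min_det (diffusion_sq_sym x y) l0).
exact: exprn_gt0.
Qed.

Lemma invmx_diffusion x y a b : closure Th y ->
  invmx (S x y) a b = (\det (S x y))^-1 * (\adj (S x y)) a b.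
Proof.
move=> cy; have d0 := det_diffusion_gt0 x cy.
by rewrite /invmx unitmxE unitfE gt_eqF// !mxE.
Qed.

(** By [lambda_min_det], 1/|S| <= (1/lambda_min S)^d. *)
Lemma pgrowth_invdet : pgrowth Th (fun _ x y => (\det (S x y))^-1).
Proof.
have [C0 [K [C00 H]]] := nd; have [m wm] := powR_wt d C00.
exists ((2 * `|K|) ^+ d), (m * d)%N; split; first by rewrite exprn_ge0// mulr_ge0.
move=> v x y _ Ty; have cy := subset_closure Ty.
have [l0 lK] := H x y cy; have d0 := det_diffusion_gt0 x cy.
have ld := lambda_min_det (diffusion_sq_sym x y) l0.
rewrite ger0_norm; last by rewrite invr_ge0 ltW.
apply: (@le_trans _ _ ((lambda_min (S x y))^-1 ^+ d)).
  by rewrite exprVn lef_pV2// posrE ?exprn_gt0.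
rewrite exprM -exprMn lerXn2r ?nnegrE//.
- by rewrite invr_ge0 ltW.
- by rewrite !mulr_ge0// exprn_ge0// (le_trans ler01)// wt_ge1.
apply: le_trans lK _; apply: (@le_trans _ _ (`|K| * (1 + enorm x `^ C0))).
  by rewrite ler_wpM2r ?ler_norm// addr_ge0// powR_ge0.
by rewrite [2 * _]mulrC -mulrA ler_wpM2l.
Qed.

Let sm3 (f : 'cV[R]_p * 'cV[R]_d * 'cV[R]_p -> R) := smooth_pg Th 3 (fun v x y => f (v, x, y)).
Let sm3c k : sm3 (fun _ => k). Proof. exact: smooth_pg_cst. Qed.
Let sm3D f g : sm3 f -> sm3 g -> sm3 (fun t => f t + g t). Proof. exact: smooth_pgD. Qed.
Let sm3M f g : sm3 f -> sm3 g -> sm3 (fun t => f t * g t). Proof. exact: smooth_pgM. Qed.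
Let smS i j : sm3 (fun t => S t.1.2 t.2 i j).
Proof.
apply: (@sqmx_closed R _ sm3 sm3c sm3D sm3M d r (fun t => c t.1.2 t.2)) => {}i {}j.
exact: (C24sharp_smooth oTh (sc i j)).
Qed.

Lemma smooth_det : smooth_pg Th 3 (fun _ x y => \det (S x y)).
Proof. exact: (@det_closed R _ sm3 sm3c sm3D sm3M d (fun t => S t.1.2 t.2) smS). Qed.

Lemma smooth_logdet : smooth_pg Th 3 (fun _ x y => ln (\det (S x y))).
Proof.
apply: smooth_pg_ln; [|exact: smooth_det|exact: pgrowth_invdet].
by move=> _ x y Ty; apply: det_diffusion_gt0; exact: subset_closure.
Qed.

Lemma smooth_invmx a b : smooth_pg Th 3 (fun _ x y => invmx (S x y) a b).
Proof.
apply: (@smooth_pg_eq _ _ _ _ 3 (fun _ x y => (\det (S x y))^-1 * (\adj (S x y)) a b)) => //.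
  by move=> v x y Ty; rewrite invmx_diffusion//; exact: subset_closure.
apply: smooth_pgM.
  apply: smooth_pgV; [|exact: smooth_det|exact: pgrowth_invdet].
  by move=> _ x y Ty; apply: det_diffusion_gt0; exact: subset_closure.
exact: (@adj_closed R _ sm3 sm3c sm3D sm3M d (fun t => S t.1.2 t.2) smS).
Qed.

Let wc (f : 'cV[R]_p -> R) := {within closure Th, continuous f}.
Let wcc k : wc (fun _ => k). Proof. by move=> x; exact: cvg_cst. Qed.
Let wcD f g : wc f -> wc g -> wc (fun t => f t + g t).
Proof. by move=> cf cg x; apply: cvgD; [exact: cf|exact: cg]. Qed.
Let wcM f g : wc f -> wc g -> wc (fun t => f t * g t).
Proof. by move=> cf cg x; apply: cvgM; [exact: cf|exact: cg]. Qed.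

Lemma continuous_coef x i j : {within closure Th, continuous (fun y => c x y i j)}.
Proof.
have [_ [D [Df _ _ [_ cD] _]]] := sc i j.
apply: (@subspace_eq_continuous _ _ _ (D [::] [::] x)); last exact: cD.
by move=> y; rewrite inE => cy; exact: Df.
Qed.

Lemma continuous_det x : {within closure Th, continuous (fun y => \det (S x y))}.
Proof.
apply: (@det_closed R _ wc wcc wcD wcM d (fun t => S x t)) => i j.
by apply: (@sqmx_closed R _ wc wcc wcD wcM d r (fun t => c x t)) => a b; exact: continuous_coef.
Qed.

Lemma continuous_logdet x : {within closure Th, continuous (fun y => ln (\det (S x y)))}.
Proof.
apply/subspace_continuousP => y cy.
have /subspace_continuousP/(_ y cy) h := @continuous_det x.
apply: (cvg_comp _ _ h); apply: continuous_ln; exact: det_diffusion_gt0.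
Qed.

Lemma continuous_invmx x a b : {within closure Th, continuous (fun y => invmx (S x y) a b)}.
Proof.
apply: (@subspace_eq_continuous _ _ _ (fun y => (\det (S x y))^-1 * (\adj (S x y)) a b)).
  by move=> y; rewrite inE => cy /=; rewrite /from_subspace invmx_diffusion.
apply: wcM; last first.
  apply: (@adj_closed R _ wc wcc wcD wcM d (fun t => S x t)) => i j.
  by apply: (@sqmx_closed R _ wc wcc wcD wcM d r (fun t => c x t)) => k l; exact: continuous_coef.
apply/subspace_continuousP => y cy.
have /subspace_continuousP/(_ y cy) h := @continuous_det x.
by apply: cvgV => //; rewrite gt_eqF// det_diffusion_gt0.
Qed.

Let mf (f : 'cV[R]_d -> R) := measurable_fun setT (f : borel_vec R d -> R).
Let mfc k : mf (fun _ => k). Proof. exact: measurable_cst. Qed.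
Let mfD f g : mf f -> mf g -> mf (fun t => f t + g t). Proof. exact: measurable_funD. Qed.
Let mfM f g : mf f -> mf g -> mf (fun t => f t * g t). Proof. exact: measurable_funM. Qed.

Lemma measurable_coef y i j : closure Th y -> mf (fun x => c x y i j).
Proof.
move=> cy; have [[L HL] _] := sc i j.
by apply: cont_meas; apply: lipschitz_continuous => x x'; exact: HL.
Qed.

Lemma measurable_diffusion y i j : closure Th y -> mf (fun x => S x y i j).
Proof.
move=> cy; apply: (@sqmx_closed R _ mf mfc mfD mfM d r (fun t => c t y)) => a b.
exact: measurable_coef.
Qed.

Lemma measurable_logdet y : closure Th y -> mf (fun x => ln (\det (S x y))).
Proof.
move=> cy; apply: (measurableT_comp (@measurable_ln R)).
by apply: (@det_closed R _ mf mfc mfD mfM d (fun t => S t y)) => i j; exact: measurable_diffusion.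
Qed.

Lemma measurable_invmx y i j : closure Th y -> mf (fun x => invmx (S x y) i j).
Proof.
move=> cy.
have -> : (fun x => invmx (S x y) i j) = (fun x => expR (- ln (\det (S x y))) * (\adj (S x y)) i j).
  apply/funext => x; rewrite invmx_diffusion// expRN lnK//.
  by rewrite posrE det_diffusion_gt0.
apply: mfM; last first.
  by apply: (@adj_closed R _ mf mfc mfD mfM d (fun t => S t y)) => a b; exact: measurable_diffusion.
apply: (measurableT_comp (@measurable_expR R)).
by apply: measurableT_comp; [exact: oppr_measurable|exact: measurable_logdet].
Qed.

(** The log-likelihood is linear in the entries of S^-1 and in log|S|;
    these are indexed together by [option ('I_d * 'I_d)]. *)
Definition lik_coef (o : option ('I_d * 'I_d)) x y : R :=
  if o is Some ab then invmx (S x y) ab.1 ab.2 else ln (\det (S x y)).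

Definition lik_weight (h : R) (dx : 'cV[R]_d) (o : option ('I_d * 'I_d)) : R :=
  if o is Some ab then - 2^-1 * (h^-1 * (dx ab.1 0 * dx ab.2 0)) else - 2^-1.

Lemma smooth_lik_coef o : smooth_pg Th 3 (fun _ x y => lik_coef o x y).
Proof. by case: o => [[a b]|]; [exact: smooth_invmx|exact: smooth_logdet]. Qed.

Lemma continuous_lik_coef o x : {within closure Th, continuous (lik_coef o x)}.
Proof. by case: o => [[a b]|]; [exact: continuous_invmx|exact: continuous_logdet]. Qed.

Lemma measurable_lik_coef o y : closure Th y -> mf (fun x => lik_coef o x y).
Proof. by case: o => [[a b]|] cy; [exact: measurable_invmx|exact: measurable_logdet]. Qed.

Lemma quasi_loglikE (x : R -> 'cV[R]_d) n (h : R) y : 0 < h -> closure Th y ->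
  quasi_loglik c x n h y = n%:R * (- 2^-1 * (ln (2 * pi * h) *+ d)) +
    \sum_(j < n) \sum_o lik_weight h (x (j.+1%:R * h) - x (j%:R * h)) o * lik_coef o (x (j%:R * h)) y.
Proof.
move=> h0 cy; rewrite /quasi_loglik -/S big_add1/= big_mkord mulr_sumr.
have -> : n%:R * (- 2^-1 * (ln (2 * pi * h) *+ d)) = \sum_(j < n) (- 2^-1 * (ln (2 * pi * h) *+ d)).
  by rewrite sumr_const card_ord mulr_natl.
rewrite -big_split/=; apply: eq_bigr => j _.
rewrite -/S; set M := S _ y; set dx := (_ - _).
have d0 : 0 < \det M by exact: det_diffusion_gt0.
have ph : 0 < 2 * pi * h by rewrite !mulr_gt0// pi_gt0.
have -> : ln (\det ((2 * pi * h) *: M)) = ln (2 * pi * h) *+ d + ln (\det M).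
  by rewrite detZ [LHS]lnM ?posrE ?exprn_gt0// lnXn.
rewrite sum_option /= -addrA mulrDr; congr (_ + _); rewrite mulrDr; congr (_ + _).
rewrite !mulr_sumr /mxdot /mxtrace -(pair_bigA _ (fun a b => lik_weight h dx (Some (a, b)) * lik_coef (Some (a, b)) _ y))/=.
apply: eq_bigr => a _; rewrite mxE !mulr_sumr; apply: eq_bigr => b _.
by rewrite /mxsq !mxE big_ord1 !mxE -/M; ring.
Qed.

End likelihood_coefficients.

(** Uniform control of the normalized quasi-likelihood. It is a linear combination of
    the functions [lik_coef], with weights given by the data, so its derivatives
    are bounded by the empirical average Psi; this does not depend on the
    parameter, which is what makes uniformity over the parameter set cheap. *)
Lemma quasi_loglik_C3 (R : realType) (d r p : nat) (Th : set 'cV[R]_p)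
    (c : 'cV[R]_d -> 'cV[R]_p -> 'M[R]_(d, r)) :
  open Th -> (forall i j, C24sharp Th (fun x g => c x g i j)) -> nondegeneracy Th c ->
  exists K m, 0 <= K /\ forall (x : R -> 'cV[R]_d) n h, 0 < h ->
    let G y := n%:R^-1 * quasi_loglik c x n h y in
    let Psi := n%:R^-1 * \sum_(j < n) K * wt (x (j%:R * h)) ^+ m *
                  (1 + h^-1 * \sum_a (x (j.+1%:R * h) - x (j%:R * h)) a 0 ^+ 2) in
    exists G1 G2 G3 : 'cV[R]_p -> 'cV[R]_p -> R, forall v y, `|v| <= 1 -> Th y ->
    [/\ is_derive (0 : R) 1 (fun t : R => G (y + t *: v)) (G1 v y),
     is_derive (0 : R) 1 (fun t : R => G1 v (y + t *: v)) (G2 v y) &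
     is_derive (0 : R) 1 (fun t : R => G2 v (y + t *: v)) (G3 v y)] /\
   [/\ `|G1 v y| <= Psi, `|G2 v y| <= Psi & `|G3 v y| <= Psi].
Proof.
move=> oTh sc nd.
have [F1 [F2 [F3 [K [m [K0 H]]]]]] := smooth_pg3_family (smooth_lik_coef oTh sc nd).
exists (K * (d%:R + 1)), m; split; first by rewrite mulr_ge0// addr_ge0.
move=> x n h h0 G Psi.
pose b (j : 'I_n) o := n%:R^-1 * lik_weight h (x (j.+1%:R * h) - x (j%:R * h)) o.
pose Gi (Fi : option ('I_d * 'I_d) -> 'cV[R]_p -> 'cV[R]_d -> 'cV[R]_p -> R) v y :=
  0 + \sum_(j < n) \sum_o b j o * Fi o v (x (j%:R * h)) y.
exists (Gi F1), (Gi F2), (Gi F3) => v y v1 Ty.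
have bnd Fi : (forall o x, `|Fi o v x y| <= K * wt x ^+ m) -> `|Gi Fi v y| <= Psi.
  move=> HF; rewrite /Gi add0r; apply: (le_trans (ler_norm_sum _ _ _)).
  rewrite /Psi mulr_sumr; apply: ler_sum => j _.
  apply: (le_trans (ler_norm_sum _ _ _)).
  rewrite /b; set dx := (x _ - x _); set w := wt _ ^+ m.
  apply: (@le_trans _ _ (\sum_o `|n%:R^-1 * lik_weight h dx o| * (K * w))).
    by apply: ler_sum => o _; rewrite normrM ler_wpM2l.
  rewrite -mulr_suml.
  have -> : n%:R^-1 * (K * (d%:R + 1) * w * (1 + h^-1 * \sum_a dx a 0 ^+ 2)) =
     (n%:R^-1 * ((d%:R + 1) * (1 + h^-1 * \sum_a dx a 0 ^+ 2))) * (K * w) by ring.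
  apply: ler_wpM2r; first by rewrite mulr_ge0// exprn_ge0// (le_trans ler01)// wt_ge1.
  under eq_bigr do rewrite normrM [`|n%:R^-1|]ger0_norm ?invr_ge0//.
  rewrite -mulr_sumr; apply: ler_wpM2l; first by rewrite invr_ge0.
  rewrite sum_option/= normrN ger0_norm//.
  set sq := \sum_(a < d) dx a 0 ^+ 2.
  have sq0 : 0 <= sq by apply: sumr_ge0 => a _; exact: sqr_ge0.
  have hs0 : 0 <= h^-1 * sq by rewrite mulr_ge0// invr_ge0 ltW.
  have : \sum_(t : 'I_d * 'I_d) `|lik_weight h dx (Some t)| <= d%:R * (h^-1 * sq).
    apply: (@le_trans _ _ (\sum_(t : 'I_d * 'I_d) h^-1 * 2^-1 * (2^-1 * (dx t.1 0 ^+ 2 + dx t.2 0 ^+ 2)))).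
      apply: ler_sum => -[a e] _ /=; rewrite !normrM normrN [`|2^-1|]ger0_norm// [`|h^-1|]ger0_norm; last by rewrite invr_ge0 ltW.
      rewrite [h^-1 * 2^-1]mulrC -!mulrA; do 2 (apply: ler_wpM2l; first by rewrite ?invr_ge0 ?ltW).
      rewrite -normrM; have := sqr_ge0 (dx a 0 - dx e 0); have := sqr_ge0 (dx a 0 + dx e 0).
      rewrite ler_norml => h1 h2; apply/andP; split; nra.
    rewrite -mulr_sumr -mulr_sumr -(pair_bigA _ (fun a e => dx a 0 ^+ 2 + dx e 0 ^+ 2))/=.
    have -> : \sum_(a < d) \sum_(e < d) (dx a 0 ^+ 2 + dx e 0 ^+ 2) = d%:R * sq + d%:R * sq.
      under eq_bigr do rewrite big_split/= sumr_const card_ord -mulr_natl.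
      by rewrite big_split/= -mulr_sumr -/sq sumr_const card_ord -[sq *+ d]mulr_natl.
    have d0 : 0 <= d%:R * (h^-1 * sq) by rewrite mulr_ge0.
    have -> : h^-1 * 2^-1 * (2^-1 * (d%:R * sq + d%:R * sq)) = 2^-1 * (d%:R * (h^-1 * sq)) by field; rewrite gt_eqF.
    lra.
  have d0 : 0 <= (d%:R : R) by [].
  rewrite mulrDl mul1r mulrDr mulr1.
  lra.
split; last first.
  split; apply: bnd => o z; have [_ [b1 b2 b3]] := H o v z y v1 Ty => //.
split.
- have E : \forall t \near (0 : R), n%:R^-1 * (n%:R * (- 2^-1 * (ln (2 * pi * h) *+ d))) +
     \sum_(j < n) \sum_o b j o * lik_coef c o (x (j%:R * h)) (y + t *: v) = G (y + t *: v).
    have nT : nbhs y Th by exact: open_nbhs_nbhs.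
    have cv : (fun t : R => y + t *: v) t @[t --> (0 : R)] --> y + 0 *: v.
      by apply: cvgD; [exact: cvg_cst|apply: cvgZr_tmp; exact: cvg_id].
    rewrite scale0r addr0 in cv; have hT := cv _ nT.
    near=> t; rewrite /G (quasi_loglikE nd)//; last first.
      by apply: subset_closure; near: t; exact: hT.
    rewrite [RHS]mulrDr; congr (_ + _); rewrite mulr_sumr; apply: eq_bigr => j _.
    by rewrite mulr_sumr; apply: eq_bigr => o _; rewrite /b mulrA.
  apply: near_eq_is_derive; first exact: E.
  rewrite /Gi add0r; apply: (@is_derive_wsum _ _ _ b (fun j o t => lik_coef c o (x (j%:R * h)) (y + t *: v))) => j o.
  by have [[]] := H o v (x (j%:R * h)) y v1 Ty.
- rewrite {2}/Gi add0r; apply: (@is_derive_wsum _ _ _ b (fun j o t => F1 o v (x (j%:R * h)) (y + t *: v))) => j o.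
  by have [[]] := H o v (x (j%:R * h)) y v1 Ty.
- rewrite {2}/Gi add0r; apply: (@is_derive_wsum _ _ _ b (fun j o t => F2 o v (x (j%:R * h)) (y + t *: v))) => j o.
  by have [[]] := H o v (x (j%:R * h)) y v1 Ty.
Unshelve. all: by end_near. Qed.

Lemma continuous_quasi_loglik (R : realType) (d r p : nat) (Th : set 'cV[R]_p)
    (c : 'cV[R]_d -> 'cV[R]_p -> 'M[R]_(d, r)) (x : R -> 'cV[R]_d) n h :
  open Th -> (forall i j, C24sharp Th (fun x g => c x g i j)) -> nondegeneracy Th c -> 0 < h ->
  {within closure Th, continuous (quasi_loglik c x n h)}.
Proof.
move=> oTh sc nd h0.
apply: (@subspace_eq_continuous _ _ _ (fun y => n%:R * (- 2^-1 * (ln (2 * pi * h) *+ d)) +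
    \sum_(j < n) \sum_o lik_weight h (x (j.+1%:R * h) - x (j%:R * h)) o * lik_coef c o (x (j%:R * h)) y)).
  by move=> y; rewrite inE => cy /=; rewrite /from_subspace (quasi_loglikE nd).
have wsum (J : Type) (s : seq J) (g : J -> 'cV[R]_p -> R) :
    (forall j, {within closure Th, continuous (g j)}) -> {within closure Th, continuous (fun y => \sum_(j <- s) g j y)}.
  move=> Hg; elim: s => [|j s IH].
    rewrite (_ : (fun _ => _) = fun _ => 0); first by move=> y; exact: cvg_cst.
    by apply/funext => t; rewrite big_nil.
  rewrite (_ : (fun _ => _) = fun t => g j t + \sum_(i <- s) g i t).
    by move=> y; apply: cvgD; [exact: Hg|exact: IH].
  by apply/funext => t; rewrite big_cons.
move=> y; apply: cvgD; first exact: cvg_cst.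
refine (@wsum _ _ (fun (j : 'I_n) y => \sum_o lik_weight h (x (j.+1%:R * h) - x (j%:R * h)) o * lik_coef c o (x (j%:R * h)) y) _ y) => j.
apply: (wsum _ _ (fun o y => lik_weight h (x (j.+1%:R * h) - x (j%:R * h)) o * lik_coef c o (x (j%:R * h)) y)) => o z.
by apply: cvgM; [exact: cvg_cst|exact: continuous_lik_coef].
Qed.

(** * Expectations of real random variables *)

Import HBNNSimple.

Lemma pos_neg_part (R : realDomainType) (x : R) :
  x = Num.max x 0 - Num.max (- x) 0 /\ `|x| = Num.max x 0 + Num.max (- x) 0.
Proof.
have [h|h] := leP 0 x.
  by rewrite (max_r (_ : - x <= 0)) ?oppr_le0// subr0 addr0 ger0_norm.
by rewrite (max_l (_ : 0 <= - x)) ?oppr_ge0 ?ltW// opprK add0r add0r ltr0_norm.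
Qed.

Section expectation.
Context (R : realType) (dO : measure_display) (Om : measurableType dO) (P : probability Om R).
Implicit Types (X Y : Om -> R).

Definition Lone X := P.-integrable setT (EFin \o X).
Definition Er X : R := \int[P]_w X w.

Lemma Lone_meas X : Lone X -> measurable_fun setT X.
Proof. by move=> /measurable_int/measurable_EFinP. Qed.

Lemma Lone_le X Y : measurable_fun setT X -> Lone Y -> (forall w, `|X w| <= Y w) -> Lone X.
Proof.
move=> mX lY XY; apply: (le_integrable _ _ _ lY) => //; first exact/measurable_EFinP.
by move=> w _; rewrite /= lee_fin (le_trans (XY w))// ler_norm.
Qed.

Lemma Lone_cst c : Lone (fun _ => c).
Proof. exact: finite_measure_integrable_cst. Qed.

Lemma LoneD X Y : Lone X -> Lone Y -> Lone (fun w => X w + Y w).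
Proof. by move=> lX lY; have := integrableD measurableT lX lY; apply: eq_integrable. Qed.

Lemma LoneZ c X : Lone X -> Lone (fun w => c * X w).
Proof. by move=> lX; have := integrableZl measurableT c lX; apply: eq_integrable. Qed.

Lemma LoneN X : Lone X -> Lone (fun w => - X w).
Proof.
by move=> /(LoneZ (-1)); apply: eq_integrable => // w _ /=; rewrite mulN1r.
Qed.

Lemma LoneB X Y : Lone X -> Lone Y -> Lone (fun w => X w - Y w).
Proof. by move=> lX lY; apply: LoneD => //; exact: LoneN. Qed.

Lemma Lone_sum (I : Type) (s : seq I) (X : I -> Om -> R) :
  (forall i, Lone (X i)) -> Lone (fun w => \sum_(i <- s) X i w).
Proof.
move=> H; elim: s => [|i s IH].
  by rewrite (_ : (fun _ => _) = fun _ => 0); [exact: Lone_cst|apply/funext => w; rewrite big_nil].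
rewrite (_ : (fun _ => _) = fun w => X i w + \sum_(j <- s) X j w); first exact: LoneD.
by apply/funext => w; rewrite big_cons.
Qed.

Lemma Lone_norm X : Lone X -> Lone (fun w => `|X w|).
Proof. by move=> lX; have := integrable_norm lX; apply: eq_integrable. Qed.

Lemma Er_cst c : Er (fun _ => c) = c.
Proof. by rewrite /Er Rintegral_cst// [X in fine X]probability_setT /= mulr1. Qed.

Lemma ErD X Y : Lone X -> Lone Y -> Er (fun w => X w + Y w) = Er X + Er Y.
Proof. by move=> lX lY; apply: RintegralD. Qed.

Lemma ErB X Y : Lone X -> Lone Y -> Er (fun w => X w - Y w) = Er X - Er Y.
Proof. by move=> lX lY; apply: RintegralB. Qed.

Lemma ErZ c X : Lone X -> Er (fun w => c * X w) = c * Er X.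
Proof. by move=> lX; apply: RintegralZl. Qed.

Lemma Er_le X Y : Lone X -> Lone Y -> (forall w, X w <= Y w) -> Er X <= Er Y.
Proof. by move=> lX lY XY; apply: le_Rintegral. Qed.

Lemma Er_ge0 X : (forall w, 0 <= X w) -> 0 <= Er X.
Proof. by move=> X0; apply: Rintegral_ge0. Qed.

Lemma Er_sum (I : Type) (s : seq I) (X : I -> Om -> R) :
  (forall i, Lone (X i)) -> Er (fun w => \sum_(i <- s) X i w) = \sum_(i <- s) Er (X i).
Proof.
move=> H; elim: s => [|i s IH].
  by rewrite big_nil (_ : (fun _ => _) = fun _ => 0); [exact: Er_cst|apply/funext => w; rewrite big_nil].
rewrite big_cons -IH (_ : (fun _ => _) = fun w => X i w + \sum_(j <- s) X j w).
  by rewrite ErD//; exact: Lone_sum.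
by apply/funext => w; rewrite big_cons.
Qed.

Lemma EFin_Er X : Lone X -> (\int[P]_w (X w)%:E)%E = (Er X)%:E.
Proof. by move=> lX; rewrite /Er /Rintegral fineK// integrable_fin_num. Qed.

Lemma ge0_Lone X : measurable_fun setT X -> (forall w, 0 <= X w) ->
  (\int[P]_w (X w)%:E < +oo)%E -> Lone X.
Proof.
move=> mX X0 h; apply/integrableP; split; first exact/measurable_EFinP.
rewrite (eq_integral (fun w => (X w)%:E))// => w _ /=.
by rewrite ger0_norm.
Qed.

Lemma ge0_Lone_le X (b : R) : measurable_fun setT X -> (forall w, 0 <= X w) ->
  (\int[P]_w (X w)%:E <= b%:E)%E -> Lone X /\ Er X <= b.
Proof.
move=> mX X0 h; have lX : Lone X by apply: ge0_Lone => //; apply: le_lt_trans h _; rewrite ltry.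
by split=> //; rewrite -lee_fin -EFin_Er.
Qed.

Lemma Er_chebyshev Y (e : R) : Lone Y -> (forall w, 0 <= Y w) -> 0 < e ->
  (P [set w | (e <= Y w)%R] <= (Er Y / e)%:E)%E.
Proof.
move=> lY Y0 e0; have mY := Lone_meas lY.
have mA : measurable [set w | e <= Y w].
  rewrite -[X in measurable X]setTI.
  apply: (mY measurableT [set y | e <= y]).
  rewrite (_ : [set y | e <= y] = `[e, +oo[%classic); first exact: measurable_itv.
  by apply/seteqP; split=> y /=; rewrite in_itv/= andbT.
rewrite mulrC EFinM lee_pdivlMl// -EFin_Er//.
rewrite -integral_cst//; apply: (@le_trans _ _ (\int[P]_(w in [set w | (e <= Y w)%R]) (Y w)%:E)%E).
  apply: ge0_le_integral => //.
  - by move=> w _; rewrite lee_fin ltW.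
  - by apply/measurable_EFinP; apply: measurable_funTS.
apply: ge0_subset_integral => //; first exact/measurable_EFinP.
by move=> w _; rewrite lee_fin.
Qed.

Definition Ltwo X := measurable_fun setT X /\ Lone (fun w => X w ^+ 2).

Lemma Ltwo_mul X Y : Ltwo X -> Ltwo Y -> Lone (fun w => X w * Y w).
Proof.
move=> [mX lX] [mY lY]; apply: (Lone_le _ (LoneD lX lY)); first exact: measurable_funM.
move=> w; rewrite ler_norml; apply/andP; split; nra.
Qed.

Lemma Ltwo_cst c : Ltwo (fun _ => c).
Proof. by split; [exact: measurable_cst|exact: Lone_cst]. Qed.

Lemma LtwoD X Y : Ltwo X -> Ltwo Y -> Ltwo (fun w => X w + Y w).
Proof.
move=> tX tY; have [[mX lX] [mY lY]] := (tX, tY); split; first exact: measurable_funD.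
apply: (Lone_le _ (LoneZ 2 (LoneD lX lY))).
  by apply: measurable_funX; exact: measurable_funD.
move=> w; rewrite ger0_norm ?sqr_ge0//; have := sqr_ge0 (X w - Y w); rewrite sqrrB sqrrD; lra.
Qed.

Lemma Ltwo_sum (I : Type) (s : seq I) (X : I -> Om -> R) :
  (forall i, Ltwo (X i)) -> Ltwo (fun w => \sum_(i <- s) X i w).
Proof.
move=> H; elim: s => [|i s IH].
  by rewrite (_ : (fun _ => _) = fun _ => 0); [exact: Ltwo_cst|apply/funext => w; rewrite big_nil].
rewrite (_ : (fun _ => _) = fun w => X i w + \sum_(j <- s) X j w); first exact: LtwoD.
by apply/funext => w; rewrite big_cons.
Qed.

Lemma Ltwo_Lone X : Ltwo X -> Lone X.
Proof.
move=> tX; have := Ltwo_mul tX (Ltwo_cst 1).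
by apply: eq_integrable => // w _ /=; rewrite mulr1.
Qed.

Lemma Er_eq X Y : X =1 Y -> Er X = Er Y.
Proof. by move=> /funext ->. Qed.

(** Conditioning on a sub-sigma-algebra is expressed by equality of integrals over its
    events; a function measurable for it is a monotone limit of combinations of
    their indicators. *)
Lemma sub_integral_eq (G : set (set Om)) (phi1 phi2 : Om -> R) (f : Om -> R) :
  sigma_algebra setT G -> G `<=` measurable ->
  measurable_fun setT phi1 -> measurable_fun setT phi2 ->
  (forall w, 0 <= phi1 w) -> (forall w, 0 <= phi2 w) ->
  (forall A, G A -> \int[P]_(w in A) (phi1 w)%:E = \int[P]_(w in A) (phi2 w)%:E)%E ->
  measurable_fun setT (f : g_sigma_algebraType G -> R) -> (forall w, 0 <= f w) ->
  (\int[P]_w (f w * phi1 w)%:E = \int[P]_w (f w * phi2 w)%:E)%E.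
Proof.
move=> sG Gm m1 m2 p1 p2 H mf f0.
have GE A : <<s G >> A -> G A by rewrite (sigma_algebra_id sG).
have mf' : measurable_fun setT (EFin \o f : g_sigma_algebraType G -> \bar R) by exact/measurable_EFinP.
pose fn := nnsfun_approx (@measurableT _ (g_sigma_algebraType G)) mf'.
have fnB n B : measurable B -> G (fn n @^-1` B).
  move=> mB; apply: GE; rewrite -[X in <<s G >> X]setTI; exact: (measurable_funP (fn n)).
have mfn n : measurable_fun setT (fn n : Om -> R).
  by move=> _ B mB; rewrite setTI; apply: Gm; exact: fnB.
have fn0 n (w : Om) : 0 <= fn n w by exact: fun_ge0.
have step n (phi : Om -> R) : measurable_fun setT phi -> (forall w, 0 <= phi w) ->
    (\int[P]_w (fn n w * phi w)%:E = \sum_(y \in range (fn n)) (y%:E * \int[P]_(w in fn n @^-1` [set y]) (phi w)%:E))%E.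
  move=> mphi phi0.
  transitivity (\int[P]_w (\sum_(y \in range (fn n)) ((y * \1_(fn n @^-1` [set y]) w) * phi w)%:E))%E.
    apply: eq_integral => w _; rewrite fsumEFin; last exact: fimfunP.
    rewrite {1}(fimfunE (fn n)); congr EFin.
    rewrite !fsbig_finite/=; [|exact: fimfunP|exact: fimfunP].
    by rewrite mulr_suml.
  rewrite ge0_integral_fsum//.
  - apply: eq_fsbigr => y; rewrite inE => -[w0 _ yE].
    have y0 : 0 <= y by rewrite -yE.
    have mA : measurable ((fn n : Om -> R) @^-1` [set y]) by apply: Gm; exact: fnB.
    have -> : (\int[P]_(w in (fn n : Om -> R) @^-1` [set y]) (phi w)%:E =
        \int[P]_w (\1_((fn n : Om -> R) @^-1` [set y]) w * phi w)%:E)%E.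
      rewrite integral_mkcond; apply: eq_integral => w _; rewrite patchE indicE.
      by case: ifP => _; rewrite ?mul1r ?mul0r.
    rewrite -ge0_integralZl//.
    + by apply: eq_integral => w _; rewrite -EFinM mulrA.
    + by apply/measurable_EFinP; apply: measurable_funM => //; exact: measurable_indic.
    + by move=> w _; rewrite lee_fin mulr_ge0.
  - move=> y; apply/measurable_EFinP; apply: measurable_funM => //; apply: measurable_funM => //.
    by apply: measurable_indic; apply: Gm; exact: fnB.
  - move=> y w _; rewrite lee_fin mulr_ge0// indicE; case: (boolP (w \in _)) => [|_]; last by rewrite mulr0.
    by rewrite inE /= => <-; rewrite mulr1.
have lim (phi : Om -> R) : measurable_fun setT phi -> (forall w, 0 <= phi w) ->
   (\int[P]_w (f w * phi w)%:E = limn (fun n => \int[P]_w (fn n w * phi w)%:E))%E.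
  move=> mphi phi0; rewrite -monotone_convergence//.
  - apply: eq_integral => w _; apply/esym/cvg_lim => //.
    apply: cvg_EFin; first by near=> n.
    apply: cvgM; last exact: cvg_cst.
    have := cvg_nnsfun_approx (@measurableT _ (g_sigma_algebraType G)) mf' _ (x := w).
    move=> /(_ (fun x _ => f0 x) I) h; exact: (fine_cvg h).
  - by move=> n; apply/measurable_EFinP; exact: measurable_funM.
  - by move=> n w _; rewrite lee_fin mulr_ge0.
  - move=> w _ n k nk; rewrite lee_fin; apply: ler_wpM2r => //.
    by have /lefP := nd_nnsfun_approx (@measurableT _ (g_sigma_algebraType G)) mf' nk; apply.
rewrite !lim//; congr (limn _); apply/funext => n; rewrite !step//.
by apply: eq_fsbigr => y _; rewrite H//; exact: fnB.
Unshelve. all: by end_near. Qed.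

Lemma sub_meas (G : set (set Om)) (f : Om -> R) : sigma_algebra setT G -> G `<=` measurable ->
  measurable_fun setT (f : g_sigma_algebraType G -> R) -> measurable_fun setT f.
Proof.
move=> sG Gm mf _ B mB; apply: Gm; rewrite -(sigma_algebra_id sG).
exact: mf.
Qed.

Lemma sub_measW (G G' : set (set Om)) d (T : measurableType d) (f : Om -> T) : G `<=` G' ->
  measurable_fun setT (f : g_sigma_algebraType G -> T) ->
  measurable_fun setT (f : g_sigma_algebraType G' -> T).
Proof. by move=> GG mf _ B mB; apply: (sub_sigma_algebra2 GG); exact: mf. Qed.

(** The martingale property: phi is centred given G, so it is orthogonal to the
    G-measurable f. *)
Lemma sub_Er0 (G : set (set Om)) (phi f : Om -> R) :
  sigma_algebra setT G -> G `<=` measurable -> Lone phi ->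
  (forall A, G A -> Er (fun w => \1_A w * phi w) = 0) ->
  measurable_fun setT (f : g_sigma_algebraType G -> R) -> Lone (fun w => f w * phi w) ->
  Er (fun w => f w * phi w) = 0.
Proof.
move=> sG Gm lphi H mf lf.
have mphi := Lone_meas lphi; have mf0 := sub_meas sG Gm mf.
pose pp w := Num.max (phi w) 0; pose pn w := Num.max (- phi w) 0.
pose fp w := Num.max (f w) 0; pose fm w := Num.max (- f w) 0.
have mpp : measurable_fun setT pp by exact: measurable_maxr.
have mpn : measurable_fun setT pn by apply: measurable_maxr => //; exact: measurableT_comp.
have mfp : measurable_fun setT (fp : g_sigma_algebraType G -> R) by exact: measurable_maxr.
have mfm : measurable_fun setT (fm : g_sigma_algebraType G -> R) by apply: measurable_maxr => //; exact: measurableT_comp.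
have pp0 w : 0 <= pp w by rewrite le_max lexx orbT.
have pn0 w : 0 <= pn w by rewrite le_max lexx orbT.
have fp0 w : 0 <= fp w by rewrite le_max lexx orbT.
have fm0 w : 0 <= fm w by rewrite le_max lexx orbT.
have phiE w : phi w = pp w - pn w := (pos_neg_part (phi w)).1.
have fE w : f w = fp w - fm w := (pos_neg_part (f w)).1.
have absphi w : `|phi w| = pp w + pn w := (pos_neg_part (phi w)).2.
have absf w : `|f w| = fp w + fm w := (pos_neg_part (f w)).2.
have lpp : Lone pp by apply: (Lone_le mpp (Lone_norm lphi)) => w; rewrite absphi ger0_norm// lerDl.
have lpn : Lone pn by apply: (Lone_le mpn (Lone_norm lphi)) => w; rewrite absphi ger0_norm// lerDr.
have eqA A : G A -> (\int[P]_(w in A) (pp w)%:E = \int[P]_(w in A) (pn w)%:E)%E.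
  move=> GA; have mA := Gm _ GA.
  have ind (g : Om -> R) : Lone g -> Lone (fun w => \1_A w * g w).
    move=> lg; apply: (Lone_le _ (Lone_norm lg)).
      by apply: measurable_funM; [exact: measurable_indic|exact: Lone_meas].
    by move=> w; rewrite normrM indicE; case: (w \in A); rewrite ?normr1 ?mul1r// normr0 mul0r.
  have toE (g : Om -> R) : Lone g -> (\int[P]_(w in A) (g w)%:E)%E = (Er (fun w => \1_A w * g w))%:E.
    move=> lg; rewrite -EFin_Er; last exact: ind.
    rewrite integral_mkcond; apply: eq_integral => w _; rewrite patchE indicE.
    by case: ifP => _; rewrite ?mul1r// mul0r.
  rewrite !toE//; congr EFin; apply/eqP; rewrite -subr_eq0 -ErB; [|exact: ind|exact: ind].
  apply/eqP; rewrite -(H A GA); apply: Er_eq => w; rewrite phiE; ring.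
have prod g : measurable_fun setT (g : g_sigma_algebraType G -> R) -> (forall w, 0 <= g w) ->
   (forall w, g w <= `|f w|) ->
   [/\ Lone (fun w => g w * pp w), Lone (fun w => g w * pn w) &
     Er (fun w => g w * pp w) = Er (fun w => g w * pn w)].
  move=> mg g0 gf; have mg0 := sub_meas sG Gm mg.
  have l1 : Lone (fun w => g w * pp w).
    apply: (Lone_le _ (Lone_norm lf)); first exact: measurable_funM.
    move=> w; rewrite !normrM; apply: ler_pM => //; first by rewrite ger0_norm.
    by rewrite absphi ger0_norm// lerDl.
  have l2 : Lone (fun w => g w * pn w).
    apply: (Lone_le _ (Lone_norm lf)); first exact: measurable_funM.
    move=> w; rewrite !normrM; apply: ler_pM => //; first by rewrite ger0_norm.
    by rewrite absphi ger0_norm// lerDr.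
  split=> //; apply: EFin_inj; rewrite -!EFin_Er//; exact: sub_integral_eq eqA mg g0.
have [l1 l2 e1] : [/\ Lone (fun w => fp w * pp w), Lone (fun w => fp w * pn w) &
     Er (fun w => fp w * pp w) = Er (fun w => fp w * pn w)].
  by apply: prod => // w; rewrite absf lerDl.
have [l3 l4 e2] : [/\ Lone (fun w => fm w * pp w), Lone (fun w => fm w * pn w) &
     Er (fun w => fm w * pp w) = Er (fun w => fm w * pn w)].
  by apply: prod => // w; rewrite absf lerDr.
rewrite (@Er_eq _ (fun w => (fp w * pp w - fp w * pn w) - (fm w * pp w - fm w * pn w))).
  rewrite ErB; [|exact: LoneB|exact: LoneB].
  by rewrite !ErB// e1 e2 !subrr.
by move=> w; rewrite fE phiE; ring.
Qed.

End expectation.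

(** * Independence of a sub-sigma-algebra *)

Lemma uniform_cvg_norm (R : realType) (T : choiceType) (f : nat -> T -> R) (g : T -> R) (A : set T) (e : R) :
  {uniform A, f n @[n --> \oo] --> g} -> 0 < e ->
  exists N, forall n, (N <= n)%N -> forall w, A w -> `|g w - f n w| < e.
Proof.
move=> unif e0.
have : nbhs (g : {uniform` A -> R}) [set h : T -> R | forall w, A w -> `|g w - h w| < e].
  apply/uniform_nbhs; exists [set xy | ball xy.1 (PosNum e0)%:num xy.2]; split; first exact: entourage_ball.
  by move=> h /= H w Aw; exact: H.
by move=> /unif [N _ HN]; exists N => n Nn w; exact: HN.
Qed.

Section independence.
Context (R : realType) (dO : measure_display) (Om : measurableType dO) (P : probability Om R).
Local Notation Er := (Er P).
Local Notation Lone := (Lone P).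
Local Notation Ltwo := (Ltwo P).

Definition subsigma (G : set (set Om)) := sigma_algebra setT G /\ G `<=` measurable.

Definition indep_of (G : set (set Om)) (r : nat) (Y : Om -> 'cV[R]_r) :=
  forall A B, G A -> <<s @open 'cV[R]_r >> B -> P (A `&` Y @^-1` B) = (P A * P (Y @^-1` B))%E.

Lemma tight_rv (Y : Om -> R) (e : R) : measurable_fun setT Y -> 0 < e ->
  exists M : nat, (P [set w | (M%:R < `|Y w|)%R] <= e%:E)%E.
Proof.
move=> mY e0.
have mn n : measurable_fun setT (fun w => (n.+1%:R)^-1 * `|Y w|).
  by apply: measurable_funM => //; exact: measurableT_comp.
have cv w : (fun n => (n.+1%:R)^-1 * `|Y w|) n @[n --> \oo] --> (0 : R).
  rewrite -[X in _ --> X](mul0r `|Y w|); apply: cvgM; [exact: cvg_harmonic|exact: cvg_cst].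
have PT : (P setT < +oo)%E by rewrite probability_setT ltry.
have ae : {ae P, forall w, setT w -> (fun n => (n.+1%:R)^-1 * `|Y w|) n @[n --> \oo] --> (0 : R)}.
  by apply: aeW => w _; exact: cv.
have [B [mB PB unif]] := ae_pointwise_almost_uniform mn (measurable_cst _) measurableT PT ae e0.
have [n Hn] := uniform_cvg_norm unif ltr01.
have {}Hn w : ~ B w -> `|0 - (n.+1%:R)^-1 * `|Y w| | < 1 by move=> Bw; exact: (Hn n (leqnn n) w).
exists n.+1; apply: le_trans (ltW PB); apply: le_measure; rewrite ?inE//.
  have mY' : measurable_fun setT (fun w => `|Y w|) by exact: measurableT_comp.
  rewrite -[X in measurable X]setTI; apply: (mY' measurableT [set y | n.+1%:R < y]).
  rewrite (_ : [set y | _] = `]n.+1%:R, +oo[%classic); first exact: measurable_itv.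
  by apply/seteqP; split=> y /=; rewrite in_itv/= andbT.
move=> w /= h; apply: contrapT => /Hn; apply/negP; rewrite -leNgt sub0r normrN normrM normr_id.
by rewrite ger0_norm ?invr_ge0// ler_pdivlMl// mulr1 ltW.
Qed.

Lemma indep_ge0 (G : set (set Om)) (r : nat) (Y : Om -> 'cV[R]_r) (psi : 'cV[R]_r -> R) (A : set Om) :
  subsigma G -> measurable_fun setT (Y : Om -> borel_vec R r) -> indep_of G Y ->
  measurable_fun setT (psi : borel_vec R r -> R) -> (forall y, 0 <= psi y) -> G A ->
  (\int[P]_w (\1_A w * psi (Y w))%:E = P A * \int[P]_w (psi (Y w))%:E)%E.
Proof.
move=> [sG Gm] mY iY mpsi psi0 GA.
pose G2 := preimage_set_system setT Y <<s @open 'cV[R]_r >>.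
have sG2 : sigma_algebra setT G2 by apply: sigma_algebra_preimage; exact: smallest_sigma_algebra.
have G2m : G2 `<=` measurable by move=> _ [B mB <-]; exact: mY.
have mA := Gm _ GA.
have PA : P A = (fine (P A))%:E by rewrite fineK//; exact: fin_num_measure.
have mf : measurable_fun setT ((psi \o Y) : g_sigma_algebraType G2 -> R).
  move=> _ B mB; rewrite setTI; apply: sub_sigma_algebra.
  exists (psi @^-1` B); last by rewrite setTI.
  by rewrite -[X in <<s _ >> X]setTI; exact: mpsi.
have fA0 : 0 <= fine (P A) by exact: fine_ge0.
have := @sub_integral_eq R dO Om P G2 (\1_A) (fun _ => fine (P A)) (psi \o Y) sG2 G2m.
move=> /(_ _ _ _ _ _ mf) H.
rewrite (eq_integral (fun w => (psi (Y w) * \1_A w)%:E)); last by move=> w _; rewrite mulrC.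
rewrite H//.
- rewrite [in RHS]PA -ge0_integralZl//.
  + by apply: eq_integral => w _; rewrite -EFinM mulrC.
  + by apply/measurable_EFinP; exact: (measurableT_comp mpsi mY).
  + by move=> w _; rewrite lee_fin.
- move=> D G2D; have mD := G2m _ G2D; rewrite integral_indic// integral_cst//.
  case: G2D => B mB; rewrite setTI => <-.
  exact: (etrans (iY A B GA mB) (congr1 (fun z => z * P (Y @^-1` B))%E PA)).
- by move=> w; exact: psi0.
Qed.

Lemma law_ge0 (r : nat) (Y1 Y2 : Om -> 'cV[R]_r) (psi : 'cV[R]_r -> R) :
  measurable_fun setT (Y1 : Om -> borel_vec R r) -> measurable_fun setT (Y2 : Om -> borel_vec R r) ->
  (forall B, <<s @open 'cV[R]_r >> B -> P (Y1 @^-1` B) = P (Y2 @^-1` B)) ->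
  measurable_fun setT (psi : borel_vec R r -> R) -> (forall y, 0 <= psi y) ->
  (\int[P]_w (psi (Y1 w))%:E = \int[P]_w (psi (Y2 w))%:E)%E.
Proof.
move=> m1 m2 E mpsi psi0.
have mp : measurable_fun setT (EFin \o psi : borel_vec R r -> \bar R) by exact/measurable_EFinP.
have H (Y : Om -> 'cV[R]_r) (mY : measurable_fun setT (Y : Om -> borel_vec R r)) :
   (\int[P]_w (psi (Y w))%:E = \int[pushforward P (Y : Om -> borel_vec R r)]_y (psi y)%:E)%E.
  rewrite (ge0_integral_pushforward mY)// => y _; by rewrite /= lee_fin.
rewrite (H _ m1) (H _ m2).
pose n1 : {measure set (borel_vec R r) -> \bar R} := measure_function_pushforward__canonical__measure_function_Measure P m1.
pose n2 : {measure set (borel_vec R r) -> \bar R} := measure_function_pushforward__canonical__measure_function_Measure P m2.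
apply: (@eq_measure_integral _ _ _ _ n2 n1) => A mA _.
exact: E.
Qed.

Lemma law_Er (r : nat) (Y1 Y2 : Om -> 'cV[R]_r) (psi : 'cV[R]_r -> R) :
  measurable_fun setT (Y1 : Om -> borel_vec R r) -> measurable_fun setT (Y2 : Om -> borel_vec R r) ->
  (forall B, <<s @open 'cV[R]_r >> B -> P (Y1 @^-1` B) = P (Y2 @^-1` B)) ->
  measurable_fun setT (psi : borel_vec R r -> R) -> Lone (psi \o Y2) ->
  Lone (psi \o Y1) /\ Er (psi \o Y1) = Er (psi \o Y2).
Proof.
move=> m1 m2 E mpsi l2.
have mp1 : measurable_fun setT (psi \o Y1) by exact: (measurableT_comp mpsi m1).
have mabs : measurable_fun setT ((fun y => `|psi y|) : borel_vec R r -> R) by exact: measurableT_comp.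
have l1 : Lone (psi \o Y1).
  have := law_ge0 m1 m2 E mabs (fun y => normr_ge0 (psi y)).
  rewrite (EFin_Er (Lone_norm l2)) => h.
  have : Lone (fun w => `|psi (Y1 w)|).
    by apply: ge0_Lone => //; [exact: measurableT_comp|rewrite h ltry].
  by move=> /(Lone_le mp1); apply.
split=> //.
pose pp y := Num.max (psi y) 0; pose pn y := Num.max (- psi y) 0.
have mpp : measurable_fun setT (pp : borel_vec R r -> R) by exact: measurable_maxr.
have mpn : measurable_fun setT (pn : borel_vec R r -> R) by apply: measurable_maxr => //; exact: measurableT_comp.
have pp0 y : 0 <= pp y by rewrite le_max lexx orbT.
have pn0 y : 0 <= pn y by rewrite le_max lexx orbT.
have bd y : `|psi y| = pp y + pn y := (pos_neg_part (psi y)).2.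
have lp (Y : Om -> 'cV[R]_r) : measurable_fun setT (Y : Om -> borel_vec R r) -> Lone (psi \o Y) ->
   Lone (pp \o Y) /\ Lone (pn \o Y).
  move=> mY lY; split; apply: (Lone_le _ (Lone_norm lY)).
  - exact: (measurableT_comp mpp mY).
  - by move=> w /=; rewrite bd ger0_norm// lerDl.
  - exact: (measurableT_comp mpn mY).
  - by move=> w /=; rewrite bd ger0_norm// lerDr.
have Eb (Y : Om -> 'cV[R]_r) : measurable_fun setT (Y : Om -> borel_vec R r) -> Lone (psi \o Y) ->
   Er (psi \o Y) = Er (pp \o Y) - Er (pn \o Y).
  move=> mY lY; have [a b] := lp Y mY lY; rewrite -ErB//; apply: Er_eq => w /=.
  exact: (pos_neg_part (psi (Y w))).1.
rewrite (Eb _ m1 l1) (Eb _ m2 l2).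
have [a1 b1] := lp _ m1 l1; have [a2 b2] := lp _ m2 l2.
by congr (_ - _); apply: EFin_inj; rewrite -!EFin_Er//; exact: law_ge0.
Qed.

Lemma indep_Er (G : set (set Om)) (r : nat) (Y : Om -> 'cV[R]_r) (psi : 'cV[R]_r -> R) (X : Om -> R) :
  subsigma G -> measurable_fun setT (Y : Om -> borel_vec R r) -> indep_of G Y ->
  measurable_fun setT (psi : borel_vec R r -> R) -> Lone (psi \o Y) ->
  measurable_fun setT (X : g_sigma_algebraType G -> R) -> Lone X ->
  Lone (fun w => X w * psi (Y w)) /\ Er (fun w => X w * psi (Y w)) = Er X * Er (psi \o Y).
Proof.
move=> [sG Gm] mY iY mpsi lpsi mX lX.
have sGm : subsigma G by [].
have mX0 := sub_meas sG Gm mX.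
have mpY : measurable_fun setT (psi \o Y) by exact: (measurableT_comp mpsi mY).
have indA A : G A -> (\int[P]_(w in A) `|psi (Y w)|%:E = P A * (Er (fun w => `|psi (Y w)|))%:E)%E.
  move=> GA; rewrite -EFin_Er; last exact: Lone_norm.
  rewrite -(@indep_ge0 G r Y (fun y => `|psi y|) A)//; last exact: measurableT_comp.
  rewrite integral_mkcond; apply: eq_integral => w _; rewrite patchE indicE.
  by case: ifP => _; rewrite ?mul1r ?mul0r.
have lXp : Lone (fun w => X w * psi (Y w)).
  have k0 : 0 <= Er (fun w => `|psi (Y w)|) by exact: Er_ge0.
  have := @sub_integral_eq R dO Om P G (fun w => `|psi (Y w)|) (fun _ => Er (fun w => `|psi (Y w)|)) (fun w => `|X w|) sG Gm.
  move=> H; have {H} : (\int[P]_w (`|X w| * `|psi (Y w)|)%:E = \int[P]_w (`|X w| * Er (fun w => `|psi (Y w)|))%:E)%E.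
    apply: H => //; first exact: measurableT_comp.
      by move=> A GA; rewrite indA// integral_cst; [exact: muleC|exact: Gm].
    exact: measurableT_comp.
  move=> H; have : Lone (fun w => `|X w| * `|psi (Y w)|).
    apply: ge0_Lone; first by apply: measurable_funM; exact: measurableT_comp.
      by move=> w; rewrite mulr_ge0.
    rewrite H (eq_integral (fun w => (Er (fun w => `|psi (Y w)|) * `|X w|)%:E)); last by move=> w _; rewrite mulrC.
    by rewrite EFin_Er ?ltry//; apply: LoneZ; exact: Lone_norm.
  by move=> h; apply: (Lone_le _ h); [exact: measurable_funM|move=> w; rewrite normrM].
split=> //.
pose k := Er (psi \o Y).
have lphi : Lone (fun w => psi (Y w) - k) by apply: LoneB => //; exact: Lone_cst.
have lXk : Lone (fun w => X w * (psi (Y w) - k)).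
  have := LoneB lXp (LoneZ k lX); apply: eq_integrable => // w _ /=; congr EFin; ring.
have : Er (fun w => X w * (psi (Y w) - k)) = 0.
  apply: (sub_Er0 sG Gm lphi _ mX lXk) => A GA.
  have mA := Gm _ GA.
  have ind (g : Om -> R) : Lone g -> Lone (fun w => \1_A w * g w).
    move=> lg; apply: (Lone_le _ (Lone_norm lg)).
      by apply: measurable_funM; [exact: measurable_indic|exact: (Lone_meas lg)].
    by move=> w; rewrite normrM indicE; case: (w \in A); rewrite ?normr1 ?mul1r// normr0 mul0r.
  pose pp y := Num.max (psi y) 0; pose pn y := Num.max (- psi y) 0.
  have mpp : measurable_fun setT (pp : borel_vec R r -> R) by exact: measurable_maxr.
  have mpn : measurable_fun setT (pn : borel_vec R r -> R) by apply: measurable_maxr => //; exact: measurableT_comp.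
  have pp0 y : 0 <= pp y by rewrite le_max lexx orbT.
  have pn0 y : 0 <= pn y by rewrite le_max lexx orbT.
  have bd y : `|psi y| = pp y + pn y := (pos_neg_part (psi y)).2.
  have lpp : Lone (pp \o Y).
    apply: (Lone_le _ (Lone_norm lpsi)); first exact: (measurableT_comp mpp mY).
    by move=> w /=; rewrite bd ger0_norm// lerDl.
  have lpn : Lone (pn \o Y).
    apply: (Lone_le _ (Lone_norm lpsi)); first exact: (measurableT_comp mpn mY).
    by move=> w /=; rewrite bd ger0_norm// lerDr.
  have PA : P A = (fine (P A))%:E by rewrite fineK//; exact: fin_num_measure.
  have toE (q : 'cV[R]_r -> R) : measurable_fun setT (q : borel_vec R r -> R) -> (forall y, 0 <= q y) -> Lone (q \o Y) ->
      Er (fun w => \1_A w * q (Y w)) = fine (P A) * Er (q \o Y).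
    move=> mq q0 lq; apply: EFin_inj; rewrite -EFin_Er; last exact: ind.
    rewrite (indep_ge0 sGm mY iY mq q0 GA) EFinM -EFin_Er//.
    exact: (congr1 (fun z => z * _)%E PA).
  have kE : k = Er (pp \o Y) - Er (pn \o Y).
    by rewrite -ErB//; apply: Er_eq => w /=; exact: (pos_neg_part (psi (Y w))).1.
  rewrite (@Er_eq _ _ _ _ _ (fun w => (\1_A w * pp (Y w) - \1_A w * pn (Y w)) - k * \1_A w)); last first.
    by move=> w; rewrite {1}(pos_neg_part (psi (Y w))).1 /pp /pn; ring.
  have l1A : Lone (\1_A).
    by have := ind _ (@Lone_cst _ _ _ P 1); apply: eq_integrable => // w _ /=; rewrite mulr1.
  have e1A : Er (\1_A) = fine (P A).
    by apply: EFin_inj; rewrite -EFin_Er// integral_indic// setIT -PA.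
  rewrite ErB; [|by apply: LoneB; exact: ind|exact: LoneZ].
  rewrite ErB; [|exact: ind|exact: ind].
  by rewrite !toE// ErZ// e1A kE; ring.
rewrite (@Er_eq _ _ _ _ _ (fun w => X w * psi (Y w) - k * X w)); last by move=> w; ring.
by rewrite ErB ?ErZ//; [move=> /eqP; rewrite subr_eq0 mulrC => /eqP|exact: LoneZ].
Qed.

(** The second moment of a martingale: each new term is independent of the past up to
    its adapted coefficient and is centred, so cross terms vanish and second
    moments add up. *)
Lemma orthogonal_sum (r : nat) (G : nat -> set (set Om)) (Y : nat -> Om -> 'cV[R]_r)
    (psi : 'cV[R]_r -> R) (xi : nat -> Om -> R) (n : nat) (k b : R) :
  0 <= k -> 0 <= b ->
  (forall j, (j <= n)%N -> subsigma (G j)) -> (forall j, (j < n)%N -> G j `<=` G j.+1) ->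
  (forall j, (j < n)%N -> measurable_fun setT (Y j : g_sigma_algebraType (G j.+1) -> borel_vec R r)) ->
  (forall j, (j < n)%N -> indep_of (G j) (Y j)) ->
  measurable_fun setT (psi : borel_vec R r -> R) ->
  (forall j, (j < n)%N -> [/\ Ltwo (psi \o Y j), Er (psi \o Y j) = 0 & Er (fun w => psi (Y j w) ^+ 2) <= k]) ->
  (forall j, (j < n)%N -> [/\ measurable_fun setT (xi j : g_sigma_algebraType (G j) -> R),
     Ltwo (xi j) & Er (fun w => xi j w ^+ 2) <= b]) ->
  Ltwo (fun w => \sum_(j < n) xi j w * psi (Y j w)) /\
  Er (fun w => (\sum_(j < n) xi j w * psi (Y j w)) ^+ 2) <= n%:R * (k * b).
Proof.
move=> k0 b0 sG GG mY iY mpsi Hpsi Hxi.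
suff H m : (m <= n)%N -> [/\ measurable_fun setT ((fun w => \sum_(j < m) xi j w * psi (Y j w)) : g_sigma_algebraType (G m) -> R),
   Ltwo (fun w => \sum_(j < m) xi j w * psi (Y j w)) &
  Er (fun w => (\sum_(j < m) xi j w * psi (Y j w)) ^+ 2) <= m%:R * (k * b)].
  by have [] := H n (leqnn n).
elim: m => [|m IH] mn.
  rewrite (_ : (fun w => \sum_(j < 0) _) = fun _ => 0); last by apply/funext => w; rewrite big_ord0.
  split; [exact: measurable_cst|exact: Ltwo_cst|].
  rewrite (_ : (fun w => _) = fun _ => 0); last by apply/funext => w; rewrite big_ord0 expr0n.
  by rewrite Er_cst mul0r.
have [mS tS eS] := IH (ltnW mn); have sGm := sG m (ltnW mn); have sGm1 := sG m.+1 mn.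
have [mxi txi exi] := Hxi m mn; have [tpsi epsi vpsi] := Hpsi m mn.
have mYm : measurable_fun setT (Y m : Om -> borel_vec R r).
  by move=> _ B mB; have [sg gm] := sGm1; apply: gm; rewrite -(sigma_algebra_id sg); exact: mY.
set S := fun w => \sum_(j < m) xi j w * psi (Y j w) in mS tS eS.
have SE w : \sum_(j < m.+1) xi j w * psi (Y j w) = S w + xi m w * psi (Y m w) by rewrite big_ord_recr.
have mpsi2 : measurable_fun setT ((fun y => psi y ^+ 2) : borel_vec R r -> R) by exact: measurable_funX.
have mxi2 : measurable_fun setT ((fun w => xi m w ^+ 2) : g_sigma_algebraType (G m) -> R) by exact: measurable_funX.
have [l1 e1] := indep_Er sGm mYm (iY m mn) mpsi2 (proj2 tpsi) mxi2 (proj2 txi).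
have lSx : Lone (fun w => S w * xi m w) by exact: Ltwo_mul.
have mSx : measurable_fun setT ((fun w => S w * xi m w) : g_sigma_algebraType (G m) -> R) by exact: measurable_funM.
have [l2 e2] := indep_Er sGm mYm (iY m mn) mpsi (Ltwo_Lone tpsi) mSx lSx.
have mxp : measurable_fun setT (fun w => xi m w * psi (Y m w)).
  by apply: measurable_funM; [case: txi|exact: (measurableT_comp mpsi mYm)].
have txp : Ltwo (fun w => xi m w * psi (Y m w)).
  split=> //; move: l1; apply: eq_integrable => // w _ /=; by rewrite exprMn.
rewrite (_ : (fun w => \sum_(j < m.+1) _) = (fun w => S w + xi m w * psi (Y m w))); last by apply/funext => w; rewrite SE.
split.
- apply: measurable_funD; first exact: (sub_measW (GG m mn) mS).
  apply: measurable_funM; first exact: (sub_measW (GG m mn) mxi).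
  exact: (measurableT_comp mpsi (mY m mn)).
- exact: LtwoD.
rewrite (@Er_eq _ _ _ _ _ (fun w => S w ^+ 2 + xi m w ^+ 2 * psi (Y m w) ^+ 2 + 2 * (S w * xi m w * psi (Y m w)))); last first.
  by move=> w; rewrite SE; ring.
rewrite ErD; [|by apply: LoneD => //; case: tS|exact: LoneZ].
rewrite ErD//; last by case: tS.
rewrite ErZ// e2 epsi mulr0 mulr0 addr0 e1 -natr1 mulrDl mul1r lerD//.
rewrite mulrC ler_pM//; first by apply: Er_ge0 => w; exact: sqr_ge0.
by apply: Er_ge0 => w; exact: sqr_ge0.
Qed.

End independence.

(** * Additive functions on the unit interval *)

Lemma meas_gt d (T : measurableType d) (R : realType) (X : T -> R) c :
  measurable_fun setT X -> measurable [set w | c < X w].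
Proof.
move=> mX; rewrite -[X in measurable X]setTI; apply: (mX measurableT [set y | c < y]).
rewrite (_ : [set y | _] = `]c, +oo[%classic); first exact: measurable_itv.
by apply/seteqP; split=> y /=; rewrite in_itv/= andbT.
Qed.

Lemma meas_ge d (T : measurableType d) (R : realType) (X : T -> R) c :
  measurable_fun setT X -> measurable [set w | c <= X w].
Proof.
move=> mX; rewrite -[X in measurable X]setTI; apply: (mX measurableT [set y | c <= y]).
rewrite (_ : [set y | _] = `[c, +oo[%classic); first exact: measurable_itv.
by apply/seteqP; split=> y /=; rewrite in_itv/= andbT.
Qed.

Lemma grid_floor (R : realType) (t : R) (n : nat) : 0 <= t <= 1 -> (0 < n)%N ->
  exists2 k, (k <= n)%N & k%:R / n%:R <= t /\ t - k%:R / n%:R <= n%:R^-1.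
Proof.
move=> /andP[t0 t1] n0; have nR : 0 < n%:R :> R by rewrite ltr0n.
have tn0 : 0 <= t * n%:R by rewrite mulr_ge0// ltW.
have /andP[h1 h2] := truncn_itv tn0.
exists (Num.truncn (t * n%:R)).
  rewrite -(ler_nat R); apply: (le_trans h1).
  by rewrite ler_piMl// ltW.
split; first by rewrite ler_pdivrMr.
rewrite lerBlDr -[X in _ <= X + _]div1r -mulrDl ler_pdivlMr//.
by rewrite -(natrD _ 1) add1n ltW.
Qed.

Lemma additive_grid (R : realType) (a : R -> R) (n : nat) :
  (forall s t, 0 <= s -> 0 <= t -> s + t <= 1 -> a (s + t) = a s + a t) -> (0 < n)%N ->
  forall k, (k <= n)%N -> a (k%:R / n%:R) = k%:R * a (n%:R^-1).
Proof.
move=> aD n0; have nR : 0 < n%:R :> R by rewrite ltr0n.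
elim=> [_|k IH kn].
  by have := aD 0 0 (lexx 0) (lexx 0); rewrite addr0 ler01 => /(_ isT) h; rewrite !mul0r; lra.
rewrite -natr1 !mulrDl !mul1r aD.
- by rewrite IH// ltnW.
- by rewrite divr_ge0.
- by rewrite invr_ge0.
- by rewrite -[X in _ + X]div1r -mulrDl ler_pdivrMr// mul1r natr1 ler_nat.
Qed.

(** Nonnegative additive functions are monotone, and monotone additive functions are
    linear: they are so on the multiples of 1/n, and t lies within 1/n of one. *)
Lemma additive_mono (R : realType) (a : R -> R) :
  (forall s t, 0 <= s -> 0 <= t -> s + t <= 1 -> a (s + t) = a s + a t) ->
  (forall t, 0 <= t <= 1 -> 0 <= a t) -> forall t, 0 <= t <= 1 -> a t = t * a 1.
Proof.
move=> aD a0 t t01.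
have E n : (0 < n)%N -> `|a t - t * a 1| <= a 1 / n%:R.
  move=> n0; have nR : 0 < n%:R :> R by rewrite ltr0n.
  have aN : a 1 = n%:R * a n%:R^-1.
    by rewrite -(additive_grid aD n0 (leqnn n)) mulfV// gt_eqF.
  have an0 : 0 <= a n%:R^-1.
    by apply: a0; rewrite invr_ge0 ltW//= invf_le1// ler1n.
  have [k kn [k1 k2]] := grid_floor t01 n0.
  have /andP[t0 t1] := t01.
  have kn0 : 0 <= (k%:R : R) / n%:R by rewrite divr_ge0.
  set d := t - k%:R / n%:R in k2.
  have d0 : 0 <= d by rewrite subr_ge0.
  have tE : t = k%:R / n%:R + d by rewrite addrC subrK.
  have n1 : (n%:R : R)^-1 <= 1 by rewrite invf_le1// ler1n.
  have ad : 0 <= a d <= a n%:R^-1.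
    rewrite a0/=; last by rewrite d0; apply: le_trans k2 n1.
    have -> : n%:R^-1 = d + (n%:R^-1 - d) by rewrite addrC subrK.
    rewrite aD// ?lerDl ?subr_ge0//; last by rewrite addrC subrK.
    by apply: a0; rewrite subr_ge0 k2/=; lra.
  have aE : a t = k%:R * a n%:R^-1 + a d.
    by rewrite {1}tE aD// -?tE// (additive_grid aD).
  have tk : t * a 1 = k%:R * a n%:R^-1 + d * n%:R * a n%:R^-1.
    by rewrite {1}tE aN; field; rewrite gt_eqF.
  have dn : 0 <= d * n%:R <= 1.
    by apply/andP; split; [rewrite mulr_ge0// ltW|rewrite -ler_pdivlMr// div1r].
  have -> : a 1 / n%:R = a n%:R^-1 by rewrite aN mulrC mulKf// gt_eqF.
  rewrite aE tk; move: dn ad an0; move: (d * n%:R) (a d) (a n%:R^-1) => x y z /andP[x0 x1] /andP[y0 y1] z0.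
  have : 0 <= x * z <= z by rewrite mulr_ge0//= ler_piMl.
  by move=> /andP[q1 q2]; rewrite ler_norml; apply/andP; split; lra.
apply/eqP; rewrite -subr_eq0 -normr_le0; apply/ler_addgt0Pr => e e0; rewrite add0r.
have [N HN] : exists N : nat, a 1 / e < N%:R.
  exists (Num.bound (a 1 / e)); apply: archi_boundP; apply: divr_ge0; [by apply: a0; rewrite lexx ler01|exact: ltW].
apply: le_trans (E N.+1 isT) _; rewrite ler_pdivrMr// mulrC -ler_pdivrMr//.
by apply: ltW; apply: lt_le_trans HN _; rewrite ler_nat.
Qed.

(** Without a sign, continuity at 0 replaces monotonicity. *)
Lemma additive_small (R : realType) (a : R -> R) :
  (forall s t, 0 <= s -> 0 <= t -> s + t <= 1 -> a (s + t) = a s + a t) -> a 1 = 0 ->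
  (forall e, 0 < e -> exists2 d, 0 < d & forall t, 0 <= t <= 1 -> t <= d -> `|a t| <= e) ->
  forall t, 0 <= t <= 1 -> a t = 0.
Proof.
move=> aD a1 asm t t01; apply/eqP; rewrite -normr_le0; apply/ler_addgt0Pr => e e0; rewrite add0r.
have [d d0 Hd] := asm e e0.
pose n := (Num.bound d^-1).+1.
have n0 : (0 < n)%N by [].
have nR : 0 < n%:R :> R by rewrite ltr0n.
have nd : (n%:R : R)^-1 <= d.
  rewrite -[leRHS]invrK lef_pV2 ?posrE ?invr_gt0//.
  apply: ltW; apply: lt_le_trans (archi_boundP _) _; first by rewrite invr_ge0 ltW.
  by rewrite ler_nat.
have [k kn [k1 k2]] := grid_floor t01 n0.
have an : a n%:R^-1 = 0.
  have := additive_grid aD n0 (leqnn n); rewrite mulfV ?gt_eqF// a1 => /esym/eqP.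
  by rewrite mulf_eq0 gt_eqF//= => /eqP.
have /andP[t0 t1] := t01.
have -> : a t = a (t - k%:R / n%:R).
  have kE : k%:R / n%:R + (t - k%:R / n%:R) = t by ring.
  have := aD (k%:R / n%:R) (t - k%:R / n%:R); rewrite kE subr_ge0 k1 t1 divr_ge0// => -> //.
  by rewrite (additive_grid aD)// an mulr0 add0r.
apply: Hd; last exact: le_trans k2 nd.
rewrite subr_ge0 k1/=; apply: le_trans t1; rewrite gerBl divr_ge0//.
Qed.

(** Superadditivity gives n a(1/n) <= a(1), and monotonicity interpolates between
    the points 1/n. *)
Lemma superadditive_linear (R : realType) (a : R -> R) :
  (forall s t, 0 <= s -> 0 <= t -> s + t <= 1 -> a s + a t <= a (s + t)) ->
  (forall t, 0 <= t <= 1 -> 0 <= a t) -> forall t, 0 < t <= 1 -> a t <= 2 * a 1 * t.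
Proof.
move=> aD a0 t /andP[t0 t1].
have mono s u : 0 <= s -> s <= u -> u <= 1 -> a s <= a u.
  move=> s0 su u1; have suE : s + (u - s) = u by ring.
  have := aD s (u - s) s0; rewrite subr_ge0 su suE => /(_ isT u1); apply: le_trans.
  by rewrite lerDl; apply: a0; apply/andP; split; lra.
pose n := Num.truncn t^-1.
have /andP[n1 n2] : (n%:R <= t^-1 < n.+1%:R) by apply: truncn_itv; rewrite invr_ge0 ltW.
have n0 : (0 < n)%N.
  have : 1 <= t^-1 by rewrite invf_ge1.
  by move=> h; have := le_lt_trans h n2; rewrite ltr1n ltnS.
have nR : 0 < n%:R :> R by rewrite ltr0n.
have grid k : (k <= n)%N -> k%:R * a n%:R^-1 <= a (k%:R / n%:R).
  elim: k => [_|k IH kn]; first by rewrite !mul0r; apply: a0; rewrite lexx ler01.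
  rewrite -natr1 !mulrDl !mul1r; apply: le_trans (aD _ _ _ _ _).
  - by rewrite lerD2r IH// ltnW.
  - by rewrite divr_ge0.
  - by rewrite invr_ge0.
  - by rewrite -[X in _ + X]div1r -mulrDl ler_pdivrMr// mul1r natr1 ler_nat.
have := grid n (leqnn n); rewrite mulfV ?gt_eqF// => h.
have tn : t <= n%:R^-1 by rewrite -[t]invrK lef_pV2 ?posrE ?invr_gt0.
have n11 : (n%:R : R)^-1 <= 1 by rewrite invf_le1// ler1n.
apply: le_trans (mono _ _ (ltW t0) tn n11) _.
have : a n%:R^-1 <= a 1 / n%:R by rewrite ler_pdivlMr// mulrC.
move=> h'; apply: le_trans h' _; rewrite [2 * _]mulrC -mulrA ler_wpM2l//; first by apply: a0; rewrite lexx ler01.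
rewrite -[leLHS]mul1r ler_pdivrMr//.
have : 1 <= t * n.+1%:R by rewrite mulrC -ler_pdivrMr// div1r ltW.
rewrite -natr1 mulrDr mulr1 -mulrA.
have : t <= t * n%:R by rewrite ler_peMr ?ler1n// ltW.
lra.
Qed.

Lemma pow4B (R : realType) (x z : R) : (x - z) ^+ 4 <= 8 * (x ^+ 4 + z ^+ 4).
Proof.
have a1 : (x - z) ^+ 2 <= 2 * (x ^+ 2 + z ^+ 2) by have := sqr_ge0 (x + z); rewrite sqrrD sqrrB; lra.
have a2 : (x ^+ 2 + z ^+ 2) ^+ 2 <= 2 * (x ^+ 4 + z ^+ 4).
  have := sqr_ge0 (x ^+ 2 - z ^+ 2); rewrite sqrrB sqrrD -!exprM; lra.
have : ((x - z) ^+ 2) ^+ 2 <= (2 * (x ^+ 2 + z ^+ 2)) ^+ 2.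
  by rewrite lerXn2r ?nnegrE ?sqr_ge0// mulr_ge0// addr_ge0// sqr_ge0.
rewrite -exprM exprMn; lra.
Qed.

Lemma enorm_meas (R : realType) (d : nat) : measurable_fun setT ((@enorm R d 1) : borel_vec R d -> R).
Proof.
apply: (@measurableT_comp _ _ _ _ _ _ (@Num.sqrt R)).
  by apply: continuous_measurable_fun; exact: sqrt_continuous.
apply: measurable_sum => i; apply: measurable_sum => j; rewrite (ord1 j).
by apply: measurable_funX; exact: coord_meas.
Qed.

(** * Moments of the increments of a Levy process *)

Section levy_moments.
Context (R : realType) (dO : measure_display) (Om : measurableType dO) (P : probability Om R).
Local Notation Er := (Er P).
Local Notation Lone := (Lone P).
Local Notation Ltwo := (Ltwo P).
Context (F : R -> set (set Om)) (r : nat) (Z : R -> Om -> 'cV[R]_r).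
Hypothesis HF : filtration F.
Hypothesis HZ : levy_process P F Z.

Lemma filtration_subsigma t : 0 <= t -> subsigma (F t).
Proof. by move=> t0; have [h _] := HF; have [] := h t t0. Qed.

Lemma filtration_le s t : 0 <= s -> s <= t -> F s `<=` F t.
Proof. by have [_] := HF; exact. Qed.

Lemma levy_adapted_meas t : 0 <= t -> measurable_fun setT (Z t : g_sigma_algebraType (F t) -> borel_vec R r).
Proof.
move=> t0; have [aZ _ _ _ _] := HZ; apply: measurable_wrt_fun; last exact: aZ.
by case: (filtration_subsigma t0).
Qed.

Lemma levy_incr_meas s t : 0 <= s -> s <= t ->
  measurable_fun setT ((fun w => Z t w - Z s w) : g_sigma_algebraType (F t) -> borel_vec R r).
Proof.
move=> s0 st; have t0 := le_trans s0 st; apply: vec_meas => // i.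
rewrite (_ : (fun _ => _) = fun w => Z t w i 0 - Z s w i 0); last by apply/funext => w; rewrite !mxE.
apply: measurable_funB.
  exact: (measurableT_comp (coord_meas i) (levy_adapted_meas t0)).
apply: (measurableT_comp (coord_meas i)).
exact: (sub_measW (filtration_le s0 st) (levy_adapted_meas s0)).
Qed.

Lemma sub_meas_vec t (Y : Om -> 'cV[R]_r) : 0 <= t ->
  measurable_fun setT (Y : g_sigma_algebraType (F t) -> borel_vec R r) ->
  measurable_fun setT (Y : Om -> borel_vec R r).
Proof.
move=> t0 mY _ B mB; have [sg gm] := filtration_subsigma t0; apply: gm.
by rewrite -(sigma_algebra_id sg); exact: mY.
Qed.

Lemma levy_incr_indep s t : 0 <= s -> s <= t -> indep_of P (F s) (fun w => Z t w - Z s w).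
Proof. by move=> s0 st A B FA mB; have [_ _ h _ _] := HZ; exact: h. Qed.

Lemma levy_incr_Er s t (psi : 'cV[R]_r -> R) : 0 <= s -> s <= t ->
  measurable_fun setT (psi : borel_vec R r -> R) -> Lone (fun w => psi (Z (t - s) w)) ->
  Lone (fun w => psi (Z t w - Z s w)) /\ Er (fun w => psi (Z t w - Z s w)) = Er (fun w => psi (Z (t - s) w)).
Proof.
move=> s0 st mpsi l; have ts : 0 <= t - s by rewrite subr_ge0.
apply: (@law_Er _ _ _ P r (fun w => Z t w - Z s w) (Z (t - s)) psi) => //.
- by apply: (sub_meas_vec (le_trans s0 st)); exact: levy_incr_meas.
- by apply: (sub_meas_vec ts); exact: levy_adapted_meas.
- by move=> B mB; have [_ _ _ h _] := HZ; exact: h.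
Qed.

Lemma Lone_pow4 (X : Om -> R) k : (k <= 4)%N -> measurable_fun setT X -> Lone (fun w => X w ^+ 4) ->
  Lone (fun w => X w ^+ k).
Proof.
move=> k4 mX l4; apply: (Lone_le _ (LoneD (Lone_cst P 1) l4)); first exact: measurable_funX.
move=> w; rewrite normrX; have [h|h] := leP `|X w| 1.
  by apply: le_trans (exprn_ile1 k (normr_ge0 _) h) _; rewrite lerDl -[4%N]/(2 * 2)%N exprM sqr_ge0.
apply: (@le_trans _ _ (`|X w| ^+ 4)); first by rewrite ler_weXn2l// ltW.
by rewrite -normrX ger0_norm ?lerDr// -[4%N]/(2 * 2)%N exprM sqr_ge0.
Qed.

(** Second-order mixed moments are obtained from these linear forms by polarization, so
    that one-dimensional arguments suffice. *)
Definition lin (u : 'I_r -> R) (z : 'cV[R]_r) : R := \sum_b u b * z b 0.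

Lemma lin_meas u : measurable_fun setT (lin u : borel_vec R r -> R).
Proof. by apply: measurable_sum => b; apply: measurable_funM => //; exact: coord_meas. Qed.

Lemma linB u z z' : lin u (z - z') = lin u z - lin u z'.
Proof. by rewrite /lin -sumrB; apply: eq_bigr => b _; rewrite !mxE mulrBr. Qed.

Lemma lin_le u z : `|lin u z| <= (\sum_b `|u b|) * enorm z.
Proof.
apply: le_trans (ler_norm_sum _ _ _) _; rewrite mulr_suml; apply: ler_sum => b _.
by rewrite normrM ler_wpM2l// coord_le_enorm.
Qed.

Lemma lin_levy_meas u t : 0 <= t -> measurable_fun setT ((fun w => lin u (Z t w)) : g_sigma_algebraType (F t) -> R).
Proof. by move=> t0; exact: (measurableT_comp (lin_meas u) (levy_adapted_meas t0)). Qed.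

Lemma lin_levy_meas0 u t : 0 <= t -> measurable_fun setT (fun w => lin u (Z t w)).
Proof.
by move=> t0; have [sg gm] := filtration_subsigma t0; exact: (sub_meas sg gm (lin_levy_meas u t0)).
Qed.

Hypothesis HM : moment_condition P (Z 1).

Lemma lin_levy_Lone1 u : Lone (fun w => lin u (Z 1 w) ^+ 4).
Proof.
have [_ _ /(_ 4) H] := HM; move: H; rewrite ltr0n => /(_ isT).
rewrite unlock => H; set K := \sum_b `|u b|.
have m1 : measurable_fun setT (Z 1 : Om -> borel_vec R r).
  by apply: (sub_meas_vec ler01); exact: levy_adapted_meas.
have pE w : enorm (Z 1 w) `^ 4 = (\sum_i Z 1 w i 0 ^+ 2) ^+ 2.
  rewrite -[4]/(4%:R) powR_mulrn ?sqrtr_ge0// -[4%N]/(2 * 2)%N exprM sqr_sqrtr; last first.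
    by do 2 (apply: sumr_ge0 => ? _); exact: sqr_ge0.
  by congr (_ ^+ 2); apply: eq_bigr => i _; rewrite big_ord1.
have le : Lone (fun w => enorm (Z 1 w) `^ 4).
  apply: ge0_Lone => //; last by move=> w; exact: powR_ge0.
  rewrite (_ : (fun w => _) = fun w => (\sum_i Z 1 w i 0 ^+ 2) ^+ 2); last by apply/funext => w; rewrite pE.
  apply: measurable_funX; apply: measurable_sum => i; apply: measurable_funX.
  exact: (measurableT_comp (coord_meas i) m1).
apply: (Lone_le _ (LoneZ (K ^+ 4) le)); first by apply: measurable_funX; exact: lin_levy_meas0.
move=> w; rewrite normrX -[4]/(4%:R) powR_mulrn ?sqrtr_ge0// -exprMn.
by rewrite lerXn2r ?nnegrE ?lin_le// mulr_ge0// ?sqrtr_ge0// sumr_ge0.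
Qed.

(** Integrability at time t < 1 from that at time 1: the value at time 1 is the value
    at time t plus an independent increment, and that increment is bounded by
    some M with positive probability, on an event independent of the past. *)
Lemma lin_levy_Lone u t : 0 <= t <= 1 -> Lone (fun w => lin u (Z t w) ^+ 4).
Proof.
move=> /andP[t0 t1].
have mY : measurable_fun setT ((fun w => Z 1 w - Z t w) : Om -> borel_vec R r).
  by apply: (sub_meas_vec ler01); exact: levy_incr_meas.
have mlY : measurable_fun setT (fun w => lin u (Z 1 w - Z t w)) by exact: (measurableT_comp (lin_meas u) mY).
pose Y w : 'cV[R]_r := Z 1 w - Z t w.
have h2 : 0 < 2^-1 :> R by rewrite invr_gt0.
have [M HMb] := tight_rv P mlY h2.
pose B := [set z : 'cV[R]_r | `|lin u z| <= M%:R].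
have mB : measurable (B : set (borel_vec R r)).
  rewrite (_ : B = ~` [set z | M%:R < `|lin u z|]).
    apply: measurableC; apply: meas_gt; exact: measurableT_comp (lin_meas u).
  by apply/seteqP; split=> z /=; rewrite /B /= leNgt => /negP.
have mpsi : measurable_fun setT (\1_B : borel_vec R r -> R) by exact: measurable_indic.
pose k := fine (\int[P]_w (\1_B (Z 1 w - Z t w))%:E)%E.
have mYB : measurable (Y @^-1` B) by rewrite -[X in measurable X]setTI; exact: mY.
have intk : (\int[P]_w (\1_B (Z 1 w - Z t w))%:E = P (Y @^-1` B))%E.
  rewrite (eq_integral (fun w => (\1_(Y @^-1` B) w)%:E)); last by move=> w _; rewrite /indic.
  by rewrite integral_indic// setIT.
have intk' : (\int[P]_w (\1_B (Z 1 w - Z t w))%:E = k%:E)%E by rewrite fineK// intk; exact: fin_num_measure.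
have k0 : 0 < k.
  apply: lt_le_trans h2 _.
  have : (P setT <= P (Y @^-1` B) + P [set w | (M%:R < `|lin u (Z 1 w - Z t w)|)%R])%E.
    have mC : measurable [set w | M%:R < `|lin u (Z 1 w - Z t w)|] by apply: meas_gt; exact: measurableT_comp.
    apply: le_trans (measureU2 _ _ _) => //; apply: le_measure; rewrite ?inE//; first exact: measurableU.
    move=> w _; have [h|h] := leP (`|lin u (Z 1 w - Z t w)|) M%:R; [by left|by right].
  have -> : P setT = 1%E by exact: probability_setT.
  rewrite -intk intk' => h; have := le_trans h (leeD (lexx k%:E) HMb).
  by rewrite -EFinD lee_fin => h'; lra.
have [sg gm] := filtration_subsigma t0.
have mf : measurable_fun setT ((fun w => lin u (Z t w) ^+ 4) : g_sigma_algebraType (F t) -> R).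
  by apply: measurable_funX; exact: lin_levy_meas.
have q0 (x : R) : 0 <= x ^+ 4 by rewrite -[4%N]/(2 * 2)%N exprM sqr_ge0.
have E : (\int[P]_w (lin u (Z t w) ^+ 4 * \1_B (Z 1 w - Z t w))%:E = \int[P]_w (lin u (Z t w) ^+ 4 * k)%:E)%E.
  apply: (sub_integral_eq sg gm _ _ _ _ _ mf) => //.
  - exact: (measurableT_comp mpsi mY).
  - by move=> w; rewrite ltW.
  - move=> A FA; have mA := gm _ FA; rewrite integral_cst//.
    rewrite -intk' muleC -(indep_ge0 (conj sg gm) mY (levy_incr_indep t0 t1) mpsi _ FA)//.
    rewrite integral_mkcond; apply: eq_integral => w _; rewrite patchE !indicE.
    by case: ifP => _; rewrite ?mul1r ?mul0r.
have l1 : Lone (fun w => 8 * (lin u (Z 1 w) ^+ 4 + M%:R ^+ 4)).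
  by apply: LoneZ; apply: LoneD; [exact: lin_levy_Lone1|exact: Lone_cst].
have l2 : Lone (fun w => lin u (Z t w) ^+ 4 * \1_B (Z 1 w - Z t w)).
  apply: (Lone_le _ l1).
    by apply: measurable_funM; [exact: sub_meas sg gm mf|exact: (measurableT_comp mpsi mY)].
  move=> w; rewrite indicE; case: (boolP (_ \in B)); last by rewrite mulr0 normr0 mulr_ge0// addr_ge0.
  rewrite inE mulr1 ger0_norm// /B /= linB; move: (lin u (Z 1 w)) (lin u (Z t w)) => x y h.
  have h4 : (x - y) ^+ 4 <= M%:R ^+ 4.
    by rewrite -[leLHS]ger0_norm// normrX lerXn2r// nnegrE.
  have := pow4B x (x - y); rewrite (_ : x - (x - y) = y); last by ring.
  lra.
have l3 : Lone (fun w => lin u (Z t w) ^+ 4 * k).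
  apply: ge0_Lone => [|w|].
  - by apply: measurable_funM => //; exact: sub_meas sg gm mf.
  - by rewrite mulr_ge0// ltW.
  - by rewrite -E EFin_Er// ltry.
have := LoneZ k^-1 l3; apply: eq_integrable => // w _ /=.
by rewrite mulrCA mulVf ?mulr1// gt_eqF.
Qed.

Lemma lin_levy_moment u (s t : R) i j : 0 <= s -> 0 <= t -> s + t <= 1 -> (i + j <= 4)%N ->
  Lone (fun w => lin u (Z s w) ^+ i * lin u (Z (s + t) w - Z s w) ^+ j) /\
  Er (fun w => lin u (Z s w) ^+ i * lin u (Z (s + t) w - Z s w) ^+ j) =
  Er (fun w => lin u (Z s w) ^+ i) * Er (fun w => lin u (Z t w) ^+ j).
Proof.
move=> s0 t0 st1 ij; have sst : s <= s + t by rewrite lerDl.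
have mpsi : measurable_fun setT ((fun z => lin u z ^+ j) : borel_vec R r -> R).
  by apply: measurable_funX; exact: lin_meas.
have ts : s + t - s = t by ring.
have lt : Lone (fun w => lin u (Z (s + t - s) w) ^+ j).
  rewrite ts; apply: Lone_pow4; [exact: leq_trans (leq_addl _ _) ij|exact: lin_levy_meas0|].
  by apply: lin_levy_Lone; lra.
have [l1 e1] := @levy_incr_Er s (s + t) (fun z => lin u z ^+ j) s0 sst mpsi lt.
have lX : Lone (fun w => lin u (Z s w) ^+ i).
  apply: Lone_pow4; [exact: leq_trans (leq_addr _ _) ij|exact: lin_levy_meas0|].
  by apply: lin_levy_Lone; lra.
have mX : measurable_fun setT ((fun w => lin u (Z s w) ^+ i) : g_sigma_algebraType (F s) -> R).
  by apply: measurable_funX; exact: lin_levy_meas.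
have mY : measurable_fun setT ((fun w => Z (s + t) w - Z s w) : Om -> borel_vec R r).
  by apply: (sub_meas_vec (addr_ge0 s0 t0)); exact: levy_incr_meas.
have [l2 e2] := indep_Er (filtration_subsigma s0) mY (levy_incr_indep s0 sst) mpsi l1 mX lX.
by split=> //; rewrite e2 -[in RHS]ts -e1.
Qed.

(** The variance of a process with stationary independent increments is additive in
    time and nonnegative, hence linear. The mean is additive as well, and it
    vanishes at time 1; stochastic continuity together with the smallness of the
    variance makes it continuous at 0, so it vanishes throughout. *)
Lemma lin_levy_zero u t : 0 <= t <= 1 -> Er (fun w => lin u (Z t w)) = 0 /\
  Er (fun w => lin u (Z t w) ^+ 2) = t * Er (fun w => lin u (Z 1 w) ^+ 2).
Proof.
move: t; pose m1 t := Er (fun w => lin u (Z t w)); pose m2 t := Er (fun w => lin u (Z t w) ^+ 2).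
have m1E s : m1 s = Er (fun w => lin u (Z s w) ^+ 1) by [].
have l k s : (k <= 4)%N -> 0 <= s <= 1 -> Lone (fun w => lin u (Z s w) ^+ k).
  by move=> k4 s01; apply: Lone_pow4 => //; [apply: lin_levy_meas0; case/andP: s01|exact: lin_levy_Lone].
have m0 : Er (fun w => 1) = 1 :> R by exact: Er_cst.
have m1D s t : 0 <= s -> 0 <= t -> s + t <= 1 -> m1 (s + t) = m1 s + m1 t.
  move=> s0 t0 st; have [l1 e1] := @lin_levy_moment u s t 1 0 s0 t0 st isT.
  have [l2 e2] := @lin_levy_moment u s t 0 1 s0 t0 st isT.
  rewrite {1}/m1 (@Er_eq _ _ _ _ _ (fun w => lin u (Z s w) ^+ 1 * lin u (Z (s + t) w - Z s w) ^+ 0 + lin u (Z s w) ^+ 0 * lin u (Z (s + t) w - Z s w) ^+ 1)); last first.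
    by move=> w; rewrite linB; ring.
  by rewrite ErD// e1 e2 -!m1E m0 mulr1 mul1r.
have m2D s t : 0 <= s -> 0 <= t -> s + t <= 1 -> m2 (s + t) = m2 s + m2 t + 2 * m1 s * m1 t.
  move=> s0 t0 st; have [l1 e1] := @lin_levy_moment u s t 2 0 s0 t0 st isT.
  have [l2 e2] := @lin_levy_moment u s t 0 2 s0 t0 st isT.
  have [l3 e3] := @lin_levy_moment u s t 1 1 s0 t0 st isT.
  rewrite {1}/m2 (@Er_eq _ _ _ _ _ (fun w => (lin u (Z s w) ^+ 2 * lin u (Z (s + t) w - Z s w) ^+ 0 + lin u (Z s w) ^+ 0 * lin u (Z (s + t) w - Z s w) ^+ 2) + 2 * (lin u (Z s w) ^+ 1 * lin u (Z (s + t) w - Z s w) ^+ 1))); last first.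
    by move=> w; rewrite linB; ring.
  rewrite ErD; [|exact: LoneD|exact: LoneZ].
  by rewrite ErD// ErZ// e1 e2 e3 -!m1E m0 mulr1 mul1r mulrA.
have V s : 0 <= s <= 1 -> Lone (fun w => (lin u (Z s w) - m1 s) ^+ 2) /\
    Er (fun w => (lin u (Z s w) - m1 s) ^+ 2) = m2 s - m1 s ^+ 2.
  move=> s01; have ls1 := l 1%N s isT s01; have ls2 := l 2%N s isT s01.
  have E : (fun w => (lin u (Z s w) - m1 s) ^+ 2) = (fun w => lin u (Z s w) ^+ 2 + (- (2 * m1 s) * lin u (Z s w) ^+ 1 + m1 s ^+ 2)).
    by apply/funext => w; ring.
  have lb : Lone (fun w => - (2 * m1 s) * lin u (Z s w) ^+ 1 + m1 s ^+ 2).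
    by apply: LoneD; [exact: LoneZ|exact: Lone_cst].
  rewrite E; split; first exact: LoneD.
  rewrite ErD// ErD//; [|exact: LoneZ|exact: Lone_cst].
  by rewrite ErZ// -m1E Er_cst -/(m2 s); ring.
pose v s := m2 s - m1 s ^+ 2.
have vE : forall t, 0 <= t <= 1 -> v t = t * v 1.
  apply: additive_mono => [s t s0 t0 st|s s01].
    by rewrite /v m2D// m1D//; ring.
  by rewrite /v -(V s s01).2; apply: Er_ge0 => w; exact: sqr_ge0.
have m11 : m1 1 = 0.
  have [H _ _] := HM; move: H; rewrite unlock => H.
  have lz (b : 'I_r) : Lone (fun w => Z 1 w b 0).
    have := Lone_pow4 (k := 1) isT _ (lin_levy_Lone1 (fun b' => (b' == b)%:R)).
    have -> : (fun w => lin (fun b' => (b' == b)%:R) (Z 1 w)) = (fun w => Z 1 w b 0).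
      apply/funext => w; rewrite /lin (bigD1 b)//= eqxx mul1r big1 ?addr0// => b' /negPf ->.
      by rewrite mul0r.
    by apply; apply: (measurableT_comp (coord_meas b)); apply: (sub_meas_vec ler01); exact: levy_adapted_meas.
  rewrite /m1 /lin Er_sum; last by move=> b; exact: LoneZ.
  by rewrite big1// => b _; rewrite ErZ// /Er /Rintegral H mulr0.
have m1small e : 0 < e -> exists2 dl, 0 < dl & forall t, 0 <= t <= 1 -> t <= dl -> `|m1 t| <= e.
  move=> e0; pose K := \sum_b `|u b| + 1.
  have K0 : 0 < K by rewrite ltr_wpDl// sumr_ge0.
  have e2 : 0 < e / 2 by rewrite divr_gt0.
  have [_ _ _ law /(_ 0 (e / 2 / K) (lexx 0))] := HZ; rewrite !divr_gt0// => /(_ isT) sc.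
  have h4 : (0 < (4^-1 : R)%:E)%E by rewrite lte_fin invr_gt0.
  have : \forall t \near within [set t | 0 <= t] (nbhs (0:R)), (P [set w | (e / 2 / K < enorm (Z t w - Z 0 w))%R] < (4^-1)%:E)%E.
    exact: (sc _ (open_ereal_lt' h4)).
  rewrite near_withinE => -[/= d1 d10 Hd1].
  have v10 : 0 <= v 1 by rewrite /v -(V 1 _).2 ?ler01 ?lexx//; apply: Er_ge0 => w; exact: sqr_ge0.
  exists (Num.min (d1 / 2) ((e / 2) ^+ 2 / 8 / (v 1 + 1))).
    by rewrite lt_min !divr_gt0// ?exprn_gt0// ltr_wpDl.
  move=> t t01; rewrite le_min => /andP[td1 tv]; have /andP[t0 t1] := t01.
  have mt := lin_levy_meas0 u t0.
  have mZt : measurable_fun setT (Z t : Om -> borel_vec R r).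
    by apply: (sub_meas_vec t0); exact: levy_adapted_meas.
  (* If the mean were larger than e, the variable, close to 0 with probability 3/4,
     would be far from its mean, but its variance is small as well. *)
  have P1 : (P [set w | (e / 2 <= `|lin u (Z t w)|)%R] <= (4^-1)%:E)%E.
    have mB : measurable ([set z | e / 2 / K < enorm z] : set (borel_vec R r)).
      by apply: meas_gt; exact: enorm_meas.
    have := law 0 t _ (lexx 0) t0 mB; rewrite subr0 /= => lawt.
    have := Hd1 t; rewrite /= sub0r normrN ger0_norm// => /(_ _ t0) h.
    have {h} := h _; rewrite lawt => h; apply: le_trans (ltW (h _)); last first.
      by apply: le_lt_trans td1 _; rewrite gtr_pMr// invf_lt1// ltr1n.
    apply: le_measure; rewrite ?inE//.
    - by apply: meas_ge; exact: measurableT_comp.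
    - by apply: meas_gt; exact: (measurableT_comp (@enorm_meas R r) mZt).
    - move=> w /= hw; rewrite ltr_pdivrMr//; have hw' := hw; apply: le_lt_trans hw' _.
      have en0 : 0 < enorm (Z t w).
        rewrite lt_neqAle sqrtr_ge0 andbT; apply/eqP => h0; move: hw; apply/negP; rewrite -ltNge.
        by apply: le_lt_trans (lin_le _ _) _; rewrite -h0 mulr0.
      by apply: le_lt_trans (lin_le _ _) _; rewrite mulrC ltr_pM2l// /K ltrDl ltr01.
  have P2 : (P [set w | ((e / 2) ^+ 2 <= (lin u (Z t w) - m1 t) ^+ 2)%R] <= (4^-1)%:E)%E.
    have [lV eV] := V t t01.
    apply: le_trans (Er_chebyshev lV _ _) _ => [w||]; [exact: sqr_ge0|by rewrite exprn_gt0|].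
    rewrite eV -/(v t) vE// lee_fin ler_pdivrMr ?exprn_gt0//.
    apply: (@le_trans _ _ (t * (v 1 + 1))); first by rewrite ler_wpM2l// lerDl.
    move: tv; rewrite ler_pdivlMr ?ltr_wpDl// => tv; apply: le_trans tv _.
    by have := sqr_ge0 (e / 2); lra.
  rewrite leNgt; apply/negP => em.
  have : (P setT <= P [set w | (e / 2 <= `|lin u (Z t w)|)%R] + P [set w | ((e / 2) ^+ 2 <= (lin u (Z t w) - m1 t) ^+ 2)%R])%E.
    have mA1 : measurable [set w | e / 2 <= `|lin u (Z t w)|] by apply: meas_ge; exact: measurableT_comp.
    have mA2 : measurable [set w | (e / 2) ^+ 2 <= (lin u (Z t w) - m1 t) ^+ 2].
      by apply: meas_ge; exact: Lone_meas (V t t01).1.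
    apply: le_trans (measureU2 _ _ _) => //; apply: le_measure; rewrite ?inE//; first exact: measurableU.
    move=> w _; have [h|h] := leP (e / 2) (`|lin u (Z t w)|); [by left|right=> /=].
    rewrite -[leRHS]real_normK ?num_real// lerXn2r ?nnegrE//; first exact: ltW.
    have := ler_normB (lin u (Z t w)) (lin u (Z t w) - m1 t).
    by rewrite opprB addrC subrK; move: h em; lra.
  have -> : P setT = 1%E by exact: probability_setT.
  by move=> h; have := le_trans h (leeD P1 P2); rewrite -EFinD lee_fin; lra.
move=> t t01; have mt0 : m1 t = 0 by exact: (additive_small m1D m11 m1small).
by split=> //; have := vE t t01; rewrite /v mt0 m11 expr0n !subr0.
Qed.

(** Expanding the fourth power of a sum of two independent centred variables leaves the
    two fourth moments and a nonnegative term: the fourth moment is superadditive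
    in time. *)
Lemma lin_levy_four u t : 0 < t <= 1 ->
  Er (fun w => lin u (Z t w) ^+ 4) <= 2 * Er (fun w => lin u (Z 1 w) ^+ 4) * t.
Proof.
have q0 (x : R) : 0 <= x ^+ 4 by rewrite -[4%N]/(2 * 2)%N exprM sqr_ge0.
apply: (@superadditive_linear R (fun t => Er (fun w => lin u (Z t w) ^+ 4))); last first.
  by move=> s _; apply: Er_ge0 => w.
move=> s t' s0 t0 st.
have M i j := @lin_levy_moment u s t' i j s0 t0 st.
have [l40 e40] := M 4%N 0%N isT; have [l31 e31] := M 3%N 1%N isT; have [l22 e22] := M 2%N 2%N isT.
have [l13 e13] := M 1%N 3%N isT; have [l04 e04] := M 0%N 4%N isT.
rewrite [leRHS](@Er_eq _ _ _ _ _ (fun w => (lin u (Z s w) ^+ 4 * lin u (Z (s + t') w - Z s w) ^+ 0 +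
    lin u (Z s w) ^+ 0 * lin u (Z (s + t') w - Z s w) ^+ 4) +
    (4 * (lin u (Z s w) ^+ 3 * lin u (Z (s + t') w - Z s w) ^+ 1) +
     4 * (lin u (Z s w) ^+ 1 * lin u (Z (s + t') w - Z s w) ^+ 3) +
     6 * (lin u (Z s w) ^+ 2 * lin u (Z (s + t') w - Z s w) ^+ 2)))); last first.
  by move=> w; rewrite linB; ring.
have lA := LoneD l40 l04; have l31' := LoneZ 4 l31; have l13' := LoneZ 4 l13; have l22' := LoneZ 6 l22.
have lB := LoneD (LoneD l31' l13') l22'.
rewrite (ErD lA lB) (ErD l40 l04) (ErD (LoneD l31' l13') l22') (ErD l31' l13').
rewrite (ErZ 4 l31) (ErZ 4 l13) (ErZ 6 l22) e40 e31 e22 e13 e04.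
have z1 q : 0 <= q <= 1 -> Er (fun w => lin u (Z q w) ^+ 1) = 0 by move=> q01; exact: (lin_levy_zero u q01).1.
have z0 q : Er (fun w => lin u (Z q w) ^+ 0) = 1 by exact: Er_cst.
have s01 : 0 <= s <= 1 by rewrite s0 (le_trans _ st)// lerDl.
have t01 : 0 <= t' <= 1 by rewrite t0 (le_trans _ st)// lerDr.
rewrite !z0 (z1 s s01) (z1 t' t01).
rewrite mulr1 mul1r !mul0r !mulr0 !add0r lerDl mulr_ge0// mulr_ge0//; apply: Er_ge0 => w; exact: sqr_ge0.
Qed.

Lemma levy_incr_moments : exists2 C, 0 <= C & forall s t, 0 <= s -> s < t -> t <= s + 1 ->
  let Y w := Z t w - Z s w in
  (forall b, [/\ Lone (fun w => Y w b 0 ^+ 4), Er (fun w => Y w b 0) = 0 & Er (fun w => Y w b 0 ^+ 4) <= C * (t - s)]) /\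
  (forall b b', Er (fun w => Y w b 0 * Y w b' 0) = (t - s) * (b == b')%:R).
Proof.
have q0 (x : R) : 0 <= x ^+ 4 by rewrite -[4%N]/(2 * 2)%N exprM sqr_ge0.
pose dl (b : 'I_r) : 'I_r -> R := fun b' => (b' == b)%:R.
have dlE b z : lin (dl b) z = z b 0.
  by rewrite /lin /dl (bigD1 b)//= eqxx mul1r big1 ?addr0// => b' /negPf ->; rewrite mul0r.
pose K b := Er (fun w => lin (dl b) (Z 1 w) ^+ 4).
have K0 b : 0 <= K b by apply: Er_ge0.
exists (\sum_b 2 * K b); first by apply: sumr_ge0 => b _; rewrite mulr_ge0.
move=> s t s0 st t1 Y; have ts0 : 0 < t - s by rewrite subr_gt0.
have ts01 : 0 <= t - s <= 1 by apply/andP; split; lra.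
have ts1 : 0 < t - s <= 1 by rewrite ts0; case/andP: ts01.
have I u k : (k <= 4)%N -> Lone (fun w => lin u (Y w) ^+ k) /\
    Er (fun w => lin u (Y w) ^+ k) = Er (fun w => lin u (Z (t - s) w) ^+ k).
  move=> k4; apply: (@levy_incr_Er s t (fun z => lin u z ^+ k) s0 (ltW st)).
    by apply: measurable_funX; exact: lin_meas.
  by apply: Lone_pow4 => //; [apply: lin_levy_meas0; exact: ltW|exact: lin_levy_Lone].
have sq u : Er (fun w => lin u (Y w) ^+ 2) = (t - s) * Er (fun w => lin u (Z 1 w) ^+ 2).
  by rewrite (I u 2%N isT).2 (lin_levy_zero u ts01).2.
split=> [b|b b'].
  have [l4 e4] := I (dl b) 4%N isT; have [_ e1] := I (dl b) 1%N isT.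
  have E k : (fun w => lin (dl b) (Y w) ^+ k) = (fun w => Y w b 0 ^+ k) by apply/funext => w; rewrite dlE.
  rewrite !E in l4 e4 e1; split=> //.
    by rewrite [LHS]e1; exact: (lin_levy_zero _ ts01).1.
  rewrite e4; apply: le_trans (lin_levy_four _ ts1) _.
  rewrite ler_wpM2r ?(ltW ts0)//; rewrite (bigD1 b)//= lerDl.
  by apply: sumr_ge0 => b' _; rewrite mulr_ge0.
pose u w := dl b w + dl b' w.
have uE z : lin u z ^+ 2 = z b 0 ^+ 2 + z b' 0 ^+ 2 + 2 * (z b 0 * z b' 0).
  have -> : lin u z = z b 0 + z b' 0.
    by rewrite -!dlE /lin -big_split; apply: eq_bigr => k _ /=; rewrite mulrDl.
  by ring.
have pol (V : Om -> 'cV[R]_r) : (forall u, Lone (fun w => lin u (V w) ^+ 2)) ->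
    2 * Er (fun w => V w b 0 * V w b' 0) =
    Er (fun w => lin u (V w) ^+ 2) - Er (fun w => lin (dl b) (V w) ^+ 2) - Er (fun w => lin (dl b') (V w) ^+ 2) /\
    Lone (fun w => V w b 0 * V w b' 0).
  move=> lV; have lu := lV u; have lb := lV (dl b); have lb' := lV (dl b').
  have E w : V w b 0 * V w b' 0 = 2^-1 * (lin u (V w) ^+ 2 - lin (dl b) (V w) ^+ 2 - lin (dl b') (V w) ^+ 2).
    by rewrite uE !dlE; field.
  have lD := LoneB (LoneB lu lb) lb'.
  rewrite (_ : (fun w => V w b 0 * V w b' 0) = fun w => 2^-1 * (lin u (V w) ^+ 2 - lin (dl b) (V w) ^+ 2 - lin (dl b') (V w) ^+ 2)); last by apply/funext => w; rewrite E.
  split; last exact: LoneZ.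
  by rewrite (ErZ _ lD) (ErB (LoneB lu lb) lb') (ErB lu lb); field.
have lZ1 v : Lone (fun w => lin v (Z 1 w) ^+ 2).
  by apply: Lone_pow4 => //; [exact: lin_levy_meas0|apply: lin_levy_Lone; rewrite ler01 lexx].
have [eY _] := pol Y (fun v => (I v 2%N isT).1).
have [eZ lZ] := pol (Z 1) lZ1.
have EZ : Er (fun w => Z 1 w b 0 * Z 1 w b' 0) = (b == b')%:R.
  have [_ /(_ b b') H _] := HM; move: H; rewrite unlock => H.
  have {}H : (\int[P]_w (Z 1 w b 0 * Z 1 w b' 0)%:E = ((1%:M : 'M[R]_r) b b')%:E)%E.
    by rewrite -H; apply: eq_integral => w _; rewrite /mxsq !mxE big_ord1 mxE.
  by apply: EFin_inj; rewrite -EFin_Er// H mxE.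
apply: (mulfI (_ : 2 != 0 :> R)) => //.
by rewrite eY !sq -EZ; have := eZ; move=> h; rewrite mulrCA h; ring.
Qed.

End levy_moments.

(** * Convergence in probability *)
Section convergence_in_probability.
Context (R : realType) (dO : measure_display) (Om : measurableType dO) (P : probability Om R).
Local Notation Er := (Er P).
Local Notation Lone := (Lone P).
Local Notation Ltwo := (Ltwo P).

(** No measurability is asked of the limit, nor of the difference: the
    exceptional events are. *)
Definition pcvg (Y_ : nat -> Om -> R) (Y : Om -> R) := forall e, 0 < e ->
  exists N0, forall N, (N0 <= N)%N -> exists B, [/\ measurable B, (P B <= e%:E)%E &
    forall w, ~ B w -> `|Y_ N w - Y w| <= e].

Lemma ext_cover (A : set Om) (e : R) : (mu_ext P A < e%:E)%E ->
  exists B, [/\ measurable B, A `<=` B & (P B <= e%:E)%E].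
Proof.
move=> /ereal_inf_lt [y [A_ [mA AA] <-] ye].
exists (\bigcup_k A_ k); split=> //; first exact: bigcupT_measurable.
apply: le_trans (ltW ye).
by apply: measure_sigma_subadditive => //; exact: bigcupT_measurable.
Qed.

Lemma ext_le_measure (A B : set Om) : measurable B -> A `<=` B -> (mu_ext P A <= P B)%E.
Proof.
move=> mB AB; apply: le_trans (le_mu_ext _ AB) _.
by rewrite measurable_mu_extE.
Qed.

(** Egorov's theorem. *)
Lemma ae_pcvg Y_ Y : (forall N, measurable_fun setT (Y_ N)) ->
  {ae P, forall w, Y_ N w @[N --> \oo] --> Y w} -> pcvg Y_ Y.
Proof.
move=> mY [B0 [mB0 PB0 HB0]] e e0.
have mC : measurable (~` B0) by exact: measurableC.
have cv w : (~` B0) w -> Y_ N w @[N --> \oo] --> Y w.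
  by move=> Bw; apply: contrapT => h; apply: Bw; exact: HB0.
have mYC N : measurable_fun (~` B0) (Y_ N) by exact: measurable_funTS.
have mYl : measurable_fun (~` B0) Y by exact: measurable_fun_cvg mYC cv.
have PC : (P (~` B0) < +oo)%E by rewrite ltey_eq fin_num_measure.
have ae : {ae P, forall w, (~` B0) w -> Y_ N w @[N --> \oo] --> Y w} by apply: aeW.
have [B [mB PB unif]] := ae_pointwise_almost_uniform mYC mYl mC PC ae e0.
have [N0 H] := uniform_cvg_norm unif e0.
exists N0 => N N0N; exists (B0 `|` B); split; first exact: measurableU.
  apply: le_trans (measureU2 _ _ _) _ => //.
  rewrite -[leRHS]add0e; apply: leeD; last exact: ltW.
  by move/eqP: PB0; rewrite eq_le => /andP[h _]; exact: h.
move=> w /not_orP[w0 w1]; rewrite distrC; apply: ltW; exact: H.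
Qed.

Lemma pcvg_cst Y : pcvg (fun _ => Y) Y.
Proof.
move=> e e0; exists 0%N => N _; exists set0; split=> //; first by rewrite measure0 lee_fin ltW.
by move=> w _; rewrite subrr normr0 ltW.
Qed.

Lemma pcvgD Y_ Y Z_ Z : pcvg Y_ Y -> pcvg Z_ Z -> pcvg (fun N w => Y_ N w + Z_ N w) (fun w => Y w + Z w).
Proof.
move=> HY HZ e e0; have e2 : 0 < e / 2 by rewrite divr_gt0.
have [N1 H1] := HY _ e2; have [N2 H2] := HZ _ e2.
exists (maxn N1 N2) => N; rewrite geq_max => /andP[h1 h2].
have [B1 [m1 P1 c1]] := H1 N h1; have [B2 [m2 P2 c2]] := H2 N h2.
exists (B1 `|` B2); split; first exact: measurableU.
  apply: le_trans (measureU2 _ _ _) _ => //; apply: le_trans (leeD P1 P2) _.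
  by rewrite -EFinD lee_fin -splitr.
move=> w /not_orP[w1 w2]; have := ler_normD (Y_ N w - Y w) (Z_ N w - Z w).
rewrite (_ : Y_ N w - Y w + (Z_ N w - Z w) = Y_ N w + Z_ N w - (Y w + Z w)); last by ring.
by move=> h; apply: le_trans h _; rewrite [e]splitr lerD// ?c1// c2.
Qed.

Lemma pcvg_sum (I : Type) (s : seq I) (Y_ : I -> nat -> Om -> R) Y : (forall i, pcvg (Y_ i) (Y i)) ->
  pcvg (fun N w => \sum_(i <- s) Y_ i N w) (fun w => \sum_(i <- s) Y i w).
Proof.
move=> H; elim: s => [|i s IH].
  have := @pcvg_cst (fun _ => 0); congr pcvg; [apply/funext => N|]; apply/funext => w; by rewrite big_nil.
have := pcvgD (H i) IH; congr pcvg; [apply/funext => N|]; apply/funext => w; by rewrite big_cons.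
Qed.

(** Multiplication by V preserves convergence in probability since V is bounded by a
    constant outside an event of small probability. *)
Lemma pcvgM (V : Om -> R) Y_ Y : measurable_fun setT V -> pcvg Y_ Y ->
  pcvg (fun N w => V w * Y_ N w) (fun w => V w * Y w).
Proof.
move=> mV HY e e0; have e2 : 0 < e / 2 by rewrite divr_gt0.
have [M HM] := tight_rv P mV e2.
pose e1 := Num.min (e / 2) (e / M.+1%:R).
have e10 : 0 < e1 by rewrite lt_min e2 divr_gt0.
have [N0 H] := HY _ e10; exists N0 => N N0N; have [B [mB PB c]] := H N N0N.
have mC : measurable [set w | M%:R < `|V w|] by apply: meas_gt; exact: measurableT_comp.
exists (B `|` [set w | M%:R < `|V w|]); split; first exact: measurableU.
  apply: le_trans (measureU2 _ _ _) _ => //; apply: le_trans (leeD PB HM) _.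
  by rewrite -EFinD lee_fin [leRHS]splitr lerD2r /e1 ge_min lexx.
move=> w /not_orP[w1] /= /negP; rewrite -leNgt => w2.
rewrite -mulrBr normrM; apply: (@le_trans _ _ (M.+1%:R * (e / M.+1%:R))); last by rewrite mulrC divfK.
apply: ler_pM => //; first by apply: le_trans w2 _; rewrite ler_nat.
by apply: le_trans (c w w1) _; rewrite /e1 ge_min lexx orbT.
Qed.

(** A lemma of Fatou's type for convergence in probability. The truncated limit is
    compared with Y_N outside an exceptional event, where the truncation level
    bounds the loss; using |a|^2 <= 2|b|^2 + 2|a - b|^2 costs the factor 2, which
    is harmless for bounds up to constants. *)
Lemma pcvg_Ltwo Y_ Y (b : R) : measurable_fun setT Y -> pcvg Y_ Y ->
  (\forall N \near \oo, Ltwo (Y_ N) /\ Er (fun w => Y_ N w ^+ 2) <= b) ->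
  Ltwo Y /\ Er (fun w => Y w ^+ 2) <= 2 * b.
Proof.
move=> mY HY [N1 _ H1].
pose f (M : nat) w := Num.min `|Y w| M%:R ^+ 2.
have f0 M w : 0 <= Num.min `|Y w| M%:R by rewrite le_min normr_ge0 ler0n.
have mf M : measurable_fun setT (f M).
  apply: measurable_funX; apply: measurable_minr => //; exact: measurableT_comp.
have fM M w : f M w <= M%:R ^+ 2 by rewrite /f lerXn2r ?nnegrE// ge_min lexx orbT.
have lf M : Lone (f M).
  by apply: (Lone_le (mf M) (Lone_cst P (M%:R ^+ 2))) => w; rewrite ger0_norm// sqr_ge0.
have Ef M : Er (f M) <= 2 * b.
  apply/ler_addgt0Pr => eta eta0.
  pose e := Num.min 1 (eta / (2 + M%:R ^+ 2)).
  have D0 : 0 < 2 + M%:R ^+ 2 :> R by rewrite ltr_wpDr// sqr_ge0.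
  have e0 : 0 < e by rewrite lt_min ltr01 divr_gt0.
  have [N0 H0] := HY e e0.
  have [[tN bN] [B [mB PB c]]] : (Ltwo (Y_ (maxn N0 N1)) /\ Er (fun w => Y_ (maxn N0 N1) w ^+ 2) <= b) /\
     exists B, [/\ measurable B, (P B <= e%:E)%E & forall w, ~ B w -> `|Y_ (maxn N0 N1) w - Y w| <= e].
    by split; [apply: H1; exact: leq_maxr|apply: H0; exact: leq_maxl].
  move: (maxn N0 N1) tN bN c => N tN bN c.
  have lB : Lone (\1_B : Om -> R).
    by apply: (Lone_le _ (Lone_cst P 1)) => // w; rewrite indicE; case: (_ \in _); rewrite ?normr1 ?normr0.
  have eB : Er (\1_B) <= e.
    by rewrite -lee_fin -EFin_Er// integral_indic// setIT.
  have l1 := LoneZ 2 tN.2; have l2 := LoneZ (M%:R ^+ 2) lB.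
  have le w : f M w <= (2 * Y_ N w ^+ 2 + M%:R ^+ 2 * \1_B w) + 2 * e ^+ 2.
    have [Bw|Bw] := pselect (B w).
      rewrite indicE mem_set// mulr1; apply: le_trans (fM M w) _.
      by have := sqr_ge0 (Y_ N w); have := sqr_ge0 e; lra.
    rewrite indicE memNset// mulr0 addr0; have h := c w Bw.
    apply: (@le_trans _ _ (`|Y w| ^+ 2)); first by rewrite /f lerXn2r ?nnegrE// ge_min lexx.
    rewrite real_normK ?num_real//.
    have h2 : (Y_ N w - Y w) ^+ 2 <= e ^+ 2.
      by rewrite -[leLHS]real_normK ?num_real// lerXn2r ?nnegrE// ltW.
    have := sqr_ge0 (2 * Y_ N w - Y w); move: h2; rewrite !sqrrB; lra.
  apply: le_trans (Er_le (lf M) (LoneD (LoneD l1 l2) (Lone_cst P (2 * e ^+ 2))) le) _.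
  rewrite (ErD (LoneD l1 l2) (Lone_cst P _)) (ErD l1 l2) (ErZ _ tN.2) (ErZ _ lB) Er_cst.
  have e1 : e <= 1 by rewrite /e ge_min lexx.
  have ee : e ^+ 2 <= e by rewrite expr2 ler_piMl// ltW.
  have m1 : M%:R ^+ 2 * Er (\1_B) <= M%:R ^+ 2 * e by rewrite ler_wpM2l// sqr_ge0.
  have m2 : (2 + M%:R ^+ 2) * e <= eta by rewrite mulrC -ler_pdivlMr// /e ge_min lexx orbT.
  move: m2; rewrite mulrDl; lra.
have lim w : (f M w)%:E @[M --> \oo] --> (Y w ^+ 2)%:E.
  apply: cvg_near_cst; exists (Num.bound `|Y w|) => // M /= hM.
  rewrite /f min_l ?real_normK ?num_real//.
  by apply: ltW; apply: lt_le_trans (archi_boundP (normr_ge0 _)) _; rewrite ler_nat.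
have mc : (\int[P]_w (f M w)%:E)%E @[M --> \oo] --> (\int[P]_w (Y w ^+ 2)%:E)%E.
  have := @cvg_monotone_convergence _ _ _ P setT measurableT (fun M w => (f M w)%:E).
  have -> : (fun w => limn (fun M => (f M w)%:E)) = (fun w => (Y w ^+ 2)%:E).
    by apply/funext => w; apply/cvg_lim => //; exact: lim.
  apply.
  - by move=> M; apply/measurable_EFinP.
  - by move=> M w _; rewrite lee_fin sqr_ge0.
  - move=> w _ m n mn; rewrite lee_fin /f lerXn2r ?nnegrE//.
    by rewrite le_min ge_min lexx/= ge_min ler_nat mn orbT.
have [] := @ge0_Lone_le _ _ _ P (fun w => Y w ^+ 2) (2 * b).
- exact: measurable_funX.
- by move=> w; exact: sqr_ge0.
- apply: cvge_to_le mc _; near=> M; by rewrite EFin_Er// lee_fin.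
by move=> ? ?; split.
Unshelve. all: by end_near. Qed.

End convergence_in_probability.

(** * Riemann sums along regular grids *)
Section grids.
Context (R : realType).
Implicit Types (f z : R -> R) (u : nat -> R) (s t v tau : R).

(** For a nondecreasing u, the index of the first of its first m points that is at
    least v. *)
Definition below u (v : R) (m : nat) : nat := (\sum_(j < m) (u j < v)%R)%N.

Lemma below_lt u v m : {homo u : i j / (i <= j)%N >-> i <= j} ->
  forall j, (j < m)%N -> (u j < v) = (j < below u v m)%N.
Proof.
move=> hu; elim: m => [//|m IH] j; rewrite ltnS leq_eqVlt /below big_ord_recr/= -/(below u v m).
have bm : (below u v m <= m)%N.
  by rewrite /below -[leqRHS]card_ord -sum1_card; apply: leq_sum => i _; case: (_ < _).
case: (ltP (u m) v) => hm.
  have E : below u v m = m.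
    rewrite /below -[RHS]card_ord -sum1_card; apply: eq_bigr => i _.
    by rewrite (le_lt_trans (hu _ _ _) hm)// ltnW.
  rewrite E addn1 => jm; rewrite ltnS leq_eqVlt jm.
  by apply: le_lt_trans hm; apply: hu; rewrite leq_eqVlt.
rewrite addn0 => /orP[/eqP->|jm]; last exact: IH.
by rewrite ltNge hm ltnNge bm.
Qed.

Lemma below_le u v m : (below u v m <= m)%N.
Proof. by rewrite /below -[leqRHS]card_ord -sum1_card; apply: leq_sum => i _; case: (_ < _). Qed.

Lemma telescope_below u v z m : {homo u : i j / (i <= j)%N >-> i <= j} ->
  \sum_(j < m) (u j < v)%R%:R * (z (u j.+1) - z (u j)) = z (u (below u v m)) - z (u 0%N).
Proof.
move=> hu; elim: m => [|m IH]; first by rewrite /below !big_ord0 subrr.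
rewrite big_ord_recr/= IH /below [in RHS]big_ord_recr/= -/(below u v m).
case: (ltP (u m) v) => hm; last by rewrite addn0 mul0r addr0.
have -> : below u v m = m.
  rewrite /below -[RHS]card_ord -sum1_card; apply: eq_bigr => i _.
  by rewrite (le_lt_trans (hu _ _ _) hm)// ltnW.
by rewrite addn1 mul1r addrC addrA subrK.
Qed.

Definition grid (s t : R) (N j : nat) := s + (t - s) * (j%:R / N%:R).

Lemma grid0 s t N : grid s t N 0 = s.
Proof. by rewrite /grid mul0r mulr0 addr0. Qed.

Lemma gridN s t N : (0 < N)%N -> grid s t N N = t.
Proof. by move=> N0; rewrite /grid mulfV ?mulr1 ?subrKC// pnatr_eq0 -lt0n. Qed.

Lemma grid_homo s t N : s <= t -> {homo grid s t N : i j / (i <= j)%N >-> i <= j}.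
Proof.
by move=> st i j ij; rewrite lerD2l ler_wpM2l ?subr_ge0// ler_wpM2r ?invr_ge0// ler_nat.
Qed.

Lemma grid_step s t N j : grid s t N j.+1 - grid s t N j = (t - s) / N%:R.
Proof. by rewrite /grid -natr1; ring. Qed.

Lemma grid_ge s t N j : s <= t -> s <= grid s t N j.
Proof. by move=> st; rewrite -[leLHS](grid0 s t N) grid_homo. Qed.

Lemma grid_le s t N j : s <= t -> (j <= N)%N -> grid s t N j <= t.
Proof.
move=> st; case: N => [|N jN]; first by rewrite leqn0 => /eqP->; rewrite grid0.
by rewrite -[leRHS](@gridN s t N.+1 isT) grid_homo.
Qed.

Lemma grid_lt s t N j : s < t -> (j < N)%N -> grid s t N j < t.
Proof.
move=> st jN; rewrite -ltrBrDl gtr_pMr ?subr_gt0//.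
by rewrite ltr_pdivrMr ?mul1r ?ltr_nat// ltr0n (leq_ltn_trans _ jN).
Qed.

Lemma grid_below s t v N : s < v <= t -> (0 < N)%N ->
  v <= grid s t N (below (grid s t N) v N) <= v + (t - s) / N%:R.
Proof.
move=> /andP[sv vt] N0; have st := lt_le_trans sv vt.
have hu := @grid_homo s t N (ltW st).
have k0 : (0 < below (grid s t N) v N)%N by rewrite -(below_lt v hu N0) grid0.
have kN := below_le (grid s t N) v N.
move: (below_lt v hu (m := N)); move: (below _ _ _) k0 kN => k k0 kN H.
apply/andP; split.
  move: kN; rewrite leq_eqVlt => /orP[/eqP->|kN]; first by rewrite gridN.
  by rewrite leNgt H// ltnn.
case: k k0 kN H => // k _ kN H.
by have := H k kN; rewrite ltnSn => /ltW h; have := grid_step s t N k; lra.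
Qed.

(** The first grid point after v decreases to v, possibly being v itself, so
    right-continuity is enough. *)
Lemma grid_right_cvg f s t v : s < v <= t -> f q @[q --> v^'+] --> f v ->
  f (grid s t N (below (grid s t N) v N)) @[N --> \oo] --> f v.
Proof.
move=> svt /cvgrPdist_le cf; apply/cvgrPdist_le => e e0.
have /(_ e e0) := cf; rewrite near_withinE => -[d /= d0 Hd].
have st : 0 < t - s by have /andP[a b] := svt; rewrite subr_gt0 (lt_le_trans a).
exists (Num.bound ((t - s) / d)).+1 => //= N hN.
have N0 : (0 < N)%N by exact: leq_ltn_trans hN.
have NR : 0 < N%:R :> R by rewrite ltr0n.
have /andP[h1 h2] := grid_below svt N0.
set q := grid _ _ _ _ in h1 h2 *.
move: h1; rewrite le_eqVlt => /orP[/eqP<-|vq]; first by rewrite subrr normr0 ltW.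
apply: Hd => //=; rewrite distrC gtr0_norm ?subr_gt0// ltrBlDl; apply: le_lt_trans h2 _.
rewrite ltrD2l ltr_pdivrMr// mulrC -ltr_pdivrMr//.
apply: lt_le_trans (archi_boundP _) _; first by rewrite divr_ge0// ltW.
by rewrite ler_nat ltnW.
Qed.

(** A stopping time is seen by the Riemann sum through the grid: the sum telescopes up to
    the first grid point after tau, and right-continuity replaces it by tau. *)
Lemma stopped_sum_cvg z s t tau : 0 <= s -> s < t -> 0 <= tau ->
  (forall v, 0 <= v -> z q @[q --> v^'+] --> z v) ->
  \sum_(j < N) (grid s t N j < tau)%R%:R * (z (grid s t N j.+1) - z (grid s t N j)) @[N --> \oo]
    --> z (Num.min t tau) - z (Num.min s tau).
Proof.
move=> s0 st tau0 cz.
have E N : \sum_(j < N) (grid s t N j < tau)%R%:R * (z (grid s t N j.+1) - z (grid s t N j)) =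
   z (grid s t N (below (grid s t N) tau N)) - z s.
  by rewrite telescope_below ?grid0//; exact/grid_homo/ltW.
under eq_fun do rewrite E.
have [ts|st'] := leP tau s.
  rewrite !min_r ?subrr//; last exact: le_trans ts (ltW st).
  have B0 N : below (grid s t N) tau N = 0%N.
    rewrite /below big1// => j _; rewrite ltNge (le_trans ts)//; exact: grid_ge (ltW st).
  under eq_fun do rewrite B0 grid0 subrr; exact: cvg_cst.
apply: cvgB; last exact: cvg_cst.
have [tt|tt] := leP t tau; last by apply: grid_right_cvg; [rewrite st' ltW|exact: cz].
apply: cvg_near_cst; exists 1%N => // N /= N0; congr z.
have -> : below (grid s t N) tau N = N.
  rewrite /below -[RHS]card_ord -sum1_card; apply: eq_bigr => i _.
  by rewrite (lt_le_trans (grid_lt st _) tt).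
by rewrite gridN.
Qed.

End grids.

(** * Riemann sums of regulated functions *)
Lemma integrable_cst_itv (R : realType) (a b k : R) :
  (@lebesgue_measure R).-integrable `]a, b] (fun _ => k%:E).
Proof.
apply/integrableP; split; first exact: measurable_cst.
have l : (@lebesgue_measure R (`]a, b]%classic : set R) < +oo)%E.
  by rewrite lebesgue_measure_itv/=; case: ifP => _; exact: ltry.
by rewrite integral_cst//; apply: lte_mul_pinfty; rewrite ?lee_fin.
Qed.

Section riemann.
Context (R : realType) (f : R -> R).
Hypothesis right_cont : forall v, 0 <= v -> f q @[q --> v^'+] --> f v.
Hypothesis left_lim : forall v, 0 < v -> cvg (f q @[q --> v^'-]).

Lemma regulated_bounded (t : R) : exists2 M, 0 <= M & forall v, 0 <= v <= t -> `|f v| <= M.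
Proof.
pose Q (M v : R) := 0 <= v <= t -> `|f v| <= M.
have /compact_near_coveringP/(_ R (pinfty_nbhs R) Q) := @segment_compact R 0 t.
case=> [v|M0 [M0r HM]].
  rewrite /= in_itv/= => /andP[v0 vt].
  have [e1 e10 H1] : exists2 e1, 0 < e1 & forall q, v < q -> q < v + e1 -> `|f q| <= `|f v| + 1.
    have /cvgrPdist_le /(_ 1 ltr01) := right_cont v0; rewrite near_withinE => -[e /= e0 He].
    exists e => // q vq qe; have := He q; rewrite /= distrC gtr0_norm ?subr_gt0// ltrBlDl => /(_ qe vq).
    by move=> h; have := ler_distD (f v) 0 (f q); rewrite !sub0r !normrN; lra.
  have [K [e2 [e20 H2]]] : exists K e2, 0 < e2 /\ forall q, 0 <= q -> q < v -> v - e2 < q -> `|f q| <= K.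
    move: v0; rewrite le_eqVlt => /orP[/eqP<-|v0].
      by exists 0, 1; split=> // q q0 q1; have := le_lt_trans q0 q1; rewrite ltxx.
    have /cvg_ex[l /cvgrPdist_le /(_ 1 ltr01)] := left_lim v0; rewrite near_withinE => -[e /= e0 He].
    exists (`|l| + 1), e; split=> // q _ qv qe; have := He q; rewrite /= gtr0_norm ?subr_gt0// => /(_ _ qv) h.
    have h' : `|l - f q| <= 1 by apply: h; lra.
    by have := ler_distD l 0 (f q); rewrite !sub0r !normrN; lra.
  have e0 : 0 < Num.min e1 e2 by rewrite lt_min e10.
  exists ([set q | `|v - q| < Num.min e1 e2], [set M | Num.max (`|f v| + 1) K < M]) => /=.
    split; first by exists (Num.min e1 e2).
    exists (Num.max (`|f v| + 1) K); split => //; exact: num_real.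
  move=> [q M] /= [hq]; rewrite gt_max => /andP[hM1 hM2] /andP[q0 qt].
  move: hq; rewrite lt_min => /andP[hq1 hq2].
  have [qv|vq|->] := ltgtP q v; last by lra.
  - by apply: le_trans (H2 q q0 qv _) (ltW hM2); move: hq2; rewrite gtr0_norm ?subr_gt0//; lra.
  - by apply: le_trans (H1 q vq _) (ltW hM1); move: hq1; rewrite ltr0_norm ?subr_lt0//; lra.
exists (Num.max (M0 + 1) 0); first by rewrite le_max lexx orbT.
move=> v v0t; have := HM (M0 + 1); rewrite ltrDl => /(_ ltr01) h.
by apply: le_trans (h v _ v0t) _; [rewrite /= in_itv/=|rewrite le_max lexx].
Qed.

(** The function equal on each grid cell to the value of f at its right end point, written
    as a combination of indicators of half-lines. *)
Definition step (s t : R) (N : nat) (v : R) :=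
  f s + \sum_(j < N) (grid s t N j < v)%R%:R * (f (grid s t N j.+1) - f (grid s t N j)).

Lemma stepE s t N v : s <= t -> step s t N v = f (grid s t N (below (grid s t N) v N)).
Proof. by move=> st; rewrite /step telescope_below ?grid0 ?subrKC//; exact: grid_homo. Qed.

Lemma step_cvg s t v : 0 <= s -> s < v <= t -> step s t N v @[N --> \oo] --> f v.
Proof.
move=> s0 svt; have /andP[sv vt] := svt; have st := le_trans (ltW sv) vt.
under eq_fun do rewrite stepE//; apply: grid_right_cvg => //.
by apply: right_cont; apply: le_trans s0 (ltW sv).
Qed.

Lemma step_meas s t N D : measurable_fun D (step s t N).
Proof.
apply: measurable_funTS; apply: measurable_funD => //; apply: measurable_sum => j.
apply: measurable_funM => //.
rewrite (_ : (fun v => _) = \1_(`]grid s t N j, +oo[%classic : set R)).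
  by apply: measurable_indic; exact: measurable_itv.
by apply/funext => v; rewrite indicE mem_setE in_itv/= andbT.
Qed.

Lemma step_bound s t N M : 0 <= s -> s <= t -> (forall v, 0 <= v <= t -> `|f v| <= M) ->
  forall v, `|step s t N v| <= M.
Proof.
move=> s0 st HM v; rewrite stepE//; apply: HM; rewrite (le_trans s0)/=; last exact: grid_ge.
by apply: grid_le => //; exact: below_le.
Qed.

Lemma abel_sum (u : nat -> R) (t : R) m :
  f (u 0%N) * (t - u 0%N) + \sum_(j < m) (f (u j.+1) - f (u j)) * (t - u j) =
  \sum_(j < m) f (u j.+1) * (u j.+1 - u j) + f (u m) * (t - u m).
Proof.
elim: m => [|m IH]; first by rewrite !big_ord0 addr0 add0r.
by rewrite !big_ord_recr/= addrA IH; ring.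
Qed.

Lemma step_integral s t N : s < t -> (0 < N)%N ->
  (\int[@lebesgue_measure R]_(v in `]s, t]) (step s t N v)%:E)%E =
  (\sum_(j < N) f (grid s t N j.+1) * ((t - s) / N%:R))%:E.
Proof.
move=> st N0.
have mD : measurable (`]s, t]%classic : set R) by exact: measurable_itv.
have lI a b : a < b -> lebesgue_measure (`]a, b]%classic : set R) = (b - a)%:E.
  by move=> ab; rewrite lebesgue_measure_itv/= lte_fin ab -EFinB.
have lD := lI s t st.
have ind (j : 'I_N) : (\int[@lebesgue_measure R]_(v in `]s, t]) ((grid s t N j < v)%R%:R)%:E)%E = (t - grid s t N j)%:E.
  transitivity (\int[@lebesgue_measure R]_(v in `]s, t]) (\1_(`]grid s t N j, +oo[%classic : set R) v)%:E)%E.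
    by apply: eq_integral => v _; rewrite indicE mem_setE in_itv/= andbT.
  rewrite integral_indic//.
  have -> : `]grid s t N j, +oo[ `&` `]s, t] = `]grid s t N j, t]%classic :> set R.
    apply/seteqP; split=> v /=; rewrite !in_itv/= andbT.
      by move=> [-> /andP[_ ->]].
    by move=> /andP[h ->]; split=> //; rewrite (le_lt_trans _ h)// grid_ge// ltW.
  by apply: lI; exact: grid_lt.
pose I (j : 'I_N) (v : R) : R := (grid s t N j < v)%R%:R.
have int (j : 'I_N) : (@lebesgue_measure R).-integrable `]s, t] (EFin \o I j).
  apply: (le_integrable _ _ _ (integrable_cst_itv s t 1)).
  - exact: measurable_itv.
  - apply/measurable_EFinP; apply: measurable_funTS.
    rewrite (_ : I j = \1_(`]grid s t N j, +oo[%classic : set R)).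
      by apply: measurable_indic; exact: measurable_itv.
    by apply/funext => v; rewrite indicE mem_setE in_itv/= andbT.
  - by move=> v _; rewrite /= normr1 lee_fin ger0_norm// /I; case: (_ < _)%R.
pose g (j : 'I_N) v := (f (grid s t N j.+1) - f (grid s t N j)) * (grid s t N j < v)%R%:R.
have ig j : (@lebesgue_measure R).-integrable `]s, t] (EFin \o g j).
  rewrite (_ : EFin \o g j = (fun v => (f (grid s t N j.+1) - f (grid s t N j))%:E * (EFin \o I j) v)%E).
    by apply: integrableZl; [exact: measurable_itv|exact: int].
  by apply/funext => v.
have ic : (@lebesgue_measure R).-integrable `]s, t] (EFin \o (fun _ => f s)).
  exact: integrable_cst_itv.
pose G l (v : R) : R := \sum_(j <- l) g j v.
have H (l : seq 'I_N) : (@lebesgue_measure R).-integrable `]s, t] (EFin \o G l) /\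
   (\int[@lebesgue_measure R]_(v in `]s, t]) (G l v)%:E)%E =
   (\sum_(j <- l) (f (grid s t N j.+1) - f (grid s t N j)) * (t - grid s t N j))%:E.
  elim: l => [|j l [i1 e1]].
    have E : EFin \o G [::] = cst 0%E by apply/funext => v /=; rewrite /G big_nil.
    split; first by rewrite E; exact: integrable0.
    by rewrite big_nil; under eq_integral do rewrite /G big_nil; rewrite integral0.
  have E v : (G (j :: l) v)%:E = ((EFin \o g j) v + (EFin \o G l) v)%E by rewrite /G big_cons.
  split.
    rewrite (_ : EFin \o G (j :: l) = (EFin \o g j) \+ (EFin \o G l)); last by apply/funext => v; exact: E.
    by apply: integrableD => //; exact: measurable_itv.
  transitivity (\int[@lebesgue_measure R]_(v in `]s, t]) ((EFin \o g j) v + (EFin \o G l) v))%E.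
    by apply: eq_integral => v _; exact: E.
  rewrite integralD//.
  rewrite e1 big_cons EFinD; congr (_ + _)%E.
  transitivity (\int[@lebesgue_measure R]_(v in `]s, t]) ((f (grid s t N j.+1) - f (grid s t N j))%:E * (EFin \o I j) v))%E.
    by apply: eq_integral => v _.
  rewrite integralZl//.
  by rewrite -[X in (_ * X)%E]/((\int[@lebesgue_measure R]_(v in `]s, t]) ((grid s t N j < v)%R%:R)%:E)%E) ind EFinM.
have [i1 e1] := H (index_enum 'I_N).
transitivity (\int[@lebesgue_measure R]_(v in `]s, t]) ((f s)%:E + (G (index_enum 'I_N) v)%:E))%E.
  apply: eq_integral => v _; rewrite -EFinD /step; congr (_ + _)%:E.
  by apply: eq_bigr => j _; rewrite /g mulrC.
rewrite integralD// e1 integral_cst//.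
transitivity ((f s)%:E * (t - s)%:E + (\sum_(j < N) (f (grid s t N j.+1) - f (grid s t N j)) * (t - grid s t N j))%:E)%E.
  by congr (_ * _ + _)%E; exact: lD.
rewrite -EFinM -EFinD; congr EFin.
have := abel_sum (grid s t N) t N; rewrite !grid0 gridN// subrr mulr0 addr0 => ->.
by apply: eq_bigr => j _; rewrite grid_step.
Qed.

(** Step functions sampled at right end points converge pointwise by right-continuity and
    are bounded because f is regulated: dominated convergence. *)
Lemma regulated_riemann (s t : R) : 0 <= s -> s < t ->
  \sum_(j < N) f (grid s t N j.+1) * ((t - s) / N%:R) @[N --> \oo] -->
  \int[@lebesgue_measure R]_(v in `[0, t]) f v - \int[@lebesgue_measure R]_(v in `[0, s]) f v.
Proof.
move=> s0 st.
have key a : 0 <= a -> a < t -> [/\ (@lebesgue_measure R).-integrable `]a, t] (EFin \o f) &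
   \sum_(j < N) f (grid a t N j.+1) * ((t - a) / N%:R) @[N --> \oo] --> \int[@lebesgue_measure R]_(v in `]a, t]) f v].
  move=> a0 at_; have [M M0 HM] := regulated_bounded t.
  have mD : measurable (`]a, t]%classic : set R) by exact: measurable_itv.
  have cv v : (`]a, t]%classic : set R) v -> step a t N v @[N --> \oo] --> f v.
    by rewrite /= in_itv/= => h; exact: step_cvg.
  have mf : measurable_fun (`]a, t]%classic : set R) f.
    by apply: measurable_fun_cvg cv => N; exact: step_meas.
  have ic : (@lebesgue_measure R).-integrable `]a, t] (fun _ => M%:E).
    exact: integrable_cst_itv.
  have [] := @dominated_convergence _ _ _ (@lebesgue_measure R) _ mD (fun N v => (step a t N v)%:E) (EFin \o f) (fun _ => M%:E).
  - by move=> N; apply/measurable_EFinP; exact: step_meas.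
  - exact/measurable_EFinP.
  - by apply: aeW => v Dv; apply: cvg_EFin; [near=> N|exact: cv].
  - exact: ic.
  - by apply: aeW => v N Dv; rewrite lee_fin; apply: step_bound => //; exact: ltW.
  move=> i _ c; split=> //.
  have E : (\int[@lebesgue_measure R]_(v in `]a, t]) (f v)%:E)%E = (\int[@lebesgue_measure R]_(v in `]a, t]) f v)%:E.
    by rewrite /Rintegral fineK//; exact: integrable_fin_num.
  have {}c : (\int[@lebesgue_measure R]_(v in `]a, t]) (step a t N v)%:E)%E @[N --> \oo] --> (\int[@lebesgue_measure R]_(v in `]a, t]) f v)%:E.
    by rewrite -E; exact: c.
  have {}c : (fun N => fine (\int[@lebesgue_measure R]_(v in `]a, t]) (step a t N v)%:E)%E) @ \oo --> \int[@lebesgue_measure R]_(v in `]a, t]) f v .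
    exact: (fine_cvg c).
  apply/cvgrPdist_le => e e0; move/cvgrPdist_le: c => /(_ e e0)[N1 _ H].
  exists (maxn 1 N1) => // N; rewrite /= geq_max => /andP[h1 h2].
  by have := H N h2; rewrite /= step_integral.
have [it _] := key 0 (lexx 0) (le_lt_trans s0 st); have [_ c] := key s s0 st.
have is_ : (@lebesgue_measure R).-integrable `]0, s] (EFin \o f).
  apply: integrableS it; [exact: measurable_itv|exact: measurable_itv|].
  by move=> v /=; rewrite !in_itv/= => /andP[-> h]; rewrite (le_trans h)// ltW.
rewrite -!Rintegral_itv_obnd_cbnd// Rintegral_itvB// bnd_simp//.
exact: ltW.
Unshelve. all: by end_near. Qed.

End riemann.

(** * Riemann sums of a stochastic differential equation *)
Lemma sqr_sum_le (R : realType) (I : finType) (x : I -> R) : (\sum_i x i) ^+ 2 <= #|I|%:R * \sum_i x i ^+ 2.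
Proof.
have E : (\sum_i x i) ^+ 2 = \sum_i \sum_j x i * x j by rewrite expr2 big_distrlr.
have E1 : #|I|%:R * \sum_i x i ^+ 2 = \sum_(i : I) \sum_(j : I) x i ^+ 2.
  rewrite mulr_sumr; apply: eq_bigr => i _; by rewrite sumr_const mulr_natl.
have E2 : #|I|%:R * \sum_i x i ^+ 2 = \sum_(i : I) \sum_(j : I) x j ^+ 2.
  by rewrite sumr_const mulr_natl.
have S : \sum_i \sum_j (x i * x j + x i * x j) <= \sum_i \sum_j (x i ^+ 2 + x j ^+ 2).
  by apply: ler_sum => i _; apply: ler_sum => j _; have := sqr_ge0 (x i - x j); rewrite sqrrB; lra.
have S1 : \sum_i \sum_j (x i * x j + x i * x j) = (\sum_i x i) ^+ 2 + (\sum_i x i) ^+ 2.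
  by rewrite E -big_split; apply: eq_bigr => i _; rewrite -big_split.
have S2 : \sum_i \sum_j (x i ^+ 2 + x j ^+ 2) = #|I|%:R * \sum_i x i ^+ 2 + #|I|%:R * \sum_i x i ^+ 2.
  by rewrite {1}E1 E2 -big_split; apply: eq_bigr => i _; rewrite -big_split.
by move: S; rewrite S1 S2; lra.
Qed.

Lemma cadlag_comp (R : realType) (d : nat) (f : 'cV[R]_d -> R) (y : R -> 'cV[R]_d) : continuous f -> cadlag y ->
  (forall v, 0 <= v -> f (y q) @[q --> v^'+] --> f (y v)) /\
  (forall v, 0 < v -> f (y q) @[q --> v^'-] --> f (left_limit y v)).
Proof.
move=> cf [cr cl]; split=> v v0.
  exact: (cvg_comp _ f (cr v v0) (cf (y v))).
exact: (cvg_comp _ f (cl v v0) (cf (left_limit y v))).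
Qed.

(** The left-limit process psi and the right-continuous process phi have the same right
    limits, so a bound that holds for psi just after v holds for phi at v. *)
Lemma right_limit_bound (R : realType) (phi psi : R -> R) (v rho K dl : R) : 0 <= v -> 0 < rho ->
  phi q @[q --> v^'+] --> phi v ->
  (forall u, 0 < u -> phi q @[q --> u^'-] --> psi u) ->
  (\forall u \near v^'+, u < v + rho -> `|K - psi u| <= dl) -> `|K - phi v| <= dl.
Proof.
move=> v0 rho0 cr cl HK; apply/ler_addgt0Pr => eta eta0.
move/cvgrPdist_le: cr => /(_ eta eta0).
rewrite !near_withinE in HK *; case: HK => e1 /= e10 H1; case=> e2 /= e20 H2.
pose e := Num.min rho (Num.min e1 e2).
have e0 : 0 < e by rewrite !lt_min rho0 e10.
pose u := v + e / 2.
have eE : e / 2 < e by rewrite ltr_pdivrMr// ltr_pMr// ltr1n.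
have h2 : 0 < e / 2 by rewrite divr_gt0.
have vu : v < u by rewrite ltrDl.
have [er [ee1 ee2]] : e <= rho /\ e <= e1 /\ e <= e2.
  by rewrite /e !ge_min !lexx /= !orbT.
have B1 : `|K - psi u| <= dl.
  apply: H1 => //=; last by rewrite /u; lra.
  by rewrite distrC gtr0_norm ?subr_gt0// /u; lra.
have B2 : `|phi v - psi u| <= eta.
  have u0 : 0 < u := le_lt_trans v0 vu.
  have c : `|phi v - phi q| @[q --> u^'-] --> `|phi v - psi u|.
    by apply: cvg_norm; apply: cvgB; [exact: cvg_cst|exact: cl].
  apply: (cvgr_to_le c); rewrite near_withinE; exists (e / 2) => //= q /=; rewrite ltr_norml => /andP[q1 q2] q3.
  apply: H2; last by move: q1 q2 q3; rewrite /u; lra.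
  by rewrite /= distrC gtr0_norm ?subr_gt0; move: q1 q2 q3; rewrite /u; lra.
by have := ler_distD (psi u) K (phi v); rewrite [X in _ <= _ + X]distrC; lra.
Qed.

Lemma cvg_sum_fin (R : realType) (I : Type) (s : seq I) (f : I -> nat -> R) (l : I -> R) :
  (forall i, f i N @[N --> \oo] --> l i) -> \sum_(i <- s) f i N @[N --> \oo] --> \sum_(i <- s) l i.
Proof.
move=> h; elim: s => [|i s IH].
  by rewrite big_nil; under eq_fun do rewrite big_nil; exact: cvg_cst.
by rewrite big_cons; under eq_fun do rewrite big_cons; apply: cvgD.
Qed.

Lemma coord_mx_meas (R : realType) (m n : nat) (i : 'I_m) (j : 'I_n) :
  measurable_fun setT ((fun M : 'M[R]_(m, n) => M i j) : g_sigma_algebraType (@open 'M[R]_(m, n)) -> R).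
Proof.
apply: (measurability _ (RGenOpens.measurableE R)) => _ [_ [a [b ->]] <-].
rewrite setTI; apply: sub_sigma_algebra.
by apply: open_comp; [move=> x _; exact: coord_continuous|exact: interval_open].
Qed.

Section simple_processes.
Context (R : realType) (dO : measure_display) (Om : measurableType dO) (P : probability Om R).
Context (F : R -> set (set Om)) (m n : nat) (H : simple_process R Om m n).
Hypothesis HF : filtration F.
Hypothesis HH : simple_predictable F H.

(** The right limit at v of an entry of the simple process; unlike the process
    itself, it is known at time v. *)
Definition sp_right (v : R) (w : Om) (i : 'I_m) (b : 'I_n) : R :=
  \sum_(l < sp_size H) ((v < sp_time H l.+1 w)%R%:R - (v < sp_time H l w)%R%:R) * sp_val H l w i b.

Lemma sp_eval_right v w i b : \forall u \near v^'+, sp_eval H u w i b = sp_right v w i b.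
Proof.
have [_ ord _] := HH.
have key (tau : R) : \forall u \near v^'+, (tau < u) = (tau <= v).
  have [h|h] := leP tau v.
    by rewrite near_withinE; near=> u => vu; rewrite (le_lt_trans h vu).
  rewrite near_withinE; exists (tau - v) => /=; first by rewrite subr_gt0.
  move=> u /= hu vu; apply/negbTE; rewrite -leNgt; move: hu; rewrite distrC gtr0_norm ?subr_gt0//; lra.
have all_l : \forall u \near v^'+, forall l : 'I_(sp_size H), (sp_time H l w < u) = (sp_time H l w <= v) /\
    (sp_time H l.+1 w < u) = (sp_time H l.+1 w <= v).
  by apply: filter_forall => l; apply: filterI; exact: key.
move: all_l; apply: filterS => u Hu.
rewrite /sp_eval /sp_right summxE; apply: eq_bigr => l _.
have [h1 h2] := Hu l; have o := ord l w (ltn_ord l).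
have -> : (u <= sp_time H l.+1 w) = ~~ (sp_time H l.+1 w < u) by rewrite leNgt.
rewrite h1 h2; case: (leP (sp_time H l w) v) => a1; case: (leP (sp_time H l.+1 w) v) => a2 /=.
- by rewrite mxE subrr mul0r.
- by rewrite subr0 mul1r.
- by have := le_lt_trans (le_trans o a2) a1; rewrite ltxx.
- by rewrite mxE subrr mul0r.
Unshelve. all: by end_near. Qed.

Lemma stopping_meas (tau : Om -> R) v : 0 <= v -> stopping_time F tau ->
  measurable_fun setT ((fun w => (v < tau w)%R%:R) : g_sigma_algebraType (F v) -> R).
Proof.
move=> v0 [_ st]; rewrite (_ : (fun _ => _) = \1_(~` [set w | tau w <= v])).
  by apply: measurable_indic; apply: measurableC; apply: sub_sigma_algebra; exact: st.
apply/funext => w; rewrite indicE; case: (ltP v (tau w)) => h; first by rewrite mem_set//=; apply/negP; rewrite -ltNge.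
by rewrite memNset//= => k; exact: k.
Qed.

(** On the event that T_l <= v, the value H_l, known at time T_l, is known at time v. *)
Lemma sp_right_meas v i b : 0 <= v ->
  measurable_fun setT ((fun w => sp_right v w i b) : g_sigma_algebraType (F v) -> R).
Proof.
move=> v0; have [st ord mv] := HH.
apply: measurable_sum => l.
have st1 := st l (ltnW (ltn_ord l)); have st2 := st l.+1 (ltn_ord l).
pose A := [set w | sp_time H l w <= v].
have FA : F v A by case: st1 => _; apply.
have mA : measurable (A : set (g_sigma_algebraType (F v))) by exact: sub_sigma_algebra.
have mV : measurable_fun (A : set (g_sigma_algebraType (F v))) (fun w => sp_val H l w i b : R).
  move=> _ B mB; apply: sub_sigma_algebra; rewrite setIC.
  have := mv l (ltn_ord l) ((fun M : 'M[R]_(m, n) => M i b) @^-1` B) _.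
  case; last by move=> _; exact.
  by have := @coord_mx_meas R m n i b measurableT B mB; rewrite setTI.
have mVA : measurable_fun setT ((fun w => sp_val H l w i b) \_ A : g_sigma_algebraType (F v) -> R).
  by apply/(measurable_restrictT _ mA).
rewrite (_ : (fun w => _) = (fun w => (v < sp_time H l.+1 w)%R%:R * ((fun w => sp_val H l w i b) \_ A) w)).
  by apply: measurable_funM => //; exact: stopping_meas.
apply/funext => w; rewrite patchE; have o := ord l w (ltn_ord l).
case: (ltP v (sp_time H l w)) => h.
  by rewrite memNset ?mulr0 ?(lt_le_trans h o) ?subrr ?mul0r// /A/= leNgt h.
by rewrite mem_set// subr0.
Qed.

Lemma sp_right_sum_cvg (z : R -> 'cV[R]_n) s t w i : 0 <= s -> s < t ->
  (forall v, 0 <= v -> z q @[q --> v^'+] --> z v) ->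
  \sum_(j < N) \sum_b sp_right (grid s t N j) w i b * (z (grid s t N j.+1) - z (grid s t N j)) b 0 @[N --> \oo]
  --> sp_integral H (fun q _ => z q) t w i 0 - sp_integral H (fun q _ => z q) s w i 0.
Proof.
move=> s0 st cz; have [stp ord _] := HH.
pose S tau b N := \sum_(j < N) (grid s t N j < tau)%R%:R * (z (grid s t N j.+1) b 0 - z (grid s t N j) b 0).
have ES N : \sum_(j < N) \sum_b sp_right (grid s t N j) w i b * (z (grid s t N j.+1) - z (grid s t N j)) b 0 =
   \sum_(l < sp_size H) \sum_b sp_val H l w i b * (S (sp_time H l.+1 w) b N - S (sp_time H l w) b N).
  rewrite (eq_bigr (fun j : 'I_N => \sum_(l < sp_size H) \sum_b sp_val H l w i b *
     (((grid s t N j < sp_time H l.+1 w)%R%:R - (grid s t N j < sp_time H l w)%R%:R) * (z (grid s t N j.+1) b 0 - z (grid s t N j) b 0)))); last first.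
    move=> j _; rewrite exchange_big/=; apply: eq_bigr => b _; rewrite /sp_right mulr_suml.
    by apply: eq_bigr => l _; rewrite !mxE; ring.
  rewrite exchange_big/=; apply: eq_bigr => l _; rewrite exchange_big/=; apply: eq_bigr => b _.
  rewrite -mulr_sumr -sumrB; congr (_ * _); apply: eq_bigr => j _; ring.
under eq_fun do rewrite ES.
have -> : sp_integral H (fun q _ => z q) t w i 0 - sp_integral H (fun q _ => z q) s w i 0 =
  \sum_(l < sp_size H) \sum_b sp_val H l w i b * ((z (Num.min t (sp_time H l.+1 w)) b 0 - z (Num.min s (sp_time H l.+1 w)) b 0) -
      (z (Num.min t (sp_time H l w)) b 0 - z (Num.min s (sp_time H l w)) b 0)).
  rewrite /sp_integral !summxE -sumrB; apply: eq_bigr => l _; rewrite !mxE -sumrB; apply: eq_bigr => b _.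
  by rewrite !mxE; ring.
have cS l b : (l <= sp_size H)%N -> S (sp_time H l w) b N @[N --> \oo] -->
    z (Num.min t (sp_time H l w)) b 0 - z (Num.min s (sp_time H l w)) b 0.
  move=> ln; apply: (@stopped_sum_cvg R (fun q => z q b 0)) => //; first by case: (stp l ln).
  by move=> v v0; apply: (cvg_comp _ (fun M : 'cV[R]_n => M b 0) (cz v v0)); exact: coord_continuous.
apply: cvg_sum_fin => l; apply: cvg_sum_fin => b; apply: cvgM; first exact: cvg_cst.
by apply: cvgB; apply: cS => //; exact: ltnW.
Qed.

End simple_processes.

Section sde_riemann.
Context (R : realType) (dO : measure_display) (Om : measurableType dO) (P : probability Om R).
Local Notation Er := (Er P).
Local Notation Lone := (Lone P).
Local Notation Ltwo := (Ltwo P).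
Context (F : R -> set (set Om)) (d r : nat) (Z : R -> Om -> 'cV[R]_r) (X : R -> Om -> 'cV[R]_d).
Context (a : 'cV[R]_d -> 'cV[R]_d) (c : 'cV[R]_d -> 'M[R]_(d, r)).
Hypothesis HF : filtration F.
Hypothesis HZ : levy_process P F Z.
Hypothesis HM : moment_condition P (Z 1).
Hypothesis ca : forall i, continuous (fun x => a x i 0).
Hypothesis cc : forall i b, continuous (fun x => c x i b).
Hypothesis HX : sde_solution P F a c Z X.

Lemma drift_meas i : measurable_fun setT ((fun x => a x i 0) : borel_vec R d -> R).
Proof. by apply: cont_meas; exact: ca. Qed.

Lemma diff_meas i b : measurable_fun setT ((fun x => c x i b) : borel_vec R d -> R).
Proof. by apply: cont_meas; exact: cc. Qed.

Lemma sde_meas t : 0 <= t -> measurable_fun setT (X t : g_sigma_algebraType (F t) -> borel_vec R d).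
Proof.
move=> t0; have [aX _ _] := HX; apply: measurable_wrt_fun; last exact: aX.
by case: (filtration_subsigma HF t0).
Qed.

Lemma sde_meas0 t : 0 <= t -> measurable_fun setT (X t : Om -> borel_vec R d).
Proof.
move=> t0 _ B mB; have [sg gm] := filtration_subsigma HF t0; apply: gm.
by rewrite -(sigma_algebra_id sg); exact: sde_meas.
Qed.

(** Sums of adapted coefficients against the increments of the Levy process along a grid
    are martingales: [orthogonal_sum] applies for each coordinate. This is the
    discrete form of the isometry of stochastic integrals. *)
Lemma levy_sum_Ltwo s t N (xi : nat -> Om -> 'I_r -> R) (k : R) : 0 <= s -> s < t -> (0 < N)%N ->
  t - s <= N%:R -> 0 <= k ->
  (forall j b, (j < N)%N -> [/\ measurable_fun setT ((fun w => xi j w b) : g_sigma_algebraType (F (grid s t N j)) -> R),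
     Ltwo (fun w => xi j w b) & Er (fun w => xi j w b ^+ 2) <= k]) ->
  Ltwo (fun w => \sum_(j < N) \sum_b xi j w b * (Z (grid s t N j.+1) w - Z (grid s t N j) w) b 0) /\
  Er (fun w => (\sum_(j < N) \sum_b xi j w b * (Z (grid s t N j.+1) w - Z (grid s t N j) w) b 0) ^+ 2)
    <= r%:R ^+ 2 * (t - s) * k.
Proof.
move=> s0 st N0 tsN k0 Hxi; have [C C0 HC] := levy_incr_moments HF HZ HM.
have NR : 0 < N%:R :> R by rewrite ltr0n.
have u0 j : 0 <= grid s t N j by apply: le_trans s0 _; exact: grid_ge (ltW st).
have us j : grid s t N j < grid s t N j.+1 by rewrite -subr_gt0 grid_step divr_gt0// subr_gt0.
have u1 j : grid s t N j.+1 <= grid s t N j + 1.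
  by rewrite -lerBlDl grid_step ler_pdivrMr// mul1r.
have kN0 : 0 <= (t - s) / N%:R by rewrite divr_ge0 ?subr_ge0// ltW.
pose Sb b w := \sum_(j < N) xi j w b * (Z (grid s t N j.+1) w - Z (grid s t N j) w) b 0.
have Hb b : Ltwo (Sb b) /\ Er (fun w => Sb b w ^+ 2) <= N%:R * ((t - s) / N%:R * k).
  apply: (@orthogonal_sum _ _ _ P r (fun j => F (grid s t N j)) (fun j w => Z (grid s t N j.+1) w - Z (grid s t N j) w)
     (fun z => z b 0) (fun j w => xi j w b) N ((t - s) / N%:R) k) => //.
  - by move=> j _; exact: filtration_subsigma.
  - by move=> j _; exact: (filtration_le HF (u0 j) (ltW (us j))).
  - by move=> j _; exact: (levy_incr_meas HF HZ (u0 j) (ltW (us j))).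
  - by move=> j _; exact: (levy_incr_indep HZ (u0 j) (ltW (us j))).
  - exact: coord_meas.
  - move=> j _; have [H1 H2] := HC _ _ (u0 j) (us j) (u1 j); have [l4 e1 _] := H1 b.
    have mY : measurable_fun setT (fun w => (Z (grid s t N j.+1) w - Z (grid s t N j) w) b 0).
      have h0 := le_trans (u0 j) (ltW (us j)).
      exact: (measurableT_comp (coord_meas b) (sub_meas_vec HF h0 (levy_incr_meas HF HZ (u0 j) (ltW (us j))))).
    split=> //.
      split=> //; exact: (@Lone_pow4 R dO Om P (fun w => (Z (grid s t N j.+1) w - Z (grid s t N j) w) b 0) 2 isT mY l4).
    by have := H2 b b; rewrite eqxx mulr1 grid_step => <-; rewrite le_eqVlt; apply/orP; left; apply/eqP.
  - by move=> j jN; exact: Hxi.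
have E w : \sum_(j < N) \sum_b xi j w b * (Z (grid s t N j.+1) w - Z (grid s t N j) w) b 0 = \sum_b Sb b w.
  by rewrite exchange_big.
have tS : Ltwo (fun w => \sum_b Sb b w) by apply: Ltwo_sum => b; case: (Hb b).
rewrite (_ : (fun w => \sum_(j < N) _) = (fun w => \sum_b Sb b w)); last by apply/funext => w; exact: E.
split=> //; rewrite (@Er_eq _ _ _ _ _ (fun w => (\sum_b Sb b w) ^+ 2)); last by move=> w; rewrite E.
have lS2 b : Lone (fun w => Sb b w ^+ 2) by case: (Hb b) => -[].
apply: (@le_trans _ _ (Er (fun w => r%:R * \sum_b Sb b w ^+ 2))).
  apply: Er_le; [by case: tS|by apply: LoneZ; exact: Lone_sum|move=> w].
  by have := @sqr_sum_le R 'I_r (fun b => Sb b w); rewrite card_ord.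
rewrite ErZ; last exact: Lone_sum.
rewrite Er_sum// expr2 -!mulrA ler_wpM2l//.
have -> : r%:R * ((t - s) * k) = \sum_(b < r) N%:R * ((t - s) / N%:R * k).
  by rewrite sumr_const card_ord -mulr_natl; field; rewrite gt_eqF.
by apply: ler_sum => b _; case: (Hb b).
Qed.

Definition clip (dl x : R) : R := Num.max (- dl) (Num.min x dl).

Lemma clip_bound dl x : 0 <= dl -> `|clip dl x| <= dl.
Proof.
by move=> d0; rewrite ler_norml /clip le_max lexx/= ge_max ge_min lexx orbT andbT; lra.
Qed.

Lemma clip_id dl x : `|x| <= dl -> clip dl x = x.
Proof. by rewrite ler_norml /clip => /andP[h1 h2]; rewrite min_l// max_r. Qed.

Lemma four_errors (e q1 q2 q3 q4 q5 q6 : R) : `|q1 - q2| <= e / 4 -> `|q2 - (q3 - q4)| <= e / 8 ->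
  `|q3 - q5| <= e / 8 -> `|q4 - q6| <= e / 8 -> `|q1 - (q5 - q6)| <= e.
Proof.
clear; rewrite !ler_norml => /andP[? ?] /andP[? ?] /andP[? ?] /andP[? ?]; apply/andP; split; lra.
Qed.

(** Choose one simple process H close to the integrand, uniformly in time, outside a
    small event. Its integral is close to I, and is the limit of its own
    Riemann sums by [sp_right_sum_cvg]. At grid points the right limits of H
    are close to c(X), so the two Riemann sums differ by a martingale sum with
    small coefficients, small by [levy_sum_Ltwo]. *)
Lemma integral_riemann (I : R -> Om -> 'cV[R]_d) s t i : 0 <= s -> s < t ->
  stochastic_integral P F Z (fun t w => c (left_limit (X ^~ w) t)) I ->
  {ae P, forall w, I 0 w = 0} ->
  pcvg P (fun N w => \sum_(j < N) \sum_b c (X (grid s t N j) w) i b * (Z (grid s t N j.+1) w - Z (grid s t N j) w) b 0)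
    (fun w => I t w i 0 - I s w i 0).
Proof.
move=> s0 st [[Hk [predk ucpk]] /(_ Hk predk ucpk) ucpI] I0 e e0.
have t0 : 0 < t := le_lt_trans s0 st.
pose D := r%:R ^+ 2 * (t - s) + 1 : R.
have D0 : 0 < D by rewrite ltr_wpDl// mulr_ge0 ?sqr_ge0// subr_ge0 ltW.
have e8 : 0 < e / 8 by rewrite divr_gt0.
have e4 : 0 < e / 4 by rewrite divr_gt0.
pose dl := Num.min 1 ((e / 4) ^+ 3 / D).
have dl0 : 0 < dl by rewrite lt_min ltr01 divr_gt0// exprn_gt0.
have dl1 : dl <= 1 by rewrite /dl ge_min lexx.
have dlD : dl ^+ 2 * D <= (e / 4) ^+ 3.
  apply: (@le_trans _ _ (dl * D)); first by apply: ler_wpM2r; [exact: ltW|rewrite expr2 ler_piMl// ltW].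
  by rewrite -ler_pdivlMr// /dl ge_min lexx orbT.
have e8E : (0 < (e / 8)%:E)%E by rewrite lte_fin.
have [k1 _ Hk1] := ucpk t dl t0 dl0 _ (open_ereal_lt' e8E).
have [k2 _ Hk2] := ucpI t (e / 8) t0 e8 _ (open_ereal_lt' e8E).
pose k := maxn k1 k2.
have [B1 [mB1 sB1 PB1]] := ext_cover (Hk1 k (leq_maxl k1 k2)).
have [B2 [mB2 sB2 PB2]] := ext_cover (Hk2 k (leq_maxr k1 k2)).
pose H := Hk k; have HH := predk k.
have [_ cdX _] := HX; have [_ cdZ _ _ _] := HZ.
have [B0 [mB0 PB0 HB0]] : {ae P, forall w, [/\ cadlag (X ^~ w), cadlag (Z ^~ w) & I 0 w = 0]}.
  by move: cdX cdZ I0; apply: filterS3 => w h1 [_ h2] h3.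
have {}HB0 w : ~ B0 w -> [/\ cadlag (X ^~ w), cadlag (Z ^~ w) & I 0 w = 0].
  by move=> Bw; apply: contrapT => h; apply: Bw; exact: HB0.
have mZc q : 0 <= q -> forall b, measurable_fun setT (fun w => Z q w b 0).
  by move=> q0 b; exact: (measurableT_comp (coord_meas b) (sub_meas_vec HF q0 (levy_adapted_meas HF HZ q0))).
have u0 N j : 0 <= grid s t N j by apply: le_trans s0 _; exact: grid_ge (ltW st).
have mH N (j : nat) b : measurable_fun setT ((fun w => sp_right H (grid s t N j) w i b) : g_sigma_algebraType (F (grid s t N j)) -> R).
  exact: (sp_right_meas HH _ _ (u0 N j)).
have mH0 N (j : nat) b : measurable_fun setT (fun w => sp_right H (grid s t N j) w i b).
  by have [sg gm] := filtration_subsigma HF (u0 N j); exact: (sub_meas sg gm (mH N j b)).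
have mDZ N (j : nat) b : measurable_fun setT (fun w => (Z (grid s t N j.+1) w - Z (grid s t N j) w) b 0).
  rewrite (_ : (fun _ => _) = fun w => Z (grid s t N j.+1) w b 0 - Z (grid s t N j) w b 0).
    by apply: measurable_funB; exact: mZc.
  by apply/funext => w; rewrite !mxE.
(* H is fixed here, so that the mesh can be refined afterwards. *)
have RN : pcvg P (fun N w => \sum_(j < N) \sum_b sp_right H (grid s t N j) w i b * (Z (grid s t N j.+1) w - Z (grid s t N j) w) b 0)
    (fun w => sp_integral H Z t w i 0 - sp_integral H Z s w i 0).
  apply: ae_pcvg.
    by move=> N; apply: measurable_sum => j; apply: measurable_sum => b; apply: measurable_funM.
  exists B0; split=> // w /= h; apply: contrapT => /HB0[_ [cZ _] _]; apply: h.
  exact: (@sp_right_sum_cvg R dO Om F d r H HH (Z ^~ w) s t w i s0 st cZ).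
have [N1 HN1] := RN _ e8.
exists (maxn N1 (Num.bound (t - s)).+1) => N; rewrite geq_max => /andP[hN1 hN2].
have [B3 [mB3 PB3 HB3]] := HN1 N hN1.
have N0 : (0 < N)%N by exact: leq_ltn_trans hN2.
have tsN : t - s <= N%:R.
  apply: ltW; apply: lt_le_trans (archi_boundP _) _; first by rewrite subr_ge0 ltW.
  by rewrite ler_nat ltnW.
(* The coefficients are small only outside an exceptional event; clipping makes
   them small everywhere and does not change them outside that event. *)
pose xi (j : nat) w b := clip dl (c (X (grid s t N j) w) i b - sp_right H (grid s t N j) w i b).
have mxi j b : measurable_fun setT ((fun w => xi j w b) : g_sigma_algebraType (F (grid s t N j)) -> R).
  apply: measurable_maxr => //; apply: measurable_minr => //; apply: measurable_funB; last exact: mH.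
  exact: (measurableT_comp (diff_meas i b) (sde_meas (u0 N j))).
have txi j b : Ltwo (fun w => xi j w b).
  have [sg gm] := filtration_subsigma HF (u0 N j); have m0 := sub_meas sg gm (mxi j b).
  split=> //; apply: (Lone_le _ (Lone_cst P (dl ^+ 2))); first exact: measurable_funX.
  by move=> w; rewrite normrX lerXn2r ?nnegrE// ?(ltW dl0)//; apply: clip_bound; exact: ltW.
have exi j b : Er (fun w => xi j w b ^+ 2) <= dl ^+ 2.
  rewrite -[leRHS](Er_cst P); apply: Er_le; [exact: (txi j b).2|exact: Lone_cst|move=> w].
  rewrite -[leLHS]real_normK ?num_real// lerXn2r ?nnegrE// ?(ltW dl0)//; apply: clip_bound; exact: ltW.
have Hxi j b : (j < N)%N -> [/\ measurable_fun setT ((fun w => xi j w b) : g_sigma_algebraType (F (grid s t N j)) -> R),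
     Ltwo (fun w => xi j w b) & Er (fun w => xi j w b ^+ 2) <= dl ^+ 2] by [].
have [tS eS] := levy_sum_Ltwo s0 st N0 tsN (sqr_ge0 dl) Hxi.
set S := (fun w => \sum_(j < N) _) in tS eS.
pose B4 := [set w | (e / 4) ^+ 2 <= S w ^+ 2].
have mB4 : measurable B4 by apply: meas_ge; exact: Lone_meas tS.2.
have PB4 : (P B4 <= (e / 4)%:E)%E.
  apply: le_trans (Er_chebyshev tS.2 _ _) _ => [w||]; [exact: sqr_ge0|by rewrite exprn_gt0|].
  rewrite lee_fin ler_pdivrMr ?exprn_gt0//; apply: le_trans eS _; rewrite -exprS.
  apply: le_trans dlD; rewrite mulrC ler_wpM2l ?sqr_ge0// /D lerDl//.
exists (B0 `|` (B1 `|` (B2 `|` (B3 `|` B4)))); split.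
- by do 4 (apply: measurableU => //).
- have PB0' : (P B0 <= 0)%E by move/eqP: PB0; rewrite eq_le => /andP[h _]; exact: h.
  have U A B x y : measurable A -> measurable B -> (P A <= x%:E)%E -> (P B <= y%:E)%E -> (P (A `|` B) <= (x + y)%:E)%E.
    by move=> mA mB hA hB; apply: le_trans (measureU2 _ _ _) _ => //; rewrite EFinD; exact: leeD.
  have m34 := measurableU _ _ mB3 mB4; have m234 := measurableU _ _ mB2 m34; have m1234 := measurableU _ _ mB1 m234.
  have := U _ _ _ _ mB0 m1234 PB0' (U _ _ _ _ mB1 m234 PB1 (U _ _ _ _ mB2 m34 PB2 (U _ _ _ _ mB3 mB4 PB3 PB4))).
  by move=> h; apply: le_trans h _; rewrite lee_fin; lra.
move=> w /not_orP[w0 /not_orP[w1 /not_orP[w2 /not_orP[w3 w4]]]].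
have [cX cZ I0w] := HB0 w w0.
have bdH u : 0 < u -> u <= t -> enorm (sp_eval H u w - c (left_limit (X ^~ w) u)) <= dl.
  by move=> u0' ut; rewrite leNgt; apply/negP => h; apply: w1; apply: sB1; exists u => //; rewrite u0'.
have bdI u : 0 < u -> u <= t -> enorm (sp_integral H Z u w - I u w) <= e / 8.
  by move=> u0' ut; rewrite leNgt; apply/negP => h; apply: w2; apply: sB2; exists u => //; rewrite u0'.
have It : `|sp_integral H Z t w i 0 - I t w i 0| <= e / 8.
  have := bdI t t0 (lexx t); apply: le_trans; have := coord_le_enorm (sp_integral H Z t w - I t w) i 0.
  by rewrite !mxE.
have Is : `|sp_integral H Z s w i 0 - I s w i 0| <= e / 8.
  move: s0; rewrite le_eqVlt => /orP[/eqP<-|s0'].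
    rewrite I0w /sp_integral summxE big1 ?mxE ?subrr ?normr0 ?ltW// => l _.
    have [st' _ _] := HH.
    rewrite !min_l; [|by case: (st' l (ltnW (ltn_ord l)))|by case: (st' l.+1 (ltn_ord l))].
    by rewrite subrr mulmx0 mxE.
  have := bdI s s0' (ltW st); apply: le_trans; have := coord_le_enorm (sp_integral H Z s w - I s w) i 0.
  by rewrite !mxE.
have diff j b : (j < N)%N -> `|c (X (grid s t N j) w) i b - sp_right H (grid s t N j) w i b| <= dl.
  move=> jN; have [crb clb] := cadlag_comp (@cc i b) cX; rewrite distrC.
  have gt := grid_lt st jN.
  apply: (@right_limit_bound R (fun u => c (X u w) i b) (fun u => c (left_limit (X ^~ w) u) i b)
     (grid s t N j) (t - grid s t N j)) => //; first by rewrite subr_gt0.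
    exact: crb.
  have := sp_eval_right HH (grid s t N j) w i b; rewrite !near_withinE; apply: filterS => u h vu ut.
  rewrite -h//; have u0' : 0 < u by exact: le_lt_trans (u0 N j) vu.
  have := bdH u u0' _; move: ut; rewrite subrKC => /ltW ut /(_ ut); apply: le_trans.
  by have := coord_le_enorm (sp_eval H u w - c (left_limit (X ^~ w) u)) i b; rewrite !mxE.
have Sw : `|S w| <= e / 4.
  rewrite leNgt; apply/negP => h; apply: w4; rewrite /B4 /= -[leRHS]real_normK ?num_real//.
  by rewrite lerXn2r ?nnegrE// ltW.
have R3 := HB3 w w3.
have SE : S w = \sum_(j < N) \sum_b c (X (grid s t N j) w) i b * (Z (grid s t N j.+1) w - Z (grid s t N j) w) b 0 -
   \sum_(j < N) \sum_b sp_right H (grid s t N j) w i b * (Z (grid s t N j.+1) w - Z (grid s t N j) w) b 0.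
  rewrite /S -sumrB; apply: eq_bigr => j _; rewrite -sumrB; apply: eq_bigr => b _.
  by rewrite /xi clip_id ?diff// mulrBl.
by apply: four_errors R3 It Is; rewrite -SE.
Qed.

(** All moment bounds on the increments of X are first proved for these sums, in which the
    randomness enters through finitely many increments, and then carried to the
    limit by [pcvg_Ltwo]. The drift is sampled at right end points because the
    path is right-continuous. *)
Lemma sde_riemann s t i : 0 <= s -> s < t ->
  pcvg P (fun N w => \sum_(j < N) a (X (grid s t N j.+1) w) i 0 * ((t - s) / N%:R) +
    \sum_(j < N) \sum_b c (X (grid s t N j) w) i b * (Z (grid s t N j.+1) w - Z (grid s t N j) w) b 0)
    (fun w => X t w i 0 - X s w i 0).
Proof.
move=> s0 st; have [_ cdX [I HI eqX]] := HX.
have I0 : {ae P, forall w, I 0 w = 0}.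
  move: eqX; apply: filterS => w /(_ 0 (lexx 0)) h; apply/matrixP => k j; rewrite (ord1 j) mxE.
  have := congr1 (fun M : 'cV[R]_d => M k 0) h; rewrite !mxE set_itv1 /Rintegral integral_set1/=.
  lra.
have hI := integral_riemann i s0 st HI I0.
pose dr w := \int[@lebesgue_measure R]_(v in `[0, t]) (a (X v w) i 0) - \int[@lebesgue_measure R]_(v in `[0, s]) (a (X v w) i 0).
have u0 N j : 0 <= grid s t N j by apply: le_trans s0 _; exact: grid_ge (ltW st).
have hdr : pcvg P (fun N w => \sum_(j < N) a (X (grid s t N j.+1) w) i 0 * ((t - s) / N%:R)) dr.
  apply: ae_pcvg.
    move=> N; apply: measurable_sum => j; apply: measurable_funM => //.
    exact: (measurableT_comp (drift_meas i) (sde_meas0 (u0 N j.+1))).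
  move: cdX; apply: filterS => w cX; have [cr cl] := cadlag_comp (@ca i) cX.
  apply: (@regulated_riemann R (fun v => a (X v w) i 0)) => // v v0.
  by apply/cvg_ex; eexists; exact: (cl v v0).
have := pcvgD hdr hI => H e e0; have [N0 HN] := H (e) e0; exists N0 => N N0N.
have [B [mB PB hB]] := HN N N0N.
have [B0 [mB0 PB0 HB0]] := eqX.
exists (B0 `|` B); split; first exact: measurableU.
  apply: le_trans (measureU2 _ _ _) _ => //.
  rewrite -[leRHS]add0e; apply: leeD => //.
  by move/eqP: PB0; rewrite eq_le => /andP[h _]; exact: h.
move=> w /not_orP[w0 w1]; have := hB w w1; congr (`|_ - _| <= _).
have E : forall q, 0 <= q -> X q w = X 0 w + \col_i0 (\int[@lebesgue_measure R]_(v in `[0, q]) (a (X v w) i0 0)) + I q w.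
  by apply: contrapT => h; apply: w0; apply: HB0.
by rewrite (E t (le_trans s0 (ltW st))) (E s s0) !mxE /dr; ring.
Qed.

End sde_riemann.

(** * Moments of the increments *)
Section moments.
Context (R : realType) (dO : measure_display) (Om : measurableType dO) (P : probability Om R).
Local Notation Er := (Er P).
Local Notation Lone := (Lone P).
Local Notation Ltwo := (Ltwo P).
Context (F : R -> set (set Om)) (d r : nat) (Z : R -> Om -> 'cV[R]_r) (X : R -> Om -> 'cV[R]_d).
Context (a : 'cV[R]_d -> 'cV[R]_d) (c : 'cV[R]_d -> 'M[R]_(d, r)) (L : R).
Hypothesis HF : filtration F.
Hypothesis HZ : levy_process P F Z.
Hypothesis HM : moment_condition P (Z 1).
Hypothesis L0 : 0 <= L.
Hypothesis La : forall i x y, `|a x i 0 - a y i 0| <= L * enorm (x - y).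
Hypothesis Lc : forall i b x y, `|c x i b - c y i b| <= L * enorm (x - y).
Hypothesis HX : sde_solution P F a c Z X.
Hypothesis HXm : forall q : R, 0 < q -> exists M : R, forall t, 0 <= t ->
  ('E_P[(fun w => enorm (X t w) `^ q)%R] <= M%:E)%E.

Let ca i : continuous (fun x => a x i 0).
Proof. by apply: lipschitz_continuous => x y; exact: La. Qed.

Let cc i b : continuous (fun x => c x i b).
Proof. by apply: lipschitz_continuous => x y; exact: Lc. Qed.

Let mX t : 0 <= t -> measurable_fun setT (X t : g_sigma_algebraType (F t) -> borel_vec R d) :=
  sde_meas HF HX (t := t).
Let mX0 t : 0 <= t -> measurable_fun setT (X t : Om -> borel_vec R d) := sde_meas0 HF HX (t := t).

Lemma wt_meas m : measurable_fun setT ((fun x => wt x ^+ m) : borel_vec R d -> R).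
Proof. by apply: measurable_funX; apply: measurable_funD => //; exact: enorm_meas. Qed.

Lemma wtX_ge0 m (x : 'cV[R]_d) : 0 <= wt x ^+ m.
Proof. by rewrite exprn_ge0// (le_trans ler01)// wt_ge1. Qed.

(* The exponent m + 1 is positive also for m = 0, as bounds on moments of order
   q > 0 require. *)
Lemma wt_le m (x : 'cV[R]_d) : wt x ^+ m <= 2 ^+ m.+1 * (1 + enorm x ^+ m.+1).
Proof.
apply: (@le_trans _ _ (wt x ^+ m.+1)); first by rewrite ler_weXn2l// wt_ge1.
rewrite /wt; set y := enorm _; have y0 : 0 <= y by exact: sqrtr_ge0.
have [y1|y1] := leP y 1.
  apply: (@le_trans _ _ (2 ^+ m.+1)); first by rewrite lerXn2r ?nnegrE ?addr_ge0//; lra.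
  by rewrite ler_peMr ?exprn_ge0// lerDl exprn_ge0.
apply: (@le_trans _ _ ((2 * y) ^+ m.+1)); first by rewrite lerXn2r ?nnegrE ?addr_ge0 ?mulr_ge0//; lra.
by rewrite exprMn ler_wpM2l ?exprn_ge0// lerDr.
Qed.

Lemma wt_moments m : exists2 K, 0 <= K & forall t, 0 <= t ->
  Lone (fun w => wt (X t w) ^+ m) /\ Er (fun w => wt (X t w) ^+ m) <= K.
Proof.
have [M HM'] := HXm (ltr0Sn R m).
exists (2 ^+ m.+1 * (1 + `|M|)); first by rewrite mulr_ge0// ?exprn_ge0// addr_ge0.
move=> t t0; have mt := mX0 t0.
have mw : measurable_fun setT (fun w => wt (X t w) ^+ m) by exact: (measurableT_comp (wt_meas m) mt).
have me : measurable_fun setT (fun w => enorm (X t w) ^+ m.+1).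
  by apply: measurable_funX; exact: (measurableT_comp (@enorm_meas R d) mt).
have := HM' t t0; rewrite unlock => HMt.
have [le ee] : Lone (fun w => enorm (X t w) ^+ m.+1) /\ Er (fun w => enorm (X t w) ^+ m.+1) <= M.
  apply: ge0_Lone_le => //; first by move=> w; rewrite exprn_ge0// sqrtr_ge0.
  apply: le_trans HMt; rewrite le_eqVlt; apply/orP; left; apply/eqP.
  by apply: eq_integral => w _; rewrite powR_mulrn// sqrtr_ge0.
have lb := LoneZ (2 ^+ m.+1) (LoneD (Lone_cst P 1) le).
have bd w : wt (X t w) ^+ m <= 2 ^+ m.+1 * (1 + enorm (X t w) ^+ m.+1) := wt_le m _.
have lw : Lone (fun w => wt (X t w) ^+ m).
  by apply: (Lone_le mw lb) => w; rewrite ger0_norm ?wtX_ge0.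
split=> //; apply: le_trans (Er_le lw lb bd) _.
rewrite (ErZ _ (LoneD (Lone_cst P 1) le)) (ErD (Lone_cst P 1) le) Er_cst ler_wpM2l ?exprn_ge0//.
by rewrite lerD2l (le_trans ee)// ler_norm.
Qed.

Lemma wt_prod_moments p q : exists2 K, 0 <= K & forall s t, 0 <= s -> 0 <= t ->
  Lone (fun w => wt (X s w) ^+ p * wt (X t w) ^+ q) /\
  Er (fun w => wt (X s w) ^+ p * wt (X t w) ^+ q) <= K.
Proof.
have [K1 K10 H1] := wt_moments (p * 2); have [K2 K20 H2] := wt_moments (q * 2).
exists (K1 + K2); first exact: addr_ge0.
move=> s t s0 t0; have [l1 e1] := H1 s s0; have [l2 e2] := H2 t t0.
have lb := LoneD l1 l2.
have bd w : wt (X s w) ^+ p * wt (X t w) ^+ q <= wt (X s w) ^+ (p * 2) + wt (X t w) ^+ (q * 2).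
  rewrite !exprM; move: (wt (X s w) ^+ p) (wt (X t w) ^+ q) => x y.
  have := sqr_ge0 (x - y); have := sqr_ge0 x; have := sqr_ge0 y; rewrite sqrrB; lra.
have l : Lone (fun w => wt (X s w) ^+ p * wt (X t w) ^+ q).
  apply: (Lone_le _ lb) => [|w]; last by rewrite ger0_norm// mulr_ge0// wtX_ge0.
  apply: measurable_funM; first exact: (measurableT_comp (wt_meas p) (mX0 s0)).
  exact: (measurableT_comp (wt_meas q) (mX0 t0)).
by split=> //; apply: le_trans (Er_le l lb bd) _; rewrite ErD// lerD.
Qed.

Lemma growth_Ltwo (f g : 'cV[R]_d -> R) K p q : 0 <= K ->
  measurable_fun setT (f : borel_vec R d -> R) -> measurable_fun setT (g : borel_vec R d -> R) ->
  (forall x, `|f x| <= K * wt x ^+ p) -> (forall x, `|g x| <= K * wt x ^+ q) ->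
  exists2 B, 0 <= B & forall s t, 0 <= s -> 0 <= t ->
    Ltwo (fun w => f (X s w) * g (X t w)) /\ Er (fun w => (f (X s w) * g (X t w)) ^+ 2) <= B.
Proof.
move=> K0 mf mg bf bg; have [B0 B00 HB] := wt_prod_moments (p * 2) (q * 2).
exists (K ^+ 4 * B0); first by rewrite mulr_ge0// exprn_ge0.
move=> s t s0 t0; have [l e] := HB s t s0 t0.
have mfg : measurable_fun setT (fun w => f (X s w) * g (X t w)).
  apply: measurable_funM; first exact: (measurableT_comp mf (mX0 s0)).
  exact: (measurableT_comp mg (mX0 t0)).
have bd w : (f (X s w) * g (X t w)) ^+ 2 <= K ^+ 4 * (wt (X s w) ^+ (p * 2) * wt (X t w) ^+ (q * 2)).
  rewrite -[leLHS]real_normK ?num_real// normrM.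
  have -> : K ^+ 4 * (wt (X s w) ^+ (p * 2) * wt (X t w) ^+ (q * 2)) =
     ((K * wt (X s w) ^+ p) * (K * wt (X t w) ^+ q)) ^+ 2 by rewrite !exprM; ring.
  by rewrite lerXn2r ?nnegrE ?mulr_ge0 ?wtX_ge0// ler_pM.
have l2 : Lone (fun w => (f (X s w) * g (X t w)) ^+ 2).
  apply: (Lone_le _ (LoneZ (K ^+ 4) l)); first exact: measurable_funX.
  by move=> w; rewrite ger0_norm ?sqr_ge0.
split=> //; apply: le_trans (Er_le l2 (LoneZ (K ^+ 4) l) bd) _.
by rewrite ErZ// ler_wpM2l// exprn_ge0.
Qed.

Lemma sum_Ltwo_bound N (g : nat -> Om -> R) (dt K : R) :
  (forall j, (j < N)%N -> Ltwo (g j) /\ Er (fun w => g j w ^+ 2) <= K) ->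
  Ltwo (fun w => \sum_(j < N) g j w * dt) /\
  Er (fun w => (\sum_(j < N) g j w * dt) ^+ 2) <= (N%:R * dt) ^+ 2 * K.
Proof.
move=> H.
have tg (j : 'I_N) : Ltwo (fun w => g j w * dt).
  have [[m l] _] := H j (ltn_ord j); split; first exact: measurable_funM.
  have := LoneZ (dt ^+ 2) l; apply: eq_integrable => // w _ /=; congr EFin; ring.
have tS : Ltwo (fun w => \sum_(j < N) g j w * dt) by exact: Ltwo_sum.
split=> //; have lj (j : 'I_N) : Lone (fun w => (g j w * dt) ^+ 2) by case: (tg j).
have lb : Lone (fun w => N%:R * \sum_(j < N) (g j w * dt) ^+ 2) by apply: LoneZ; exact: Lone_sum.
apply: le_trans (Er_le tS.2 lb _) _ => [w|].
  by have := @sqr_sum_le R 'I_N (fun j => g j w * dt); rewrite card_ord.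
rewrite ErZ; last exact: Lone_sum.
rewrite Er_sum// expr2 -mulrA -!mulrA ler_wpM2l//.
apply: (@le_trans _ _ (\sum_(j < N) dt ^+ 2 * K)).
  apply: ler_sum => j _; have [[m l] e] := H j (ltn_ord j).
  rewrite (@Er_eq _ _ _ _ _ (fun w => dt ^+ 2 * g j w ^+ 2)); last by move=> w; ring.
  by rewrite ErZ// ler_wpM2l// sqr_ge0.
by rewrite sumr_const card_ord -mulr_natl le_eqVlt; apply/orP; left; apply/eqP; ring.
Qed.

Lemma growth_lip (f : 'cV[R]_d -> R) : (forall x y, `|f x - f y| <= L * enorm (x - y)) ->
  forall x, `|f x| <= (`|f 0| + L) * wt x ^+ 1.
Proof.
move=> Lf x; have := Lf x 0; rewrite subr0 expr1 /wt => h.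
have e0 : 0 <= enorm x by exact: sqrtr_ge0.
have := ler_distD (f 0) (f x) 0; rewrite !subr0 => h2.
apply: le_trans h2 _; apply: le_trans (lerD h (lexx _)) _; rewrite -subr_ge0.
have -> : (`|f 0| + L) * (1 + enorm x) - (L * enorm x + `|f 0|) = L + `|f 0| * enorm x by ring.
by rewrite addr_ge0// mulr_ge0.
Qed.

Lemma Ltwo_sumsq (Y1 Y2 : Om -> R) b1 b2 : Ltwo Y1 -> Ltwo Y2 -> Er (fun w => Y1 w ^+ 2) <= b1 ->
  Er (fun w => Y2 w ^+ 2) <= b2 ->
  Ltwo (fun w => Y1 w + Y2 w) /\ Er (fun w => (Y1 w + Y2 w) ^+ 2) <= 2 * (b1 + b2).
Proof.
move=> t1 t2 e1 e2; have t12 := LtwoD t1 t2; split=> //.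
have lb := LoneZ 2 (LoneD t1.2 t2.2).
apply: le_trans (Er_le t12.2 lb _) _ => [w|].
  by have := sqr_ge0 (Y1 w - Y2 w); rewrite sqrrB sqrrD; lra.
by rewrite (ErZ _ (LoneD t1.2 t2.2)) (ErD t1.2 t2.2) ler_wpM2l// lerD.
Qed.

Lemma mesh_ok s t N : t <= s + 1 -> (0 < N)%N -> t - s <= N%:R :> R.
Proof. by move=> ts N0; apply: (@le_trans _ _ 1); [lra|rewrite ler1n]. Qed.

Lemma weighted_growth (I : finType) (f : I -> 'cV[R]_d -> R) m :
  (forall i x y, `|f i x - f i y| <= L * enorm (x - y)) ->
  exists2 B, 0 <= B & forall i s t, 0 <= s -> 0 <= t ->
    Ltwo (fun w => wt (X s w) ^+ m * f i (X t w)) /\ Er (fun w => (wt (X s w) ^+ m * f i (X t w)) ^+ 2) <= B.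
Proof.
move=> Lf.
have /choice[B HB] : forall i, exists B, 0 <= B /\ forall s t, 0 <= s -> 0 <= t ->
    Ltwo (fun w => wt (X s w) ^+ m * f i (X t w)) /\ Er (fun w => (wt (X s w) ^+ m * f i (X t w)) ^+ 2) <= B.
  move=> i; pose K := 1 + (`|f i 0| + L).
  have K0 : 0 <= K by rewrite !addr_ge0.
  have bV (x : 'cV[R]_d) : `|wt x ^+ m| <= K * wt x ^+ m.
    by rewrite ger0_norm ?wtX_ge0// ler_peMl ?wtX_ge0// lerDl addr_ge0.
  have bf x : `|f i x| <= K * wt x ^+ 1.
    by apply: le_trans (growth_lip (Lf i) x) _; rewrite ler_wpM2r ?wtX_ge0// lerDr.
  have mf : measurable_fun setT (f i : borel_vec R d -> R).
    by apply: cont_meas; apply: lipschitz_continuous (Lf i).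
  by have [B ? ?] := growth_Ltwo K0 (wt_meas m) mf bV bf; exists B.
exists (\sum_i B i); first by apply: sumr_ge0 => i _; case: (HB i).
move=> i s t s0 t0; have [_ H] := HB i; have [h1 h2] := H s t s0 t0; split=> //; apply: le_trans h2 _.
by rewrite (bigD1 i)//= lerDl sumr_ge0// => k _; case: (HB k).
Qed.

(** In the Riemann sums of [sde_riemann] the drift part is of order t - s and the
    martingale part has second moment of order t - s. The weight depends on the
    past of s only and multiplies the adapted coefficients. *)
Lemma increment_moment m : exists2 C, 0 <= C & forall s t i, 0 <= s -> s < t -> t <= s + 1 ->
  Ltwo (fun w => wt (X s w) ^+ m * (X t w i 0 - X s w i 0)) /\
  Er (fun w => (wt (X s w) ^+ m * (X t w i 0 - X s w i 0)) ^+ 2) <= C * (t - s).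
Proof.
have mc i b := diff_meas cc i b.
have [BA BA0 HA] := @weighted_growth _ (fun i x => a x i 0) m La.
have [BC BC0 HC] := @weighted_growth _ (fun (ib : 'I_d * 'I_r) x => c x ib.1 ib.2) m (fun ib x y => Lc ib.1 ib.2 x y).
exists (4 * (BA + r%:R ^+ 2 * BC)); first by rewrite mulr_ge0// addr_ge0// mulr_ge0// sqr_ge0.
move=> s t i s0 st t1; have ts0 : 0 < t - s by rewrite subr_gt0.
have mV : measurable_fun setT (fun w => wt (X s w) ^+ m) := measurableT_comp (wt_meas m) (mX0 s0).
have mVF u : s <= u -> measurable_fun setT ((fun w => wt (X s w) ^+ m) : g_sigma_algebraType (F u) -> R).
  move=> su; apply: (sub_measW (filtration_le HF s0 su)); exact: (measurableT_comp (wt_meas m) (mX s0)).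
have u0 N j : 0 <= grid s t N j by apply: le_trans s0 _; exact: grid_ge (ltW st).
have us N j : s <= grid s t N j by exact: grid_ge (ltW st).
have mYX : measurable_fun setT (fun w => wt (X s w) ^+ m * (X t w i 0 - X s w i 0)).
  apply: measurable_funM => //; apply: measurable_funB.
    exact: (measurableT_comp (coord_meas i) (mX0 (le_trans s0 (ltW st)))).
  exact: (measurableT_comp (coord_meas i) (mX0 s0)).
have pc := pcvgM mV (sde_riemann HF HZ HM ca cc HX i s0 st).
have key : Ltwo (fun w => wt (X s w) ^+ m * (X t w i 0 - X s w i 0)) /\
  Er (fun w => (wt (X s w) ^+ m * (X t w i 0 - X s w i 0)) ^+ 2) <= 2 * (2 * (BA * (t - s) + r%:R ^+ 2 * (t - s) * BC)).
  apply: (pcvg_Ltwo mYX pc); exists 1%N => // N /= N0.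
  have NR : 0 < N%:R :> R by rewrite ltr0n.
  have [tA eA] := @sum_Ltwo_bound N (fun j w => wt (X s w) ^+ m * a (X (grid s t N j.+1) w) i 0) ((t - s) / N%:R) BA
     (fun j _ => HA i s (grid s t N j.+1) s0 (u0 N j.+1)).
  have Hxi j b : (j < N)%N -> [/\ measurable_fun setT ((fun w => wt (X s w) ^+ m * c (X (grid s t N j) w) i b) : g_sigma_algebraType (F (grid s t N j)) -> R),
     Ltwo (fun w => wt (X s w) ^+ m * c (X (grid s t N j) w) i b) & Er (fun w => (wt (X s w) ^+ m * c (X (grid s t N j) w) i b) ^+ 2) <= BC].
    move=> _; have [h1 h2] := HC (i, b) s _ s0 (u0 N j); split=> //.
    apply: measurable_funM; first exact: mVF.
    exact: (measurableT_comp (mc i b) (mX (u0 N j))).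
  have [tC eC] := @levy_sum_Ltwo _ _ _ _ _ _ _ HF HZ HM s t N (fun j w b => wt (X s w) ^+ m * c (X (grid s t N j) w) i b) BC s0 st N0 (mesh_ok t1 N0) BC0 Hxi.
  have eA' : Er (fun w => (\sum_(j < N) wt (X s w) ^+ m * a (X (grid s t N j.+1) w) i 0 * ((t - s) / N%:R)) ^+ 2) <= BA * (t - s).
    apply: le_trans eA _; rewrite [N%:R * _]mulrC divfK ?gt_eqF// mulrC ler_wpM2l// expr2 ler_piMl ?(ltW ts0)//; lra.
  have [tS eS] := Ltwo_sumsq tA tC eA' eC.
  have E w : wt (X s w) ^+ m * (\sum_(j < N) a (X (grid s t N j.+1) w) i 0 * ((t - s) / N%:R) +
      \sum_(j < N) \sum_b c (X (grid s t N j) w) i b * (Z (grid s t N j.+1) w - Z (grid s t N j) w) b 0) =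
     \sum_(j < N) wt (X s w) ^+ m * a (X (grid s t N j.+1) w) i 0 * ((t - s) / N%:R) +
     \sum_(j < N) \sum_b wt (X s w) ^+ m * c (X (grid s t N j) w) i b * (Z (grid s t N j.+1) w - Z (grid s t N j) w) b 0.
    rewrite mulrDr; congr (_ + _); rewrite mulr_sumr; apply: eq_bigr => j _; first by rewrite mulrA.
    by rewrite mulr_sumr; apply: eq_bigr => b _; rewrite mulrA.
  split; first by move: tS; congr Ltwo; apply/funext => w; rewrite E.
  by rewrite (@Er_eq _ _ _ _ _ (fun w => _ ^+ 2) (fun w => congr1 (fun x => x ^+ 2) (E w))).
case: key => k1 k2; split=> //; apply: le_trans k2 _; rewrite le_eqVlt; apply/orP; left; apply/eqP; ring.
Qed.

(** Over a short time the solution moves like the Levy process, with frozen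
    coefficients: the remainder is one order smaller. *)
Definition remainder s t i w :=
  X t w i 0 - X s w i 0 - \sum_b c (X s w) i b * (Z t w - Z s w) b 0.

(** With frozen coefficients subtracted, the coefficients of the martingale part of the
    Riemann sums become c(X_u) - c(X_s), with second moment of order u - s by
    the Lipschitz condition and [increment_moment]: a factor t - s is gained. *)
Lemma remainder_moment m : exists2 C, 0 <= C & forall s t i, 0 <= s -> s < t -> t <= s + 1 ->
  Ltwo (fun w => wt (X s w) ^+ m * remainder s t i w) /\
  Er (fun w => (wt (X s w) ^+ m * remainder s t i w) ^+ 2) <= C * (t - s) ^+ 2.
Proof.
have mc i b := diff_meas cc i b.
have [BA BA0 HA] := @weighted_growth _ (fun i x => a x i 0) m La.
have [C1 C10 HC1] := increment_moment m.
pose BC := L ^+ 2 * (d%:R * C1).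
have BC0 : 0 <= BC by rewrite mulr_ge0 ?sqr_ge0// mulr_ge0.
exists (4 * (BA + r%:R ^+ 2 * BC)); first by rewrite mulr_ge0// addr_ge0// mulr_ge0// sqr_ge0.
move=> s t i s0 st t1; have ts0 : 0 < t - s by rewrite subr_gt0.
have mV : measurable_fun setT (fun w => wt (X s w) ^+ m) := measurableT_comp (wt_meas m) (mX0 s0).
have mVF u : s <= u -> measurable_fun setT ((fun w => wt (X s w) ^+ m) : g_sigma_algebraType (F u) -> R).
  move=> su; apply: (sub_measW (filtration_le HF s0 su)); exact: (measurableT_comp (wt_meas m) (mX s0)).
have u0 N j : 0 <= grid s t N j by apply: le_trans s0 _; exact: grid_ge (ltW st).
have us N j : s <= grid s t N j by exact: grid_ge (ltW st).
have t0 := le_trans s0 (ltW st).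
have mZ q b : 0 <= q -> measurable_fun setT (fun w => Z q w b 0).
  by move=> q0; exact: (measurableT_comp (coord_meas b) (sub_meas_vec HF q0 (levy_adapted_meas HF HZ q0))).
have mR : measurable_fun setT (remainder s t i).
  apply: measurable_funB; first apply: measurable_funB.
  - exact: (measurableT_comp (coord_meas i) (mX0 t0)).
  - exact: (measurableT_comp (coord_meas i) (mX0 s0)).
  - apply: measurable_sum => b; apply: measurable_funM; first exact: (measurableT_comp (mc i b) (mX0 s0)).
    rewrite (_ : (fun _ => _) = fun w => Z t w b 0 - Z s w b 0); last by apply/funext => w; rewrite !mxE.
    by apply: measurable_funB; exact: mZ.
have mYX : measurable_fun setT (fun w => wt (X s w) ^+ m * remainder s t i w) by exact: measurable_funM.
have pc := pcvgM mV (pcvgD (sde_riemann HF HZ HM ca cc HX i s0 st) (pcvg_cst P (fun w => - \sum_b c (X s w) i b * (Z t w - Z s w) b 0))).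
have key : Ltwo (fun w => wt (X s w) ^+ m * remainder s t i w) /\
  Er (fun w => (wt (X s w) ^+ m * remainder s t i w) ^+ 2) <= 2 * (2 * (BA * (t - s) ^+ 2 + r%:R ^+ 2 * (t - s) * (BC * (t - s)))).
  apply: (pcvg_Ltwo mYX pc); exists 1%N => // N /= N0.
  have NR : 0 < N%:R :> R by rewrite ltr0n.
  have [tA eA] := @sum_Ltwo_bound N (fun j w => wt (X s w) ^+ m * a (X (grid s t N j.+1) w) i 0) ((t - s) / N%:R) BA
     (fun j _ => HA i s (grid s t N j.+1) s0 (u0 N j.+1)).
  have Hxi j b : (j < N)%N -> [/\ measurable_fun setT ((fun w => wt (X s w) ^+ m * (c (X (grid s t N j) w) i b - c (X s w) i b)) : g_sigma_algebraType (F (grid s t N j)) -> R),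
     Ltwo (fun w => wt (X s w) ^+ m * (c (X (grid s t N j) w) i b - c (X s w) i b)) &
     Er (fun w => (wt (X s w) ^+ m * (c (X (grid s t N j) w) i b - c (X s w) i b)) ^+ 2) <= BC * (t - s)].
    move=> jN; set u := grid s t N j.
    have mF : measurable_fun setT ((fun w => wt (X s w) ^+ m * (c (X u w) i b - c (X s w) i b)) : g_sigma_algebraType (F u) -> R).
      apply: measurable_funM; first exact: (mVF _ (us N j)).
      apply: measurable_funB; first exact: (measurableT_comp (mc i b) (mX (u0 N j))).
      apply: (sub_measW (filtration_le HF s0 (us N j))); exact: (measurableT_comp (mc i b) (mX s0)).
    have [sg gm] := filtration_subsigma HF (u0 N j); have m0 := sub_meas sg gm mF.
    have := us N j; rewrite le_eqVlt => /orP[/eqP su|su].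
      have E w : wt (X s w) ^+ m * (c (X u w) i b - c (X s w) i b) = 0 by rewrite /u -su subrr mulr0.
      split=> //; first by rewrite (_ : (fun _ => _) = fun _ => 0); [exact: Ltwo_cst|apply/funext => w; rewrite E].
      rewrite (@Er_eq _ _ _ _ _ (fun _ => 0)); last by move=> w; rewrite E expr0n.
      by rewrite Er_cst mulr_ge0// ltW.
    have u1 : u <= s + 1 by apply: le_trans t1; apply: grid_le; [exact: ltW|exact: ltnW].
    have Hk k := HC1 s u k s0 su u1.
    have lS : Lone (fun w => \sum_k (wt (X s w) ^+ m * (X u w k 0 - X s w k 0)) ^+ 2).
      by apply: Lone_sum => k; case: (Hk k) => -[].
    have bd w : (wt (X s w) ^+ m * (c (X u w) i b - c (X s w) i b)) ^+ 2 <=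
        L ^+ 2 * \sum_k (wt (X s w) ^+ m * (X u w k 0 - X s w k 0)) ^+ 2.
      have -> : L ^+ 2 * \sum_k (wt (X s w) ^+ m * (X u w k 0 - X s w k 0)) ^+ 2 =
         (wt (X s w) ^+ m * (L * enorm (X u w - X s w))) ^+ 2.
        rewrite exprMn [in RHS]exprMn /enorm sqr_sqrtr; last by do 2 (apply: sumr_ge0 => ? _); exact: sqr_ge0.
        rewrite mulrCA; congr (_ * _); rewrite mulr_sumr; apply: eq_bigr => k _.
        by rewrite big_ord1 !mxE exprMn.
      rewrite -[leLHS]real_normK ?num_real// lerXn2r ?nnegrE//.
        by rewrite mulr_ge0 ?wtX_ge0// mulr_ge0// sqrtr_ge0.
      by rewrite normrM ger0_norm ?wtX_ge0// ler_wpM2l ?wtX_ge0.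
    have l2 : Lone (fun w => (wt (X s w) ^+ m * (c (X u w) i b - c (X s w) i b)) ^+ 2).
      apply: (Lone_le _ (LoneZ (L ^+ 2) lS)); first exact: measurable_funX.
      by move=> w; rewrite ger0_norm ?sqr_ge0.
    split=> //; apply: le_trans (Er_le l2 (LoneZ (L ^+ 2) lS) bd) _.
    rewrite ErZ// /BC -mulrA ler_wpM2l ?sqr_ge0// Er_sum; last by move=> k; case: (Hk k) => -[].
    apply: (@le_trans _ _ (\sum_(k < d) C1 * (t - s))).
      apply: ler_sum => k _; case: (Hk k) => _ h; apply: le_trans h _; rewrite ler_wpM2l// lerD2r.
      by apply: grid_le; [exact: ltW|exact: ltnW].
    by rewrite sumr_const card_ord -mulrA mulr_natl.
  have [tC eC] := @levy_sum_Ltwo _ _ _ _ _ _ _ HF HZ HM s t N (fun j w b => wt (X s w) ^+ m * (c (X (grid s t N j) w) i b - c (X s w) i b)) (BC * (t - s)) s0 st N0 (mesh_ok t1 N0) (mulr_ge0 BC0 (ltW ts0)) Hxi.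
  have eA' : Er (fun w => (\sum_(j < N) wt (X s w) ^+ m * a (X (grid s t N j.+1) w) i 0 * ((t - s) / N%:R)) ^+ 2) <= BA * (t - s) ^+ 2.
    by apply: le_trans eA _; rewrite [N%:R * _]mulrC divfK ?gt_eqF// mulrC.
  have [tS eS] := Ltwo_sumsq tA tC eA' eC.
  have E w : wt (X s w) ^+ m * (\sum_(j < N) a (X (grid s t N j.+1) w) i 0 * ((t - s) / N%:R) +
      \sum_(j < N) \sum_b c (X (grid s t N j) w) i b * (Z (grid s t N j.+1) w - Z (grid s t N j) w) b 0 +
      (- \sum_b c (X s w) i b * (Z t w - Z s w) b 0)) =
     \sum_(j < N) wt (X s w) ^+ m * a (X (grid s t N j.+1) w) i 0 * ((t - s) / N%:R) +
     \sum_(j < N) \sum_b wt (X s w) ^+ m * (c (X (grid s t N j) w) i b - c (X s w) i b) * (Z (grid s t N j.+1) w - Z (grid s t N j) w) b 0.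
    (* The frozen term is itself a Riemann sum, with constant coefficient. *)
    have tel : \sum_b c (X s w) i b * (Z t w - Z s w) b 0 =
       \sum_(j < N) \sum_b c (X s w) i b * (Z (grid s t N j.+1) w - Z (grid s t N j) w) b 0.
      rewrite exchange_big/=; apply: eq_bigr => b _; rewrite -mulr_sumr; congr (_ * _).
      have := telescope_sumr (fun j => Z (grid s t N j) w b 0) (leq0n N); rewrite big_mkord grid0 gridN// !mxE => <-.
      by apply: eq_bigr => j _; rewrite !mxE.
    rewrite tel -addrA -sumrB mulrDr; congr (_ + _); rewrite mulr_sumr; apply: eq_bigr => j _; first by rewrite mulrA.
    by rewrite -sumrB mulr_sumr; apply: eq_bigr => b _; rewrite -mulrBl mulrA.
  split; first by move: tS; congr Ltwo; apply/funext => w; rewrite E.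
  by rewrite (@Er_eq _ _ _ _ _ (fun w => _ ^+ 2) (fun w => congr1 (fun x => x ^+ 2) (E w))).
case: key => k1 k2; split=> //; apply: le_trans k2 _; rewrite le_eqVlt; apply/orP; left; apply/eqP; ring.
Qed.

End moments.

(** * Ergodic averages *)
Import HBNNSimple.

Lemma inv_nat_cvg0 (R : realType) : (n%:R : R)^-1 @[n --> \oo] --> (0 : R).
Proof. by apply/(gtr0_cvgV0 _); [exists 1%N => // n /= n0; rewrite ltr0n|exact: cvgr_idn]. Qed.

Section ergodic.
Context (R : realType) (dO : measure_display) (Om : measurableType dO) (P : probability Om R).
Local Notation Er := (Er P).
Local Notation Lone := (Lone P).
Local Notation Ltwo := (Ltwo P).
Context (F : R -> set (set Om)) (d r : nat) (Z : R -> Om -> 'cV[R]_r) (X : R -> Om -> 'cV[R]_d).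
Context (a : 'cV[R]_d -> 'cV[R]_d) (c : 'cV[R]_d -> 'M[R]_(d, r)).
Context (Pt : R -> R.-pker borel_vec R d ~> borel_vec R d) (pi0 : probability (borel_vec R d) R).
Hypothesis HF : filtration F.
Hypothesis HX : sde_solution P F a c Z X.
Hypothesis HPt : transition_function P F a c Z Pt.
Hypothesis Hst : stability P X Pt pi0.

Let mX t : 0 <= t -> measurable_fun setT (X t : g_sigma_algebraType (F t) -> borel_vec R d) :=
  sde_meas HF HX (t := t).
Let mX0 t : 0 <= t -> measurable_fun setT (X t : Om -> borel_vec R d) := sde_meas0 HF HX (t := t).

(** The Markov property for functions instead of events, by approximation with simple
    functions. *)
Lemma transition_integral s t A (f : borel_vec R d -> R) : 0 <= s -> 0 <= t -> F s A ->
  measurable_fun setT f -> (forall x, 0 <= f x) ->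
  (\int[P]_(w in A) (f (X (s + t) w))%:E = \int[P]_(w in A) \int[Pt t (X s w)]_y (f y)%:E)%E.
Proof.
move=> s0 t0 FA mf f0.
have [sg gm] := filtration_subsigma HF s0; have mA := gm _ FA.
have mXst := mX0 (addr_ge0 s0 t0); have mXs := mX0 s0.
have mf' : measurable_fun setT (EFin \o f) by exact/measurable_EFinP.
pose fn := nnsfun_approx measurableT mf'.
have fn0 n x : 0 <= fn n x by exact: fun_ge0.
have mfn n : measurable_fun setT (fn n : borel_vec R d -> R) by [].
have mpre n y : measurable (fn n @^-1` [set y]) by rewrite -[X in measurable X]setTI; exact: mfn.
have mker B : measurable B -> measurable_fun setT (fun w => Pt t (X s w) B).
  by move=> mB; exact: (measurableT_comp (measurable_kernel (Pt t) B mB) mXs).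
have step n : (\int[P]_(w in A) (fn n (X (s + t) w))%:E = \int[P]_(w in A) \int[Pt t (X s w)]_y (fn n y)%:E)%E.
  transitivity (\sum_(y \in range (fn n)) (y%:E * P (A `&` X (s + t) @^-1` (fn n @^-1` [set y]))))%E.
    transitivity (\int[P]_(w in A) (\sum_(y \in range (fn n)) ((y * \1_(X (s + t) @^-1` (fn n @^-1` [set y])) w))%:E))%E.
      apply: eq_integral => w _; rewrite fsumEFin; last exact: fimfunP.
      by rewrite {1}(fimfunE (fn n)).
    have mpX y : measurable (X (s + t) @^-1` (fn n @^-1` [set y])).
      by rewrite -[X in measurable X]setTI; exact: mXst.
    rewrite ge0_integral_fsum//.
    - apply: eq_fsbigr => y; rewrite inE => -[x _ yE].
      have y0 : 0 <= y by rewrite -yE.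
      under eq_integral do rewrite EFinM.
      rewrite ge0_integralZl//.
      + by rewrite integral_indic// setIC.
      + by apply/measurable_EFinP; exact: measurable_indic.
    - by move=> y; apply/measurable_EFinP; apply: measurable_funM => //; exact: measurable_indic.
    - move=> y w _; rewrite lee_fin indicE; case: (boolP (w \in _)) => [|_]; last by rewrite mulr0.
      by rewrite inE /= mulr1 => <-.
  transitivity (\int[P]_(w in A) (\sum_(y \in range (fn n)) (y%:E * Pt t (X s w) (fn n @^-1` [set y]))))%E; last first.
    by apply: eq_integral => w _; rewrite integralT_nnsfun sintegralE.
  rewrite ge0_integral_fsum//.
  - apply: eq_fsbigr => y; rewrite inE => -[x _ yE].
    have y0 : 0 <= y by rewrite -yE.
    rewrite ge0_integralZl//; last by apply: measurable_funTS; exact: mker.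
    by congr (_ * _)%E; exact: (HPt HX s0 t0 FA (mpre n y)).
  - by move=> y; apply: measurable_funeM; apply: measurable_funTS; exact: mker.
  - move=> y w _; have [y0|y0] := leP 0 y; first by rewrite mule_ge0// lee_fin.
    rewrite (_ : fn n @^-1` [set y] = set0) ?measure0 ?mule0//.
    by apply/seteqP; split=> // x /= E; move: y0; rewrite -E ltNge fn0.
have limf x : (fn n x)%:E @[n --> \oo] --> (f x)%:E.
  by apply: cvg_nnsfun_approx => // z _; rewrite lee_fin.
have nd x : {homo (fun n => (fn n x)%:E) : m n / (m <= n)%N >-> (m <= n)%E}.
  by move=> m n mn; rewrite lee_fin; apply/lefP; exact: nd_nnsfun_approx.
have limI w : limn (fun n => \int[Pt t (X s w)]_y (fn n y)%:E)%E = (\int[Pt t (X s w)]_y (f y)%:E)%E.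
  rewrite -monotone_convergence//.
  - by apply: eq_integral => y _; apply/cvg_lim => //; exact: limf.
  - by move=> n; exact/measurable_EFinP.
  - by move=> n y _; rewrite lee_fin.
transitivity (limn (fun n => \int[P]_(w in A) (fn n (X (s + t) w))%:E))%E.
  rewrite -monotone_convergence//.
  - by apply: eq_integral => w _; apply/esym/cvg_lim => //; exact: limf.
  - by move=> n; apply/measurable_EFinP; apply: measurable_funTS; exact: (measurableT_comp (mfn n) mXst).
  - by move=> n w _; rewrite lee_fin.
rewrite (_ : (fun n => _) = (fun n => \int[P]_(w in A) \int[Pt t (X s w)]_y (fn n y)%:E)%E); last by apply/funext => n; rewrite step.
rewrite -monotone_convergence//.
- by apply: eq_integral => w _; exact: limI.
- move=> n; apply: measurable_funTS.
  have := @measurable_fun_integral_kernel _ _ _ _ R (fun w => Pt t (X s w)) mker (fun y => (fn n y)%:E).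
  by apply=> [y|]; [rewrite lee_fin|exact/measurable_EFinP].
- by move=> n w _; apply: integral_ge0 => y _; rewrite lee_fin.
- move=> w _ m n mn; apply: ge0_le_integral => //.
  + by move=> y _; rewrite lee_fin.
  + exact/measurable_EFinP.
  + exact/measurable_EFinP.
  + by move=> y _; exact: nd.
Qed.

Lemma abse_sub_fin (x y : \bar R) : (0 <= x)%E -> (0 <= y)%E -> (`|x - y| < +oo)%E ->
  x \is a fin_num /\ y \is a fin_num.
Proof. by case: x => [x| |]; case: y => [y| |]. Qed.

(** The conditional mean of f(X_(s+t)) given the past of s is u(X_s), and exponential
    ergodicity says that u is within e^(-lam t), up to polynomial growth, of
    the stationary mean. *)
Lemma transition_decay (f : borel_vec R d -> R) (q : R) : 0 < q -> measurable_fun setT f ->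
  (forall x, 0 <= f x) -> (forall x, f x <= 1 + enorm x `^ q) ->
  exists2 lam, 0 < lam & exists2 K, 0 <= K & pi0.-integrable setT (EFin \o f) /\
    forall t, 0 <= t -> exists u : borel_vec R d -> R, [/\ measurable_fun setT u,
      forall x, (\int[Pt t x]_y (f y)%:E)%E = (u x)%:E &
      forall x, `|u x - \int[pi0]_y f y| <= K * expR (- lam * t) * (1 + enorm x `^ q)].
Proof.
move=> q0 mf f0 fq.
have [/(_ q q0)[lam lam0 [K HK]] _] := Hst.
exists lam => //; exists `|K| => //.
have bf y : `|f y| <= 1 + enorm y `^ q by rewrite ger0_norm.
have fin t x : 0 <= t -> (\int[Pt t x]_y (f y)%:E)%E \is a fin_num /\ (\int[pi0]_y (f y)%:E)%E \is a fin_num.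
  move=> t0; apply: abse_sub_fin; [by apply: integral_ge0 => y _; rewrite lee_fin|by apply: integral_ge0 => y _; rewrite lee_fin|].
  rewrite ltNge; apply/negP; rewrite leye_eq => /eqP E.
  have := HK x t f t0 mf bf; rewrite E mulry gtr0_sg ?expR_gt0// mul1e leye_eq.
  by [].
split; first by apply: ge0_Lone => //; rewrite ltey_eq (fin 0 0 (lexx 0)).2.
move=> t t0; have H x := HK x t f t0 mf bf; have {}fin x := fin t x t0.
exists (fun x => fine (\int[Pt t x]_y (f y)%:E)%E); split.
- apply: measurableT_comp => //.
  apply: (@measurable_fun_integral_kernel _ _ _ _ R (Pt t) _ (fun y => (f y)%:E)).
  + by move=> U mU; exact: measurable_kernel.
  + by move=> y; rewrite lee_fin.
  + exact/measurable_EFinP.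
- by move=> x; rewrite fineK//; case: (fin x).
- move=> x; have [f1 f2] := fin x; have := H x.
  rewrite -(fineK f1) -(fineK f2) -EFinB abse_EFin -EFinM lee_fin /Rintegral => h.
  apply: (@le_trans _ _ (K * expR (- lam * t) * (1 + enorm x `^ q))); last first.
    by rewrite ler_wpM2r ?addr_ge0 ?powR_ge0// ler_wpM2r ?expR_ge0// ler_norm.
  rewrite mulNr expRN mulrAC ler_pdivlMr ?expR_gt0// mulrC; exact: h.
Qed.

(** Geometrically decaying correlations make the variance of the sum linear in n, with
    the factor 1/(1 - rho) for the range of dependence. *)
Lemma mixing_variance (g : nat -> Om -> R) (C rho : R) : 0 <= C -> 0 <= rho -> rho < 1 ->
  (forall j, Ltwo (g j)) -> (forall i j, (i <= j)%N -> Er (fun w => g i w * g j w) <= C * rho ^+ (j - i)) ->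
  forall n, Ltwo (fun w => \sum_(j < n) g j w) /\
    Er (fun w => (\sum_(j < n) g j w) ^+ 2) <= n%:R * (2 * C / (1 - rho)).
Proof.
move=> C0 r0 r1 tg cg; have r1' : 0 < 1 - rho by rewrite subr_gt0.
have geo n : \sum_(j < n) rho ^+ (n - j) <= rho / (1 - rho).
  elim: n => [|n IH]; first by rewrite big_ord0 divr_ge0// ltW.
  rewrite big_ord_recr/= subSnn expr1 (eq_bigr (fun j : 'I_n => rho * rho ^+ (n - j))).
    rewrite -mulr_sumr -[X in _ + X]mulr1 -mulrDr ler_wpM2l//.
    have -> : (1 - rho)^-1 = rho / (1 - rho) + 1 by field; rewrite gt_eqF.
    lra.
  by move=> j _; rewrite subSn ?exprS// ltnW.
elim=> [|n [tS eS]].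
  rewrite (_ : (fun w => \sum_(j < 0) _) = fun _ => 0); last by apply/funext => w; rewrite big_ord0.
  split; first exact: Ltwo_cst.
  rewrite (@Er_eq _ _ _ _ _ (fun _ => 0)); last by move=> w; rewrite big_ord0 expr0n.
  by rewrite Er_cst mul0r.
have E w : \sum_(j < n.+1) g j w = \sum_(j < n) g j w + g n w by rewrite big_ord_recr.
rewrite (_ : (fun w => \sum_(j < n.+1) _) = (fun w => \sum_(j < n) g j w + g n w)); last by apply/funext => w; rewrite E.
split; first exact: LtwoD.
have lc (j : 'I_n) : Lone (fun w => g j w * g n w) by exact: Ltwo_mul.
have lS : Lone (fun w => \sum_(j < n) g j w * g n w) by exact: Lone_sum.
rewrite (@Er_eq _ _ _ _ _ (fun w => (\sum_(j < n) g j w) ^+ 2 + (2 * (\sum_(j < n) g j w * g n w) + g n w ^+ 2))); last first.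
  by move=> w; rewrite E -mulr_suml; ring.
have l2 := LoneZ 2 lS; have ln := (tg n).2.
rewrite (ErD tS.2 (LoneD l2 ln)) (ErD l2 ln) (ErZ _ lS) (Er_sum _ lc).
have -> : n.+1%:R * (2 * C / (1 - rho)) = n%:R * (2 * C / (1 - rho)) + 2 * C / (1 - rho) by rewrite -natr1 mulrDl mul1r.
rewrite lerD//.
have h1 : \sum_(j < n) Er (fun w => g j w * g n w) <= C * (rho / (1 - rho)).
  apply: (@le_trans _ _ (\sum_(j < n) C * rho ^+ (n - j))).
    by apply: ler_sum => j _; apply: cg; exact: ltnW.
  by rewrite -mulr_sumr ler_wpM2l.
have h2 : Er (fun w => g n w ^+ 2) <= C by have := cg n n (leqnn n); rewrite subnn expr0 mulr1.
have -> : 2 * C / (1 - rho) = 2 * (C * (rho / (1 - rho))) + 2 * C by field; rewrite gt_eqF.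
lra.
Qed.

Lemma Er_pcvg (Y_ : nat -> Om -> R) (Y : Om -> R) : 
  (forall e, 0 < e -> \forall n \near \oo, Lone (fun w => `|Y_ n w - Y w|) /\ Er (fun w => `|Y_ n w - Y w|) <= e) ->
  pcvg P Y_ Y.
Proof.
move=> H e e0; have e2 : 0 < e ^+ 2 by rewrite exprn_gt0.
have [N _ HN] := H _ e2; exists N => n Nn; have [l el] := HN n Nn.
exists [set w | e <= `|Y_ n w - Y w|]; split.
- by apply: meas_ge; exact: Lone_meas l.
- apply: le_trans (Er_chebyshev l _ e0) _ => [w|]; first exact: normr_ge0.
  by rewrite lee_fin ler_pdivrMr// -expr2.
- by move=> w /negP; rewrite -ltNge => /ltW.
Qed.

Lemma Er_sqr_pcvg (Y_ : nat -> Om -> R) (Y : Om -> R) : 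
  (forall e, 0 < e -> \forall n \near \oo, Lone (fun w => (Y_ n w - Y w) ^+ 2) /\ Er (fun w => (Y_ n w - Y w) ^+ 2) <= e) ->
  pcvg P Y_ Y.
Proof.
move=> H e e0; have e3 : 0 < e ^+ 3 by rewrite exprn_gt0.
have [N _ HN] := H _ e3; exists N => n Nn; have [l el] := HN n Nn.
have e2 : 0 < e ^+ 2 by rewrite exprn_gt0.
exists [set w | e ^+ 2 <= (Y_ n w - Y w) ^+ 2]; split.
- by apply: meas_ge; exact: Lone_meas l.
- apply: le_trans (Er_chebyshev l _ e2) _ => [w|]; first exact: sqr_ge0.
  by rewrite lee_fin ler_pdivrMr// -exprS.
- move=> w /negP; rewrite -ltNge => h; rewrite leNgt; apply/negP => h2; move: h; apply/negP.
  by rewrite -leNgt -[leRHS]real_normK ?num_real// lerXn2r ?nnegrE// ltW.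
Qed.

Hypothesis HXm : forall q : R, 0 < q -> exists M : R, forall t, 0 <= t ->
  ('E_P[(fun w => enorm (X t w) `^ q)%R] <= M%:E)%E.

(** For observations at distance h the correlation ratio is rho = e^(-lam h), so
    1/(1 - rho) is of order 1 + 1/h and the variance of the average is of order
    1/n + 1/(n h), which tends to 0. *)
Lemma ergodic_average_ge0 (h : nat -> R) (f : borel_vec R d -> R) m : (forall n, 0 < h n) ->
  n%:R * h n @[n --> \oo] --> +oo -> measurable_fun setT f -> (forall x, 0 <= f x) ->
  (forall x, f x <= 1 + enorm x ^+ m.+1) ->
  pi0.-integrable setT (EFin \o f) /\
  pcvg P (fun n w => n%:R^-1 * \sum_(j < n) f (X (j%:R * h n) w)) (fun _ => \int[pi0]_y f y).
Proof.
move=> h0 hT mf f0 fm.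
have fq x : f x <= 1 + enorm x `^ m.+1%:R by rewrite powR_mulrn ?sqrtr_ge0.
have [lam lam0 [K K0 [intf HK]]] := transition_decay (ltr0Sn R m) mf f0 fq; split=> //.
set mu := \int[pi0]_y f y.
have [M M0 HM] := wt_moments HF HX HXm (m.+1 * 2).
pose D := 2 + `|mu|.
have D0 : 0 <= D by rewrite addr_ge0.
have pw (x : 'cV[R]_d) : 1 + enorm x ^+ m.+1 <= wt x ^+ m.+1.
  rewrite /wt; move: (enorm x) (sqrtr_ge0 _ : 0 <= enorm x) => y y0.
  elim: m {intf fm fq HM HK M M0} => [|k IH]; first by rewrite !expr1.
  rewrite [in leRHS]exprS; apply: (@le_trans _ _ ((1 + y) * (1 + y ^+ k.+1))); last by rewrite ler_wpM2l// addr_ge0.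
  rewrite mulrDl mul1r mulrDr mulr1 -exprS; have := exprn_ge0 k.+1 y0; lra.
have fb x : `|f x - mu| <= D * wt x ^+ m.+1.
  apply: le_trans (ler_normB _ _) _; rewrite (ger0_norm (f0 x)) /D mulrDl; apply: lerD.
    apply: le_trans (fm x) _; apply: le_trans (pw x) _; rewrite ler_peMl ?ler1n//.
    by rewrite exprn_ge0// (le_trans ler01)// wt_ge1.
  by rewrite ler_peMr// exprn_ege1// wt_ge1.
have w0 (x : 'cV[R]_d) : 0 <= wt x ^+ m.+1 by rewrite exprn_ge0// (le_trans ler01)// wt_ge1.
have tf t : 0 <= t -> Ltwo (fun w => f (X t w) - mu).
  move=> t0; have [lM _] := HM t t0.
  have mf1 : measurable_fun setT (fun w => f (X t w) - mu).
    by apply: measurable_funB => //; exact: (measurableT_comp mf (mX0 t0)).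
  split=> //; apply: (Lone_le _ (LoneZ (D ^+ 2) lM)); first exact: measurable_funX.
  by move=> w; rewrite normrX exprM -exprMn lerXn2r ?nnegrE// mulr_ge0.
pose C := D * K * M.
have C0 : 0 <= C by rewrite !mulr_ge0.
have cov s t : 0 <= s -> 0 <= t -> Er (fun w => (f (X s w) - mu) * (f (X (s + t) w) - mu)) <= C * expR (- lam * t).
  move=> s0 t0; have [u [mu_ uE ub]] := HK t t0; have st0 := addr_ge0 s0 t0.
  have [lM eM] := HM s s0; have [sg gm] := filtration_subsigma HF s0.
  have lfs := Ltwo_Lone (tf _ st0).
  have ub' x : `|u x - mu| <= K * expR (- lam * t) * wt x ^+ m.+1.
    apply: le_trans (ub x) _; rewrite powR_mulrn ?sqrtr_ge0// ler_wpM2l//.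
    by rewrite mulr_ge0// expR_ge0.
  have k0 : 0 <= K * expR (- lam * t) by rewrite mulr_ge0// expR_ge0.
  have tu : Ltwo (fun w => u (X s w) - mu).
    have mu1 : measurable_fun setT (fun w => u (X s w) - mu).
      by apply: measurable_funB => //; exact: (measurableT_comp mu_ (mX0 s0)).
    split=> //; apply: (Lone_le _ (LoneZ ((K * expR (- lam * t)) ^+ 2) lM)); first exact: measurable_funX.
    by move=> w; rewrite normrX exprM -exprMn lerXn2r ?nnegrE// mulr_ge0.
  have lus := Ltwo_Lone tu.
  have lphi : Lone (fun w => f (X (s + t) w) - u (X s w)).
    by have := LoneB lfs lus; apply: eq_integrable => // w _ /=; congr EFin; ring.
  have lprod : Lone (fun w => (f (X s w) - mu) * (f (X (s + t) w) - u (X s w))).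
    have := LoneB (Ltwo_mul (tf s s0) (tf _ st0)) (Ltwo_mul (tf s s0) tu).
    by apply: eq_integrable => // w _ /=; congr EFin; ring.
  have lf1 : Lone (fun w => f (X (s + t) w)).
    by have := LoneD lfs (Lone_cst P mu); apply: eq_integrable => // w _ /=; rewrite subrK.
  have lu1 : Lone (fun w => u (X s w)).
    by have := LoneD lus (Lone_cst P mu); apply: eq_integrable => // w _ /=; rewrite subrK.
  have Z0 : Er (fun w => (f (X s w) - mu) * (f (X (s + t) w) - u (X s w))) = 0.
    apply: (sub_Er0 sg gm lphi _ _ lprod) => [A FA|]; last first.
      by apply: measurable_funB => //; exact: (measurableT_comp mf (mX s0)).
    have mA := gm _ FA.
    have ind (g : Om -> R) : Lone g -> Lone (fun w => \1_A w * g w).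
      move=> lg; apply: (Lone_le _ (Lone_norm lg)).
        by apply: measurable_funM; [exact: measurable_indic|exact: (Lone_meas lg)].
      by move=> w; rewrite normrM indicE; case: (w \in A); rewrite ?normr1 ?mul1r// normr0 mul0r.
    have indE (g : Om -> R) : Lone g -> ((Er (fun w => \1_A w * g w))%:E = \int[P]_(w in A) (g w)%:E)%E.
      move=> lg; rewrite -EFin_Er; last exact: ind.
      rewrite [RHS]integral_mkcond; apply: eq_integral => w _; rewrite patchE indicE.
      by case: ifP => _; rewrite ?mul1r ?mul0r.
    rewrite (@Er_eq _ _ _ _ _ (fun w => \1_A w * f (X (s + t) w) - \1_A w * u (X s w))); last by move=> w; rewrite mulrBr.
    rewrite ErB; [|exact: ind|exact: ind].
    apply/eqP; rewrite subr_eq0; apply/eqP; apply: EFin_inj; rewrite !indE//.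
    by rewrite transition_integral//; apply: eq_integral => w _; rewrite uE.
  have l1 := Ltwo_mul (tf s s0) tu.
  rewrite (@Er_eq _ _ _ _ _ (fun w => (f (X s w) - mu) * (f (X (s + t) w) - u (X s w)) + (f (X s w) - mu) * (u (X s w) - mu))); last by move=> w; ring.
  rewrite ErD// Z0 add0r.
  have lb := LoneZ (D * (K * expR (- lam * t))) lM.
  apply: le_trans (Er_le l1 lb _) _ => [w|].
    apply: le_trans (ler_norm _) _; rewrite normrM.
    apply: (@le_trans _ _ ((D * wt (X s w) ^+ m.+1) * (K * expR (- lam * t) * wt (X s w) ^+ m.+1))).
      by apply: ler_pM.
    by rewrite exprM le_eqVlt; apply/orP; left; apply/eqP; ring.
  rewrite ErZ//; apply: (@le_trans _ _ (D * (K * expR (- lam * t)) * M)); first by rewrite ler_wpM2l// mulr_ge0.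
  by rewrite /C le_eqVlt; apply/orP; left; apply/eqP; ring.
have var n : (0 < n)%N -> Lone (fun w => (n%:R^-1 * \sum_(j < n) f (X (j%:R * h n) w) - mu) ^+ 2) /\
   Er (fun w => (n%:R^-1 * \sum_(j < n) f (X (j%:R * h n) w) - mu) ^+ 2) <= 2 * C * (n%:R^-1 + (lam * (n%:R * h n))^-1).
  move=> n0; have nR : 0 < n%:R :> R by rewrite ltr0n.
  have x0 : 0 < lam * h n by rewrite mulr_gt0.
  pose rho := expR (- (lam * h n)).
  have r0 : 0 <= rho by exact: expR_ge0.
  have r1 : rho < 1 by rewrite expR_lt1 oppr_lt0.
  have tg j : Ltwo (fun w => f (X (j%:R * h n) w) - mu) by apply: tf; rewrite mulr_ge0// ltW.
  have cg i j : (i <= j)%N -> Er (fun w => (f (X (i%:R * h n) w) - mu) * (f (X (j%:R * h n) w) - mu)) <= C * rho ^+ (j - i).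
    move=> ij; have := @cov (i%:R * h n) ((j - i)%:R * h n); rewrite -mulrDl -natrD subnKC//.
    rewrite !mulr_ge0 ?(ltW (h0 n))// => /(_ isT isT); rewrite /rho -expRM_natl; congr (_ <= _ * expR _).
    by rewrite mulNr mulrCA mulrN.
  have [tS eS] := mixing_variance C0 r0 r1 tg cg n.
  have E w : n%:R^-1 * \sum_(j < n) f (X (j%:R * h n) w) - mu = n%:R^-1 * \sum_(j < n) (f (X (j%:R * h n) w) - mu).
    by rewrite sumrB sumr_const card_ord mulrBr -[mu *+ n]mulr_natl [n%:R^-1 * (_ * mu)]mulrA mulVf ?mul1r// gt_eqF.
  rewrite (_ : (fun w => _) = (fun w => n%:R^-1 ^+ 2 * (\sum_(j < n) (f (X (j%:R * h n) w) - mu)) ^+ 2)); last first.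
    by apply/funext => w; rewrite E exprMn.
  split; first exact: (LoneZ _ tS.2).
  rewrite (ErZ _ tS.2); apply: (@le_trans _ _ (n%:R^-1 ^+ 2 * (n%:R * (2 * C / (1 - rho))))).
    by rewrite ler_wpM2l// sqr_ge0.
  have -> : n%:R^-1 ^+ 2 * (n%:R * (2 * C / (1 - rho))) = 2 * C * (n%:R^-1 * (1 - rho)^-1).
    by field; rewrite !gt_eqF// subr_gt0.
  have -> : n%:R^-1 + (lam * (n%:R * h n))^-1 = n%:R^-1 * (1 + (lam * h n)^-1).
    by field; rewrite !gt_eqF.
  rewrite ler_wpM2l ?mulr_ge0// ler_wpM2l ?invr_ge0//.
  have e1 : 1 + lam * h n <= expR (lam * h n) by exact: expR_ge1Dx.
  have rE : rho * expR (lam * h n) = 1 by rewrite /rho expRN mulVf// gt_eqF// expR_gt0.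
  have r1' : 0 < 1 - rho by rewrite subr_gt0.
  rewrite -[leLHS]mul1r ler_pdivrMr//.
  have -> : (1 + (lam * h n)^-1) = (lam * h n)^-1 * (1 + lam * h n) by field; rewrite !gt_eqF.
  rewrite -mulrA ler_pdivlMl// mulr1 mulrBr mulr1.
  have : rho * (1 + lam * h n) <= 1 by rewrite -[leRHS]rE ler_wpM2l.
  rewrite [_ * rho]mulrC; lra.
apply: Er_sqr_pcvg => e e0.
have c1 : 2 * C * (n%:R^-1 + (lam * (n%:R * h n))^-1) @[n --> \oo] --> (0 : R).
  rewrite -(mulr0 (2 * C)); apply: cvgM; first exact: cvg_cst.
  rewrite -(addr0 0); apply: cvgD; first exact: inv_nat_cvg0.
  under eq_fun do rewrite invfM; rewrite -(mulr0 lam^-1); apply: cvgM; first exact: cvg_cst.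
  by apply/(gtr0_cvgV0 _) => //; exists 1%N => // n /= n0; rewrite mulr_gt0// ltr0n.
near=> n; have n0 : (0 < n)%N by near: n; exists 1%N.
have [l el] := var n n0; split=> //; apply: le_trans el _.
near: n; exact: (cvgr_le _ c1 _ e0).
Unshelve. all: by end_near. Qed.

(** The positive and negative parts of f are rescaled to meet the bound 1 + |x|^q under
    which ergodicity is formulated. *)
Lemma ergodic_average (h : nat -> R) (f : borel_vec R d -> R) K m : (forall n, 0 < h n) ->
  n%:R * h n @[n --> \oo] --> +oo -> measurable_fun setT f -> 0 <= K ->
  (forall x, `|f x| <= K * wt x ^+ m) ->
  pi0.-integrable setT (EFin \o f) /\
  pcvg P (fun n w => n%:R^-1 * \sum_(j < n) f (X (j%:R * h n) w)) (fun _ => \int[pi0]_y f y).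
Proof.
move=> h0 hT mf K0 fK; pose k := K * 2 ^+ m.+1 + 1.
have k0 : 0 < k by rewrite ltr_wpDl// mulr_ge0// exprn_ge0.
pose f1 x := k^-1 * Num.max (f x) 0; pose f2 x := k^-1 * Num.max (- f x) 0.
have bd x y : 0 <= y -> y <= `|f x| -> k^-1 * y <= 1 + enorm x ^+ m.+1.
  move=> y0 yf; rewrite ler_pdivrMl//; apply: le_trans yf _; apply: le_trans (fK x) _.
  apply: (@le_trans _ _ (K * (2 ^+ m.+1 * (1 + enorm x ^+ m.+1)))); first by rewrite ler_wpM2l// wt_le.
  by rewrite mulrA ler_wpM2r ?addr_ge0 ?exprn_ge0 ?sqrtr_ge0// /k lerDl.
have E x := pos_neg_part (f x).
have p0 x : 0 <= Num.max (f x) 0 by rewrite le_max lexx orbT.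
have n0 x : 0 <= Num.max (- f x) 0 by rewrite le_max lexx orbT.
have ki : 0 <= k^-1 by rewrite invr_ge0 ltW.
have [i1 c1] : pi0.-integrable setT (EFin \o f1) /\
  pcvg P (fun n w => n%:R^-1 * \sum_(j < n) f1 (X (j%:R * h n) w)) (fun _ => \int[pi0]_y f1 y).
  apply: (@ergodic_average_ge0 h f1 m) => // [|x|x]; [|by rewrite mulr_ge0|].
    by apply: measurable_funM => //; exact: measurable_maxr.
  by apply: bd => //; rewrite (E x).2 lerDl.
have [i2 c2] : pi0.-integrable setT (EFin \o f2) /\
  pcvg P (fun n w => n%:R^-1 * \sum_(j < n) f2 (X (j%:R * h n) w)) (fun _ => \int[pi0]_y f2 y).
  apply: (@ergodic_average_ge0 h f2 m) => // [|x|x]; [|by rewrite mulr_ge0|].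
    by apply: measurable_funM => //; apply: measurable_maxr => //; exact: measurableT_comp.
  by apply: bd => //; rewrite (E x).2 lerDr.
have fE x : f x = k * f1 x + - k * f2 x.
  by rewrite /f1 /f2 mulNr !mulrA mulfV ?gt_eqF// !mul1r; exact: (E x).1.
have l1 := @LoneZ R _ _ pi0 k f1 i1; have l2 := @LoneZ R _ _ pi0 (- k) f2 i2.
have fE' : f = (fun x => k * f1 x + - k * f2 x) by apply/funext => x; exact: fE.
have i0 : pi0.-integrable setT (EFin \o f) by rewrite fE'; exact: (LoneD l1 l2).
split=> //.
have Emu : \int[pi0]_y f y = k * (\int[pi0]_y f1 y) + - k * (\int[pi0]_y f2 y).
  by rewrite fE'; exact: etrans (ErD l1 l2) (congr2 +%R (ErZ k i1) (ErZ (- k) i2)).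
rewrite Emu.
have := pcvgD (pcvgM (@measurable_cst _ _ _ _ setT k) c1) (pcvgM (@measurable_cst _ _ _ _ setT (- k)) c2).
congr pcvg; apply/funext => n; apply/funext => w.
rewrite mulrCA [X in _ + X = _]mulrCA -mulrDr; congr (_ * _); rewrite !mulr_sumr -big_split; apply: eq_bigr => j _.
by rewrite fE.
Qed.

End ergodic.

(** * Averages of squared increments *)
Section quadratic_variation.
Context (R : realType) (dO : measure_display) (Om : measurableType dO) (P : probability Om R).
Local Notation Er := (Er P).
Local Notation Lone := (Lone P).
Local Notation Ltwo := (Ltwo P).
Context (F : R -> set (set Om)) (d r : nat) (Z : R -> Om -> 'cV[R]_r) (X : R -> Om -> 'cV[R]_d).
Context (a : 'cV[R]_d -> 'cV[R]_d) (c : 'cV[R]_d -> 'M[R]_(d, r)) (L : R).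
Hypothesis HF : filtration F.
Hypothesis HZ : levy_process P F Z.
Hypothesis HM : moment_condition P (Z 1).
Hypothesis L0 : 0 <= L.
Hypothesis La : forall i x y, `|a x i 0 - a y i 0| <= L * enorm (x - y).
Hypothesis Lc : forall i b x y, `|c x i b - c y i b| <= L * enorm (x - y).
Hypothesis HX : sde_solution P F a c Z X.
Hypothesis HXm : forall q : R, 0 < q -> exists M : R, forall t, 0 <= t ->
  ('E_P[(fun w => enorm (X t w) `^ q)%R] <= M%:E)%E.
Context (h : nat -> R).
Hypothesis h0 : forall n, 0 < h n.
Hypothesis hT : n%:R * h n @[n --> \oo] --> +oo.
Hypothesis hto0 : h n @[n --> \oo] --> (0 : R).

Let mX t : 0 <= t -> measurable_fun setT (X t : g_sigma_algebraType (F t) -> borel_vec R d) :=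
  sde_meas HF HX (t := t).
Let mX0 t : 0 <= t -> measurable_fun setT (X t : Om -> borel_vec R d) := sde_meas0 HF HX (t := t).

Lemma polynomial_Ltwo (f : 'cV[R]_d -> R) K p : 0 <= K ->
  measurable_fun setT (f : borel_vec R d -> R) -> (forall x, `|f x| <= K * wt x ^+ p) ->
  exists2 B, 0 <= B & forall t, 0 <= t -> Ltwo (fun w => f (X t w)) /\ Er (fun w => f (X t w) ^+ 2) <= B.
Proof.
move=> K0 mf bf; have [M M0 HM'] := wt_moments HF HX HXm (p * 2).
exists (K ^+ 2 * M); first by rewrite mulr_ge0// sqr_ge0.
move=> t t0; have [l e] := HM' t t0.
have mfX : measurable_fun setT (fun w => f (X t w)) by exact: (measurableT_comp mf (mX0 t0)).
have bd w : f (X t w) ^+ 2 <= K ^+ 2 * wt (X t w) ^+ (p * 2).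
  rewrite exprM -exprMn -[leLHS]real_normK ?num_real// lerXn2r ?nnegrE//.
  by apply: le_trans (bf (X t w)).
have l2 : Lone (fun w => f (X t w) ^+ 2).
  apply: (Lone_le _ (LoneZ (K ^+ 2) l)); first exact: measurable_funX.
  by move=> w; rewrite ger0_norm ?sqr_ge0.
split=> //; apply: le_trans (Er_le l2 (LoneZ (K ^+ 2) l) bd) _.
by rewrite ErZ// ler_wpM2l// sqr_ge0.
Qed.

Let tm n j : 0 <= j%:R * h n.
Proof. by rewrite mulr_ge0// ltW. Qed.

Let tS n j : j.+1%:R * h n - j%:R * h n = h n.
Proof. by rewrite -natr1; ring. Qed.

Let tlt n j : j%:R * h n < j.+1%:R * h n.
Proof. by rewrite -subr_gt0 tS. Qed.

Definition dX n j w i := X (j.+1%:R * h n) w i 0 - X (j%:R * h n) w i 0.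
Definition dZ n j w : 'cV[R]_r := Z (j.+1%:R * h n) w - Z (j%:R * h n) w.

Let mdZ n j b : measurable_fun setT (fun w => dZ n j w b 0).
Proof.
have s0 := tm n j; have t0 := tm n j.+1.
exact: (measurableT_comp (coord_meas b) (sub_meas_vec HF t0 (levy_incr_meas HF HZ s0 (ltW (tlt n j))))).
Qed.

(** Each product of two driving increments, divided by h and compensated by its mean, has
    second moment of order 1/h, from the fourth moments of the Levy process. These
    are martingale differences, so the average has second moment of order
    1/(n h). *)
Lemma levy_square_average (f : 'cV[R]_d -> R) K m b b' : 0 <= K ->
  measurable_fun setT (f : borel_vec R d -> R) -> (forall x, `|f x| <= K * wt x ^+ m) ->
  pcvg P (fun n w => n%:R^-1 * \sum_(j < n) f (X (j%:R * h n) w) *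
    ((h n)^-1 * (dZ n j w b 0 * dZ n j w b' 0) - (b == b')%:R)) (fun _ => 0).
Proof.
move=> K0 mf bf; have [B B0 HB] := polynomial_Ltwo K0 mf bf.
have [C C0 HC] := levy_incr_moments HF HZ HM.
have psi_m n : measurable_fun setT ((fun z => (h n)^-1 * (z b 0 * z b' 0) - (b == b')%:R) : borel_vec R r -> R).
  by apply: measurable_funB => //; apply: measurable_funM => //; apply: measurable_funM; exact: coord_meas.
have key n : (0 < n)%N -> h n <= 1 ->
   Ltwo (fun w => \sum_(j < n) f (X (j%:R * h n) w) * ((h n)^-1 * (dZ n j w b 0 * dZ n j w b' 0) - (b == b')%:R)) /\
   Er (fun w => (\sum_(j < n) f (X (j%:R * h n) w) * ((h n)^-1 * (dZ n j w b 0 * dZ n j w b' 0) - (b == b')%:R)) ^+ 2) <=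
     n%:R * (2 * (C + 1) / h n * B).
  move=> n0 hn1; have hn := h0 n; have nR : 0 < n%:R :> R by rewrite ltr0n.
  apply: (@orthogonal_sum _ _ _ P r (fun j => F (j%:R * h n)) (dZ n)
     (fun z => (h n)^-1 * (z b 0 * z b' 0) - (b == b')%:R) (fun j w => f (X (j%:R * h n) w)) n (2 * (C + 1) / h n) B) => //.
  - by rewrite divr_ge0 ?mulr_ge0 ?addr_ge0// ltW.
  - by move=> j _; exact: (filtration_subsigma HF (tm n j)).
  - by move=> j _; exact: (filtration_le HF (tm n j) (ltW (tlt n j))).
  - by move=> j _; exact: (levy_incr_meas HF HZ (tm n j) (ltW (tlt n j))).
  - by move=> j _; exact: (levy_incr_indep HZ (tm n j) (ltW (tlt n j))).
  - move=> j _; have t1 : j.+1%:R * h n <= j%:R * h n + 1 by rewrite -lerBlDl tS.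
    have [H1 H2] := HC _ _ (tm n j) (tlt n j) t1; rewrite tS in H1 H2.
    have [l4 _ e4] := H1 b; have [l4' _ e4'] := H1 b'; have e2 := H2 b b'.
    have lb := LoneD l4 l4'.
    have lz2 : Lone (fun w => (dZ n j w b 0 * dZ n j w b' 0) ^+ 2).
      apply: (Lone_le _ lb); first by apply: measurable_funX; exact: measurable_funM.
      move=> w; rewrite ger0_norm ?sqr_ge0// -/(dZ n j w); move: (dZ n j w b 0) (dZ n j w b' 0) => x y.
      have := sqr_ge0 (x ^+ 2 - y ^+ 2); have := sqr_ge0 (x ^+ 2); have := sqr_ge0 (y ^+ 2).
      by rewrite sqrrB exprMn -!exprM; lra.
    have ez2 : Er (fun w => (dZ n j w b 0 * dZ n j w b' 0) ^+ 2) <= C * h n.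
      have l12 := LoneZ 2^-1 lb.
      apply: le_trans (Er_le lz2 l12 _) _ => [w|].
        rewrite -/(dZ n j w); move: (dZ n j w b 0) (dZ n j w b' 0) => x y.
        by have := sqr_ge0 (x ^+ 2 - y ^+ 2); rewrite sqrrB exprMn -!exprM; lra.
      rewrite (ErZ _ lb) (ErD l4 l4'); lra.
    have tz : Ltwo (fun w => dZ n j w b 0 * dZ n j w b' 0) by split=> //; exact: measurable_funM.
    have lz := Ltwo_Lone tz.
    have tpsi : Ltwo (fun w => (h n)^-1 * (dZ n j w b 0 * dZ n j w b' 0) + - (b == b')%:R).
      apply: LtwoD; last exact: Ltwo_cst.
      split; first by apply: measurable_funM => //; exact: tz.1.
      by have := LoneZ ((h n)^-1 ^+ 2) lz2; apply: eq_integrable => // w _ /=; congr EFin; ring.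
    split=> //.
      rewrite /comp (ErB (LoneZ _ lz) (Lone_cst P _)) (ErZ _ lz) e2 Er_cst; apply/eqP; rewrite subr_eq0; apply/eqP; exact: (mulKf (lt0r_neq0 hn)).
    have lb2 := LoneZ 2 (LoneD (LoneZ ((h n)^-1 ^+ 2) lz2) (Lone_cst P 1)).
    apply: le_trans (Er_le tpsi.2 lb2 _) _ => [w|].
      move: (dZ n j w b 0 * dZ n j w b' 0) => x; set y := (h n)^-1.
      have d1 : ((b == b')%:R : R) ^+ 2 <= 1 by case: (b == b'); rewrite ?expr1n ?expr0n.
      rewrite -exprMn; have := sqr_ge0 (y * x + (b == b')%:R); rewrite sqrrD sqrrB; lra.
    rewrite (ErZ _ (LoneD (LoneZ _ lz2) (Lone_cst P 1))) (ErD (LoneZ _ lz2) (Lone_cst P 1)) (ErZ _ lz2) Er_cst.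
    rewrite -mulrA ler_wpM2l// mulrDl mul1r; apply: lerD; last by rewrite invf_ge1.
    apply: (@le_trans _ _ ((h n)^-1 ^+ 2 * (C * h n))); first by rewrite ler_wpM2l// sqr_ge0.
    by rewrite le_eqVlt; apply/orP; left; apply/eqP; field; rewrite gt_eqF.
  - move=> j _; have [t2 e2] := HB _ (tm n j); split=> //.
    exact: (measurableT_comp mf (mX (tm n j))).
apply: Er_sqr_pcvg => e e0; pose D := 2 * (C + 1) * B.
have c1 : D * (n%:R * h n)^-1 @[n --> \oo] --> (0 : R).
  rewrite -(mulr0 D); apply: cvgM; first exact: cvg_cst.
  by apply/(gtr0_cvgV0 _) => //; exists 1%N => // n /= n0; rewrite mulr_gt0// ltr0n.
near=> n; have n0 : (0 < n)%N by near: n; exists 1%N.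
have hn1 : h n <= 1 by near: n; exact: (cvgr_le _ hto0 _ ltr01).
have [[mS lS] eS] := key n n0 hn1.
set S := (fun w => \sum_(j < n) _) in mS lS eS.
rewrite (_ : (fun w => _ ^+ 2) = (fun w => n%:R^-1 ^+ 2 * S w ^+ 2)); last by apply/funext => w; rewrite subr0 exprMn.
split; first exact: LoneZ.
rewrite (ErZ _ lS); apply: (@le_trans _ _ (D * (n%:R * h n)^-1)).
  apply: (@le_trans _ _ (n%:R^-1 ^+ 2 * (n%:R * (2 * (C + 1) / h n * B)))); first by rewrite ler_wpM2l// sqr_ge0.
  by rewrite /D le_eqVlt; apply/orP; left; apply/eqP; field; rewrite !gt_eqF// ltr0n.
by near: n; exact: (cvgr_le _ c1 _ e0).
Unshelve. all: by end_near. Qed.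

Definition dW n j w i := remainder Z X c (j%:R * h n) (j.+1%:R * h n) i w.
Definition dY n j w i := \sum_b c (X (j%:R * h n) w) i b * dZ n j w b 0.

Lemma dX_split n j w i : dX n j w i = dY n j w i + dW n j w i.
Proof. by rewrite /dW /remainder -/(dX n j w i) -/(dZ n j w) -/(dY n j w i); ring. Qed.

Let la1 (x y eta : R) : 0 < eta -> `|x * y| <= eta * x ^+ 2 + eta^-1 * y ^+ 2.
Proof.
move=> e0; have ei : 0 < eta^-1 by rewrite invr_gt0.
have E : eta * x ^+ 2 + eta^-1 * y ^+ 2 = eta * ((x - eta^-1 * y) ^+ 2 + 2 * (eta^-1 * (x * y))).
  by field; rewrite gt_eqF.
have E' : eta * x ^+ 2 + eta^-1 * y ^+ 2 = eta * ((x + eta^-1 * y) ^+ 2 - 2 * (eta^-1 * (x * y))).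
  by field; rewrite gt_eqF.
have K1 : eta * (2 * (eta^-1 * (x * y))) = 2 * (x * y) by field; rewrite gt_eqF.
have p1 := mulr_ge0 (ltW e0) (sqr_ge0 (x - eta^-1 * y)).
have p2 := mulr_ge0 (ltW e0) (sqr_ge0 (x + eta^-1 * y)).
have s0 : 0 <= eta * x ^+ 2 + eta^-1 * y ^+ 2 by rewrite addr_ge0// mulr_ge0 ?sqr_ge0// ltW.
rewrite ler_norml; apply/andP; split.
  have : - (2 * (x * y)) <= eta * x ^+ 2 + eta^-1 * y ^+ 2 by rewrite E' mulrBr K1; lra.
  lra.
have : 2 * (x * y) <= eta * x ^+ 2 + eta^-1 * y ^+ 2 by rewrite E mulrDr K1; lra.
lra.
Qed.

(** The increment is of order h^(1/2) and the remainder of order h in L^2, so their product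
    divided by h is of order h^(1/2) in mean. *)
Lemma remainder_average (f : 'cV[R]_d -> R) K m i k : 0 <= K ->
  measurable_fun setT (f : borel_vec R d -> R) -> (forall x, `|f x| <= K * wt x ^+ m) ->
  pcvg P (fun n w => n%:R^-1 * \sum_(j < n) f (X (j%:R * h n) w) *
    ((h n)^-1 * (dX n j w i * dX n j w k - dY n j w i * dY n j w k))) (fun _ => 0).
Proof.
move=> K0 mf bf.
have [C1 C10 H1] := increment_moment HF HZ HM L0 La Lc HX HXm m.
have [C2 C20 H2] := remainder_moment HF HZ HM L0 La Lc HX HXm m.
pose V n j w := wt (X (j%:R * h n) w) ^+ m.
have V1 n j w : 1 <= V n j w by rewrite exprn_ege1// wt_ge1.
have V0 n j w : 0 <= V n j w := le_trans ler01 (V1 n j w).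
have B1 n j l : h n <= 1 -> Ltwo (fun w => V n j w * dX n j w l) /\ Er (fun w => (V n j w * dX n j w l) ^+ 2) <= C1 * h n.
  by move=> hn; have := H1 _ _ l (tm n j) (tlt n j); rewrite -lerBlDl tS => /(_ hn).
have B2 n j l : h n <= 1 -> Ltwo (fun w => V n j w * dW n j w l) /\ Er (fun w => (V n j w * dW n j w l) ^+ 2) <= C2 * h n ^+ 2.
  by move=> hn; have := H2 _ _ l (tm n j) (tlt n j); rewrite -lerBlDl tS => /(_ hn).
have mV n j : measurable_fun setT (V n j) by exact: (measurableT_comp (@wt_meas R d m) (mX0 (tm n j))).
have mdX n j l : measurable_fun setT (fun w => dX n j w l).
  by apply: measurable_funB; [exact: (measurableT_comp (coord_meas l) (mX0 (tm n j.+1)))|exact: (measurableT_comp (coord_meas l) (mX0 (tm n j)))].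
have cc l b : continuous (fun x => c x l b) by apply: lipschitz_continuous => x y; exact: Lc.
have mdY n j l : measurable_fun setT (fun w => dY n j w l).
  apply: measurable_sum => b; apply: measurable_funM => //.
  exact: (measurableT_comp (diff_meas cc l b) (mX0 (tm n j))).
have mfX n j : measurable_fun setT (fun w => f (X (j%:R * h n) w)) by exact: (measurableT_comp mf (mX0 (tm n j))).
pose g n j w := f (X (j%:R * h n) w) * ((h n)^-1 * (dX n j w i * dX n j w k - dY n j w i * dY n j w k)).
have mg n j : measurable_fun setT (g n j).
  by apply: measurable_funM => //; apply: measurable_funM => //; apply: measurable_funB; exact: measurable_funM.
(* With dX = dY + dW, abbreviated X = Y + W: XX - YY = X_i W_k + W_i X_k - W_i W_k *)
(* The weight eta balances the two factors of a product and is chosen small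
   before h tends to 0. *)
have key n j eta : h n <= 1 -> 0 < eta -> Lone (g n j) /\
    Er (fun w => `|g n j w|) <= K * (2 * (eta * C1) + h n * (2 * C2 * (eta^-1 + 1))).
  move=> hn e0; have hp := h0 n; have ei : 0 < eta^-1 by rewrite invr_gt0.
  have [ti bi] := B1 n j i hn; have [tk bk] := B1 n j k hn.
  have [ui ci] := B2 n j i hn; have [uk ck] := B2 n j k hn.
  have lb1 := LoneZ eta (LoneD ti.2 tk.2); have lb2 := LoneZ (eta^-1 + 1) (LoneD ui.2 uk.2).
  have lb := LoneZ (K * (h n)^-1) (LoneD lb1 lb2).
  have bd w : `|g n j w| <= K * (h n)^-1 * (eta * ((V n j w * dX n j w i) ^+ 2 + (V n j w * dX n j w k) ^+ 2) +
       (eta^-1 + 1) * ((V n j w * dW n j w i) ^+ 2 + (V n j w * dW n j w k) ^+ 2)).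
    rewrite /g !normrM (ger0_norm (_ : 0 <= (h n)^-1)); last by rewrite invr_ge0 ltW.
    have -> : dX n j w i * dX n j w k - dY n j w i * dY n j w k =
        dX n j w i * dW n j w k + dX n j w k * dW n j w i - dW n j w i * dW n j w k.
      by rewrite !dX_split; ring.
    have fV : `|f (X (j%:R * h n) w)| <= K * V n j w by exact: bf.
    move: (V1 n j w) (V0 n j w) fV; move: (V n j w) (dX n j w i) (dX n j w k) (dW n j w i) (dW n j w k) => v xi xk wi wk v1 v0 fV.
    rewrite [X in X <= _]mulrCA [K * _]mulrC -[X in _ <= X]mulrA ler_wpM2l ?invr_ge0 ?(ltW hp)//.
    apply: le_trans (ler_wpM2r (normr_ge0 _) fV) _; rewrite -mulrA ler_wpM2l//.
    have vv (x y : R) : v * `|x * y| <= `|(v * x) * (v * y)|.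
      rewrite -[in leLHS](ger0_norm v0) -normrM !normrM mulrACA -!normrM.
      have -> : v * v * (x * y) = v * (v * (x * y)) by ring.
      by rewrite [X in _ <= X]normrM (ger0_norm v0) ler_peMl.
    apply: (@le_trans _ _ (v * `|xi * wk| + v * `|xk * wi| + v * `|wi * wk|)).
      rewrite -!mulrDr ler_wpM2l//; apply: le_trans (ler_normB _ _) _; rewrite lerD2r; exact: ler_normD.
    have q1 := le_trans (vv xi wk) (la1 (v * xi) (v * wk) e0).
    have q2 := le_trans (vv xk wi) (la1 (v * xk) (v * wi) e0).
    have q3 := le_trans (vv wi wk) (la1 (v * wi) (v * wk) ltr01); rewrite invr1 !mul1r in q3.
    by rewrite !mulrDr !mulrDl !mul1r; move: q1 q2 q3; lra.
  have lg : Lone (g n j) by apply: (Lone_le (mg n j) lb).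
  split=> //; apply: le_trans (Er_le (Lone_norm lg) lb bd) _.
  rewrite (ErZ _ (LoneD lb1 lb2)) (ErD lb1 lb2) (ErZ _ (LoneD ti.2 tk.2)) (ErD ti.2 tk.2) (ErZ _ (LoneD ui.2 uk.2)) (ErD ui.2 uk.2).
  have -> : K * (2 * (eta * C1) + h n * (2 * C2 * (eta^-1 + 1))) =
     K * (h n)^-1 * (eta * (C1 * h n + C1 * h n) + (eta^-1 + 1) * (C2 * h n ^+ 2 + C2 * h n ^+ 2)).
    by field; rewrite !gt_eqF.
  rewrite ler_wpM2l//; first by rewrite mulr_ge0// invr_ge0 ltW.
  apply: lerD; [apply: ler_wpM2l; [exact: ltW|exact: lerD]|apply: ler_wpM2l; [by rewrite addr_ge0// ltW|exact: lerD]].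
apply: Er_pcvg => e e0.
pose eta := e / (4 * (K * C1) + 1).
have KC0 : 0 < 4 * (K * C1) + 1 by rewrite ltr_wpDl// !mulr_ge0.
have eta0 : 0 < eta by rewrite divr_gt0.
have c1 : K * (2 * (eta * C1) + h n * (2 * C2 * (eta^-1 + 1))) @[n --> \oo] --> K * (2 * (eta * C1) + 0 * (2 * C2 * (eta^-1 + 1))).
  apply: cvgM; first exact: cvg_cst; apply: cvgD; first exact: cvg_cst.
  by apply: cvgM => //; exact: cvg_cst.
have lim : K * (2 * (eta * C1) + 0 * (2 * C2 * (eta^-1 + 1))) < e.
  rewrite mul0r addr0 (_ : K * _ = e * ((2 * (K * C1)) / (4 * (K * C1) + 1))); last by rewrite /eta; ring.
  rewrite gtr_pMr// ltr_pdivrMr// mul1r; have := mulr_ge0 K0 C10; lra.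
near=> n; have n0 : (0 < n)%N by near: n; exists 1%N.
have nR : 0 < n%:R :> R by rewrite ltr0n.
have hn : h n <= 1 by near: n; exact: (cvgr_le _ hto0 _ ltr01).
have lS : Lone (fun w => n%:R^-1 * \sum_(j < n) g n j w).
  by apply: LoneZ; apply: Lone_sum => j; case: (key n j eta hn eta0).
have lS' : Lone (fun w => \sum_(j < n) `|g n j w|) by apply: Lone_sum => j; apply: Lone_norm; case: (key n j eta hn eta0).
rewrite (_ : (fun w => `|_|) = (fun w => `|n%:R^-1 * \sum_(j < n) g n j w|)); last by apply/funext => w; rewrite subr0.
split; first exact: Lone_norm.
apply: (@le_trans _ _ (Er (fun w => n%:R^-1 * \sum_(j < n) `|g n j w|))).
  apply: Er_le; [exact: Lone_norm|exact: LoneZ|move=> w].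
  by rewrite normrM ger0_norm ?invr_ge0// ler_wpM2l ?invr_ge0//; exact: ler_norm_sum.
rewrite (ErZ _ lS') Er_sum; last by move=> j; apply: Lone_norm; case: (key n j eta hn eta0).
rewrite ler_pdivrMl//; apply: (@le_trans _ _ (\sum_(j < n) e)); last by rewrite sumr_const card_ord mulr_natl.
apply: ler_sum => j _; case: (key n j eta hn eta0) => _ h1; apply: le_trans h1 _.
by near: n; apply: (cvgr_le _ c1).
Unshelve. all: by end_near. Qed.

(** The squared increments are replaced by those of the Levy process with frozen
    coefficients, whose squares average to the identity matrix. *)
Lemma quadratic_average (f : 'cV[R]_d -> R) K m i k : 0 <= K ->
  measurable_fun setT (f : borel_vec R d -> R) -> (forall x, `|f x| <= K * wt x ^+ m) ->
  pcvg P (fun n w => n%:R^-1 * \sum_(j < n) f (X (j%:R * h n) w) *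
    ((h n)^-1 * (dX n j w i * dX n j w k) - \sum_b c (X (j%:R * h n) w) i b * c (X (j%:R * h n) w) k b)) (fun _ => 0).
Proof.
move=> K0 mf bf.
have cc l b : continuous (fun x => c x l b) by apply: lipschitz_continuous => x y; exact: Lc.
have p1 := remainder_average i k K0 mf bf.
have p2 (bb : 'I_r * 'I_r) : pcvg P (fun n w => n%:R^-1 * \sum_(j < n)
    (f (X (j%:R * h n) w) * (c (X (j%:R * h n) w) i bb.1 * c (X (j%:R * h n) w) k bb.2)) *
    ((h n)^-1 * (dZ n j w bb.1 0 * dZ n j w bb.2 0) - (bb.1 == bb.2)%:R)) (fun _ => 0).
  pose K1 := `|c 0 i bb.1| + L; pose K2 := `|c 0 k bb.2| + L.
  have K10 : 0 <= K1 by rewrite addr_ge0.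
  have K20 : 0 <= K2 by rewrite addr_ge0.
  apply: (@levy_square_average (fun x => f x * (c x i bb.1 * c x k bb.2)) (K * (K1 * K2)) (m + 2) bb.1 bb.2).
  - by rewrite !mulr_ge0.
  - by apply: measurable_funM => //; apply: measurable_funM; exact: (diff_meas cc).
  - move=> x; have g1 := growth_lip L0 (Lc i bb.1) x; have g2 := growth_lip L0 (Lc k bb.2) x.
    have w0 p : 0 <= wt x ^+ p by exact: wtX_ge0.
    apply: (@le_trans _ _ ((K * wt x ^+ m) * ((K1 * wt x ^+ 1) * (K2 * wt x ^+ 1)))).
      by rewrite !normrM; apply: ler_pM => //; apply: ler_pM.
    by rewrite exprD le_eqVlt; apply/orP; left; apply/eqP; ring.
have := pcvgD p1 (pcvg_sum (index_enum _) p2); congr pcvg; last by apply/funext => w; rewrite add0r big1.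
apply/funext => n; apply/funext => w.
rewrite -mulr_sumr -mulrDr; congr (_ * _); rewrite exchange_big/= -big_split; apply: eq_bigr => j _ /=.
rewrite (eq_bigr (fun bb : 'I_r * 'I_r => f (X (j%:R * h n) w) * ((h n)^-1 * ((c (X (j%:R * h n) w) i bb.1 * dZ n j w bb.1 0) * (c (X (j%:R * h n) w) k bb.2 * dZ n j w bb.2 0)) -
   c (X (j%:R * h n) w) i bb.1 * c (X (j%:R * h n) w) k bb.2 * (bb.1 == bb.2)%:R))); last by move=> bb _; ring.
rewrite -mulr_sumr -mulrDr; congr (_ * _).
rewrite big_split/= -mulr_sumr sumrN.
have -> : \sum_(bb : 'I_r * 'I_r) (c (X (j%:R * h n) w) i bb.1 * dZ n j w bb.1 0) * (c (X (j%:R * h n) w) k bb.2 * dZ n j w bb.2 0) = dY n j w i * dY n j w k.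
  by rewrite /dY big_distrlr/= pair_big.
have -> : \sum_(bb : 'I_r * 'I_r) c (X (j%:R * h n) w) i bb.1 * c (X (j%:R * h n) w) k bb.2 * (bb.1 == bb.2)%:R =
    \sum_b c (X (j%:R * h n) w) i b * c (X (j%:R * h n) w) k b.
  rewrite -(pair_big xpredT xpredT (fun b b' => c (X (j%:R * h n) w) i b * c (X (j%:R * h n) w) k b' * (b == b')%:R))/=.
  apply: eq_bigr => b _; rewrite (bigD1 b)//= eqxx mulr1 big1 ?addr0// => b' /negPf.
  by rewrite eq_sym => ->; rewrite mulr0.
ring.
Qed.

(** Psi is the bound on the derivatives of the contrast in [quasi_loglik_C3]; this makes
    it bounded in probability. *)
Lemma square_average_bound (K : R) m : 0 <= K -> exists2 B, 0 <= B & \forall n \near \oo,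
  let Psi w := n%:R^-1 * \sum_(j < n) K * wt (X (j%:R * h n) w) ^+ m *
     (1 + (h n)^-1 * \sum_i dX n j w i ^+ 2) in
  Lone Psi /\ Er Psi <= B.
Proof.
move=> K0; have [C1 C10 H1] := increment_moment HF HZ HM L0 La Lc HX HXm m.
have [M M0 HM'] := wt_moments HF HX HXm m.
exists (K * (M + d%:R * C1)); first by rewrite mulr_ge0// addr_ge0// mulr_ge0.
near=> n; have n0 : (0 < n)%N by near: n; exists 1%N.
have nR : 0 < n%:R :> R by rewrite ltr0n.
have hn : h n <= 1 by near: n; exact: (cvgr_le _ hto0 _ ltr01).
have hp := h0 n; set Psi := (fun w => n%:R^-1 * _).
pose V j w := wt (X (j%:R * h n) w) ^+ m.
have V1 j w : 1 <= V j w by rewrite exprn_ege1// wt_ge1.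
have V0 j w : 0 <= V j w := le_trans ler01 (V1 j w).
have B1 j l : Ltwo (fun w => V j w * dX n j w l) /\ Er (fun w => (V j w * dX n j w l) ^+ 2) <= C1 * h n.
  by have := H1 _ _ l (tm n j) (tlt n j); rewrite -lerBlDl tS => /(_ hn).
have lV j : Lone (V j) /\ Er (V j) <= M by exact: HM'.
have lq j : Lone (fun w => \sum_i (V j w * dX n j w i) ^+ 2) by apply: Lone_sum => i; case: (B1 j i) => -[].
pose Q j w := K * (V j w + (h n)^-1 * \sum_i (V j w * dX n j w i) ^+ 2).
have lQ j : Lone (Q j) by apply: LoneZ; apply: LoneD; [case: (lV j)|exact: LoneZ].
have eQ j : Er (Q j) <= K * (M + d%:R * C1).
  have [l1 e1] := lV j; have l2 := LoneZ (h n)^-1 (lq j).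
  rewrite /Q (ErZ _ (LoneD l1 l2)) (ErD l1 l2) (ErZ _ (lq j)) ler_wpM2l// lerD//.
  rewrite ler_pdivrMl// Er_sum; last by move=> i; case: (B1 j i) => -[].
  apply: (@le_trans _ _ (\sum_(i < d) C1 * h n)); first by apply: ler_sum => i _; case: (B1 j i).
  by rewrite sumr_const card_ord -mulr_natl le_eqVlt; apply/orP; left; apply/eqP; ring.
have mPsi : measurable_fun setT Psi.
  apply: measurable_funM => //; apply: measurable_sum => j; apply: measurable_funM.
    by apply: measurable_funM => //; exact: (Lone_meas (lV j).1).
  apply: measurable_funD => //; apply: measurable_funM => //; apply: measurable_sum => i; apply: measurable_funX.
  by apply: measurable_funB; [exact: (measurableT_comp (coord_meas i) (mX0 (tm n j.+1)))|exact: (measurableT_comp (coord_meas i) (mX0 (tm n j)))].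
have lQs : Lone (fun w => \sum_(j < n) Q j w) by exact: Lone_sum.
have Psi0 w : 0 <= Psi w.
  rewrite mulr_ge0 ?invr_ge0// sumr_ge0// => j _; rewrite !mulr_ge0//; first exact: V0.
  by rewrite addr_ge0// mulr_ge0 ?invr_ge0 ?(ltW hp)// sumr_ge0// => i _; exact: sqr_ge0.
have bd w : Psi w <= n%:R^-1 * \sum_(j < n) Q j w.
  rewrite ler_wpM2l ?invr_ge0//; apply: ler_sum => j _; rewrite /Q -mulrA ler_wpM2l// -/(V j w) mulrDr mulr1 lerD2l.
  rewrite mulrCA ler_wpM2l ?invr_ge0 ?(ltW hp)// mulr_sumr; apply: ler_sum => i _.
  by rewrite exprMn ler_wpM2r ?sqr_ge0// expr2 ler_peMl.
have lP : Lone Psi by apply: (Lone_le mPsi (LoneZ n%:R^-1 lQs)) => w; rewrite ger0_norm.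
split=> //; apply: le_trans (Er_le lP (LoneZ n%:R^-1 lQs) bd) _.
rewrite (ErZ _ lQs) Er_sum// ler_pdivrMl//.
apply: (@le_trans _ _ (\sum_(j < n) K * (M + d%:R * C1))); first by apply: ler_sum.
by rewrite sumr_const card_ord -[leLHS]mulr_natl.
Unshelve. all: by end_near. Qed.

End quadratic_variation.

(** * Uniformity over the parameter set *)

(** Bounded sets are totally bounded: round coordinates down to a multiple of rho and
    choose one point of Th in each class that meets Th. *)
Lemma finite_net (R : realType) (p : nat) (Th : set 'cV[R]_p) (g0 : 'cV[R]_p) (M rho : R) :
  Th g0 -> (forall y, Th y -> `|y| <= M) -> 0 < rho ->
  exists (K : finType) (rep : K -> 'cV[R]_p), (forall k, Th (rep k)) /\
    forall y, Th y -> exists k, `|y - rep k| <= rho.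
Proof.
move=> Tg0 HM rho0.
have M0 : 0 <= M := le_trans (normr_ge0 g0) (HM g0 Tg0).
pose N := (Num.truncn (2 * M / rho)).+1.
have tr (y : 'cV[R]_p) i : Th y -> 0 <= (y i 0 + M) / rho <= 2 * M / rho.
  move=> Ty; have := le_trans (norm_coord y i 0) (HM y Ty); rewrite ler_norml => /andP[h1 h2].
  by rewrite divr_ge0 ?(ltW rho0)//=; [rewrite ler_pM2r ?invr_gt0//; lra|lra].
pose key (y : 'cV[R]_p) : {ffun 'I_p -> 'I_N} := [ffun i => inord (Num.truncn ((y i 0 + M) / rho))].
have /choice[rep Hrep] : forall k, exists y, Th y /\ forall y', Th y' -> key y' = k -> key y = k.
  move=> k; have [[y [Ty ky]]|h] := pselect (exists y, Th y /\ key y = k); first by exists y.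
  by exists g0; split=> // y' Ty' ky'; exfalso; apply: h; exists y'.
exists {ffun 'I_p -> 'I_N}, rep; split; first by move=> k; case: (Hrep k).
move=> y Ty; exists (key y); have [Tr /(_ y Ty erefl) kr] := Hrep (key y).
apply: norm_le_coord => [|i j]; first exact: ltW.
have := congr1 (fun f : {ffun 'I_p -> 'I_N} => (f i : nat)) kr; rewrite !ffunE (ord1 j).
have tN (z : 'cV[R]_p) : Th z -> (Num.truncn (((z i 0 : R) + M) / rho)%R < N)%N.
  by move=> Tz; rewrite ltnS; apply: le_truncn; case/andP: (tr z i Tz).
rewrite !inordK ?tN// => E; rewrite !mxE.
have /andP[a1 a2] := truncn_itv (proj1 (andP (tr _ i Ty))).
have /andP[b1 b2] := truncn_itv (proj1 (andP (tr _ i Tr))).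
rewrite E in b1 b2; move: a1 a2 b1 b2; rewrite -natr1; move: (Num.truncn _)%:R => q.
rewrite !ler_pdivlMr// !ltr_pdivrMr// !mulrDl !mul1r => a1 a2 b1 b2.
by rewrite ler_norml; apply/andP; split; lra.
Qed.

(** The mean value theorem along the segment, which stays in Th by convexity. *)
Lemma convex_lipschitz (R : realType) (p : nat) (Th : set 'cV[R]_p) (G : 'cV[R]_p -> R)
    (G1 : 'cV[R]_p -> 'cV[R]_p -> R) (C : R) : convex_set Th ->
  (forall v y, `|v| <= 1 -> Th y -> is_derive (0 : R) 1 (fun t : R => G (y + t *: v)) (G1 v y) /\ `|G1 v y| <= C) ->
  forall y y', Th y -> Th y' -> `|G y' - G y| <= C * `|y' - y|.
Proof.
move=> cTh HG y y' Ty Ty'; set b := `|y' - y|.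
have [b0|b0] := eqVneq b 0.
  have /eqP : b == 0 by rewrite b0.
  by move=> /normr0_eq0/eqP; rewrite subr_eq0 => /eqP ->; rewrite subrr normr0 b0 mulr0.
have bp : 0 < b by rewrite lt_neqAle eq_sym b0 normr_ge0.
pose v := b^-1 *: (y' - y).
have v1 : `|v| <= 1.
  by rewrite normrZ (ger0_norm (_ : 0 <= b^-1)) ?invr_ge0 ?(ltW bp)// -/b mulVf.
have seg t : 0 <= t <= b -> Th (y + t *: v).
  move=> /andP[t0 tb]; have l01 : 0 <= t / b <= 1 by apply/andP; split; [rewrite divr_ge0// ltW|rewrite ler_pdivrMr// mul1r].
  have := cTh y' y (@Itv01 R (t / b) (proj1 (andP l01)) (proj2 (andP l01))) (mem_set Ty') (mem_set Ty).
  rewrite inE; congr Th; rewrite /conv/= /v scalerA scalerBr.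
  by rewrite /unstable.onem scalerBl scale1r addrCA.
pose phi t := G (y + t *: v).
have dphi t : 0 <= t <= b -> is_derive (t : R) 1 phi (G1 v (y + t *: v)).
  by move=> tb; apply: is_derive_line; case: (HG v (y + t *: v) v1 (seg t tb)).
have hd t : t \in `]0, b[ -> is_derive (t : R) 1 phi (G1 v (y + t *: v)).
  by rewrite in_itv/= => /andP[? ?]; apply: dphi; rewrite !ltW.
have hc : {within `[0, b], continuous phi}.
  apply: derivable_within_continuous => t; rewrite in_itv/= => tb.
  by have := dphi t tb => h; exact: ex_derive.
have [t] := MVT_segment (ltW bp) hd hc; rewrite in_itv/= => tb; rewrite /phi scale0r addr0 subr0.
have -> : y + b *: v = y' by rewrite /v scalerA mulfV// scale1r addrC subrK.
move=> ->; rewrite normrM (ger0_norm (ltW bp)) ler_wpM2r ?(ltW bp)//.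
by case: (HG v _ v1 (seg t tb)).
Qed.

Lemma pcvg_fin (R : realType) (dO : measure_display) (Om : measurableType dO) (P : probability Om R)
  (K : finType) (Y_ : K -> nat -> Om -> R) (Y : K -> Om -> R) : (forall k, pcvg P (Y_ k) (Y k)) ->
  forall e, 0 < e -> exists N0, forall N, (N0 <= N)%N -> exists B, [/\ measurable B, (P B <= e%:E)%E &
    forall w, ~ B w -> forall k, `|Y_ k N w - Y k w| <= e].
Proof.
move=> H.
suff S (s : seq K) e : 0 < e -> exists N0, forall N, (N0 <= N)%N -> exists B, [/\ measurable B, (P B <= e%:E)%E &
    forall w, ~ B w -> forall k, k \in s -> `|Y_ k N w - Y k w| <= e].
  move=> e e0; have [N0 HN] := S (enum K) e e0; exists N0 => N hN; have [B [mB PB hB]] := HN N hN.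
  by exists B; split=> // w Bw k; apply: hB => //; rewrite mem_enum.
elim: s e => [|k s IH] e e0.
  by exists 0%N => N _; exists set0; split=> //; rewrite measure0 lee_fin ltW.
have e2 : 0 < e / 2 by rewrite divr_gt0.
have ee : e / 2 <= e by rewrite ler_pdivrMr// ler_peMr ?ler1n// ltW.
have [N1 H1] := IH _ e2; have [N2 H2] := H k _ e2.
exists (maxn N1 N2) => N; rewrite geq_max => /andP[h1 h2].
have [B1 [m1 P1 c1]] := H1 N h1; have [B2 [m2 P2 c2]] := H2 N h2.
exists (B1 `|` B2); split; first exact: measurableU.
  apply: le_trans (measureU2 _ _ _) _ => //; apply: le_trans (leeD P1 P2) _.
  by rewrite -EFinD lee_fin -splitr.
move=> w /not_orP[w1 w2] j; rewrite inE => /orP[/eqP ->|js].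
  exact: le_trans (c2 w w2) ee.
by apply: le_trans (c1 w w1 j js) ee.
Qed.

(** * The limit of the quasi-likelihood contrast *)
Section contrast.
Context (R : realType) (dO : measure_display) (Om : measurableType dO) (P : probability Om R).
Context (F : R -> set (set Om)) (d r p : nat) (Z : R -> Om -> 'cV[R]_r) (X : R -> Om -> 'cV[R]_d).
Context (Th : set 'cV[R]_p) (a : 'cV[R]_d -> 'cV[R]_d) (c : 'cV[R]_d -> 'cV[R]_p -> 'M[R]_(d, r)) (L : R) (g0 : 'cV[R]_p).
Context (Pt : R -> R.-pker borel_vec R d ~> borel_vec R d) (pi0 : probability (borel_vec R d) R).
Hypothesis HF : filtration F.
Hypothesis HZ : levy_process P F Z.
Hypothesis HM : moment_condition P (Z 1).
Hypothesis L0 : 0 <= L.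
Hypothesis La : forall i x y, `|a x i 0 - a y i 0| <= L * enorm (x - y).
Hypothesis Lc : forall i b x y, `|c x g0 i b - c y g0 i b| <= L * enorm (x - y).
Hypothesis HX : sde_solution P F a (c ^~ g0) Z X.
Hypothesis HPt : transition_function P F a (c ^~ g0) Z Pt.
Hypothesis Hst : stability P X Pt pi0.
Hypothesis oTh : open Th.
Hypothesis Tg0 : Th g0.
Hypothesis sc : forall i j, C24sharp Th (fun x g => c x g i j).
Hypothesis nd : nondegeneracy Th c.
Context (h : nat -> R).
Hypothesis h0 : forall n, 0 < h n.
Hypothesis hT : n%:R * h n @[n --> \oo] --> +oo.
Hypothesis hto0 : h n @[n --> \oo] --> (0 : R).

Let HXm := proj2 Hst.
Local Notation S := (diffusion_sq c).

(** Twice the Kullback-Leibler divergence between centred Gaussian laws of covariances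
    S(x, g0) and S(x, y). *)
Definition contrast_integrand y x :=
  \tr (invmx (S x y) *m S x g0 - 1%:M) + ln (\det (S x y) / \det (S x g0)).

(** The log-likelihood ratio is an average of a function of the observations, to which
    [ergodic_average] applies, plus a form linear in the squared increments
    divided by h, which [quadratic_average] replaces by S(X, g0). *)
Lemma contrast_cvg y : Th y ->
  pcvg P (fun n w => n%:R^-1 * quasi_loglik c (X ^~ w) n (h n) y - n%:R^-1 * quasi_loglik c (X ^~ w) n (h n) g0)
    (fun _ => - 2^-1 * \int[pi0]_x contrast_integrand y x).
Proof.
move=> Ty; have cy : closure Th y by exact: subset_closure.
have cg : closure Th g0 by exact: subset_closure.
pose D o x := lik_coef c o x y - lik_coef c o x g0.
have mD o : measurable_fun setT (D o : borel_vec R d -> R).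
  by apply: measurable_funB; apply: (measurable_lik_coef sc nd).
have gD o : exists K m, 0 <= K /\ forall x, `|D o x| <= K * wt x ^+ m.
  have [K [m [K0 HK]]] := smooth_pg_growth (smooth_lik_coef oTh sc nd o).
  have z1 : `|0 : 'cV[R]_p| <= 1 by rewrite normr0.
  exists (K + K), m; split; first exact: addr_ge0.
  by move=> x; apply: le_trans (ler_normB _ _) _; rewrite mulrDl lerD// (HK 0).
pose Sg x i k := \sum_b c x g0 i b * c x g0 k b.
have SgE x i k : S x g0 i k = Sg x i k by rewrite /diffusion_sq mxE; apply: eq_bigr => b _; rewrite mxE.
have cc l b : continuous (fun x => c x g0 l b) by apply: lipschitz_continuous => x x'; exact: Lc.
have mSg i k : measurable_fun setT ((fun x => Sg x i k) : borel_vec R d -> R).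
  by apply: measurable_sum => b; apply: measurable_funM; exact: (diff_meas cc).
have gSg i k : exists K m, 0 <= K /\ forall x, `|Sg x i k| <= K * wt x ^+ m.
  exists (\sum_b (`|c 0 g0 i b| + L) * (`|c 0 g0 k b| + L)), 2%N; split.
    by apply: sumr_ge0 => b _; rewrite mulr_ge0// addr_ge0.
  move=> x; apply: le_trans (ler_norm_sum _ _ _) _; rewrite mulr_suml; apply: ler_sum => b _.
  have g1 := growth_lip L0 (Lc i b) x; have g2 := growth_lip L0 (Lc k b) x.
  rewrite normrM expr2 mulrACA; rewrite !expr1 in g1 g2; exact: ler_pM.
have [K0 [m0 [K00 gD0]]] := gD None.
have [iN cN] := ergodic_average HF HX HPt Hst HXm h0 hT (mD None) K00 gD0.
have Hq (ik : 'I_d * 'I_d) : pi0.-integrable setT (EFin \o (fun x => D (Some ik) x * Sg x ik.1 ik.2)) /\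
   pcvg P (fun n w => n%:R^-1 * \sum_(j < n) D (Some ik) (X (j%:R * h n) w) * ((h n)^-1 * (dX X h n j w ik.1 * dX X h n j w ik.2)))
    (fun _ => \int[pi0]_x (D (Some ik) x * Sg x ik.1 ik.2)).
  have [K [m [K0' gDs]]] := gD (Some ik); have [K2 [m2 [K20 gS]]] := gSg ik.1 ik.2.
  have q1 := quadratic_average HF HZ HM L0 La Lc HX HXm h0 hT hto0 ik.1 ik.2 K0' (mD (Some ik)) gDs.
  have mDS : measurable_fun setT ((fun x => D (Some ik) x * Sg x ik.1 ik.2) : borel_vec R d -> R).
    by apply: measurable_funM.
  have gDS x : `|D (Some ik) x * Sg x ik.1 ik.2| <= (K * K2) * wt x ^+ (m + m2).
    by rewrite normrM exprD mulrACA; apply: ler_pM.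
  have [i2 q2] := ergodic_average HF HX HPt Hst HXm h0 hT mDS (mulr_ge0 K0' K20) gDS.
  split=> //; have := pcvgD q1 q2; congr pcvg; last by apply/funext => w; rewrite add0r.
  apply/funext => n; apply/funext => w; rewrite -mulrDr -big_split; congr (_ * _).
  by apply: eq_bigr => j _ /=; rewrite /Sg; ring.
have main := pcvgM (@measurable_cst _ _ Om _ setT (- 2^-1 : R)) (pcvgD cN (pcvg_sum (index_enum _) (fun ik => (Hq ik).2))).
have lsum (s : seq ('I_d * 'I_d)) : pi0.-integrable setT (EFin \o (fun x => \sum_(ik <- s) D (Some ik) x * Sg x ik.1 ik.2)).
  by apply: (@Lone_sum _ _ _ pi0 _ s (fun ik x => D (Some ik) x * Sg x ik.1 ik.2)) => ik; case: (Hq ik).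
have lim : \int[pi0]_x contrast_integrand y x = \int[pi0]_x D None x + \sum_ik \int[pi0]_x (D (Some ik) x * Sg x ik.1 ik.2).
  have E x : contrast_integrand y x = D None x + \sum_ik D (Some ik) x * Sg x ik.1 ik.2.
    have d1 : 0 < \det (S x y) by exact: (det_diffusion_gt0 nd).
    have d2 : 0 < \det (S x g0) by exact: (det_diffusion_gt0 nd).
    rewrite /contrast_integrand ln_div ?posrE// addrC; congr (_ + _).
    have u : S x g0 \in unitmx by rewrite unitmxE unitfE gt_eqF.
    rewrite -(mulVmx u) -mulmxBl /mxtrace -(pair_big xpredT xpredT (fun i k => D (Some (i, k)) x * Sg x i k))/=.
    apply: eq_bigr => i _; rewrite mxE; apply: eq_bigr => k _; rewrite !mxE; congr (_ * _).
    by apply: eq_bigr => b _; rewrite mxE mulrC.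
  rewrite (_ : contrast_integrand y = (fun x => D None x + \sum_ik D (Some ik) x * Sg x ik.1 ik.2)); last by apply/funext => x; exact: E.
  exact: etrans (ErD iN (lsum _)) (congr2 +%R erefl (@Er_sum _ _ _ pi0 _ _ (fun ik x => D (Some ik) x * Sg x ik.1 ik.2) (fun ik => (Hq ik).1))).
rewrite lim; move: main; congr pcvg; apply/funext => n; apply/funext => w.
rewrite -mulrBr !(quasi_loglikE nd)// opprD addrACA subrr add0r -sumrB.
rewrite /cst -mulr_sumr -mulrDr mulrCA; congr (_ * _).
rewrite exchange_big/= -big_split/= mulr_sumr; apply: eq_bigr => j _.
rewrite -sumrB sum_option /= mulrDr; congr (_ + _); first by rewrite /D /= mulrBr.
by rewrite mulr_sumr; apply: eq_bigr => ik _; rewrite /D /dX /= !mxE; ring.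
Qed.

End contrast.

(** * The expansion on a good event *)
Lemma closure_norm_le (R : realType) (p : nat) (Th : set 'cV[R]_p) (M : R) :
  (forall y, Th y -> `|y| <= M) -> forall y, closure Th y -> `|y| <= M.
Proof.
move=> H y cy; apply/ler_addgt0Pr => e e0.
have [z [Tz]] := cy (ball y e) (nbhsx_ballx y e e0).
rewrite -ball_normE /= => yz; have := H z Tz.
by have := ler_distD z y 0; rewrite !subr0; lra.
Qed.

Lemma enorm_sq_ge (R : realType) (p : nat) (y : 'cV[R]_p) : `|y| ^+ 2 <= enorm y ^+ 2.
Proof. by rewrite lerXn2r ?nnegrE// ?sqrtr_ge0// norm_le_enorm. Qed.

Lemma square_shift (R : realType) (u v rho M : R) : 0 <= u -> 0 <= v -> 0 <= rho -> 0 <= M ->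
  u <= v + rho -> u <= 2 * M -> v <= 2 * M -> u ^+ 2 <= v ^+ 2 + 4 * M * rho.
Proof.
move=> u0 v0 r0 M0 q1 q2 q3; have [uv|uv] := leP u v.
  apply: (@le_trans _ _ (v ^+ 2)); first by rewrite lerXn2r ?nnegrE.
  by rewrite lerDl mulr_ge0// mulr_ge0.
have -> : u ^+ 2 = v ^+ 2 + (u - v) * (u + v) by ring.
by rewrite lerD2l mulrC; apply: ler_pM; lra.
Qed.

Lemma contrast_shift (R : realType) (gy gk gg Y chi dl q q' x x' : R) :
  gk - gg - Y <= dl / 2 -> Y <= - chi * q' -> gy - gk <= x -> chi * q <= chi * (q' + x') ->
  x + chi * x' <= dl / 2 -> gy - gg <= - chi * q + dl.
Proof. by rewrite mulrDr !mulNr => *; lra. Qed.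

Section main.
Context (R : realType) (dO : measure_display) (Om : measurableType dO) (P : probability Om R).
Context (F : R -> set (set Om)) (d r pa p : nat) (Z : R -> Om -> 'cV[R]_r) (X : R -> Om -> 'cV[R]_d).
Context (Tha : set 'cV[R]_pa) (Th : set 'cV[R]_p) (a : 'cV[R]_d -> 'cV[R]_pa -> 'cV[R]_d)
  (c : 'cV[R]_d -> 'cV[R]_p -> 'M[R]_(d, r)) (al0 : 'cV[R]_pa) (g0 : 'cV[R]_p).
Context (Pt : R -> R.-pker borel_vec R d ~> borel_vec R d) (pi0 : probability (borel_vec R d) R).
Context (pi1 : 'cV[R]_p -> R) (h : nat -> R) (ghat : nat -> Om -> 'cV[R]_p).
Hypothesis HF : filtration F.
Hypothesis HZ : levy_process P F Z.
Hypothesis HTh : bounded_convex_domain Th.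
Hypothesis Hal0 : Tha al0.
Hypothesis Hg0 : Th g0.
Hypothesis HX : sde_solution P F (a ^~ al0) (c ^~ g0) Z X.
Hypothesis HPt : transition_function P F (a ^~ al0) (c ^~ g0) Z Pt.
Hypothesis h0 : forall n, 0 < h n.
Hypothesis hT : n%:R * h n @[n --> \oo] --> +oo.
Hypothesis Hnh2 : n%:R * h n ^+ 2 @[n --> \oo] --> (0 : R).
Hypothesis HM : moment_condition P (Z 1).
Hypothesis Hsm : smoothness Tha Th a c.
Hypothesis nd : nondegeneracy Th c.
Hypothesis Hst : stability P X Pt pi0.
Hypothesis Hid : identifiability Tha Th a c pi0 al0 g0.
Hypothesis Hpr : prior_density Th pi1.
Hypothesis Hpi1c : {within closure Th, continuous pi1}.
Hypothesis Hpi1b : exists M : R, forall g, closure Th g -> `|pi1 g| <= M.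
Hypothesis Hpi1g0 : 0 < pi1 g0.
Hypothesis Hghat : forall n w, closure Th (ghat n w) /\
  forall g, closure Th g -> quasi_loglik c (X ^~ w) n (h n) g <= quasi_loglik c (X ^~ w) n (h n) (ghat n w).

Let G n w y := n%:R^-1 * quasi_loglik c (X ^~ w) n (h n) y.

(** h is the quotient of n h^2 by n h. *)
Lemma mesh_cvg0 : h n @[n --> \oo] --> (0 : R).
Proof.
apply/cvgrPdist_le => e e0; have e2 : 0 < e ^+ 2 by rewrite exprn_gt0.
have [N _ HN] := cvgr_le _ Hnh2 _ e2.
exists (maxn 1 N) => // n; rewrite /= geq_max => /andP[n1 Nn].
rewrite sub0r normrN ger0_norm ?(ltW (h0 n))//.
rewrite -(@ler_pXn2r _ 2%N)// ?nnegrE ?(ltW e0) ?(ltW (h0 n))//.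
apply: le_trans (HN n Nn); rewrite ler_peMl ?sqr_ge0// ler1n//.
Qed.

Lemma common_lipschitz : exists2 L, 0 <= L &
  (forall i x y, `|a x al0 i 0 - a y al0 i 0| <= L * enorm (x - y)) /\
  (forall i b x y, `|c x g0 i b - c y g0 i b| <= L * enorm (x - y)).
Proof.
have [sa sc] := Hsm.
have ca : closure Tha al0 by exact: subset_closure.
have cg : closure Th g0 by exact: subset_closure.
have /choice[La HLa] : forall i, exists L : R, forall x y, `|a x al0 i 0 - a y al0 i 0| <= L * enorm (x - y).
  by move=> i; have [[L HL] _] := sa i; exists L => x y; exact: HL.
have /choice[Lc HLc] : forall ib : 'I_d * 'I_r, exists L : R, forall x y, `|c x g0 ib.1 ib.2 - c y g0 ib.1 ib.2| <= L * enorm (x - y).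
  by move=> [i b]; have [[L HL] _] := sc i b; exists L => x y; exact: HL.
exists (\sum_i `|La i| + \sum_ib `|Lc ib|); first by rewrite addr_ge0// sumr_ge0.
split=> [i x y|i b x y].
  apply: le_trans (HLa i x y) _; rewrite ler_wpM2r ?sqrtr_ge0//; apply: le_trans (ler_norm _) _.
  by rewrite (bigD1 i)//= -addrA lerDl addr_ge0// sumr_ge0.
apply: le_trans (HLc (i, b) x y) _; rewrite ler_wpM2r ?sqrtr_ge0//; apply: le_trans (ler_norm _) _.
by rewrite (bigD1 (i, b))//= addrCA lerDl addr_ge0// sumr_ge0.
Qed.

(** Outside an event of probability at most e, every stochastic input of the expansion is
    replaced by deterministic inequalities with constants that depend on e only:
    the derivatives of the contrast are bounded, and at finitely many parameters
    the contrast is close to its limit, hence nearly below the quadratic of the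
    identifiability condition; the Lipschitz bound extends this to the whole
    parameter set. Then [maximizer] and [laplace] apply, for every large N at once,
    so that N = n and N = n h are covered together. *)
Lemma good_event e : 0 < e -> exists C N0 : R, 0 < N0 /\ exists n0 : nat, forall n, (n0 <= n)%N ->
  exists B, [/\ measurable B, (P B <= e%:E)%E & forall w, ~ B w -> forall N, N0 <= N ->
   `| ln (fine (\int[@lebesgue_vec R p : set (borel_vec R p) -> \bar R]_(g in Th) (expR (N * G n w g) * pi1 g)%:E)%E)
       - N * G n w (ghat n w) + p%:R / 2 * ln N| <= C].
Proof.
move=> e0; have e2 : 0 < e / 2 by rewrite divr_gt0.
have [oTh _ bTh cTh] := HTh; have [sa sc] := Hsm; have [L L0 [La Lc]] := common_lipschitz.
have hto0 := mesh_cvg0.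
have [chi [_ [chi0 _ Hchi _]]] := Hid.
have [M HMb] : exists M, forall y, Th y -> `|y| <= M.
  have [M0 [_ HM0]] := bTh; exists (M0 + 1) => y Ty; apply: (HM0 (M0 + 1)) => //; by rewrite ltrDl.
have HMc := closure_norm_le HMb.
have M0 : 0 <= M := le_trans (normr_ge0 g0) (HMb g0 Hg0).
have HD g g' : closure Th g -> closure Th g' -> `|g - g'| <= 2 * M.
  by move=> /HMc h1 /HMc h2; apply: le_trans (ler_normB _ _) _; lra.
have cpi1 : {for g0, continuous pi1}.
  have := continuous_subspaceW (@subset_closure _ Th) Hpi1c.
  by rewrite continuous_open_subspace// => /(_ g0); apply; exact: mem_set.
have [s0 s00 Hs0] : exists2 s0, 0 < s0 & forall g, `|g - g0| < s0 -> Th g /\ pi1 g0 / 2 <= pi1 g.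
  have n1 : nbhs g0 Th by exact: open_nbhs_nbhs.
  have n2 : nbhs g0 [set g | pi1 g0 / 2 <= pi1 g].
    by apply: (cvgr_ge _ cpi1); rewrite ltr_pdivrMr// ltr_pMr// ltr1n.
  have n12 : nbhs g0 [set g : 'cV[R]_p | Th g /\ pi1 g0 / 2 <= pi1 g] by exact: filterI.
  move: n12 => /nbhs_normP[s0 /= s00 Hs].
  by exists s0 => // g hg; apply: Hs; rewrite /= distrC.
have [M1 HM1] : exists M1, forall g, Th g -> 0 <= pi1 g <= M1.
  have [M1 H1] := Hpi1b; exists M1 => g Tg; rewrite (proj1 Hpr)//=.
  by apply: le_trans (ler_norm _) (H1 g (subset_closure Tg)).
have m00 : 0 < pi1 g0 / 2 by rewrite divr_gt0.
(* The level C bounds Psi outside an event of probability at most e / 2, by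
   Markov's inequality. *)
have [K [m [K0 HC3]]] := quasi_loglik_C3 oTh sc nd.
have [B0 B00 [n1 _ Hn1]] := square_average_bound HF HZ HM L0 La Lc HX (proj2 Hst) h0 hto0 m K0.
pose C := 2 * (B0 + 1) / e.
have C0 : 0 < C by rewrite divr_gt0// mulr_gt0// ltr_wpDl.
have [dl [lam [Lam [s [dl0 lam0 Lam0 sp0 Hmax]]]]] := @maximizer R p Th g0 chi C (2 * M) s0 oTh chi0 (ltW C0) s00 (fun g hg => proj1 (Hs0 g hg)) HD.
have [C' [N0 [N00 Hlap]]] := laplace oTh Hpi1c HM1 Hs0 m00 s00 lam0 Lam0 sp0.
(* The mesh rho of the net is such that the variations of the contrast and of the
   quadratic bound within a cell add up to dl / 2 at most; the other half of dl
   is for the stochastic error at the points of the net. *)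
pose D := C + chi * (4 * M) + 1.
have D0 : 0 < D by rewrite ltr_wpDl// addr_ge0 ?(ltW C0)// !mulr_ge0// ltW.
pose rho := dl / 2 / D.
have rho0 : 0 < rho by rewrite !divr_gt0.
have [Kf [rep [Trep net]]] := finite_net Hg0 HMb rho0.
have cvgk k := contrast_cvg HF HZ HM L0 La Lc HX HPt Hst oTh Hg0 sc nd h0 hT hto0 (Trep k).
have e1 : 0 < Num.min (e / 2) (dl / 2) by rewrite lt_min e2 divr_gt0.
have [n2 Hn2] := pcvg_fin cvgk e1.
exists C', N0; split=> //; exists (maxn n1 n2) => n; rewrite geq_max => /andP[h1 h2].
have [lPsi ePsi] := Hn1 n h1; have [B2 [mB2 PB2 HB2]] := Hn2 n h2.
set Psi := (fun w => n%:R^-1 * _) in lPsi ePsi.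
have Psi0 w : 0 <= Psi w.
  rewrite mulr_ge0 ?invr_ge0// sumr_ge0// => j _; rewrite !mulr_ge0//; first exact: wtX_ge0.
  by rewrite addr_ge0// mulr_ge0 ?invr_ge0 ?(ltW (h0 n))// sumr_ge0// => i _; exact: sqr_ge0.
pose B1 := [set w | C <= Psi w].
have mB1 : measurable B1 by apply: meas_ge; exact: Lone_meas lPsi.
have PB1 : (P B1 <= (e / 2)%:E)%E.
  apply: le_trans (Er_chebyshev lPsi Psi0 C0) _; rewrite lee_fin ler_pdivrMr//.
  apply: le_trans ePsi _; rewrite (_ : e / 2 * C = B0 + 1); last by rewrite /C; field; rewrite gt_eqF.
  by rewrite lerDl.
exists (B1 `|` B2); split; first exact: measurableU.
  apply: le_trans (measureU2 _ _ _) _ => //; apply: le_trans (leeD PB1 PB2) _.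
  by rewrite -EFinD lee_fin [leRHS]splitr lerD2l ge_min lexx.
move=> w /not_orP[w1 w2] N NN.
have PsiC : Psi w <= C by rewrite leNgt; apply/negP => hh; apply: w1; exact: ltW.
have [G1 [G2 [G3 HG]]] := HC3 (X ^~ w) n (h n) (h0 n).
have PsiE : n%:R^-1 * \sum_(j < n) K * wt (X (j%:R * h n) w) ^+ m *
    (1 + (h n)^-1 * \sum_i (X (j.+1%:R * h n) w - X (j%:R * h n) w) i 0 ^+ 2) = Psi w.
  rewrite /Psi; congr (_ * _); apply: eq_bigr => j _; congr (_ * (_ + _ * _)).
  by apply: eq_bigr => i _; rewrite /dX !mxE.
rewrite PsiE in HG.
have HG' v y : `|v| <= 1 -> Th y -> [/\ is_derive (0 : R) 1 (fun t => G n w (y + t *: v)) (G1 v y),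
       is_derive (0 : R) 1 (fun t => G1 v (y + t *: v)) (G2 v y),
       is_derive (0 : R) 1 (fun t => G2 v (y + t *: v)) (G3 v y),
       `|G2 v y| <= C & `|G3 v y| <= C].
  by move=> v1 Ty; have [[d1 d2 d3] [b1 b2 b3]] := HG v y v1 Ty; split=> //; exact: le_trans PsiC.
have lipG y y' : Th y -> Th y' -> `|G n w y' - G n w y| <= C * `|y' - y|.
  apply: (@convex_lipschitz R p Th (G n w) G1 C cTh) => v z v1 Tz.
  by have [[d1 _ _] [b1 _ _]] := HG v z v1 Tz; split=> //; exact: le_trans PsiC.
have upG y : Th y -> G n w y - G n w g0 <= - chi * `|y - g0| ^+ 2 + dl.
  move=> Ty; have [k yk] := net y Ty.
  have := HB2 w w2 k; rewrite -/(G n w (rep k)) -/(G n w g0) ler_norml => /andP[_ bk].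
  have bk' : Num.min (e / 2) (dl / 2) <= dl / 2 by rewrite ge_min lexx orbT.
  have idk : - 2^-1 * (\int[pi0]_x contrast_integrand c g0 (rep k) x) <= - chi * `|rep k - g0| ^+ 2.
    apply: le_trans (Hchi (rep k) (Trep k)) _; rewrite !mulNr lerN2 ler_wpM2l ?(ltW chi0)//; exact: enorm_sq_ge.
  have lk := lipG (rep k) y (Trep k) Ty; have lk' := le_trans (ler_norm _) lk.
  have Ck : C * `|y - rep k| <= C * rho by rewrite ler_wpM2l// ltW.
  have sqk : `|y - g0| ^+ 2 <= `|rep k - g0| ^+ 2 + 4 * M * rho.
    have q1 : `|y - g0| <= `|rep k - g0| + rho.
      by rewrite [leRHS]addrC; apply: le_trans (ler_distD (rep k) y g0) _; rewrite lerD2r.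
    have q2 := HD _ _ (subset_closure Ty) (subset_closure Hg0).
    have q3 := HD _ _ (subset_closure (Trep k)) (subset_closure Hg0).
    exact: (square_shift (normr_ge0 _) (normr_ge0 _) (ltW rho0) M0 q1 q2 q3).
  have csq : chi * `|y - g0| ^+ 2 <= chi * (`|rep k - g0| ^+ 2 + 4 * M * rho) by rewrite ler_wpM2l// ltW.
  have Drho : C * rho + chi * (4 * M * rho) <= dl / 2.
    have -> : dl / 2 = D * rho by rewrite /rho [D * _]mulrC divfK// gt_eqF.
    by rewrite [chi * _]mulrA -mulrDl ler_wpM2r ?(ltW rho0)// /D lerDl.
  exact: contrast_shift (le_trans bk bk') idk (le_trans lk' Ck) csq Drho.
have cG : {within closure Th, continuous (G n w)}.
  have cq := @continuous_quasi_loglik R d r p Th c (X ^~ w) n (h n) oTh sc nd (h0 n); move=> y.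
  by apply: cvgM; [exact: cvg_cst|exact: cq].
have [cgh mgh] := Hghat n w.
have mgh' g : closure Th g -> G n w g <= G n w (ghat n w).
  by move=> cg; rewrite ler_wpM2l ?invr_ge0//; exact: mgh.
have [k1 k2 k3] := Hmax (G n w) G1 G2 G3 (ghat n w) cgh mgh' cG upG HG'.
apply: Hlap => // g Tg.
have := continuous_subspaceW (@subset_closure _ Th) cG.
by rewrite continuous_open_subspace// => /(_ g); apply; exact: mem_set.
Qed.

(** With N = n b, the integrand of the free energy is e^(N G) with G the normalized
    quasi-likelihood, so [good_event] is the assertion up to division by N. *)
Lemma free_energy_expansion (b : nat -> R) : (forall n, 0 < b n) -> n%:R * b n @[n --> \oo] --> +oo ->
  bigOp P (fun n w => free_energy Th pi1 (quasi_loglik c (X ^~ w) n (h n)) n (b n) -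
     (- n%:R^-1 * quasi_loglik c (X ^~ w) n (h n) (ghat n w) + p%:R / (2 * (n%:R * b n)) * ln (n%:R * b n)))
   (fun n => (n%:R * b n)^-1).
Proof.
move=> b0 bT e e0; have [C [N0 [N00 [n0 HC]]]] := good_event e0.
exists C; near=> n; have n00 : (0 < n)%N by near: n; exists 1%N.
have nR : 0 < n%:R :> R by rewrite ltr0n.
have n0n : (n0 <= n)%N by near: n; exists n0.
have Nn : N0 <= n%:R * b n by near: n; move/cvgryPge: bT; exact.
have [B [mB PB HB]] := HC n n0n.
apply: le_trans PB; apply: ext_le_measure => // w /=; apply: contraPP => Bw.
apply/negP; rewrite -leNgt.
have T0 : 0 < n%:R * b n by rewrite mulr_gt0.
have := HB w Bw _ Nn; rewrite /free_energy.
have E : (fun g => (expR (b n * quasi_loglik c (X ^~ w) n (h n) g) * pi1 g)%:E) = (fun g => (expR (n%:R * b n * G n w g) * pi1 g)%:E).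
  apply/funext => g; congr (expR _ * _)%:E; rewrite /G; field; rewrite gt_eqF//.
rewrite E; set I := ln _ => HI.
have -> : - (n%:R * b n)^-1 * I - (- n%:R^-1 * quasi_loglik c (X ^~ w) n (h n) (ghat n w) +
     p%:R / (2 * (n%:R * b n)) * ln (n%:R * b n)) =
   - (n%:R * b n)^-1 * (I - n%:R * b n * G n w (ghat n w) + p%:R / 2 * ln (n%:R * b n)).
  by rewrite /G; field; rewrite !gt_eqF.
have Ti : 0 <= (n%:R * b n)^-1 by rewrite invr_ge0 ltW.
by rewrite normrM normrN (ger0_norm Ti) mulrC; apply: ler_wpM2r.
Unshelve. all: by end_near. Qed.

End main.

(** * The two expansions *)

Theorem theorem4p1 (R : realType)
  (dO : measure_display) (Om : measurableType dO) (P : probability Om R)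
  (F : R -> set (set Om))
  (d r pa pg : nat)
  (Z : R -> Om -> 'cV[R]_r) (X : R -> Om -> 'cV[R]_d)
  (Tha : set 'cV[R]_pa) (Thg : set 'cV[R]_pg)
  (a : 'cV[R]_d -> 'cV[R]_pa -> 'cV[R]_d)
  (c : 'cV[R]_d -> 'cV[R]_pg -> 'M[R]_(d, r))
  (al0 : 'cV[R]_pa) (g0 : 'cV[R]_pg)
  (Pt : R -> R.-pker borel_vec R d ~> borel_vec R d)
  (pi0 : probability (borel_vec R d) R)
  (pi1 : 'cV[R]_pg -> R)
  (h : nat -> R) (c1 : R)
  (ghat : nat -> Om -> 'cV[R]_pg)
  (HF : filtration F)
  (HZ : levy_process P F Z)
  (HZX0 : independent_of_process P (X 0) Z)
  (HTha : bounded_convex_domain Tha) (HThg : bounded_convex_domain Thg)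
  (Hal0 : Tha al0) (Hg0 : Thg g0)
  (HX : sde_solution P F (a ^~ al0) (c ^~ g0) Z X)
  (HPt : transition_function P F (a ^~ al0) (c ^~ g0) Z Pt)
  (Hh0 : forall n, 0 < h n)
  (HT : (n%:R * h n : R) @[n --> \oo] --> +oo)
  (Hnh2 : (n%:R * h n ^+ 2 : R) @[n --> \oo] --> (0 : R))
  (Hmoments : moment_condition P (Z 1))
  (Hsmooth : smoothness Tha Thg a c)
  (Hnondeg : nondegeneracy Thg c)
  (Hstab : stability P X Pt pi0)
  (Hident : identifiability Tha Thg a c pi0 al0 g0)
  (Hprior : prior_density Thg pi1)
  (Hpi1c : {within closure Thg, continuous pi1})
  (Hpi1b : exists M : R, forall g, closure Thg g -> `|pi1 g| <= M)
  (Hpi1g0 : 0 < pi1 g0)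
  (Hc1 : 0 < c1 < 1)
  (HTn : exists2 K : R, 0 < K &
     \forall n \near \oo, K * n%:R `^ c1 <= n%:R * h n)
  (Hghat : forall n w, closure Thg (ghat n w) /\
     forall g, closure Thg g ->
       quasi_loglik c (X ^~ w) n (h n) g
       <= quasi_loglik c (X ^~ w) n (h n) (ghat n w)) :
  let H1 n w := quasi_loglik c (X ^~ w) n (h n) in
  let F1 n b w := free_energy Thg pi1 (H1 n w) n b in
  let T n := n%:R * h n in
  bigOp P
    (fun n w => F1 n 1 w - (- n%:R^-1 * H1 n w (ghat n w)
                            + pg%:R / (2 * n%:R) * ln n%:R))
    (fun n => n%:R^-1) /\
  bigOp P
    (fun n w => F1 n (h n) w - (- n%:R^-1 * H1 n w (ghat n w)
                                + pg%:R / (2 * T n) * ln (T n)))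
    (fun n => (T n)^-1).
Proof.
move=> H1 F1 T; have exp := free_energy_expansion HF HZ HThg Hal0 Hg0 HX HPt Hh0 HT Hnh2 Hmoments Hsmooth Hnondeg Hstab Hident Hprior Hpi1c Hpi1b Hpi1g0 Hghat.
split; last exact: exp Hh0 HT.
have b1 : n%:R * (1 : R) @[n --> \oo] --> +oo by under eq_fun do rewrite mulr1; exact: cvgr_idn.
move=> e e0; have [M HM] := exp (fun _ => 1) (fun _ => ltr01) b1 e e0; exists M.
by move: HM; apply: filterS => n; rewrite !mulr1.
Qed.
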